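(* Let $T>0$ and $d\ge 1$. Suppose the Hamiltonian $H:\mathbb{R}^d\times\mathbb{R}^d\times\mathcal{P}_2(\mathbb{R}^d)\to\mathbb{R}$ and the terminal cost $\mathcal{G}:\mathcal{P}_2(\mathbb{R}^d)\to\mathbb{R}$ satisfy the Data Assumptions of the context. For $\varepsilon>0$ let $U^{\varepsilon}:[0,T]\times\mathcal{P}_2(\mathbb{R}^d)\to\mathbb{R}$ be a bounded viscosity solution of $$-\partial_t U^\varepsilon(t,\mu)+\int_{\mathbb{R}^d}H(x,\partial_\mu U^\varepsilon(t,\mu,x),\mu)\,d\mu(x)-\varepsilon\int_{\mathbb{R}^d}\mathrm{tr}\big[\nabla\partial_\mu U^\varepsilon(t,\mu,x)\big]\,d\mu(x)=0\qquad(\mathrm{HJ}_\varepsilon)$$ and let $U:[0,T]\times\mathcal{P}_2(\mathbb{R}^d)\to\mathbb{R}$ be a bounded viscosity solution of $$-\partial_t U(t,\mu)+\int_{\mathbb{R}^d}H(x,\partial_\mu U(t,\mu,x),\mu)\,d\mu(x)=0,\qquad(\mathrm{HJ}_0)$$ such that $U^\varepsilon(T,\mu)=U(T,\mu)=\mathcal{G}(\mu)$ for all $\mu\in\mathcal{P}_2(\mathbb{R}^d)$. Suppose additionally that, for each $\varepsilon$, $U^\varepsilon$ is $W_1$-Lipschitz continuous in $\mu$ uniformly in time, that $U$ is $W_2$-Lipschitz continuous in $\mu$ uniformly in time, and that $U$ is jointly continuous with respect to the product topology of $[0,T]\times\mathcal{P}_2(\mathbb{R}^d)$, where $\mathcal{P}_2(\mathbb{R}^d)$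 is endowed with the weak convergence described in the context. Then there exists a constant $C\ge 0$, depending only on the data (in particular not on $\varepsilon$), such that $$\sup_{(t,\mu)\in[0,T]\times\mathcal{P}_2(\mathbb{R}^d)}|U^\varepsilon(t,\mu)-U(t,\mu)|\le C\sqrt{\varepsilon}.$$
   Context: **Wasserstein space.** $\mathcal{P}_2(\mathbb{R}^d)$ is the set of Borel probability measures on $\mathbb{R}^d$ with finite second moment $\mathcal{M}_2(\mu)=\int|x|^2d\mu$; $W_1,W_2$ are the $L^1$- and $L^2$-Wasserstein distances. A plan on $\mathbb{R}^{2d}$ is called optimal if it is an optimal coupling of its marginals for the quadratic cost $|x-y|^2$. $\pi_i$ are coordinate projections. **Weak convergence in $\mathcal{P}_2(\mathbb{R}^d)$.** $\mu_n\to\mu$ weakly in $\mathcal{P}_2(\mathbb{R}^d)$ if $\mu_n\to\mu$ narrowly and $\sup_n\mathcal{M}_2(\mu_n)<\infty$. **Data Assumptions.** (a) $H$ is continuous; (b) there is $C>0$ such that for all $p,q,x,y\in\mathbb{R}^d$, $\mu,\nu\in\mathcal{P}_2(\mathbb{R}^d)$: $|H(x,p,\mu)-H(y,q,\nu)|\le C(1+|p|+|q|)(W_2(\mu,\nu)+|x-y|+|p-q|)$; (c) there is $C>0$ with $|H(x,p,\mu)|\le C(1+|x|^2+|p|^2+\mathcal{M}_2(\mu))$ for all $(x,p,\mu)$; $\mathcal{G}$ is bounded and $W_1$-Lipschitz continuous. **Plans as velocities.** For $\mu\in\mathcal{P}_2(\mathbb{R}^d)$ let $\mathcal{P}_{2,\mu}(\mathbb{R}^{2d})=\{\gamma\in\mathcal{P}_2(\mathbb{R}^{2d}):(\pi_1)_\#\gamma=\mu\}$,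 $\exp_\mu(\gamma)=(\pi_1+\pi_2)_\#\gamma$, $\|\gamma\|_\mu=(\int|y|^2d\gamma(x,y))^{1/2}$, and, for $\lambda\in\mathbb{R}$, $\lambda\cdot\gamma=(\pi_1,\lambda\pi_2)_\#\gamma$. For $\gamma,\xi\in\mathcal{P}_{2,\mu}(\mathbb{R}^{2d})$, $\Gamma_\mu(\gamma,\xi)$ is the set of $\theta\in\mathcal{P}(\mathbb{R}^{3d})$ with $(\pi_1,\pi_2)_\#\theta=\gamma$, $(\pi_1,\pi_3)_\#\theta=\xi$; $\langle\gamma,\xi\rangle_{\theta,\mu}=\int\langle y,z\rangle d\theta(x,y,z)$; and $W_\mu^2(\gamma,\xi)=\min_{\theta\in\Gamma_\mu(\gamma,\xi)}\int|y-z|^2d\theta(x,y,z)$. The geometric tangent space $\mathrm{Tan}^K_\mu\mathcal{P}_2(\mathbb{R}^d)$ is the $W_\mu$-closure of the set of $\gamma\in\mathcal{P}_{2,\mu}(\mathbb{R}^{2d})$ such that $(\pi_1,\pi_1+\eta\pi_2)_\#\gamma$ is optimal for some $\eta>0$. **Sub/superdifferential.** For $\phi:\mathcal{P}_2(\mathbb{R}^d)\to(-\infty,+\infty]$ and $\mu$ with $\phi(\mu)<\infty$, $\partial^-\phi(\mu)$ is the set of $\gamma\in\mathrm{Tan}^K_\mu\mathcal{P}_2(\mathbb{R}^d)$ such that for all $\xi\in\mathcal{P}_{2,\mu}(\mathbb{R}^{2d})$ and $\theta\in\Gamma_\mu(\gamma,\xi)$, $\phi(\exp_\mu(\xi))-\phi(\mu)\ge\langle\xi,\gamma\rangle_{\theta,\mu}+o(\|\xi\|_\mu)$;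 and $\partial^+\phi(\mu)=\{-1\cdot\gamma:\gamma\in\partial^-(-\phi)(\mu)\}$. For functions of $(t,\mu)$, $(r,\gamma)\in\partial^-\phi(t,\mu)$ means $\gamma\in\mathrm{Tan}^K_\mu\mathcal{P}_2(\mathbb{R}^d)$ and $\phi(s,\exp_\mu(\xi))-\phi(t,\mu)\ge r(s-t)+\langle\xi,\gamma\rangle_{\theta,\mu}+o(|s-t|+\|\xi\|_\mu)$ for all $s\in[0,T]$, $\xi\in\mathcal{P}_{2,\mu}(\mathbb{R}^{2d})$ and $\theta\in\Gamma_\mu(\gamma,\xi)$; $\partial^+$ is defined by the reversed inequality. If $\mu$ is absolutely continuous, elements of $\mathrm{Tan}^K_\mu$ are of the form $(\mathrm{Id}\times p)_\#\mu$ with $p\in L^2_\mu(\mathbb{R}^d;\mathbb{R}^d)$ and one writes $p$ for the plan. **Viscosity solution of $(\mathrm{HJ}_0)$.** Put $\mathcal{H}(\gamma)=\int_{\mathbb{R}^{2d}}H(x,z,(\pi_1)_\#\gamma)\,d\gamma(x,z)$. $U$ is a viscosity subsolution (supersolution) if for all $t\in[0,T)$, $\mu\in\mathcal{P}_2(\mathbb{R}^d)$ and $(r,\gamma)\in\partial^+U(t,\mu)$ (resp. $\partial^-U(t,\mu)$) one has $-r+\mathcal{H}(\gamma)\le0$ (resp. $\ge0$); a viscosity solution is both. **Viscosity solution of $(\mathrm{HJ}_\varepsilon)$.** The entropy is $\mathcal{E}(\mu)=\int\log\mu\,d\mu$ if $\mu\in\mathcal{P}_2(\mathbb{R}^d)$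 is absolutely continuous (density also denoted $\mu$), $+\infty$ otherwise; the Fisher information is $\mathcal{I}(\mu)=\int|\nabla\log\mu|^2d\mu=\int|\nabla\mu|^2/\mu\,dx$ if $\mu$ is absolutely continuous and this is finite, $+\infty$ otherwise. $V$ is a viscosity subsolution of $(\mathrm{HJ}_\varepsilon)$ if there is $K>0$, depending only on $V$, $H$ and $\varepsilon$, such that for every $\delta>0$, whenever $t\in[0,T)$, $\mathcal{I}(\mu)<\infty$ and $(r,p)\in\partial^+(V-\delta\mathcal{E})(t,\mu)$, $$-r+\varepsilon\int\langle\nabla\log\mu(x),p(x)\rangle d\mu(x)+\int H(x,p(x),\mu)d\mu(x)\le K\delta;$$ it is a viscosity supersolution if, similarly, whenever $t\in[0,T)$, $\mathcal I(\mu)<\infty$ and $(r,p)\in\partial^-(V+\delta\mathcal{E})(t,\mu)$, the same left-hand side is $\ge-K\delta$; a viscosity solution is both.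
   Formalization: Viscosity sub-/supersolutions are also required to be upper/lower semicontinuous on [0,T]×(P_2,W_2), so U^ε is continuous in time; without this H=0, G=0, U=0, U^ε=1 for t<T and U^ε(T,·)=0 is a counterexample. *)

(* Defs.v *)
From HB Require Import structures.
From mathcomp Require Import all_boot all_order all_algebra.
From mathcomp Require Import all_classical all_reals all_analysis.
From mathcomp Require Import measurable_realfun ring lra.
Set Implicit Arguments.
Unset Strict Implicit.
Unset Printing Implicit Defensive.
Import Order.TTheory GRing.Theory Num.Theory.
Import numFieldNormedType.Exports.
Local Open Scope classical_set_scope.
Local Open Scope ring_scope.

(* the Borel sigma-algebra on R^n *)
Definition rV_borel_display : measure_display.
Proof. by constructor. Qed.

Section borel_rV.
Variables (R : realType) (n : nat).

Definition rV_borel : set (set 'rV[R]_n) := <<s (@open 'rV[R]_n) >>.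

Let rV_borel0 : rV_borel set0.
Proof. exact: sigma_algebra0. Qed.

Let rV_borelC A : rV_borel A -> rV_borel (~` A).
Proof. exact: sigma_algebraC. Qed.

Let rV_borelU (F : (set 'rV[R]_n)^nat) :
  (forall i, rV_borel (F i)) -> rV_borel (\bigcup_i (F i)).
Proof. exact: sigma_algebra_bigcup. Qed.

HB.instance Definition _ := @isMeasurable.Build rV_borel_display
  'rV[R]_n rV_borel rV_borel0 rV_borelC rV_borelU.
End borel_rV.


Section borel_rV_theory.
Context (R : realType).

Lemma measurable_rV_open n (A : set 'rV[R]_n) : open A -> measurable A.
Proof. by move=> oA; exact: sub_sigma_algebra. Qed.

Lemma measurable_coord n (i : 'I_n) :
  measurable_fun setT (fun x : 'rV[R]_n => x ord0 i).
Proof.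
apply: (measurability _ (RGenOpens.measurableE R)).
move=> _ [_ [r [s ->]] <-]; rewrite setTI; apply: measurable_rV_open.
apply: open_comp; last exact: interval_open.
by move=> x _; exact: coord_continuous.
Qed.

Let box n (qk : 'rV[rat]_n * nat) : set 'rV[R]_n :=
  [set x | forall i, `|x ord0 i - ratr (qk.1 ord0 i)| < qk.2.+1%:R^-1].

Let open_bigcup_box n (U : set 'rV[R]_n) : open U ->
  U = \bigcup_(qk in [set qk | box qk `<=` U]) box qk.
Proof.
move=> oU; rewrite eqEsubset; split => [x Ux|x [qk /=]]; last exact.
have /nbhs_ballP[e /= e0 xeU] : nbhs x U by exact: open_nbhs_nbhs.
have [k ke] : exists k, k.+1%:R^-1 < e / 2.
  have [k _ /(_ k (leqnn k))] := near_infty_natSinv_lt (PosNum (divr_gt0 e0 (ltr0n _ 2))).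
  by exists k.
have q_ (i : 'I_n) : {q : rat | `|x ord0 i - ratr q| < k.+1%:R^-1}.
  apply/cid; have [|q] := @rat_in_itvoo R (x ord0 i) (x ord0 i + k.+1%:R^-1).
    by rewrite ltrDl invr_gt0.
  rewrite in_itv/= => /andP[xq qx]; exists q.
  by rewrite ltr0_norm ?subr_lt0// opprB ltrBlDl.
pose q := (\row_i sval (q_ i) : 'rV[rat]_n).
have qx i : `|x ord0 i - ratr (q ord0 i)| < k.+1%:R^-1.
  by rewrite mxE; exact: svalP (q_ i).
exists (q, k); last exact: qx.
move=> y /= yq; apply: xeU; split => // i j; rewrite ord1 /ball/=.
rewrite -(subrKA (ratr (q ord0 j))) (le_lt_trans (ler_normD _ _))//.
rewrite [ltRHS]splitr ltrD ?(lt_trans _ ke)//.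
by rewrite distrC; exact: yq.
Qed.

Lemma measurable_rV d (T : measurableType d) n (f : T -> 'rV[R]_n) :
  (forall i, measurable_fun setT (fun t => f t ord0 i)) ->
  measurable_fun setT f.
Proof.
move=> mf; apply: (@measurability _ _ _ _ _ _ (@open 'rV[R]_n)) => //.
move=> _ [U oU <-]; rewrite setTI (open_bigcup_box oU) preimage_bigcup.
rewrite bigcup_mkcond; apply: countable_bigcupT_measurable.
  exact: countableP.
move=> qk; case: ifPn => // _.
rewrite [X in measurable X](_ : _ = \bigcap_(i : 'I_n)
    (fun t => f t ord0 i) @^-1`
    [set r : R | `|r - ratr (qk.1 ord0 i)| < qk.2.+1%:R^-1]); last first.
  by rewrite eqEsubset; split => t /= h i; [move=> _|]; exact: h.
apply: fin_bigcap_measurable => // i _.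
rewrite -[X in measurable X]setTI; apply: mf => //.
apply: open_measurable.
rewrite (_ : [set _ | _] = ball (ratr (qk.1 ord0 i) : R) qk.2.+1%:R^-1).
  exact: ball_open.
by apply/seteqP; split => r /=; rewrite /ball/= distrC.
Qed.

End borel_rV_theory.

Section lebesgue_rV.
Context (R : realType).

Definition cons_rV n (p : measurableTypeR R * 'rV[R]_n) : 'rV[R]_n.+1 :=
  \row_i oapp (fun j => p.2 ord0 j) p.1 (unlift ord0 i).

Definition uncons_rV n (x : 'rV[R]_n.+1) : measurableTypeR R * 'rV[R]_n :=
  (x ord0 ord0, \row_j x ord0 (lift ord0 j)).

Lemma cons_rVK n : cancel (@cons_rV n) (@uncons_rV n).
Proof.
move=> [r x]; rewrite /uncons_rV/= mxE unlift_none/=; congr pair.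
by apply/rowP => j; rewrite !mxE liftK.
Qed.

Lemma uncons_rVK n : cancel (@uncons_rV n) (@cons_rV n).
Proof.
move=> x; apply/rowP => i; rewrite mxE /=.
by case: unliftP => [j ->|->] //=; rewrite mxE.
Qed.

Lemma measurable_cons_rV n : measurable_fun setT (@cons_rV n).
Proof.
apply: measurable_rV => i; rewrite /cons_rV.
under eq_fun do rewrite mxE.
case: unliftP => [j _|_] /=; last exact: measurable_fst.
exact: measurableT_comp (measurable_coord j) measurable_snd.
Qed.

Lemma measurable_uncons_rV n : measurable_fun setT (@uncons_rV n).
Proof.
apply/measurable_fun_pairP; split => /=; first exact: measurable_coord.
apply: measurable_rV => i /=.
by under eq_fun do rewrite mxE; exact: measurable_coord.
Qed.

Section step.
Context n (m : {sigma_finite_measure set 'rV[R]_n -> \bar R}).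

Definition lebesgue_cons : set 'rV[R]_n.+1 -> \bar R :=
  pushforward ((@lebesgue_measure R) \x m)%E (@cons_rV n).



Let lebesgue_cons0 : lebesgue_cons set0 = 0%E.
Proof. have mc := @measurable_cons_rV n; exact: measure0. Qed.

Let lebesgue_cons_ge0 A : (0 <= lebesgue_cons A)%E.
Proof. have mc := @measurable_cons_rV n; exact: measure_ge0. Qed.

Let lebesgue_cons_sigma_additive : semi_sigma_additive lebesgue_cons.
Proof. have mc := @measurable_cons_rV n; exact: measure_semi_sigma_additive. Qed.

HB.instance Definition _ := isMeasure.Build _ _ _ lebesgue_cons
  lebesgue_cons0 lebesgue_cons_ge0 lebesgue_cons_sigma_additive.

Let lebesgue_cons_sigma_finite : sigma_finite setT lebesgue_cons.
Proof.
have /sigma_finiteP[F [TF ndF Foo]] := sigma_finiteT (@lebesgue_measure R).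
have /sigma_finiteP[G [TG ndG Goo]] := sigma_finiteT m.
exists (fun k => @uncons_rV n @^-1` (F k `*` G k)).
  rewrite -preimage_bigcup predeqE => x; split => //= _.
  have [i _ Fi] : (\bigcup_i F i) (uncons_rV x).1 by rewrite -TF.
  have [j _ Gj] : (\bigcup_i G i) (uncons_rV x).2 by rewrite -TG.
  exists (maxn i j) => //; split.
    by move: Fi; exact/subsetPset/ndF/leq_maxl.
  by move: Gj; exact/subsetPset/ndG/leq_maxr.
move=> k; have [mF Fk] := Foo k; have [mG Gk] := Goo k; split.
  rewrite -[X in measurable X]setTI.
  by apply: measurable_uncons_rV => //; exact: measurableX.
rewrite /lebesgue_cons /pushforward -comp_preimage.
rewrite (_ : _ \o _ = id) ?preimage_id//; last first.
  by apply/funext => p /=; rewrite cons_rVK.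
by rewrite product_measure1E// lte_mul_pinfty// ge0_fin_numE.
Qed.

HB.instance Definition _ := Measure_isSigmaFinite.Build _ _ _ lebesgue_cons
  lebesgue_cons_sigma_finite.

End step.

(* n-dimensional Lebesgue measure, as an iterated product; see
   [lebesgue_rV_box] *)
Fixpoint lebesgue_rV n : {sigma_finite_measure set 'rV[R]_n -> \bar R} :=
  match n with
  | 0 => \d_(0 : 'rV[R]_0)
  | n'.+1 => lebesgue_cons (lebesgue_rV n')
  end.

Lemma lebesgue_rV_box n (A : 'I_n -> set (measurableTypeR R)) :
  (forall i, measurable (A i)) ->
  lebesgue_rV n [set x : 'rV[R]_n | forall i, A i (x ord0 i)] =
  (\prod_(i < n) lebesgue_measure (A i))%E.
Proof.
elim: n A => [|n IHn] A mA.
  by rewrite big_ord0 /= diracE mem_set// => -[].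
rewrite big_ord_recl -IHn//= /lebesgue_cons /pushforward.
rewrite -product_measure1E//; last first.
  rewrite [X in measurable X](_ : _ = \bigcap_(i : 'I_n)
      (fun x : 'rV[R]_n => x ord0 i) @^-1` A (lift ord0 i)); last first.
    by rewrite eqEsubset; split => x /= h i; [move=> _|]; exact: h.
  apply: fin_bigcap_measurable => // i _.
  rewrite -[X in measurable X]setTI.
  exact: (@measurable_coord R n i _ _ (mA (lift ord0 i))).
congr product_measure1; apply/seteqP; split => -[r x] /=.
  move=> h; split => [|i]; first by have := h ord0; rewrite mxE unlift_none.
  by have := h (lift ord0 i); rewrite mxE liftK.
move=> [Ar Ax] i; rewrite mxE; case: unliftP => [j ->|->] //=.
Qed.

End lebesgue_rV.

(* The library norm on 'rV[R]_n is the sup norm; the Euclidean structure is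
   given by [dot], [sqnorm] and [enorm]. *)
Section euclid.
Context (R : realType) (n : nat).

Definition dot (x y : 'rV[R]_n) : R := \sum_(i < n) x ord0 i * y ord0 i.
Definition sqnorm (x : 'rV[R]_n) : R := dot x x.
Definition enorm (x : 'rV[R]_n) : R := Num.sqrt (sqnorm x).
Definition sqnorm2 (z : 'rV[R]_n * 'rV[R]_n) : R := sqnorm z.1 + sqnorm z.2.

Lemma sqnorm_ge0 x : 0 <= sqnorm x.
Proof. by apply: sumr_ge0 => i _; rewrite -expr2 sqr_ge0. Qed.

Lemma sqnorm2_ge0 z : 0 <= sqnorm2 z.
Proof. by rewrite addr_ge0 ?sqnorm_ge0. Qed.

Lemma sqnormD x y : sqnorm (x + y) <= 2 * (sqnorm x + sqnorm y).
Proof.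
rewrite /sqnorm /dot -big_split/= mulr_sumr ler_sum// => i _.
rewrite mxE -!expr2 -subr_ge0.
rewrite (_ : _ - _ = (x ord0 i - y ord0 i) ^+ 2) ?sqr_ge0//.
by rewrite sqrrB sqrrD mulr_natl mulr2n; ring.
Qed.

Lemma sqnormZ (a : R) x : sqnorm (a *: x) = a ^+ 2 * sqnorm x.
Proof.
rewrite /sqnorm /dot mulr_sumr; apply: eq_bigr => i _.
by rewrite mxE mulrACA expr2.
Qed.

Lemma measurable_sqnorm : measurable_fun setT sqnorm.
Proof.
apply: measurable_sum => i.
by apply: measurable_funM; exact: measurable_coord.
Qed.

Lemma measurable_sqnorm2 : measurable_fun setT sqnorm2.
Proof.
by apply: measurable_funD; apply: measurableT_comp => //;
  exact: measurable_sqnorm.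
Qed.

End euclid.

Section P2.
Context d (T : measurableType d) (R : realType) (q : T -> R).

(* Two elements may agree on all measurable sets without being equal in Rocq,
   measures being functions on arbitrary sets; they are then at Wasserstein
   distance 0, so Lipschitz functions do not distinguish them. *)
Record fin_moment := FinMoment {
  fm_prob :> probability T R ;
  fm_fin : (\int[fm_prob]_x (q x)%:E < +oo)%E }.

End P2.

Section image.
Context d d' (T : measurableType d) (T' : measurableType d') (R : realType).

Definition image_law (f : T -> T') (m : probability T R)
    (m' : probability T' R) : Prop :=
  forall A, measurable A -> pushforward m f A = m' A.

Context (q : T -> R) (q' : T' -> R) (f : T -> T').
Hypotheses (mf : measurable_fun setT f) (mq : measurable_fun setT q)
  (mq' : measurable_fun setT q') (q0 : forall x, 0 <= q x)
  (q'0 : forall x, 0 <= q' x).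
Variables (c : R) (c0 : 0 <= c) (qf : forall x, q' (f x) <= c * q x).

Let f_mfun : {mfun T >-> T'} := mfun_Sub (mem_set mf : f \in mfun).

Lemma image_fin (m : fin_moment q) :
  (\int[distribution m f_mfun]_x (q' x)%:E < +oo)%E.
Proof.
rewrite ge0_integral_distribution; last 2 first.
- by apply/measurable_EFinP.
- by move=> y; rewrite lee_fin.
apply: (@le_lt_trans _ _ (\int[m]_x (c%:E * (q x)%:E))%E).
  apply: ge0_le_integral => //=.
  - by move=> x _; rewrite lee_fin.
  - by apply: measurableT_comp mf; apply/measurable_EFinP.
  - by apply: measurable_funeM; exact/measurable_EFinP.
  - by move=> x _; rewrite -EFinM lee_fin.
rewrite ge0_integralZl//.
- by apply: lte_mul_pinfty => //; exact: fm_fin.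
- exact/measurable_EFinP.
- by move=> x _; rewrite lee_fin.
Qed.

Definition fm_image (m : fin_moment q) : fin_moment q' :=
  FinMoment (image_fin m).

End image.

Section P2_spaces.
Context (R : realType) (d : nat).

(* P_2(R^d) and P_2(R^2d), with elements of the latter seen as plans *)
Definition P2 := fin_moment (@sqnorm R d).
Definition plan := fin_moment (@sqnorm2 R d).

Definition M2 (mu : P2) : R := \int[mu]_x sqnorm x.

Let E := 'rV[R]_d.

Fact measurable_exp_map : measurable_fun setT (fun z : E * E => z.1 + z.2).
Proof.
apply: measurable_rV => i; under eq_fun do rewrite mxE.
by apply: measurable_funD; apply: measurableT_comp (measurable_coord i) _.
Qed.

Fact exp_map_le (z : E * E) : sqnorm (z.1 + z.2) <= 2 * sqnorm2 z.
Proof. exact: sqnormD. Qed.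

Fact fst_le (z : E * E) : sqnorm z.1 <= 1 * sqnorm2 z.
Proof. by rewrite mul1r lerDl sqnorm_ge0. Qed.

Fact snd_le (z : E * E) : sqnorm z.2 <= 1 * sqnorm2 z.
Proof. by rewrite mul1r lerDr sqnorm_ge0. Qed.

Definition move_map (eta : R) (z : E * E) : E * E := (z.1, z.1 + eta *: z.2).

Fact measurable_move_map eta : measurable_fun setT (move_map eta).
Proof.
apply/measurable_fun_pairP; split => /=; first exact: measurable_fst.
apply: measurable_rV => i /=; under eq_fun do rewrite !mxE.
apply: measurable_funD; first exact: measurableT_comp (measurable_coord i) _.
apply: measurable_funM => //.
exact: measurableT_comp (measurable_coord i) _.
Qed.

Fact move_map_le eta (z : E * E) :
  sqnorm2 (move_map eta z) <= (3 + 2 * eta ^+ 2) * sqnorm2 z.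
Proof.
have := sqnormD z.1 (eta *: z.2); rewrite sqnormZ /sqnorm2/=.
have := sqnorm_ge0 z.1; have := sqnorm_ge0 z.2.
have := sqr_ge0 eta; nra.
Qed.

Fact move_map_cst_ge0 (eta : R) : 0 <= 3 + 2 * eta ^+ 2.
Proof. by rewrite addr_ge0// mulr_ge0// sqr_ge0. Qed.

Definition marg1 (g : plan) : P2 :=
  fm_image measurable_fst (@measurable_sqnorm2 R d) (@measurable_sqnorm R d)
    (@sqnorm2_ge0 R d) (@sqnorm_ge0 R d) ler01 fst_le g.

Definition marg2 (g : plan) : P2 :=
  fm_image measurable_snd (@measurable_sqnorm2 R d) (@measurable_sqnorm R d)
    (@sqnorm2_ge0 R d) (@sqnorm_ge0 R d) ler01 snd_le g.

Definition exp_plan (g : plan) : P2 :=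
  fm_image measurable_exp_map (@measurable_sqnorm2 R d) (@measurable_sqnorm R d)
    (@sqnorm2_ge0 R d) (@sqnorm_ge0 R d) (ler0n R 2) exp_map_le g.

(* (pi_1, pi_1 + eta pi_2)_# g *)
Definition move_plan (eta : R) (g : plan) : plan :=
  fm_image (measurable_move_map eta) (@measurable_sqnorm2 R d)
    (@measurable_sqnorm2 R d) (@sqnorm2_ge0 R d) (@sqnorm2_ge0 R d)
    (move_map_cst_ge0 eta) (move_map_le eta) g.

End P2_spaces.

Section wasserstein.
Context (R : realType) (d : nat).
Let E := 'rV[R]_d.

Definition coupling (mu nu : P2 R d) : set (probability (E * E)%type R) :=
  [set k | image_law fst k mu /\ image_law snd k nu].

Definition transport_cost (c : E * E -> R) (mu nu : P2 R d) : \bar R :=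
  ereal_inf [set (\int[k]_z (c z)%:E)%E | k in coupling mu nu].

(* The infima are finite on P_2, so [fine] loses nothing. *)
Definition W1 (mu nu : P2 R d) : R :=
  fine (transport_cost (fun z => enorm (z.1 - z.2)) mu nu).
Definition W2 (mu nu : P2 R d) : R :=
  Num.sqrt (fine (transport_cost (fun z => sqnorm (z.1 - z.2)) mu nu)).

Definition optimal (g : plan R d) : Prop :=
  (\int[g]_z (sqnorm (z.1 - z.2))%:E)%E =
  transport_cost (fun z => sqnorm (z.1 - z.2)) (marg1 g) (marg2 g).

Definition narrow_cvg (mu_ : nat -> P2 R d) (mu : P2 R d) : Prop :=
  forall f : E -> R, continuous f -> (exists M : R, forall x, `|f x| <= M) ->
    (fun n => \int[mu_ n]_x f x) @ \oo --> \int[mu]_x f x.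

Definition weak_cvg (mu_ : nat -> P2 R d) (mu : P2 R d) : Prop :=
  narrow_cvg mu_ mu /\ exists M : R, forall n, M2 (mu_ n) <= M.

End wasserstein.

Section plans_as_velocities.
Context (R : realType) (d : nat).
Let E := 'rV[R]_d.

Definition plans_over (mu : P2 R d) : set (plan R d) :=
  [set g | image_law fst g mu].

Definition plan_norm (g : plan R d) : R :=
  Num.sqrt (\int[g]_z sqnorm z.2).

(* triples ((x, y), z), coupling the velocities y of g and z of xi *)
Definition Gamma (g xi : plan R d) : set (probability (E * E * E)%type R) :=
  [set th | image_law fst th g /\
            image_law (fun w => (w.1.1, w.2)) th xi].

Definition pairing (th : probability (E * E * E)%type R) : R :=
  \int[th]_w dot w.1.2 w.2.

(* the distance W_mu, mu being the common first marginal of g and xi *)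
Definition Wfib (g xi : plan R d) : \bar R :=
  ((ereal_inf [set (\int[th]_w (sqnorm (w.1.2 - w.2))%:E)%E
              | th in Gamma g xi]) `^ 2^-1)%E.

Definition tangentK (mu : P2 R d) : set (plan R d) :=
  [set g | plans_over mu g /\ forall e : R, 0 < e ->
    exists g', [/\ plans_over mu g',
      exists2 eta : R, 0 < eta & optimal (move_plan eta g') &
      (Wfib g g' < e%:E)%E]].

Section differentials.
Variables (T : R) (phi : R -> P2 R d -> \bar R) (t : R) (mu : P2 R d).

(* The remainder o(|s - t| + |xi|) is uniform in s, xi and th. Functions of
   time are only ever evaluated on [0, T]. *)
Definition subdiff (r : R) (g : plan R d) : Prop :=
  [/\ phi t mu \is a fin_num, tangentK mu g &
    forall e : R, 0 < e -> exists2 eta : R, 0 < eta &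
      forall (s : R) (xi : plan R d) th, s \in `[0, T] ->
        plans_over mu xi -> Gamma g xi th ->
        `|s - t| + plan_norm xi < eta ->
        (phi s (exp_plan xi) - phi t mu >=
         (r * (s - t) + pairing th - e * (`|s - t| + plan_norm xi))%:E)%E].

Definition superdiff (r : R) (g : plan R d) : Prop :=
  [/\ phi t mu \is a fin_num, tangentK mu g &
    forall e : R, 0 < e -> exists2 eta : R, 0 < eta &
      forall (s : R) (xi : plan R d) th, s \in `[0, T] ->
        plans_over mu xi -> Gamma g xi th ->
        `|s - t| + plan_norm xi < eta ->
        (phi s (exp_plan xi) - phi t mu <=
         (r * (s - t) + pairing th + e * (`|s - t| + plan_norm xi))%:E)%E].

End differentials.
End plans_as_velocities.

Section entropy.
Context (R : realType) (d : nat).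
Let E := 'rV[R]_d.
Let leb := lebesgue_rV R d.

Definition iter_partial (s : seq 'I_d) (f : E -> R) : E -> R :=
  foldr (fun i g x => 'D_(delta_mx ord0 i : E) (g : E -> R^o) x) f s.

Definition smooth (f : E -> R) : Prop := forall s : seq 'I_d,
  continuous (iter_partial s f) /\
  forall i x, derivable (iter_partial s f : E -> R^o) x (delta_mx ord0 i).

Definition test_fun (f : E -> R) : Prop :=
  smooth f /\ exists2 K : set E, compact K & forall x, ~ K x -> f x = 0.

Definition weak_gradient (f : E -> R) (g : E -> E) : Prop :=
  (forall i (K : set E), compact K ->
     leb.-integrable K (fun x => (g x ord0 i)%:E)) /\
  forall i (psi : E -> R), test_fun psi ->
    \int[leb]_x (f x * iter_partial [:: i] psi x) =
    - \int[leb]_x (g x ord0 i * psi x).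

(* weak gradients are unique up to Lebesgue-null sets *)
Definition wgrad (f : E -> R) : E -> E :=
  xget (fun=> 0) [set g | weak_gradient f g].

Definition density (mu : P2 R d) (x : E) : R :=
  fine (Radon_Nikodym (charge_of_finite_measure mu) leb x).

Definition entropy (mu : P2 R d) : \bar R :=
  if `[< mu `<< leb >] then (\int[mu]_x (ln (density mu x))%:E)%E else +oo%E.

(* grad (log mu); only its values mu-a.e., hence where density mu > 0, matter *)
Definition score (mu : P2 R d) (x : E) : E :=
  (density mu x)^-1 *: wgrad (density mu) x.

Definition fisher (mu : P2 R d) : \bar R :=
  if `[< mu `<< leb /\ exists g, weak_gradient (density mu) g >]
  then (\int[mu]_x (sqnorm (score mu x))%:E)%E else +oo%E.

End entropy.

Section hamilton_jacobi.
Context (R : realType) (d : nat).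
Let E := 'rV[R]_d.
Variables (H : E -> E -> P2 R d -> R) (G : P2 R d -> R) (T : R).

Definition data_assumptions : Prop :=
  [/\
    forall (x p : E) (mu : P2 R d) (e : R), 0 < e -> exists2 eta : R, 0 < eta &
      forall (y q : E) (nu : P2 R d), enorm (x - y) < eta -> enorm (p - q) < eta ->
        W2 mu nu < eta -> `|H x p mu - H y q nu| < e,
    exists2 C : R, 0 < C & forall p q x y mu nu,
      `|H x p mu - H y q nu| <= C * (1 + enorm p + enorm q) *
                               (W2 mu nu + enorm (x - y) + enorm (p - q)),
    exists2 C : R, 0 < C & forall x p mu,
      `|H x p mu| <= C * (1 + enorm x ^+ 2 + enorm p ^+ 2 + M2 mu),
    (exists M : R, forall mu, `|G mu| <= M) &
    (exists L : R, forall mu nu, `|G mu - G nu| <= L * W1 mu nu)].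

Definition Hplan (g : plan R d) : R := \int[g]_z H z.1 z.2 (marg1 g).

(* Semicontinuity on [0, T] x (P_2, W_2). As is customary, viscosity
   subsolutions are upper semicontinuous and supersolutions lower
   semicontinuous. Testing with sub- and superdifferentials at t < T alone would
   be too weak: for H = 0, the function equal to 1 for t < T and to 0 at t = T
   would be a solution with zero terminal value. *)
Definition usc (V : R -> P2 R d -> R) : Prop :=
  forall t mu (e : R), t \in `[0, T] -> 0 < e -> exists2 eta : R, 0 < eta &
    forall s nu, s \in `[0, T] -> `|s - t| < eta -> W2 mu nu < eta ->
      V s nu < V t mu + e.
Definition lsc (V : R -> P2 R d -> R) : Prop :=
  forall t mu (e : R), t \in `[0, T] -> 0 < e -> exists2 eta : R, 0 < eta &
    forall s nu, s \in `[0, T] -> `|s - t| < eta -> W2 mu nu < eta ->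
      V t mu - e < V s nu.

Definition hj0_subsolution (U : R -> P2 R d -> R) : Prop :=
  usc U /\ forall t mu r g, 0 <= t < T ->
    superdiff T (fun s nu => (U s nu)%:E) t mu r g -> - r + Hplan g <= 0.

Definition hj0_supersolution (U : R -> P2 R d -> R) : Prop :=
  lsc U /\ forall t mu r g, 0 <= t < T ->
    subdiff T (fun s nu => (U s nu)%:E) t mu r g -> 0 <= - r + Hplan g.

Definition hj0_solution (U : R -> P2 R d -> R) : Prop :=
  hj0_subsolution U /\ hj0_supersolution U.

Variable eps : R.

Definition hjeps_lhs (r : R) (mu : P2 R d) (p : E -> E) : R :=
  - r + eps * (\int[mu]_x dot (score mu x) (p x)) + \int[mu]_x H x (p x) mu.

(* g = (Id x p)_# mu; then p is in L^2_mu because g has finite second moment *)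
Definition graph_plan (mu : P2 R d) (p : E -> E) (g : plan R d) : Prop :=
  measurable_fun setT p /\ image_law (fun x => (x, p x)) mu g.

Definition hjeps_subsolution (V : R -> P2 R d -> R) : Prop :=
  usc V /\ exists2 K : R, 0 < K &
  forall (delta t : R) (mu : P2 R d) (r : R) (p : E -> E) (g : plan R d),
    0 < delta -> 0 <= t < T -> (fisher mu < +oo)%E -> graph_plan mu p g ->
    superdiff T (fun s nu => (V s nu)%:E - delta%:E * entropy nu)%E t mu r g ->
    hjeps_lhs r mu p <= K * delta.

Definition hjeps_supersolution (V : R -> P2 R d -> R) : Prop :=
  lsc V /\ exists2 K : R, 0 < K &
  forall (delta t : R) (mu : P2 R d) (r : R) (p : E -> E) (g : plan R d),
    0 < delta -> 0 <= t < T -> (fisher mu < +oo)%E -> graph_plan mu p g ->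
    subdiff T (fun s nu => (V s nu)%:E + delta%:E * entropy nu)%E t mu r g ->
    - (K * delta) <= hjeps_lhs r mu p.

Definition hjeps_solution (V : R -> P2 R d -> R) : Prop :=
  hjeps_subsolution V /\ hjeps_supersolution V.

Definition bounded_on (V : R -> P2 R d -> R) : Prop :=
  exists M : R, forall t mu, t \in `[0, T] -> `|V t mu| <= M.

Definition lipschitz_wrt (W : P2 R d -> P2 R d -> R) (V : R -> P2 R d -> R) :=
  exists L : R, forall t mu nu, t \in `[0, T] ->
    `|V t mu - V t nu| <= L * W mu nu.

Definition weakly_continuous (V : R -> P2 R d -> R) : Prop :=
  forall (t_ : nat -> R) (mu_ : nat -> P2 R d) (t : R) (mu : P2 R d),
    (forall n, t_ n \in `[0, T]) -> t \in `[0, T] ->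
    t_ n @[n --> \oo] --> t -> weak_cvg mu_ mu ->
    V (t_ n) (mu_ n) @[n --> \oo] --> V t mu.

End hamilton_jacobi.

(* Main.v *)
(* Double the variables over plans: maximise over times t, s and plans pi on
   R^d x R^d, with marginals mu and nu,
     U1(t, mu) - U2(s, nu) - a(t) int |x - y|^2 dpi - lam M_2(mu) - (t - s)^2 / beta
   minus a linear term in time and delta times the entropy of the marginal seen
   by the viscous equation, where a(t) = eps^(-1/2) e^(9 C (T - t)).  A maximum
   exists by weak compactness.  At a maximum pi is an optimal plan, so it is
   carried by the subdifferential of a convex function phi, and the plans with
   velocities 2 (a + lam) x - 2 a y at x and 2 a (x - y) at y are tangent, being
   limits of velocities whose straight displacement, for a short time, follows
   subgradients of convex functions.  They are thus a super- and a
   subdifferential.  Varying the marginal that carries the entropy shows that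
   this marginal has a score in L^2; pi is then the graph of a map, whose
   monotonicity gives the one-sided integration by parts that bounds the
   viscous term by 2 (a + lam) d eps, of order sqrt eps.  The two Hamiltonians
   differ by C (1/a + 9 a int |x - y|^2 dpi) up to vanishing terms, and the
   derivative of the time weight absorbs the second summand.  At t = T the bound
   Lg |x - y| <= Lg^2 / (2 a) + a |x - y|^2 / 2 concludes. *)

Require Import Defs.
From HB Require Import structures.
From mathcomp Require Import all_boot all_order all_algebra.
From mathcomp Require Import all_classical all_reals all_analysis.
From mathcomp Require Import measurable_realfun ring lra.
Set Implicit Arguments.
Unset Strict Implicit.
Unset Printing Implicit Defensive.
Import Order.TTheory GRing.Theory Num.Theory.
Import numFieldNormedType.Exports.
Local Open Scope classical_set_scope.
Local Open Scope ring_scope.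

(** The doubling runs over plans, not over pairs of measures: the squared distance is then linear in
    the variable, and a coupling of a velocity plan with a displacement directly produces a
    competitor in which one marginal moves and the other is kept. Only the viscous equation can be
    tested with an entropy, so the other marginal may be singular and its velocity need not be a
    map; tangency has to be proved for plans. Weak compactness gives neither W2 convergence nor
    convergence of second moments: the subtracted terms only need lower semicontinuity, while the
    two solutions must be semicontinuous along weakly convergent sequences, one by weak continuity,
    the other by W1-Lipschitz continuity. All laws are realised on the unit interval, so that weak
    convergence becomes almost sure convergence and lower semicontinuity becomes Fatou's lemma. The
    scale eps^(-1/2) balances the error C / a of the Hamiltonians against the viscous term, of order
    eps a d; the 9 in the weight is the coefficient of C a int |x - y|^2 dpi in the Hamiltonian
    error. *)

Local Notation "m '.-L1' f" := (m.-integrable setT (EFin \o f))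
  (at level 2, f at level 1, format "m '.-L1'  f").

(** * Limits, measurability and integrable functions *)

Section limits_and_bounds.
Context (R : realType) (u v : nat -> R) (l m b : R).
Hypotheses (ul : u @ \oo --> l) (vm : v @ \oo --> m).

Lemma cvgr_le_cvg : (\forall n \near \oo, u n <= v n) -> l <= m.
Proof.
rewrite -(cvg_lim (@Rhausdorff R) ul) -(cvg_lim (@Rhausdorff R) vm); apply: ler_lim.
- by apply/cvg_ex; exists l.
- by apply/cvg_ex; exists m.
Qed.

Lemma cvgr_le_bound : (\forall n \near \oo, u n <= b) -> l <= b.
Proof. by rewrite -(cvg_lim (@Rhausdorff R) ul); apply: limr_le; apply/cvg_ex; exists l. Qed.

Lemma cvgr_ge_bound : (\forall n \near \oo, b <= u n) -> b <= l.
Proof. by rewrite -(cvg_lim (@Rhausdorff R) ul); apply: limr_ge; apply/cvg_ex; exists l. Qed.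

End limits_and_bounds.

Section measurable_vectors.
Context (R : realType) (n : nat) d (T : measurableType d).
Implicit Types f g : T -> 'rV[R]_n.

Lemma measurable_entry f i :
  measurable_fun setT f -> measurable_fun setT (fun t => f t ord0 i).
Proof. by move=> mf; exact: measurableT_comp (measurable_coord i) mf. Qed.

Lemma measurable_addv f g : measurable_fun setT f -> measurable_fun setT g ->
  measurable_fun setT (fun t => f t + g t).
Proof.
move=> mf mg; apply: measurable_rV => i; under eq_fun do rewrite mxE.
by apply: measurable_funD; exact: measurable_entry.
Qed.

Lemma measurable_scalerv (k : T -> R) f : measurable_fun setT k ->
  measurable_fun setT f -> measurable_fun setT (fun t => k t *: f t).
Proof.
move=> mk mf; apply: measurable_rV => i; under eq_fun do rewrite mxE.
by apply: measurable_funM => //; exact: measurable_entry.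
Qed.

Lemma measurable_scalev (k : R) f :
  measurable_fun setT f -> measurable_fun setT (fun t => k *: f t).
Proof. by move=> mf; exact: measurable_scalerv. Qed.

Lemma measurable_oppv f :
  measurable_fun setT f -> measurable_fun setT (fun t => - f t).
Proof.
by move=> mf; under eq_fun do rewrite -scaleN1r; exact: measurable_scalev.
Qed.

Lemma measurable_subv f g : measurable_fun setT f -> measurable_fun setT g ->
  measurable_fun setT (fun t => f t - g t).
Proof. by move=> mf mg; apply: measurable_addv => //; exact: measurable_oppv. Qed.

Lemma measurable_sumv I (r : seq I) (h : I -> T -> 'rV[R]_n) :
  (forall i, measurable_fun setT (h i)) ->
  measurable_fun setT (fun t => \sum_(i <- r) h i t).
Proof.
move=> mh; apply: measurable_rV => j; under eq_fun do rewrite summxE.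
by apply: measurable_sum => i; exact: measurable_entry.
Qed.

Lemma measurable_dot f g : measurable_fun setT f -> measurable_fun setT g ->
  measurable_fun setT (fun t => dot (f t) (g t)).
Proof.
move=> mf mg; rewrite /dot; apply: measurable_sum => i.
by apply: measurable_funM; exact: measurable_entry.
Qed.

Lemma measurable_sqn f :
  measurable_fun setT f -> measurable_fun setT (fun t => sqnorm (f t)).
Proof. by move=> mf; exact: measurable_dot. Qed.

End measurable_vectors.

Lemma continuous_measurable_rV (R : realType) n (f : 'rV[R]_n -> R) :
  continuous f -> measurable_fun setT f.
Proof.
move=> cf; apply: (measurability _ (RGenOpens.measurableE R)).
move=> _ [_ [r [s ->]] <-]; rewrite setTI; apply: measurable_rV_open.
by apply: open_comp; [move=> x _; exact: cf|exact: interval_open].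
Qed.

Lemma continuous_measurable_rVv (R : realType) n m (f : 'rV[R]_n -> 'rV[R]_m) :
  continuous f -> measurable_fun setT f.
Proof.
move=> cf; apply: measurable_rV => i; apply: continuous_measurable_rV => x.
exact: (continuous_comp (cf x) (@coord_continuous _ _ _ ord0 i (f x))).
Qed.

Lemma measurable_row_mx (R : realType) m n :
  measurable_fun setT (fun z : 'rV[R]_m * 'rV[R]_n => row_mx z.1 z.2).
Proof.
apply: measurable_rV => i; rewrite -(splitK i); case: (fintype.split i) => j /=.
  under eq_fun do rewrite row_mxEl.
  exact: measurableT_comp (measurable_coord j) measurable_fst.
under eq_fun do rewrite row_mxEr.
exact: measurableT_comp (measurable_coord j) measurable_snd.
Qed.

Lemma cvg_rV (R : realType) n (T : Type) (F : set_system T) {FF : Filter F}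
    (f : T -> 'rV[R]_n) (l : 'rV[R]_n) :
  (forall i, (fun t => f t ord0 i) @ F --> l ord0 i) -> f @ F --> l.
Proof.
move=> fl; apply/cvg_ballP => e e0.
have : \forall t \near F, forall i, ball (l ord0 i) e (f t ord0 i).
  apply: (@filter_forall _ _ _ _ FF) => i.
  by move/cvg_ballP: (fl i); exact.
apply: filterS => t h; split => // i j; rewrite (ord1 i); exact: h.
Qed.

Lemma cvg_rV_coord (R : realType) n (T : Type) (F : set_system T) {FF : Filter F}
    (f : T -> 'rV[R]_n) (l : 'rV[R]_n) i :
  f @ F --> l -> (fun t => f t ord0 i) @ F --> l ord0 i.
Proof.
move=> fl; apply: (@continuous_cvg _ _ _ _ _ _ (fun x : 'rV[R]_n => x ord0 i)) fl.
exact: coord_continuous.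
Qed.

Lemma continuous_rV (R : realType) (T : topologicalType) n (f : T -> 'rV[R]_n) :
  (forall i, continuous (fun t => f t ord0 i)) -> continuous f.
Proof. by move=> h t; apply: cvg_rV => i; exact: h. Qed.

(** Pairs carry the product sigma-algebra; measurability is pulled back along [row_mx] from row
    vectors of length n + m, whose sigma-algebra is generated by the open sets. *)
Lemma continuous_measurable_pair (R : realType) n m
    (f : 'rV[R]_n * 'rV[R]_m -> R) : continuous f -> measurable_fun setT f.
Proof.
move=> cf.
rewrite (_ : f = (fun z => f (lsubmx z, rsubmx z)) \o
                 (fun z : 'rV[R]_n * 'rV[R]_m => row_mx z.1 z.2)); last first.
  by apply/funext => -[x y] /=; rewrite row_mxKl row_mxKr.
apply: measurableT_comp (@measurable_row_mx R n m).
apply: continuous_measurable_rV => z.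
apply: (continuous_comp (f := fun z => (lsubmx z, rsubmx z))); last exact: cf.
have cl : continuous (fun z : 'rV[R]_(n + m) => lsubmx z).
  apply: continuous_rV => i; under eq_fun do rewrite mxE.
  exact: coord_continuous.
have cr : continuous (fun z : 'rV[R]_(n + m) => rsubmx z).
  apply: continuous_rV => i; under eq_fun do rewrite mxE.
  exact: coord_continuous.
exact: (cvg_pair (cl z) (cr z)).
Qed.

Section L1.
Context d (T : measurableType d) (R : realType) (m : {measure set T -> \bar R}).
Implicit Types f g : T -> R.

Lemma L1_measurable f : m.-L1 f -> measurable_fun setT f.
Proof. by move=> /measurable_int /measurable_EFinP. Qed.

Lemma L1_le f g : measurable_fun setT f -> (forall x, `|f x| <= g x) ->
  m.-L1 g -> m.-L1 f.
Proof.
move=> mf fg ig; apply: (le_integrable _ _ _ ig) => //; first exact/measurable_EFinP.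
by move=> x _ /=; rewrite lee_fin (le_trans (fg x))// ler_norm.
Qed.

Lemma L1_lty f : measurable_fun setT f -> (forall x, 0 <= f x) ->
  (\int[m]_x (f x)%:E < +oo)%E -> m.-L1 f.
Proof.
move=> mf f0 foo; apply/integrableP; split; first exact/measurable_EFinP.
by under eq_integral do rewrite /= ger0_norm//.
Qed.

Lemma L1_fin f : m.-L1 f -> (\int[m]_x (f x)%:E)%E \is a fin_num.
Proof. by move=> /(@integrable_fin_num _ _ _ _ _ measurableT). Qed.

Lemma RintegralE f : m.-L1 f -> (\int[m]_x f x)%:E = (\int[m]_x (f x)%:E)%E.
Proof. by move=> /L1_fin fi; rewrite /Rintegral fineK. Qed.

Lemma L1D f g : m.-L1 f -> m.-L1 g -> m.-L1 (fun x => f x + g x).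
Proof. by move=> fi gi; have := integrableD measurableT fi gi. Qed.

Lemma L1B f g : m.-L1 f -> m.-L1 g -> m.-L1 (fun x => f x - g x).
Proof. by move=> fi gi; have := integrableB measurableT fi gi. Qed.

Lemma L1Z k f : m.-L1 f -> m.-L1 (fun x => k * f x).
Proof. by move=> fi; have := integrableZl measurableT k fi. Qed.

Lemma L1N f : m.-L1 f -> m.-L1 (fun x => - f x).
Proof. by move=> /(L1Z (-1)); under eq_fun do rewrite mulN1r. Qed.

Lemma L1_norm f : m.-L1 f -> m.-L1 (fun x => `|f x|).
Proof.
move=> fi; apply/integrableP; split.
  by apply/measurable_EFinP/measurableT_comp => //; exact: L1_measurable.
by under eq_integral do rewrite /= normr_id; case/integrableP: fi.
Qed.

Lemma L1_sum I (r : seq I) (P : pred I) (f : I -> T -> R) :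
  (forall i, P i -> m.-L1 (f i)) -> m.-L1 (fun x => \sum_(i <- r | P i) f i x).
Proof.
move=> fi; elim: r => [|i r IH].
  rewrite (_ : (fun _ => _) = cst 0); first exact: integrable0.
  by apply/funext => x; rewrite big_nil.
rewrite (_ : (fun _ => _) = fun x =>
    (if P i then f i x else 0) + \sum_(i <- r | P i) f i x); last first.
  by apply/funext => x; rewrite big_cons; case: ifP; rewrite ?add0r.
by apply: L1D => //; case Pi: (P i); [exact: fi|exact: integrable0].
Qed.

Lemma RintD f g : m.-L1 f -> m.-L1 g ->
  \int[m]_x (f x + g x) = \int[m]_x f x + \int[m]_x g x.
Proof. by move=> ? ?; rewrite RintegralD. Qed.

Lemma RintB f g : m.-L1 f -> m.-L1 g ->
  \int[m]_x (f x - g x) = \int[m]_x f x - \int[m]_x g x.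
Proof. by move=> ? ?; rewrite RintegralB. Qed.

Lemma RintZ k f : m.-L1 f -> \int[m]_x (k * f x) = k * \int[m]_x f x.
Proof. by move=> ?; rewrite RintegralZl. Qed.

Lemma RintN f : m.-L1 f -> \int[m]_x (- f x) = - \int[m]_x f x.
Proof.
by move=> fi; under eq_Rintegral do rewrite -mulN1r; rewrite RintZ ?mulN1r.
Qed.

Lemma Rint_sum I (r : seq I) (P : pred I) (f : I -> T -> R) :
  (forall i, P i -> m.-L1 (f i)) ->
  \int[m]_x (\sum_(i <- r | P i) f i x) = \sum_(i <- r | P i) \int[m]_x f i x.
Proof.
move=> fi; elim: r => [|i r IH].
  rewrite big_nil; under eq_Rintegral do rewrite big_nil.
  by rewrite /Rintegral integral0.
under eq_Rintegral do rewrite big_cons; rewrite big_cons.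
case: ifPn => Pi //; rewrite RintD ?IH//; first exact: fi.
exact: L1_sum.
Qed.

Lemma le_Rint f g : m.-L1 f -> m.-L1 g -> (forall x, f x <= g x) ->
  \int[m]_x f x <= \int[m]_x g x.
Proof. by move=> ? ? fg; apply: le_Rintegral. Qed.

Lemma Rint_ge0 f : (forall x, 0 <= f x) -> 0 <= \int[m]_x f x.
Proof. by move=> f0; apply: Rintegral_ge0. Qed.

Lemma ae_le_Rint f g : m.-L1 f -> m.-L1 g -> {ae m, forall x, f x <= g x} ->
  \int[m]_x f x <= \int[m]_x g x.
Proof.
move=> fi gi fg; rewrite -subr_ge0 -RintB//.
(* The positive part agrees almost everywhere with the difference and is nonnegative everywhere. *)
have -> : \int[m]_x (g x - f x) = \int[m]_x Num.max (g x - f x) 0.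
  rewrite /Rintegral; congr fine; apply: ae_eq_integral => //.
  - by apply/measurable_EFinP/measurable_funB; exact: L1_measurable.
  - apply/measurable_EFinP; apply: measurable_maxr => //.
    by apply: measurable_funB; exact: L1_measurable.
  - apply: filterS fg => x fgx _; congr EFin.
    by apply/esym/max_idPl; rewrite subr_ge0.
by apply: Rint_ge0 => x; rewrite le_max lexx orbT.
Qed.

Lemma ae_eq_Rint f g : measurable_fun setT f -> measurable_fun setT g ->
  {ae m, forall x, f x = g x} -> \int[m]_x f x = \int[m]_x g x.
Proof.
move=> mf mg fg; rewrite /Rintegral; congr fine; apply: ae_eq_integral => //;
  try exact/measurable_EFinP.
by apply: filterS fg => x fgx _; rewrite fgx.
Qed.

Lemma ae_eq_L1 f g : measurable_fun setT g -> m.-L1 f ->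
  {ae m, forall x, f x = g x} -> m.-L1 g.
Proof.
move=> mg fi fg; apply/integrableP; split; first exact/measurable_EFinP.
have mf := L1_measurable fi.
case/integrableP: fi => _; congr (_ < _)%E.
apply: ae_eq_integral => //.
- by apply/measurable_EFinP; apply: measurableT_comp.
- by apply/measurable_EFinP; apply: measurableT_comp.
- by apply: filterS fg => x fgx _ /=; rewrite fgx.
Qed.

Lemma Rint_dominated_ae (f_ : nat -> T -> R) f g :
  (forall n, m.-L1 (f_ n)) -> measurable_fun setT f ->
  m.-L1 g -> {ae m, forall x, (fun n => f_ n x) @ \oo --> f x} ->
  {ae m, forall x, forall n, `|f_ n x| <= g x} ->
  m.-L1 f /\ (fun n => \int[m]_x f_ n x) @ \oo --> \int[m]_x f x.
Proof.
move=> fin mf gi cf fg.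
have [] := @dominated_convergence _ _ _ m setT measurableT
  (fun n => EFin \o f_ n) (EFin \o f) (EFin \o g).
- by move=> n; exact: measurable_int (fin n).
- exact/measurable_EFinP.
- by apply: filterS cf => x cfx _; by apply: cvg_EFin => //; exact: nearW.
- exact: gi.
- by apply: filterS fg => x h n _ /=; rewrite lee_fin.
move=> fi _ cI; split => //.
apply: fine_cvg; rewrite RintegralE//.
Qed.

Lemma Rint_dominated (f_ : nat -> T -> R) f g :
  (forall n, measurable_fun setT (f_ n)) -> measurable_fun setT f ->
  m.-L1 g -> {ae m, forall x, (fun n => f_ n x) @ \oo --> f x} ->
  (forall n x, `|f_ n x| <= g x) ->
  m.-L1 f /\ (fun n => \int[m]_x f_ n x) @ \oo --> \int[m]_x f x.
Proof.
move=> mf_ mf gi cf fg; apply: (Rint_dominated_ae _ mf gi cf); last by apply: aeW.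
by move=> n; exact: L1_le (mf_ n) (fg n) gi.
Qed.

Lemma Rint_fatou (f_ : nat -> T -> R) f c :
  (forall n, m.-L1 (f_ n)) -> measurable_fun setT f ->
  (forall n x, 0 <= f_ n x) -> (forall x, 0 <= f x) ->
  {ae m, forall x, (fun n => f_ n x) @ \oo --> f x} ->
  (forall n, \int[m]_x f_ n x <= c) ->
  m.-L1 f /\ \int[m]_x f x <= c.
Proof.
move=> fi mf f_0 f0 cf lec.
have fle : (\int[m]_x (f x)%:E <= c%:E)%E.
  have := @fatou _ _ _ m setT measurableT (fun n => EFin \o f_ n)
    (fun n => ltac:(apply/measurable_EFinP; exact: L1_measurable))
    (fun n x _ => ltac:(by rewrite lee_fin)).
  rewrite (_ : (\int[m]_x limn_einf _)%E = (\int[m]_x (f x)%:E)%E); last first.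
    apply: ae_eq_integral => //.
    - have -> : (fun x => limn_einf ((fun n => EFin \o f_ n) ^~ x)) =
        (fun x => - limn_esup (fun n => - (f_ n x)%:E))%E.
        apply/funext => x; rewrite -limn_einfN; congr limn_einf.
        by apply/funext => n; rewrite /comp oppeK.
      apply: measurableT_comp => //; apply: measurable_fun_limn_esup => n.
      apply: measurableT_comp => //; apply/measurable_EFinP; exact: L1_measurable.
    - exact/measurable_EFinP.
    - apply: filterS cf => x cfx _ /=.
      have cx : (fun n => (f_ n x)%:E) @ \oo --> (f x)%:E.
        by apply: cvg_EFin cfx; exact: nearW.
      have := cvg_limn_einf_sup cx; case => -> _ //.
  move=> /le_trans; apply.
  rewrite (_ : (fun n => \int[m]_x (EFin \o f_ n) x)%E =
    (fun n => (\int[m]_x f_ n x)%:E)); last first.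
    by apply/funext => n; rewrite RintegralE.
  have : (limn_einf (fun n => (\int[m]_x f_ n x)%:E) <=
      limn_einf (fun n : nat => c%:E))%E.
    rewrite !limn_einf_lim; apply: lee_lim; [exact: is_cvg_einfs|exact: is_cvg_einfs|].
    apply: nearW => n; apply: le_ereal_inf_tmp => _ [k /= nk <-].
    apply: (@le_trans _ _ (\int[m]_x f_ k x)%:E); last by rewrite lee_fin.
    by apply: ereal_inf_lbound; exists k.
  move=> /le_trans; apply.
  have : (fun n : nat => c%:E) @ \oo --> c%:E by exact: cvg_cst.
  by move=> /cvg_limn_einf_sup[-> _].
have L : m.-L1 f by apply: L1_lty => //; rewrite (le_lt_trans fle)// ltry.
by split => //; rewrite -lee_fin RintegralE.
Qed.

End L1.

(** * Laws of random variables *)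

Section laws.
Context d d' (T : measurableType d) (T' : measurableType d') (R : realType).

Section law.
Variables (P : probability T R) (f : T -> T') (mf : measurable_fun setT f).

Definition law : probability T' R :=
  distribution P (mfun_Sub (mem_set mf : f \in mfun)).

Lemma lawE A : law A = P (f @^-1` A). Proof. by []. Qed.

Lemma image_law_law : image_law f P law. Proof. by []. Qed.

End law.

Variables (m : probability T R) (m' : probability T' R) (f : T -> T').
Hypotheses (mf : measurable_fun setT f) (fm : image_law f m m').

Lemma image_law_ge0_integral (g : T' -> \bar R) : measurable_fun setT g ->
  (forall y, 0 <= g y)%E -> (\int[m']_y g y = \int[m]_x g (f x))%E.
Proof.
move=> mg g0; transitivity (\int[law m mf]_y g y)%E.
  by apply: eq_measure_integral => A mA _; apply: esym; exact: fm.
by rewrite ge0_integral_distribution.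
Qed.

Lemma image_law_L1 (g : T' -> R) : measurable_fun setT g ->
  m'.-L1 g <-> m.-L1 (g \o f).
Proof.
move=> mg; have mgf := measurableT_comp mg mf.
have E : (\int[m']_y `|(g y)%:E| = \int[m]_x `|(g (f x))%:E|)%E.
  by apply: (image_law_ge0_integral (g := fun y => `|(g y)%:E|%E)) => //;
    apply: measurableT_comp => //; exact/measurable_EFinP.
split => /integrableP[_ h]; apply/integrableP; split;
  try exact/measurable_EFinP.
  by rewrite /= -E.
by rewrite /= E.
Qed.

Lemma image_law_Rint (g : T' -> R) : measurable_fun setT g ->
  \int[m']_y g y = \int[m]_x g (f x).
Proof.
move=> mg; rewrite /Rintegral; congr fine; rewrite integralE.
rewrite [in RHS]integralE; congr (_ - _)%E.
  rewrite (image_law_ge0_integral (g := (fun y => (g y)%:E)^\+%E))//.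
    by apply: eq_integral => x _; rewrite !funeposE.
  by apply: measurable_funepos; exact/measurable_EFinP.
rewrite (image_law_ge0_integral (g := (fun y => (g y)%:E)^\-%E))//.
  by apply: eq_integral => x _; rewrite !funenegE.
by apply: measurable_funeneg; exact/measurable_EFinP.
Qed.

Lemma image_law_ae (Q : T' -> Prop) : measurable [set y | Q y] ->
  {ae m', forall y, Q y} <-> {ae m, forall x, Q (f x)}.
Proof.
move=> mQ; have mQC : measurable (~` [set y | Q y]) by exact: measurableC.
split=> [[A [mA A0 QA]]|[A [mA A0 QA]]].
  exists (f @^-1` A); split => //; last by move=> x /= h; exact: QA.
    by rewrite -[X in measurable X]setTI; exact: mf.
  by rewrite -A0 -fm.
exists (~` [set y | Q y]); split => //.
rewrite -fm// /pushforward.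
apply/eqP; rewrite eq_le measure_ge0 andbT -A0 le_measure ?inE//.
by rewrite -[X in measurable X]setTI; exact: mf.
Qed.

End laws.

Section image_law_calculus.
Context d1 d2 d3 (T1 : measurableType d1) (T2 : measurableType d2)
  (T3 : measurableType d3) (R : realType).

Lemma image_law_comp (m1 : probability T1 R) (m2 : probability T2 R)
    (m3 : probability T3 R) f g :
  measurable_fun setT g -> image_law f m1 m2 -> image_law g m2 m3 ->
  image_law (g \o f) m1 m3.
Proof.
move=> mg fm gm A mA; rewrite -gm// /pushforward -fm//.
by rewrite -[X in measurable X]setTI; exact: mg.
Qed.

Lemma image_law_factor (m1 : probability T1 R) (m2 : probability T2 R)
    (m3 : probability T3 R) f g :
  measurable_fun setT g -> image_law f m1 m2 -> image_law (g \o f) m1 m3 ->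
  image_law g m2 m3.
Proof.
move=> mg fm gfm A mA; rewrite -gfm// /pushforward -fm//.
by rewrite -[X in measurable X]setTI; exact: mg.
Qed.

Lemma image_law_unique (m1 : probability T1 R) (m2 m3 : probability T2 R) f A :
  image_law f m1 m2 -> image_law f m1 m3 -> measurable A -> m2 A = m3 A.
Proof. by move=> h2 h3 mA; rewrite -h2// h3. Qed.

Lemma image_law_ext (m1 : probability T1 R) (m2 : probability T2 R) f g :
  f =1 g -> image_law f m1 m2 -> image_law g m1 m2.
Proof. by move=> /funext ->. Qed.

End image_law_calculus.

Lemma image_law_id d (T : measurableType d) (R : realType) (m : probability T R) :
  image_law id m m.
Proof. by move=> A mA; rewrite /pushforward preimage_id. Qed.

Section fin_moment_law.
Context d d' (T : measurableType d) (T' : measurableType d') (R : realType).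
Variables (q : T' -> R) (P : probability T R) (f : T -> T').
Hypotheses (mf : measurable_fun setT f) (mq : measurable_fun setT q)
  (q0 : forall y, 0 <= q y) (fq : P.-L1 (q \o f)).

Lemma law_fin_moment : (\int[law P mf]_y (q y)%:E < +oo)%E.
Proof.
rewrite (image_law_ge0_integral mf (image_law_law P mf))//.
- by rewrite -RintegralE// ltry.
exact/measurable_EFinP.
Qed.

Definition fm_law : fin_moment q := FinMoment law_fin_moment.

End fin_moment_law.

Section moments.
Context (R : realType) (d : nat).
Local Notation E := 'rV[R]_d.

Lemma fin_moment_L1 dT (T : measurableType dT) (q : T -> R) (m : fin_moment q) :
  measurable_fun setT q -> (forall x, 0 <= q x) -> m.-L1 q.
Proof. by move=> mq q0; apply: L1_lty => //; exact: fm_fin. Qed.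

Lemma P2_L1 (mu : P2 R d) : mu.-L1 (@sqnorm R d).
Proof. exact: (fin_moment_L1 mu (@measurable_sqnorm R d) (@sqnorm_ge0 R d)). Qed.

Lemma plan_L1 (g : plan R d) : g.-L1 (@sqnorm2 R d).
Proof. exact: (fin_moment_L1 g (@measurable_sqnorm2 R d) (@sqnorm2_ge0 R d)). Qed.

Lemma plan_L1_fst (g : plan R d) : g.-L1 (fun z => sqnorm z.1).
Proof.
apply: L1_le (plan_L1 g); first exact: (measurable_sqn measurable_fst).
by move=> x; rewrite ger0_norm ?sqnorm_ge0// lerDl sqnorm_ge0.
Qed.

Lemma plan_L1_snd (g : plan R d) : g.-L1 (fun z => sqnorm z.2).
Proof.
apply: L1_le (plan_L1 g); first exact: (measurable_sqn measurable_snd).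
by move=> x; rewrite ger0_norm ?sqnorm_ge0// lerDr sqnorm_ge0.
Qed.

Section of_random.
Context dT (T : measurableType dT) (P : probability T R) (X Y : T -> E).
Hypotheses (mX : measurable_fun setT X) (mY : measurable_fun setT Y)
  (iX : P.-L1 (fun w => sqnorm (X w))) (iY : P.-L1 (fun w => sqnorm (Y w))).

Definition P2_of : P2 R d :=
  fm_law mX (@measurable_sqnorm R d) (@sqnorm_ge0 R d) iX.

Lemma measurable_pair_of : measurable_fun setT (fun w => (X w, Y w)).
Proof. exact/measurable_fun_pairP. Qed.

Definition plan_of : plan R d :=
  fm_law measurable_pair_of (@measurable_sqnorm2 R d) (@sqnorm2_ge0 R d)
    (L1D iX iY).

Lemma P2_of_law : image_law X P P2_of. Proof. by []. Qed.

Lemma plan_of_law : image_law (fun w => (X w, Y w)) P plan_of. Proof. by []. Qed.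

End of_random.

Lemma marg1_law (g : plan R d) : image_law fst g (marg1 g). Proof. by []. Qed.

Lemma marg2_law (g : plan R d) : image_law snd g (marg2 g). Proof. by []. Qed.

Lemma exp_plan_law (g : plan R d) : image_law (fun z : E * E => z.1 + z.2) g (exp_plan g).
Proof. by []. Qed.

Lemma move_plan_law eta (g : plan R d) :
  image_law (move_map eta) g (move_plan eta g).
Proof. by []. Qed.

End moments.

Section ae_monotone.
Context d (T : measurableType d) (R : realType) (m : {measure set T -> \bar R}).

Lemma ae_imp (P Q : T -> Prop) : (forall x, P x -> Q x) ->
  {ae m, forall x, P x} -> {ae m, forall x, Q x}.
Proof. by move=> PQ; apply: filterS. Qed.

Lemma ae_imp2 (P Q S : T -> Prop) : (forall x, P x -> Q x -> S x) ->
  {ae m, forall x, P x} -> {ae m, forall x, Q x} -> {ae m, forall x, S x}.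
Proof. by move=> PQ; apply: filterS2. Qed.

Lemma ae_imp3 (P Q S U : T -> Prop) : (forall x, P x -> Q x -> S x -> U x) ->
  {ae m, forall x, P x} -> {ae m, forall x, Q x} -> {ae m, forall x, S x} ->
  {ae m, forall x, U x}.
Proof. by move=> PQ; apply: filterS3. Qed.

End ae_monotone.

Section uniform.
Context (R : realType).

(** The one probability space on which laws and plans are realised by random variables. *)
Definition unif : probability (measurableTypeR R) R := uniform_prob (@ltr01 R).

Lemma unif_itvoy (c : R) : 0 <= c <= 1 -> unif `]c, +oo[%classic = (1 - c)%:E.
Proof.
move=> /andP[c0 c1]; rewrite /unif /= /uniform_prob integral_uniform_pdf.
rewrite (_ : _ `&` _ = `]c, 1]%classic); last first.
  apply/seteqP; split => x /=; rewrite !in_itv/= ?andbT.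
    by move=> [-> /andP[_ ->]].
  by move=> /andP[cx x1]; rewrite cx x1 (le_trans c0 (ltW cx)).
rewrite (eq_integral (fun=> 1%:E)); last first.
  move=> x; rewrite inE/= in_itv/= => /andP[cx x1].
  by rewrite /uniform_pdf x1 (le_trans c0 (ltW cx)) subr0 invr1.
rewrite integral_cst//= lebesgue_measure_itv/= lte_fin mul1e.
by case: ltP => // c1'; rewrite (le_anti (introT andP (conj c1 c1'))) subrr.
Qed.

Lemma unif_countable (A : set R) : countable A -> unif.-negligible A.
Proof.
move=> cA; have A0 := countable_lebesgue_measure0 cA.
have mA : measurable A by exact: countable_measurable.
apply/negligibleP => //; have := @dominates_uniform_prob R 0 1 ltr01.
by move=> /null_content_dominatesP; exact.
Qed.

End uniform.

Lemma probability_itvoy_unique (R : realType)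
    (m1 m2 : {measure set R -> \bar R}) :
  (m1 setT < +oo)%E ->
  (forall r : R, m1 `]r, +oo[%classic = m2 `]r, +oo[%classic) ->
  forall A, measurable A -> m1 A = m2 A.
Proof.
move=> m1oo m12; apply: (@measure_unique _ R R (@RGenOInfty.G R)
  (fun k => `](-(k%:R) : R), +oo[%classic)).
- exact: RGenOInfty.measurableE.
- move=> _ _ [r ->] [s ->]; exists (Num.max r s).
  apply/seteqP; split => x /=; rewrite !in_itv/= !andbT gt_max.
    by move=> [-> ->].
  by move=> /andP[].
- by move=> i; exists (- i%:R).
- rewrite -subTset => x _ /=; exists (Num.bound `|x|) => //=.
  rewrite in_itv/= andbT ltrNl (le_lt_trans (ler_norm _))// normrN.
  exact: archi_boundP.
- by move=> _ [r ->].
- by move=> k; rewrite (le_lt_trans _ m1oo)// le_measure ?inE.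
Qed.

(** * Skorokhod representation *)

Section quantile.
Context d (T : measurableType d) (R : realType) (P : probability T R) (K : T -> R).
Hypotheses (mK : measurable_fun setT K) (K01 : forall x, 0 <= K x <= 1).

Let F (r : R) : R := fine (P (K @^-1` `]-oo, r]%classic)).

Let mKitv (B : set R) : measurable B -> measurable (K @^-1` B).
Proof. by move=> mB; rewrite -[X in measurable X]setTI; exact: mK. Qed.

Let FE r : P (K @^-1` `]-oo, r]%classic) = (F r)%:E.
Proof. by rewrite /F fineK// fin_num_measure//; exact: mKitv. Qed.

Let F_ge0 r : 0 <= F r. Proof. exact: fine_ge0. Qed.
Let F_le1 r : F r <= 1. Proof. by rewrite -lee_fin -FE probability_le1//; exact: mKitv. Qed.

Let F_homo r s : r <= s -> F r <= F s.
Proof.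
move=> rs; rewrite -lee_fin -!FE le_measure ?inE//; try exact: mKitv.
by move=> x /=; rewrite !in_itv/= => /le_trans; exact.
Qed.

Let F_rc r u : (forall s, r < s -> u <= F s) -> u <= F r.
Proof.
move=> h; pose X : {RV P >-> R} := mfun_Sub (mem_set mK : K \in mfun).
have := @cdf_right_continuous _ _ _ P X r.
have cdfE s : cdf X s = (F s)%:E by rewrite -FE.
move=> cX; rewrite -lee_fin -cdfE; apply: cvge_ge cX.
near=> s; rewrite cdfE lee_fin; apply: h; near: s; exact: nbhs_right_gt.
Unshelve. all: by end_near. Qed.

(** The clause [1 <= r] keeps the set nonempty when u exceeds every value of [F], so that the
    quantile is defined, monotone and in [0, 1] on the whole line. *)
Let S (u : R) : set R := [set r | 0 <= r /\ (u <= F r \/ 1 <= r)].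

Definition quantile (u : R) : R := inf (S u).

Let S_inf u : has_inf (S u).
Proof. by split; [exists 1; split => //; right|exists 0 => x []]. Qed.

Lemma quantile01 u : 0 <= quantile u <= 1.
Proof.
apply/andP; split.
  by apply: lb_le_inf; [exists 1; split => //; right|move=> x []].
by apply: ge_inf; [exists 0 => x []|split => //; right].
Qed.

Lemma quantile_homo u v : u <= v -> quantile u <= quantile v.
Proof.
move=> uv; apply: lb_le_inf; first by exists 1; split => //; right.
move=> r [r0 h]; apply: ge_inf; first by exists 0 => x [].
by split => //; case: h => [h|]; [left; exact: le_trans h|right].
Qed.

Lemma quantile_measurable : measurable_fun setT quantile.
Proof. by apply: nondecreasing_measurable => //; exact: quantile_homo. Qed.

(** The Galois connection between a distribution function and its quantile; right continuity of [F]
    makes the infimum attained. *)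
Let quantile_gt u r : 0 <= r < 1 -> (r < quantile u) = (F r < u).
Proof.
move=> /andP[r0 r1]; apply/idP/idP; apply: contraTT; rewrite -!leNgt.
  by move=> uF; apply: ge_inf; [exists 0 => x []|split => //; left].
move=> qr; apply: F_rc => s rs.
(* For s >= 1 the infimum may come from the extra clause of [S]; the midpoint of r and 1 serves
   instead. *)
wlog s1 : s rs / s < 1 => [wl|].
  have [|s1] := ltP s 1; first exact: wl.
  apply: le_trans (F_homo (le_trans _ s1)); first last.
    by apply: (midf_le (ltW r1)).2.
  by apply: wl; rewrite ?(midf_lt r1).
have [||t [t0 h] ts] := @inf_adherent R (S u) (s - quantile u).
- by rewrite subr_gt0 (le_lt_trans qr).
- exact: S_inf.
move: ts; rewrite -/(quantile u) subrKC => ts.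
case: h => [h|]; first by rewrite (le_trans h)// F_homo// ltW.
by rewrite leNgt (lt_trans ts s1).
Qed.

Lemma quantile_law A : measurable A -> unif R (quantile @^-1` A) = P (K @^-1` A).
Proof.
move=> mA; rewrite -[LHS](lawE (unif R) quantile_measurable) -[RHS](lawE P mK).
apply: (@probability_itvoy_unique R (law (unif R) quantile_measurable) (law P mK)) mA => [|r].
  apply: (@le_lt_trans _ _ 1%E); last exact: ltry.
  exact: (@probability_le1 _ _ _ (law (unif R) quantile_measurable) setT measurableT).
change (unif R (quantile @^-1` `]r, +oo[%classic) = P (K @^-1` `]r, +oo[%classic)).
have -> : P (K @^-1` `]r, +oo[%classic) = (1 - F r)%:E.
  rewrite -setCitvl preimage_setC probability_setC//; last first.
    have mI : measurable `]-oo, r]%classic by [].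
    exact: (mKitv mI).
  by rewrite EFinB -FE.
have [r0|r0] := ltP r 0.
  have -> : F r = 0.
    rewrite /F (_ : _ @^-1` _ = set0) ?measure0//; apply/seteqP; split => x //=.
    by rewrite in_itv/= => /le_lt_trans/(_ r0); case/andP: (K01 x) => ? _; rewrite ltNge => /negP.
  rewrite (_ : _ @^-1` _ = setT) ?probability_setT ?subr0//.
  apply/seteqP; split => x //= _; rewrite in_itv/= andbT (lt_le_trans r0)//.
  by case/andP: (quantile01 x).
have [r1|r1] := ltP r 1.
  rewrite (_ : _ @^-1` _ = `]F r, +oo[%classic).
    by rewrite unif_itvoy// F_ge0 F_le1.
  by apply/seteqP; split => x /=; rewrite !in_itv/= !andbT quantile_gt ?r0.
have -> : F r = 1.
  rewrite /F (_ : _ @^-1` _ = setT) ?probability_setT//; apply/seteqP; split => x //= _.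
  by rewrite in_itv/= (le_trans _ r1)//; case/andP: (K01 x).
rewrite (_ : _ @^-1` _ = set0) ?measure0 ?subrr//; apply/seteqP; split => x //=.
rewrite in_itv/= andbT => /(le_lt_trans r1); case/andP: (quantile01 x) => _.
by rewrite leNgt => /negP.
Qed.

End quantile.

Lemma increasing_seq_ge (f : nat -> nat) : increasing_seq f -> forall n, (n <= f n)%N.
Proof.
move=> fi; elim=> // n IH; apply: leq_ltn_trans IH _.
by have := fi n.+1 n; rewrite !leEnat => E; rewrite ltnNge E -ltnNge.
Qed.

Lemma increasing_seqS (f : nat -> nat) :
  (forall n, (f n < f n.+1)%N) -> increasing_seq f.
Proof.
move=> h; have H m k : (f m < f (m + k.+1))%N.
  elim: k => [|k IH]; first by rewrite addn1.
  by rewrite addnS (ltn_trans IH).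
move=> m n; apply/idP/idP; last first.
  rewrite leq_eqVlt => /predU1P[->//|mn].
  by rewrite -(subnKC mn) addSnnS; exact/ltnW/H.
apply: contraTT; rewrite -!ltnNge => mn.
by rewrite -(subnKC mn) addSnnS; exact: H.
Qed.

Lemma cvg_subseq (T : topologicalType) (u : nat -> T) (l : T) (f : nat -> nat) :
  (forall n, (n <= f n)%N) -> u @ \oo --> l -> (u \o f) @ \oo --> l.
Proof.
move=> fn ul; apply: cvg_comp ul => A [N _ NA]; exists N => // n /= Nn.
by apply: NA => /=; apply: leq_trans (fn n).
Qed.

(** Cantor's diagonal argument on top of the Bolzano-Weierstrass theorem. *)
Lemma diagonal_subseq (R : realType) (u : nat -> nat -> R) :
  (forall j, exists M, forall n, `|u j n| <= M) ->
  exists2 f : nat -> nat, increasing_seq f & forall j, cvgn (u j \o f).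
Proof.
move=> ub.
have step (j : nat) (f : nat -> nat) :
    {g : nat -> nat | increasing_seq g & cvgn (u j \o f \o g)}.
  apply/cid2; apply: (@bolzano_weierstrass R (u j \o f)).
  have [M uM] := ub j; exists M; split; first exact: num_real.
  by move=> x Mx n _ /=; rewrite (le_trans (uM _))// ltW.
pose g j f := s2val (step j f).
(* [Phi n] composes the first n extractions; the extraction of rank j makes [u j] converge. *)
pose Phi := fix Phi n := if n is n'.+1 then Phi n' \o g n' (Phi n') else id.
have gi j f : increasing_seq (g j f) by rewrite /g; case: (step j f).
have Pi n : increasing_seq (Phi n).
  elim: n => [|n IH] //= a b; rewrite /=; have := IH (g n (Phi n) a) (g n (Phi n) b).
  by move=> ->; have := gi n (Phi n) a b.
exists (fun n => Phi n n).
  apply: increasing_seqS => n /=.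
  have := Pi n (g n (Phi n) n.+1) n; rewrite !leEnat => E.
  rewrite ltnNge E -ltnNge.
  exact: (leq_trans (ltnSn n) (increasing_seq_ge (gi _ _) _)).
move=> j.
(* From rank j.+1 on, every [Phi] refines [Phi j.+1], so the diagonal is eventually a subsequence of
   it. *)
have tail m : exists2 h : nat -> nat, (forall n, (n <= h n)%N) &
    Phi (j.+1 + m)%N = Phi j.+1 \o h.
  elim: m => [|m [h hn hE]]; first by exists id => //; rewrite addn0.
  exists (h \o g (j.+1 + m)%N (Phi (j.+1 + m)%N)).
    by move=> n /=; apply: leq_trans (hn _); exact/increasing_seq_ge/gi.
  rewrite addnS; change (Phi (j.+1 + m)%N \o g (j.+1 + m)%N (Phi (j.+1 + m)%N) =
    Phi j.+1 \o (h \o g (j.+1 + m)%N (Phi (j.+1 + m)%N))).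
  by rewrite hE.
have [h hP] := choice (fun m => let: ex_intro2 h a b := tail m in
  ex_intro (fun h => (forall n, (n <= h n)%N) /\ Phi (j.+1 + m)%N = Phi j.+1 \o h)
    h (conj a b)).
have /cvg_ex[l ul] : cvgn (u j \o Phi j.+1) by rewrite /= /g; case: (step j _).
apply/cvg_ex; exists l.
have : (u j \o Phi j.+1 \o (fun n => h n (j.+1 + n)%N)) @ \oo --> l.
  apply: cvg_subseq ul => n; apply: leq_trans ((hP n).1 _); exact: leq_addl.
have E n : Phi (n + j.+1)%N (n + j.+1)%N = Phi j.+1 (h n (j.+1 + n)%N).
  by rewrite addnC (hP n).2.
have -> : u j \o Phi j.+1 \o (fun n => h n (j.+1 + n)%N) =
    [sequence (u j \o (fun n => Phi n n)) (n + j.+1)%N]_n.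
  by apply/funext => n; congr (u j _); exact/esym/E.
by rewrite cvg_shiftn.
Qed.

Section helly.
Context (R : realType) (q_ : nat -> R -> R).
Hypotheses (q01 : forall n u, 0 <= q_ n u <= 1)
  (q_homo : forall n u v, u <= v -> q_ n u <= q_ n v).

(** Diagonal extraction gives convergence at all rationals. Monotonicity then forces convergence
    wherever the limit over the rationals has no jump, that is, off a countable set. *)
Lemma helly : exists (f : nat -> nat) (q : R -> R),
  [/\ increasing_seq f, measurable_fun setT q &
      {ae unif R, forall u, (fun n => q_ (f n) u) @ \oo --> q u}].
Proof.
have [|f fi fc] := @diagonal_subseq R
  (fun j n => q_ n (ratr (odflt 0 (unpickle j : option rat)))).
  by move=> j; exists 1 => n; rewrite ger0_norm; case/andP: (q01 n (ratr (odflt 0 (unpickle j)))).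
have cr (r : rat) : cvgn (fun n => q_ (f n) (ratr r)).
  by have := fc (pickle r); rewrite pickleK.
pose L (r : rat) : R := limn (fun n => q_ (f n) (ratr r)).
have L01 r : 0 <= L r <= 1.
  apply/andP; split.
    by apply: limr_ge => //; apply: nearW => n; case/andP: (q01 (f n) (ratr r)).
  by apply: limr_le => //; apply: nearW => n; case/andP: (q01 (f n) (ratr r)).
have Lhomo r s : (ratr r : R) <= ratr s -> L r <= L s.
  by move=> rs; apply: ler_lim => //; apply: nearW => n; exact: q_homo.
pose A (u : R) := [set L r | r in [set r : rat | ratr r < u]].
pose B (u : R) := [set L r | r in [set r : rat | u < ratr r]].
have Asup u : has_sup (A u).
  split; last by exists 1 => _ [r _ <-]; case/andP: (L01 r).
  have [|r] := @rat_in_itvoo R (u - 1) u; first by rewrite ltrBlDr ltrDl.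
  by rewrite in_itv/= => /andP[_ ru]; exists (L r); exists r.
have Binf u : has_inf (B u).
  split; last by exists 0 => _ [r _ <-]; case/andP: (L01 r).
  have [|r] := @rat_in_itvoo R u (u + 1); first by rewrite ltrDl.
  by rewrite in_itv/= => /andP[ru _]; exists (L r); exists r.
pose q u := sup (A u).
exists f, q; split => //.
  apply: nondecreasing_measurable => // u v uv.
  apply: sup_le_ub; first exact: (Asup u).1.
  move=> _ [r /= ru <-]; apply: ub_le_sup; first exact: (Asup v).2.
  by exists r => //=; exact: lt_le_trans uv.
(* A jump at u contains a rational, and jumps at distinct points are disjoint; hence they are
   countably many. *)
pose bad (u : R) := sup (A u) < inf (B u).
have bad_cnt : countable [set u | bad u].
  have bt (u : R) : {t : rat | bad u -> sup (A u) < ratr t < inf (B u)}.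
    apply/cid; case: (pselect (bad u)) => [bu|nb]; last by exists 0.
    by have [t] := rat_in_itvoo bu; rewrite in_itv/= => ?; exists t.
  apply/pcard_injP; exists (fun u => pickle (sval (bt u))).
  move=> u v; rewrite !inE /= => bu bv /(pcan_inj pickleK) tuv.
  have key (x y : R) : bad x -> bad y -> sval (bt x) = sval (bt y) -> ~ (x < y).
    move=> bx by_ txy xy.
    have [r] := rat_in_itvoo xy; rewrite in_itv/= => /andP[xr ry].
    have /andP[_ h1] := svalP (bt x) bx; have /andP[h2 _] := svalP (bt y) by_.
    have h3 : inf (B x) <= L r by apply: ge_inf; [exact: (Binf x).2|exists r].
    have h4 : L r <= sup (A y) by apply: ub_le_sup; [exact: (Asup y).2|exists r].
    rewrite txy in h1; have := lt_trans h2 h1.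
    by rewrite ltNge (le_trans h3 h4).
  case: (ltgtP u v) => // [uv|vu]; first by have := key _ _ bu bv tuv.
  by have := key _ _ bv bu (esym tuv).
apply: negligibleS (unif_countable bad_cnt) => u /=; apply: contra_notP => nbad.
have qB : inf (B u) <= q u by rewrite leNgt; apply/negP.
apply/cvgrPdist_lt => e e0.
have [_ [r /= ru <-] Lr] := sup_adherent e0 (Asup u).
have [_ [s /= us <-] Ls] := inf_adherent e0 (Binf u).
have h1 : \forall n \near \oo, q u - e < q_ (f n) (ratr r).
  exact: (cvgr_gt (L r) (cr r)).
have h2 : \forall n \near \oo, q_ (f n) (ratr s) < q u + e.
  by apply: (cvgr_lt (L s) (cr s)); rewrite (lt_le_trans Ls)// lerD2r.
near=> n.
have a1 : q u - e < q_ (f n) (ratr r) by near: n.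
have a2 : q_ (f n) (ratr s) < q u + e by near: n.
have a3 := q_homo (f n) (ltW ru); have a4 := q_homo (f n) (ltW us).
by rewrite ltr_norml; apply/andP; split; lra.
Unshelve. all: by end_near. Qed.

End helly.

Section code.
Context (R : realType) (n : nat).
Local Notation E := 'rV[R]_n.

(** The half-spaces with rational bound orthogonal to a coordinate, enumerated by [pickle]; together
    they determine the point. *)
Definition bit (k : nat) (x : E) : bool :=
  if (unpickle k : option ('I_n * rat)) is Some (i, q) then ratr q < x ord0 i
  else false.

Lemma bitE i q x : bit (pickle (i, q)) x = (ratr q < x ord0 i).
Proof. by rewrite /bit pickleK. Qed.

(* Ternary digits 0 and 2: the code is injective and nearby codes share their
   first bits. *)
Definition psum (m : nat) (x : E) : R :=
  \sum_(k < m) 2 * (bit k x)%:R / 3 ^+ k.+1.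

Definition code (x : E) : R := limn (psum^~ x).

Let psumS m x : psum m.+1 x = psum m x + 2 * (bit m x)%:R / 3 ^+ m.+1.
Proof. by rewrite /psum big_ord_recr. Qed.

Let psum_tail m k x : psum (m + k) x <= psum m x + (3 ^- m - 3 ^- (m + k)).
Proof.
elim: k => [|k IH]; first by rewrite addn0 subrr addr0.
rewrite addnS psumS.
have : 2 * (bit (m + k) x)%:R / 3 ^+ (m + k).+1 <= 3 ^- (m + k) - 3 ^- (m + k).+1 :> R.
  rewrite exprS invfM; set c := 3 ^- (m + k).
  have : 0 < c :> R by rewrite invr_gt0 exprn_gt0.
  by case: bit; rewrite ?mulr1 ?mulr0 ?mul0r; lra.
by move=> h; lra.
Qed.

Let psum_homo m k x : (m <= k)%N -> psum m x <= psum k x.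
Proof.
move=> /subnK <-; elim: (k - m)%N => // j IH; rewrite addSn psumS.
by rewrite (le_trans IH)// lerDl mulr_ge0// invr_ge0 exprn_ge0.
Qed.

Let psum_cvg x : cvgn (psum^~ x).
Proof.
apply: nondecreasing_is_cvgn; first by move=> m k; exact: psum_homo.
exists 1 => _ [m _ <-]; have := psum_tail 0 m x.
rewrite add0n expr0 invr1 /psum big_ord0 add0r => /le_trans; apply.
by rewrite gerBl invr_ge0 exprn_ge0.
Qed.

Lemma code_bounds m x : psum m x <= code x <= psum m x + 3 ^- m.
Proof.
apply/andP; split.
  apply: limr_ge; first exact: psum_cvg.
  by exists m => // k /= mk; exact: psum_homo.
apply: limr_le; first exact: psum_cvg.
exists m => // k /= /subnKC <-; rewrite (le_trans (psum_tail _ _ _))// lerD2l.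
by rewrite gerBl invr_ge0 exprn_ge0.
Qed.

Lemma code01 x : 0 <= code x <= 1.
Proof. by have := code_bounds 0 x; rewrite /psum big_ord0 expr0 invr1 add0r. Qed.

Lemma code_measurable : measurable_fun setT code.
Proof.
apply: (@measurable_fun_cvg _ _ _ _ (fun m => psum m)); last first.
  by move=> x _; exact: psum_cvg.
move=> m; apply: measurable_sum => k; apply: measurable_funM => //.
apply: measurable_funM => //; rewrite /bit.
case: unpickle => [[i q]|]; last exact: measurable_cst.
apply: (@measurableT_comp _ _ _ _ _ _ (fun b : bool => b%:R : R)) => //.
apply: measurable_fun_ltr => //; exact: measurable_coord.
Qed.

Lemma code_bit x y k : `|code x - code y| < 3 ^- k.+1 -> bit k x = bit k y.
Proof.
elim/ltn_ind: k x y => k IH x y h.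
have pE : psum k x = psum k y.
  apply: eq_bigr => j _; congr (_ * _%:R / _); congr nat_of_bool.
  apply: (IH j) => //; apply: lt_le_trans h _.
  rewrite lef_pV2 ?posrE ?exprn_gt0// ler_weXn2l ?ler1n//.
  exact: (ltnW (ltn_ord j)).
(* At the first differing bit the codes differ by a digit 2, worth 2 / 3^(k+1), while all later
   digits amount to at most 1 / 3^(k+1). *)
have key (u v : E) : psum k u = psum k v -> bit k u -> ~~ bit k v ->
    3 ^- k.+1 <= code u - code v.
  move=> uv bu bv; have := code_bounds k.+1 u; have := code_bounds k.+1 v.
  rewrite !psumS uv bu (negbTE bv) mulr0 mul0r mulr1 addr0.
  by move=> /andP[_ h1] /andP[h2 _]; lra.
move: h; case bx: (bit k x); case by_: (bit k y) => //.
  move=> h; have := key x y pE bx (negbT by_).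
  by move=> /(le_trans)/(_ (ler_norm _)); rewrite leNgt h.
rewrite distrC => h; have := key y x (esym pE) by_ (negbT bx).
by move=> /(le_trans)/(_ (ler_norm _)); rewrite leNgt h.
Qed.

(** A bit read off a real that need not be a code. The tolerance is half the gap of [code_bit]: the
    condition is open, it agrees with [bit] on codes, and it is decided in the limit along
    convergent codes. *)
Definition rbit (k : nat) (r : R) : Prop :=
  exists2 x, bit k x & `|code x - r| < 3 ^- k.+1 / 2.

Lemma rbit_code k x : rbit k (code x) <-> bit k x.
Proof.
split=> [[y ky yx]|kx].
  rewrite -(@code_bit y)// (lt_trans yx)// ltr_pdivrMr//.
  by rewrite ltr_pMr ?ltr1n// invr_gt0 exprn_gt0.
by exists x => //; rewrite subrr normr0 divr_gt0// invr_gt0 exprn_gt0.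
Qed.

Lemma rbit_cvg (x_ : nat -> E) (r : R) k :
  (fun m => code (x_ m)) @ \oo --> r ->
  \forall m \near \oo, bit k (x_ m) <-> rbit k r.
Proof.
move=> cr; have e0 : 0 < 3 ^- k.+1 / 2 :> R by rewrite divr_gt0// invr_gt0 exprn_gt0.
have /cvgrPdist_lt /(_ _ e0) := cr; apply: filterS => m; rewrite distrC => h.
split=> [b|[y ky yr]]; first by exists (x_ m).
rewrite -(@code_bit y)//.
rewrite -(subrKA r) (le_lt_trans (ler_normD _ _))//.
by rewrite [ltRHS]splitr ltrD// distrC.
Qed.

Lemma rbit_open k : open (rbit k).
Proof.
rewrite (_ : rbit k = \bigcup_(x in bit k) ball (code x) (3 ^- k.+1 / 2)).
  by apply: bigcup_open => x _; exact: ball_open.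
by apply/seteqP; split => r [x h1 h2]; exists x.
Qed.

(** The supremum of a Dedekind cut; it is infinite when the cut is degenerate, which [fine] then
    sends to 0. *)
Definition decode_coord (i : 'I_n) (r : R) : \bar R :=
  ereal_sup [set (ratr q)%:E | q in [set q : rat | rbit (pickle (i, q)) r]].

Definition decode (r : R) : E := \row_i fine (decode_coord i r).

Lemma decode_measurable : measurable_fun setT decode.
Proof.
apply: measurable_rV => i; rewrite /decode; under eq_fun do rewrite mxE.
apply: measurableT_comp => //.
pose h (k : nat) (r : R) : \bar R :=
  if (unpickle k : option rat) is Some q then
    (if `[< rbit (pickle (i, q)) r >] then (ratr q)%:E else -oo%E) else -oo%E.
rewrite (_ : decode_coord i = fun r => esups (h^~ r) 0%N).
  apply: measurable_fun_esups => k; rewrite /h.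
  case: unpickle => [q|]; last exact: measurable_cst.
  apply: measurable_fun_ifT => //.
  have mO : measurable (rbit (pickle (i, q))).
    by apply: open_measurable; exact: rbit_open.
  apply: (@measurable_fun_bool _ _ _ _ true).
  rewrite setTI (_ : _ @^-1` _ = rbit (pickle (i, q)))//.
  by apply/seteqP; split => r /=; [move/asboolP|move=> ?; exact/asboolP].
apply/funext => r; apply/le_anti/andP; split.
  apply: ge_ereal_sup => _ [q /= rq <-]; apply: ereal_sup_ubound.
  by exists (pickle q) => //=; rewrite /h pickleK; case: asboolP.
apply: ge_ereal_sup => _ [k _ <-]; rewrite /h.
case: unpickle => [q|]; last exact: leNye.
case: asboolP => [rq|_]; last exact: leNye.
by apply: ereal_sup_ubound; exists q.
Qed.

Lemma decode_coordP i r (s : R) :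
  (forall q : rat, ratr q < s -> rbit (pickle (i, q)) r) ->
  (forall q : rat, s < ratr q -> ~ rbit (pickle (i, q)) r) ->
  decode_coord i r = s%:E.
Proof.
move=> h1 h2; apply/le_anti/andP; split.
  apply: ge_ereal_sup => _ [q /= rq <-]; rewrite lee_fin leNgt.
  by apply/negP => /h2.
apply/lee_addgt0Pr => e e0.
have [|q] := @rat_in_itvoo R (s - e) s; first by rewrite ltrBlDr ltrDl.
rewrite in_itv/= => /andP[q1 q2].
apply: (@le_trans _ _ ((ratr q)%:E + e%:E)%E).
  by rewrite -EFinD lee_fin -lerBlDr ltW.
by rewrite leeD2r//; apply: ereal_sup_ubound; exists q => //; exact: h1.
Qed.

Lemma codeK : cancel code decode.
Proof.
move=> x; apply/rowP => i; rewrite mxE (@decode_coordP i _ (x ord0 i))//.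
  by move=> q qx; apply/rbit_code; rewrite bitE.
by move=> q xq /rbit_code; rewrite bitE ltNge ltW.
Qed.

(** A limit of codes need not be a code, since the points may escape to infinity. Every bit is
    eventually constant, and boundedness along infinitely many indices makes the limiting cut
    nonempty and bounded above. *)
Lemma decode_cvg (x_ : nat -> E) (r : R) :
  (fun m => code (x_ m)) @ \oo --> r ->
  (exists B, forall N, exists2 m, (N <= m)%N & sqnorm (x_ m) <= B) ->
  x_ @ \oo --> decode r.
Proof.
move=> cr [B hB].
have frq (P : set nat) : (\forall m \near \oo, P m) ->
    exists2 m, P m & sqnorm (x_ m) <= B.
  by move=> [N _ NP]; have [m Nm mB] := hB N; exists m => //; exact: NP.
have cB (x : E) i : sqnorm x <= B -> `|x ord0 i| <= 1 + B.
  move=> xB; have : x ord0 i ^+ 2 <= B.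
    apply: le_trans xB; rewrite /sqnorm /dot (bigD1 i)//= expr2 lerDl.
    by apply: sumr_ge0 => j _; rewrite -expr2 sqr_ge0.
  set a := x ord0 i => aB.
  have := normr_ge0 a; have : `|a| ^+ 2 = a ^+ 2 by rewrite real_normK ?num_real.
  by nra.
apply: cvg_rV => i; rewrite mxE.
pose b (q : rat) := rbit (pickle (i, q)) r.
have bP q : \forall m \near \oo, (ratr q < x_ m ord0 i) <-> b q.
  have := rbit_cvg (pickle (i, q)) cr.
  by apply: filterS => m; rewrite bitE.
have b_dn (q q' : rat) : (ratr q : R) <= ratr q' -> b q' -> b q.
  move=> qq' bq'; have [m [h1 h2] _] := frq _ (filterI (bP q) (bP q')).
  by apply/h1; apply: le_lt_trans qq' _; exact/h2.
have b1 q : (ratr q : R) < - (1 + B) -> b q.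
  move=> qB; have [m h mB] := frq _ (bP q); apply/h.
  by apply: lt_le_trans qB _; have := cB _ i mB; rewrite ler_norml => /andP[].
have b2 q : 1 + B < (ratr q : R) -> ~ b q.
  move=> qB; have [m h mB] := frq _ (bP q) => /h.
  apply/negP; rewrite -leNgt; apply: le_trans (ltW qB).
  by have := cB _ i mB; rewrite ler_norml => /andP[].
pose S := [set (ratr q : R) | q in b].
have supS : has_sup S.
  split; last first.
    by exists (1 + B) => _ [q bq <-]; rewrite leNgt; apply/negP => /b2; exact.
  have [|q] := @rat_in_itvoo R (- (1 + B) - 1) (- (1 + B)); first by rewrite ltrBlDr ltrDl.
  by rewrite in_itv/= => /andP[_ /b1 bq]; exists (ratr q); exists q.
have h1 q : (ratr q : R) < sup S -> b q.
  rewrite -subr_gt0 => qs; have [_ [q' bq' <-]] := sup_adherent qs supS.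
  by rewrite subKr => /ltW qq'; exact: b_dn bq'.
have h2 q : sup S < ratr q -> ~ b q.
  by move=> qs bq; move: qs; rewrite ltNge ub_le_sup//; [exact: supS.2|exists q].
rewrite (decode_coordP h1 h2) /=.
apply/cvgrPdist_lt => e e0.
have [|q] := @rat_in_itvoo R (sup S - e) (sup S); first by rewrite ltrBlDr ltrDl.
rewrite in_itv/= => /andP[q1 q2].
have [|p] := @rat_in_itvoo R (sup S) (sup S + e); first by rewrite ltrDl.
rewrite in_itv/= => /andP[p1 p2].
apply: filterS (filterI (bP q) (bP p)) => m [Hq Hp].
have xq : ratr q < x_ m ord0 i by apply/Hq/h1.
have xp : x_ m ord0 i <= ratr p by rewrite leNgt; apply/negP => /Hp; exact: h2.
by rewrite ltr_norml; apply/andP; split; lra.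
Qed.

End code.

(** By Fatou's lemma the lower limit of the sequence is integrable, hence finite almost
    everywhere. *)
Lemma fatou_frequently d (T : measurableType d) (R : realType)
    (m : {measure set T -> \bar R}) (f_ : nat -> T -> R) c :
  (forall n, m.-L1 (f_ n)) -> (forall n x, 0 <= f_ n x) ->
  (forall n, \int[m]_x f_ n x <= c) ->
  {ae m, forall x, exists B, forall N, exists2 n, (N <= n)%N & f_ n x <= B}.
Proof.
move=> fi f0 fc.
pose g x := limn_einf (fun n => (f_ n x)%:E).
have mg : measurable_fun setT g.
  rewrite (_ : g = fun x => - limn_esup (fun n => - (f_ n x)%:E))%E; last first.
    apply/funext => x; rewrite -limn_einfN; congr limn_einf.
    by apply/funext => n; rewrite /comp oppeK.
  apply: measurableT_comp => //; apply: measurable_fun_limn_esup => n.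
  by apply: measurableT_comp => //; apply/measurable_EFinP; exact: L1_measurable.
have g0 x : (0 <= g x)%E.
  rewrite /g limn_einf_lim; apply: lime_ge; first exact: is_cvg_einfs.
  apply: nearW => n; apply: le_ereal_inf_tmp => _ [k _ <-].
  by rewrite lee_fin.
have gc : (\int[m]_x g x <= c%:E)%E.
  apply: (le_trans (@fatou _ _ _ m setT measurableT (fun n => EFin \o f_ n)
    (fun n => ltac:(apply/measurable_EFinP; exact: L1_measurable))
    (fun n x _ => ltac:(by rewrite lee_fin)))).
  rewrite limn_einf_lim; apply: lime_le; first exact: is_cvg_einfs.
  apply: nearW => n; apply: (@le_trans _ _ (\int[m]_x f_ n x)%:E); last by rewrite lee_fin.
  by apply: ereal_inf_lbound; exists n => //=; rewrite RintegralE.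
have gi : m.-integrable setT g.
  apply/integrableP; split => //; under eq_integral do rewrite gee0_abs//.
  by rewrite (le_lt_trans gc)// ltry.
have := integrable_ae measurableT gi; apply: filterS => x /(_ I) gx.
apply/not_existsP => nB.
have : (fun n => (f_ n x)%:E) @ \oo --> +oo%E.
  apply/cvgeyPge => A; have := nB A; move=> /existsNP[N hN].
  exists N => // n /= Nn; rewrite lee_fin leNgt; apply/negP => fA.
  by apply: hN; exists n => //; exact: ltW.
move=> /cvg_limn_einf_sup[gy _].
by move: gx; rewrite /g gy.
Qed.

(* Helly selection for the quantile functions of the codes. *)
Theorem skorokhod (R : realType) n (P_ : nat -> probability 'rV[R]_n R) (M : R) :
  (forall k, (P_ k).-L1 (@sqnorm R n)) ->
  (forall k, \int[P_ k]_x sqnorm x <= M) ->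
  exists (f : nat -> nat) (X_ : nat -> measurableTypeR R -> 'rV[R]_n)
      (X : measurableTypeR R -> 'rV[R]_n),
    [/\ increasing_seq f, (forall k, measurable_fun setT (X_ k)),
        measurable_fun setT X,
        (forall k, image_law (X_ k) (unif R) (P_ (f k))) &
        {ae unif R, forall u, (fun k => X_ k u) @ \oo --> X u}].
Proof.
move=> iP leM.
pose q_ k := quantile (P_ k) (@code R n).
have [f [q [fi mq qc]]] := @helly R q_ (fun k => quantile01 (P_ k) _)
  (fun k => @quantile_homo _ _ _ (P_ k) _).
have mq_ k : measurable_fun setT (q_ k) by exact: quantile_measurable.
have ql k A : measurable A -> unif R (q_ k @^-1` A) = P_ k (@code R n @^-1` A).
  by apply: quantile_law; [exact: code_measurable|exact: code01].
pose X_ k : measurableTypeR R -> 'rV[R]_n := @decode R n \o q_ (f k).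
exists f, X_, (@decode R n \o q).
have mX k : measurable_fun setT (X_ k).
  by apply: measurableT_comp => //; [exact: decode_measurable|exact: mq_].
have lX k : image_law (X_ k) (unif R) (P_ (f k)).
  move=> A mA; rewrite /pushforward comp_preimage ql.
    congr (P_ _ _); apply/seteqP; split => x /=; by rewrite codeK.
  by rewrite -[X in measurable X]setTI; exact: decode_measurable.
split => //; first by apply: measurableT_comp => //; exact: decode_measurable.
(* The quantile has the law of the code, so it almost surely takes its values among codes, where
   encoding inverts decoding. *)
have cX : {ae unif R, forall u, forall k,
    code (decode n (q_ (f k) u)) = q_ (f k) u}.
  apply: ae_foralln => k.
  pose D := [set r : R | code (decode n r) = r].
  have mD : measurable D.
    have := @measurable_fun_eqr _ _ R setT (@code R n \o @decode R n) id.
    move=> /(_ ltac:(exact: measurableT_comp (@code_measurable R n) (@decode_measurable R n))).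
    move=> /(_ ltac:(exact: measurable_id)) /(_ measurableT [set true] ltac:(by [])).
    rewrite setTI; congr measurable; apply/seteqP; split => r /=; first by move/eqP.
    by move=> /= ->; rewrite eqxx.
  exists (q_ (f k) @^-1` (~` D)); split.
  - by rewrite -[X in measurable X]setTI; apply: mq_ => //; exact: measurableC.
  - apply: (etrans (ql (f k) (~` D) (measurableC mD))).
    rewrite (_ : _ @^-1` _ = set0) ?measure0//; apply/seteqP; split => x //=.
    by rewrite /D /= codeK.
  - by move=> u /= h; rewrite /D /=.
have fB : {ae unif R, forall u, exists B, forall N,
    exists2 k, (N <= k)%N & sqnorm (X_ k u) <= B}.
  apply: (@fatou_frequently _ _ _ (unif R) (fun k u => sqnorm (X_ k u)) M).
  - move=> k; have /(image_law_L1 (mX k) (lX k)) := @measurable_sqnorm R n.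
    by move=> [+ _]; apply; exact: iP.
  - by move=> k u; exact: sqnorm_ge0.
  - move=> k; rewrite -(image_law_Rint (mX k) (lX k) (@measurable_sqnorm R n)).
    exact: leM.
apply: (@ae_imp3 _ _ R (unif R)) qc cX fB => u qu cu Bu.
apply: decode_cvg => //; rewrite (_ : (fun _ => _) = (fun k => q_ (f k) u))//.
by apply/funext => k; exact: cu.
Qed.

(** * Convergence of plans *)

Section euclidean_norm.
Context (R : realType) (n : nat).
Implicit Types x y z : 'rV[R]_n.

Lemma dotC x y : dot x y = dot y x.
Proof. by apply: eq_bigr => i _; rewrite mulrC. Qed.

Lemma dotDl x y z : dot (x + y) z = dot x z + dot y z.
Proof. by rewrite /dot -big_split; apply: eq_bigr => i _; rewrite mxE mulrDl. Qed.

Lemma dotZl (a : R) x y : dot (a *: x) y = a * dot x y.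
Proof. by rewrite /dot mulr_sumr; apply: eq_bigr => i _; rewrite mxE mulrA. Qed.

Lemma dotDr x y z : dot x (y + z) = dot x y + dot x z.
Proof. by rewrite dotC dotDl !(dotC x). Qed.

Lemma dotZr (a : R) x y : dot x (a *: y) = a * dot x y.
Proof. by rewrite dotC dotZl dotC. Qed.

Lemma dotNl x y : dot (- x) y = - dot x y.
Proof. by rewrite -scaleN1r dotZl mulN1r. Qed.

Lemma dotNr x y : dot x (- y) = - dot x y.
Proof. by rewrite dotC dotNl dotC. Qed.

Lemma dotBl x y z : dot (x - y) z = dot x z - dot y z.
Proof. by rewrite dotDl dotNl. Qed.

Lemma dotBr x y z : dot x (y - z) = dot x y - dot x z.
Proof. by rewrite dotDr dotNr. Qed.

Lemma dot0l x : dot 0 x = 0.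
Proof. by rewrite -(scale0r (0 : 'rV[R]_n)) dotZl mul0r. Qed.

Lemma dot0r x : dot x 0 = 0. Proof. by rewrite dotC dot0l. Qed.

Lemma dot_suml I (r : seq I) (P : pred I) (f : I -> 'rV[R]_n) x :
  dot (\sum_(i <- r | P i) f i) x = \sum_(i <- r | P i) dot (f i) x.
Proof.
by elim/big_rec2: _ => [|i u v _ <-]; [exact: dot0l|exact: dotDl].
Qed.

Lemma dot_delta x i : dot x (delta_mx ord0 i) = x ord0 i.
Proof.
rewrite /dot (bigD1 i)//= mxE !eqxx mulr1 big1 ?addr0// => j ji.
by rewrite mxE (negbTE ji) andbF mulr0.
Qed.

Lemma sqnorm_delta (a : R) i : sqnorm (a *: delta_mx ord0 i : 'rV[R]_n) = a ^+ 2.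
Proof. by rewrite sqnormZ /sqnorm dot_delta mxE !eqxx mulr1. Qed.

Lemma sqnormDE x y : sqnorm (x + y) = sqnorm x + 2 * dot x y + sqnorm y.
Proof. by rewrite /sqnorm !(dotDl, dotDr) (dotC y x); ring. Qed.

Lemma sqnormBE x y : sqnorm (x - y) = sqnorm x - 2 * dot x y + sqnorm y.
Proof. by rewrite sqnormDE dotNr /sqnorm dotNl dotNr; ring. Qed.

Lemma sqnormN x : sqnorm (- x) = sqnorm x.
Proof. by rewrite /sqnorm dotNl dotNr opprK. Qed.

Lemma sqnormBC x y : sqnorm (x - y) = sqnorm (y - x).
Proof. by rewrite -sqnormN opprB. Qed.

Lemma sqnorm0 : sqnorm (0 : 'rV[R]_n) = 0.
Proof. by rewrite /sqnorm dot0l. Qed.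

Lemma sqnormB_le x y : sqnorm (x - y) <= 2 * (sqnorm x + sqnorm y).
Proof. by rewrite -[in leRHS](sqnormN y); exact: sqnormD. Qed.

Lemma sqnorm_triangle x y z :
  sqnorm (x - z) <= 2 * (sqnorm (x - y) + sqnorm (y - z)).
Proof. by rewrite -(subrKA y); exact: sqnormD. Qed.

Lemma sqr_coord_le x i : x ord0 i ^+ 2 <= sqnorm x.
Proof.
rewrite /sqnorm /dot (bigD1 i)//= expr2 lerDl.
by apply: sumr_ge0 => j _; rewrite -expr2 sqr_ge0.
Qed.

Lemma sqnorm_eq0 x : sqnorm x <= 0 -> x = 0.
Proof.
move=> x0; apply/rowP => i; rewrite mxE; apply/eqP.
by rewrite -sqrf_eq0 eq_le sqr_ge0 (le_trans (sqr_coord_le x i)).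
Qed.

Lemma dot_young (e : R) x y : 0 < e ->
  2 * `|dot x y| <= e * sqnorm x + e^-1 * sqnorm y.
Proof.
move=> e0; have H u : 2 * dot u y <= e * sqnorm u + e^-1 * sqnorm y.
  have := sqnorm_ge0 (e *: u - y); rewrite sqnormBE sqnormZ dotZl => h.
  rewrite -(ler_pM2l e0) mulrDr (mulrA e e^-1) divff ?gt_eqF// mul1r.
  by lra.
have [_|_] := ger0P (dot x y); first exact: H.
by rewrite -dotNl (le_trans (H _))// sqnormN.
Qed.

Lemma enorm_ge0 x : 0 <= enorm x. Proof. exact: sqrtr_ge0. Qed.

Lemma sqr_enorm x : enorm x ^+ 2 = sqnorm x.
Proof. by rewrite sqr_sqrtr// sqnorm_ge0. Qed.

Lemma dot_enorm x y : `|dot x y| <= enorm x * enorm y.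
Proof.
rewrite -(@ler_pXn2r _ 2)// ?nnegrE ?mulr_ge0 ?enorm_ge0//.
rewrite exprMn !sqr_enorm real_normK ?num_real//.
have [y0|y0] := leP (sqnorm y) 0.
  by rewrite (sqnorm_eq0 y0) dot0r sqnorm0 mulr0 expr0n.
have := sqnorm_ge0 (sqnorm y *: x - dot x y *: y).
rewrite sqnormBE !sqnormZ !(dotZl, dotZr) => h.
by rewrite -(ler_pM2l y0); lra.
Qed.

Lemma enorm_triangle x y : enorm (x + y) <= enorm x + enorm y.
Proof.
rewrite -(@ler_pXn2r _ 2)// ?nnegrE ?addr_ge0 ?enorm_ge0//.
rewrite sqrrD !sqr_enorm sqnormDE.
have := le_trans (ler_norm _) (dot_enorm x y).
by lra.
Qed.

Lemma enormZ (a : R) x : enorm (a *: x) = `|a| * enorm x.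
Proof. by rewrite /enorm sqnormZ sqrtrM ?sqr_ge0// sqrtr_sqr. Qed.

Lemma enormN x : enorm (- x) = enorm x.
Proof. by rewrite /enorm sqnormN. Qed.

Lemma enormBC x y : enorm (x - y) = enorm (y - x).
Proof. by rewrite /enorm sqnormBC. Qed.

Lemma coord_le_enorm x i : `|x ord0 i| <= enorm x.
Proof. by rewrite -sqrtr_sqr ler_wsqrtr// sqr_coord_le. Qed.

Lemma enorm_le1 x : enorm x <= 1 + sqnorm x.
Proof. by have := enorm_ge0 x; rewrite -sqr_enorm; nra. Qed.

Lemma measurable_enorm d (T : measurableType d) (f : T -> 'rV[R]_n) :
  measurable_fun setT f -> measurable_fun setT (fun t => enorm (f t)).
Proof.
move=> mf; apply: (@measurableT_comp _ _ _ _ _ _ (@Num.sqrt R)).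
  by apply: continuous_measurable_fun; exact: sqrt_continuous.
exact: measurable_sqn.
Qed.

Lemma continuous_dot (T : topologicalType) (f g : T -> 'rV[R]_n) :
  continuous f -> continuous g -> continuous (fun t => dot (f t) (g t)).
Proof.
move=> cf cg t; rewrite /dot.
apply: (@cvg_big _ _ +%R) => [|i _]; first by move=> x; exact: add_continuous.
by apply: cvgM; apply: cvg_rV_coord; [exact: cf|exact: cg].
Qed.

Lemma continuous_sqnorm : continuous (@sqnorm R n).
Proof. by apply: continuous_dot => t; exact: cvg_id. Qed.

Lemma continuous_enorm : continuous (@enorm R n).
Proof.
move=> x; apply: (@continuous_comp _ _ _ (@sqnorm R n) (@Num.sqrt R)).
  exact: continuous_sqnorm.
exact: sqrt_continuous.
Qed.

End euclidean_norm.

Lemma frequently_subseq (P : nat -> Prop) : ~ (\forall n \near \oo, P n) ->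
  exists2 f : nat -> nat, (forall n, (n <= f n)%N) & forall n, ~ P (f n).
Proof.
move=> nP; have H n : exists m, (n <= m)%N /\ ~ P m.
  apply: contra_notP nP => /forallNP h; exists n => // m /= nm.
  by apply: contrapT => nPm; apply: (h m).
by have [f fP] := choice H; exists f => n; case: (fP n).
Qed.

Section convergence_of_integrals.
Context d (T : measurableType d) (R : realType) (P : probability T R).

Lemma L1_cst (c : R) : P.-L1 (fun _ => c).
Proof. exact: finite_measure_integrable_cst. Qed.

Lemma Rint_cst (c : R) : \int[P]_x c = c.
Proof.
by rewrite Rintegral_cst//= (_ : P setT = 1%E) ?mulr1//; exact: probability_setT.
Qed.

Lemma Rint_lsc (f_ : nat -> T -> R) f e : 0 < e ->
  (forall n, P.-L1 (f_ n)) -> P.-L1 f ->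
  (forall n x, 0 <= f_ n x) -> (forall x, 0 <= f x) ->
  {ae P, forall x, (fun n => f_ n x) @ \oo --> f x} ->
  \forall n \near \oo, \int[P]_x f x - e < \int[P]_x f_ n x.
Proof.
move=> e0 fi_ fi f_0 f0 cf; apply: contrapT => /frequently_subseq[g gn hg].
have [||||||_] := @Rint_fatou _ _ _ P (f_ \o g) f (\int[P]_x f x - e).
- by move=> n; exact: fi_.
- exact: L1_measurable fi.
- by move=> n x; exact: f_0.
- exact: f0.
- apply: ae_imp cf => x cfx; exact: (cvg_subseq gn cfx).
- by move=> n; rewrite leNgt; exact/negP/hg.
- by move=> h; lra.
Qed.

Lemma L1_of_sqr (f : T -> R) : measurable_fun setT f ->
  P.-L1 (fun x => f x ^+ 2) -> P.-L1 f.
Proof.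
move=> mf fi; apply: (L1_le mf (g := fun x => 1 + f x ^+ 2)).
  by move=> x; have := normr_ge0 (f x); rewrite -(real_normK (num_real (f x))); nra.
by apply: L1D => //; exact: L1_cst.
Qed.

(* Young's inequality [h <= s h^2 + 1/s] makes [s h^2 + 1/s - h] nonnegative,
   and Fatou applies to it. *)
Lemma Rint_cvg0 (h_ : nat -> T -> R) M :
  (forall n, measurable_fun setT (h_ n)) -> (forall n x, 0 <= h_ n x) ->
  (forall n, P.-L1 (fun x => h_ n x ^+ 2)) ->
  (forall n, \int[P]_x (h_ n x ^+ 2) <= M) ->
  {ae P, forall x, (fun n => h_ n x) @ \oo --> 0} ->
  (fun n => \int[P]_x h_ n x) @ \oo --> 0.
Proof.
move=> mh h0 hi hM ch.
have hi1 n : P.-L1 (h_ n) by exact: L1_of_sqr.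
have M0 : 0 <= M by apply: le_trans (hM 0%N); apply: Rint_ge0 => x; exact: sqr_ge0.
apply/cvgrPdist_lt => e e0; pose s := e / (2 * (M + 1)).
have s0 : 0 < s by rewrite divr_gt0// mulr_gt0// ltr_wpDl.
pose f_ n x := s * h_ n x ^+ 2 + s^-1 - h_ n x.
have fi n : P.-L1 (f_ n).
  by apply: L1B => //; apply: L1D; [exact: L1Z|exact: L1_cst].
have f0 n x : 0 <= f_ n x.
  have := h0 n x; have : s * s^-1 = 1 by rewrite divff ?gt_eqF.
  have : 0 < s^-1 by rewrite invr_gt0.
  rewrite /f_; set t := s^-1; set a := h_ n x => t0 st a0.
  have : 0 <= s * (a - t) ^+ 2 by rewrite mulr_ge0 ?sqr_ge0 ?ltW.
  have -> : s * (a - t) ^+ 2 = s * a ^+ 2 - 2 * a * (s * t) + t * (s * t) by ring.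
  by rewrite st; lra.
have e20 : 0 < e / 2 by rewrite divr_gt0.
have := @Rint_lsc f_ (fun _ => s^-1) (e / 2) e20 fi (L1_cst _) f0
  (fun _ => ltac:(by rewrite invr_ge0 ltW)).
have cf : {ae P, forall x, (fun n => f_ n x) @ \oo --> s^-1}.
  apply: ae_imp ch => x chx.
  have : (fun n => s * h_ n x ^+ 2 + s^-1 - h_ n x) @ \oo --> s * 0 ^+ 2 + s^-1 - 0.
    apply: cvgB => //; apply: cvgD; last exact: cvg_cst.
    by apply: cvgMr; apply: (@cvg_comp _ _ _ _ (fun y : R => y ^+ 2) _ _ _ chx);
       exact: exprn_continuous.
  by rewrite expr0n mulr0 add0r subr0.
move=> /(_ cf); apply: filterS => n; rewrite Rint_cst /f_.
rewrite RintB//; last by apply: L1D; [exact: L1Z|exact: L1_cst].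
rewrite RintD//; [|exact: L1Z|exact: L1_cst].
rewrite RintZ// Rint_cst => h.
rewrite sub0r normrN ger0_norm; last by apply: Rint_ge0.
have : s * \int[P]_x (h_ n x ^+ 2) <= s * M by rewrite ler_wpM2l// ltW.
have : s * M < e / 2.
  rewrite /s mulrAC ltr_pdivrMr ?mulr_gt0 ?ltr_wpDl//.
  by rewrite mulrA divfK ?pnatr_eq0// ltr_pM2l// ltrDl.
by lra.
Qed.

End convergence_of_integrals.

Section wasserstein_bounds.
Context (R : realType) (n : nat).
Local Notation E := 'rV[R]_n.

Section of_random_variables.
Context dT (T : measurableType dT) (P : probability T R) (X Y : T -> E)
  (mu nu : P2 R n).
Hypotheses (mX : measurable_fun setT X) (mY : measurable_fun setT Y)
  (Xmu : image_law X P mu) (Ynu : image_law Y P nu).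

Lemma transport_cost_le (c : E * E -> R) : measurable_fun setT c ->
  (forall z, 0 <= c z) -> P.-L1 (fun w => c (X w, Y w)) ->
  (transport_cost c mu nu <= (\int[P]_w c (X w, Y w))%:E)%E.
Proof.
move=> mc c0 ci; have mXY := measurable_pair_of mX mY.
apply: ereal_inf_lbound; exists (law P mXY).
  split=> A mA; rewrite /pushforward lawE; [exact: Xmu|exact: Ynu].
rewrite (image_law_ge0_integral mXY (image_law_law P mXY)).
- by rewrite RintegralE.
- exact/measurable_EFinP.
- by move=> z; rewrite lee_fin.
Qed.

Lemma fine_transport_cost_le (c : E * E -> R) : measurable_fun setT c ->
  (forall z, 0 <= c z) -> P.-L1 (fun w => c (X w, Y w)) ->
  fine (transport_cost c mu nu) <= \int[P]_w c (X w, Y w).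
Proof.
move=> mc c0 ci; have := transport_cost_le mc c0 ci.
have : (0 <= transport_cost c mu nu)%E.
  apply: le_ereal_inf_tmp => _ [k _ <-]; apply: integral_ge0 => z _.
  by rewrite lee_fin.
by case: (transport_cost c mu nu) => [r| |].
Qed.

Lemma W1_le : P.-L1 (fun w => enorm (X w - Y w)) ->
  W1 mu nu <= \int[P]_w enorm (X w - Y w).
Proof.
move=> ci; apply: (@fine_transport_cost_le (fun z => enorm (z.1 - z.2))) => //.
  by apply: measurable_enorm; exact: (measurable_subv measurable_fst measurable_snd).
by move=> z; exact: enorm_ge0.
Qed.

Lemma sqr_W2_le : P.-L1 (fun w => sqnorm (X w - Y w)) ->
  W2 mu nu ^+ 2 <= \int[P]_w sqnorm (X w - Y w).
Proof.
move=> ci; rewrite /W2 -[leRHS]sqr_sqrtr; last first.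
  by apply: Rint_ge0 => w; exact: sqnorm_ge0.
rewrite ler_pXn2r ?nnegrE ?sqrtr_ge0// ler_wsqrtr//.
apply: (@fine_transport_cost_le (fun z => sqnorm (z.1 - z.2))) => //.
  by apply: measurable_sqn; exact: (measurable_subv measurable_fst measurable_snd).
by move=> z; exact: sqnorm_ge0.
Qed.

End of_random_variables.

Lemma W1_ge0 (mu nu : P2 R n) : 0 <= W1 mu nu.
Proof.
apply/fine_ge0/le_ereal_inf_tmp => _ [k _ <-]; apply: integral_ge0 => z _.
by rewrite lee_fin enorm_ge0.
Qed.

Lemma W2_ge0 (mu nu : P2 R n) : 0 <= W2 mu nu.
Proof. exact: sqrtr_ge0. Qed.

(** Replaces Leibniz equality between laws built in different ways, in particular between marginals
    of different plans. *)
Definition same_law (mu nu : P2 R n) := image_law id mu nu.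

Lemma W1_same (mu nu : P2 R n) : same_law mu nu -> W1 mu nu = 0.
Proof.
move=> h; apply/le_anti; rewrite W1_ge0 andbT.
have I0 : (fun x : E => enorm (x - x)) = fun=> 0.
  by apply/funext => x; rewrite subrr /enorm sqnorm0 sqrtr0.
apply: (le_trans (@W1_le _ _ mu id id mu nu _ _ _ _ _)) => //.
- by rewrite I0; exact: L1_cst.
- by rewrite I0 Rint_cst.
Qed.

Lemma W2_same (mu nu : P2 R n) : same_law mu nu -> W2 mu nu = 0.
Proof.
move=> h; apply/eqP; rewrite -sqrf_eq0 eq_le sqr_ge0 andbT.
have I0 : (fun x : E => sqnorm (x - x)) = fun=> 0.
  by apply/funext => x; rewrite subrr sqnorm0.
apply: (le_trans (@sqr_W2_le _ _ mu id id mu nu _ _ _ _ _)) => //.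
- by rewrite I0; exact: L1_cst.
- by rewrite I0 Rint_cst.
Qed.

End wasserstein_bounds.

Section plan_convergence.
Context (R : realType) (d : nat).
Local Notation E := 'rV[R]_d.
Local Notation Om := (measurableTypeR R).

(** Weak convergence, recorded by a Skorokhod representation with bounded second moments. Nothing
    else is ever used about it. *)
Definition plan_cvg (pi_ : nat -> plan R d) (pi : plan R d) : Prop :=
  exists X_ Y_ : nat -> Om -> E, exists X Y : Om -> E,
  [/\ (forall k, measurable_fun setT (X_ k) /\ measurable_fun setT (Y_ k)),
      measurable_fun setT X /\ measurable_fun setT Y,
      (forall k, image_law (fun u => (X_ k u, Y_ k u)) (unif R) (pi_ k)),
      image_law (fun u => (X u, Y u)) (unif R) pi &
      {ae unif R, forall u, (fun k => X_ k u) @ \oo --> X u /\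
                            (fun k => Y_ k u) @ \oo --> Y u}] /\
  exists M, forall k, \int[pi_ k]_z sqnorm2 z <= M.

Lemma plan_cvg_subseq (pi_ : nat -> plan R d) pi (g : nat -> nat) :
  (forall n, (n <= g n)%N) -> plan_cvg pi_ pi -> plan_cvg (pi_ \o g) pi.
Proof.
move=> gn [X_ [Y_ [X [Y [[h1 h2 h3 h4 h5] [M h6]]]]]].
exists (X_ \o g), (Y_ \o g), X, Y; split; last by exists M => k; exact: h6.
split => // [k|k|]; [exact: h1|exact: h3|].
by apply: ae_imp h5 => u [hX hY]; split; [exact: (cvg_subseq gn hX)|exact: (cvg_subseq gn hY)].
Qed.

Lemma measurable_swap_plan : measurable_fun setT (fun z : E * E => (z.2, z.1)).
Proof. by apply/measurable_fun_pairP; split; [exact: measurable_snd|exact: measurable_fst]. Qed.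

Lemma continuous_sqnorm2 : continuous (@sqnorm2 R d).
Proof.
move=> z; apply: cvgD; apply: continuous_comp; try exact: continuous_sqnorm.
  exact: cvg_fst.
exact: cvg_snd.
Qed.

(** Bounded second moments play the role of tightness; the limit inherits a finite second moment by
    Fatou's lemma. *)
Theorem plan_compact (pi_ : nat -> plan R d) M :
  (forall k, \int[pi_ k]_z sqnorm2 z <= M) ->
  exists2 f : nat -> nat, increasing_seq f & exists pi, plan_cvg (pi_ \o f) pi.
Proof.
move=> hM.
have mr := @measurable_row_mx R d d.
(* A plan is seen as a law on row vectors of twice the length, to which [skorokhod] applies. *)
pose P_ k : probability 'rV[R]_(d + d) R := law (pi_ k) mr.
have sqE (z : E * E) : sqnorm (row_mx z.1 z.2) = sqnorm2 z.
  rewrite /sqnorm /dot big_split_ord /=; congr (_ + _); apply: eq_bigr => i _.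
    by rewrite row_mxEl.
  by rewrite row_mxEr.
have sqE' k : (pi_ k).-L1 (@sqnorm R (d + d) \o (fun z : E * E => row_mx z.1 z.2)).
  by rewrite (_ : _ \o _ = @sqnorm2 R d); [exact: plan_L1|apply/funext => z; exact: sqE].
have iP k : (P_ k).-L1 (@sqnorm R (d + d)).
  apply/(image_law_L1 mr (image_law_law (pi_ k) mr)); [exact: measurable_sqnorm|].
  exact: sqE'.
have [|f [Z_ [Z [fi mZ_ mZ lZ cZ]]]] := @skorokhod R (d + d) P_ M iP.
  move=> k; rewrite (image_law_Rint mr (image_law_law (pi_ k) mr)); last exact: measurable_sqnorm.
  by under eq_Rintegral do rewrite sqE; exact: hM.
exists f => //.
have cl : continuous (fun z : 'rV[R]_(d + d) => lsubmx z : E).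
  apply: continuous_rV => i; under eq_fun do rewrite mxE.
  exact: coord_continuous.
have cr : continuous (fun z : 'rV[R]_(d + d) => rsubmx z : E).
  apply: continuous_rV => i; under eq_fun do rewrite mxE.
  exact: coord_continuous.
have ml := continuous_measurable_rVv cl; have mrr := continuous_measurable_rVv cr.
pose X_ k : Om -> E := fun u => lsubmx (Z_ k u).
pose Y_ k : Om -> E := fun u => rsubmx (Z_ k u).
pose X : Om -> E := fun u => lsubmx (Z u).
pose Y : Om -> E := fun u => rsubmx (Z u).
have mX_ k : measurable_fun setT (X_ k) by exact: measurableT_comp.
have mY_ k : measurable_fun setT (Y_ k) by exact: measurableT_comp.
have mX : measurable_fun setT X by exact: measurableT_comp.
have mY : measurable_fun setT Y by exact: measurableT_comp.
have lXY k : image_law (fun u => (X_ k u, Y_ k u)) (unif R) (pi_ (f k)).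
  pose s (z : 'rV[R]_(d + d)) : E * E := (lsubmx z, rsubmx z).
  have ms : measurable_fun setT s by exact/measurable_fun_pairP.
  have h : image_law s (P_ (f k)) (pi_ (f k)).
    move=> A mA; rewrite /pushforward lawE; congr (pi_ _ _).
    by apply/seteqP; split => -[x y] /=; rewrite /s /= row_mxKl row_mxKr.
  exact: (image_law_comp ms (lZ k) h).
have cXY : {ae unif R, forall u, (fun k => X_ k u) @ \oo --> X u /\
    (fun k => Y_ k u) @ \oo --> Y u}.
  apply: (@ae_imp _ _ R (unif R)) cZ => u cu; split.
    by apply: (@continuous_cvg _ _ _ _ _ _ (fun z => lsubmx z : E)) cu; exact: cl.
  by apply: (@continuous_cvg _ _ _ _ _ _ (fun z => rsubmx z : E)) cu; exact: cr.
have mXY := measurable_pair_of mX mY.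
have i2 : (unif R).-L1 (fun u => sqnorm2 (X u, Y u)).
  apply: (proj1 (@Rint_fatou _ _ _ (unif R) (fun k u => sqnorm2 (X_ k u, Y_ k u)) _ M _ _ _ _ _ _)).
  - move=> k; have mk := measurable_pair_of (mX_ k) (mY_ k).
    apply/(image_law_L1 mk (lXY k)); [exact: measurable_sqnorm2|exact: plan_L1].
  - by apply: (measurableT_comp _ mXY); exact: measurable_sqnorm2.
  - by move=> k u; exact: sqnorm2_ge0.
  - by move=> u; exact: sqnorm2_ge0.
  - apply: (@ae_imp _ _ R (unif R)) cXY => u [cx cy].
    apply: (@continuous_cvg _ _ _ _ _ _ (@sqnorm2 R d)); first exact: continuous_sqnorm2.
    exact: (cvg_pair cx cy).
  - move=> k; have mk := measurable_pair_of (mX_ k) (mY_ k).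
    by rewrite -(image_law_Rint mk (lXY k)); [exact: hM|exact: measurable_sqnorm2].
pose pi : plan R d :=
  fm_law mXY (@measurable_sqnorm2 R d) (@sqnorm2_ge0 R d) i2.
exists pi, X_, Y_, X, Y; split; last by exists M => k; exact: hM.
by split.
Qed.

Lemma plan_cvg_swap (pi_ : nat -> plan R d) (pi : plan R d)
    (pi'_ : nat -> plan R d) (pi' : plan R d) :
  (forall k, image_law (fun z : E * E => (z.2, z.1)) (pi_ k) (pi'_ k)) ->
  image_law (fun z : E * E => (z.2, z.1)) pi pi' ->
  plan_cvg pi_ pi -> plan_cvg pi'_ pi'.
Proof.
move=> s_ s [X_ [Y_ [X [Y [[h1 [h2 h2'] h3 h4 h5] [M h6]]]]]].
exists Y_, X_, Y, X; split.
  split => //.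
  - by move=> k; case: (h1 k).
  - by move=> k; exact: (image_law_comp measurable_swap_plan (h3 k) (s_ k)).
  - exact: (image_law_comp measurable_swap_plan h4 s).
  - by apply: (@ae_imp _ _ R (unif R)) h5 => u [].
exists M => k; rewrite (image_law_Rint measurable_swap_plan (s_ k)); last exact: measurable_sqnorm2.
by under eq_Rintegral do rewrite /sqnorm2/= addrC; exact: h6.
Qed.

Section consequences.
Variables (pi_ : nat -> plan R d) (pi : plan R d).
Hypothesis pipi : plan_cvg pi_ pi.

Lemma plan_cvg_lsc (c : E * E -> R) C : continuous c -> (forall z, 0 <= c z) ->
  (forall k, (pi_ k).-L1 c) -> (forall k, \int[pi_ k]_z c z <= C) ->
  pi.-L1 c /\ \int[pi]_z c z <= C.
Proof.
move=> cc c0 ic hc; have mc := continuous_measurable_pair cc.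
case: pipi => X_ [Y_ [X [Y [[h1 [mX mY] h3 h4 h5] [M h6]]]]].
have mk k := measurable_pair_of (h1 k).1 (h1 k).2.
have m0 := measurable_pair_of mX mY.
have [|||||| A B] := @Rint_fatou _ _ _ (unif R) (fun k u => c (X_ k u, Y_ k u))
    (fun u => c (X u, Y u)) C.
- by move=> k; apply/(image_law_L1 (mk k) (h3 k)).
- exact: (measurableT_comp mc m0).
- by move=> k u; exact: c0.
- by move=> u; exact: c0.
- apply: (@ae_imp _ _ R (unif R)) h5 => u [cx cy].
  by apply: (@continuous_cvg _ _ _ _ _ _ c); [exact: cc|exact: (cvg_pair cx cy)].
- by move=> k; rewrite -(image_law_Rint (mk k) (h3 k)).
split; first exact/(image_law_L1 m0 h4).
by rewrite (image_law_Rint m0 h4).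
Qed.

(** At most linear growth makes [g] bounded in L^2 along the sequence, hence uniformly integrable;
    with quadratic growth only the lower bound [plan_cvg_lsc] would survive. *)
Lemma plan_cvg_growth (g : E -> R) (A : R) : continuous g -> 0 <= A ->
  (forall x, g x ^+ 2 <= A * (1 + sqnorm x)) ->
  (fun k => \int[marg1 (pi_ k)]_x g x) @ \oo --> \int[marg1 pi]_x g x.
Proof.
move=> cg A0 gA; have mg := continuous_measurable_rV cg.
case: pipi => X_ [Y_ [X [Y [[h1 [mX mY] h3 h4 h5] [M h6]]]]].
have lX k : image_law (X_ k) (unif R) (marg1 (pi_ k)).
  exact: (image_law_comp measurable_fst (h3 k) (marg1_law (pi_ k))).
have l0 : image_law X (unif R) (marg1 pi).
  exact: (image_law_comp measurable_fst h4 (marg1_law pi)).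
have iX k : (unif R).-L1 (fun u => sqnorm (X_ k u)).
  by apply/(image_law_L1 (h1 k).1 (lX k)); [exact: measurable_sqnorm|exact: P2_L1].
have i0 : (unif R).-L1 (fun u => sqnorm (X u)).
  by apply/(image_law_L1 mX l0); [exact: measurable_sqnorm|exact: P2_L1].
have mgX k : measurable_fun setT (fun u => g (X_ k u)).
  exact: (measurableT_comp mg (h1 k).1).
have mg0 : measurable_fun setT (fun u => g (X u)) by exact: (measurableT_comp mg mX).
have XM k : \int[unif R]_u sqnorm (X_ k u) <= M.
  have mk := measurable_pair_of (h1 k).1 (h1 k).2.
  apply: le_trans (h6 k); rewrite (image_law_Rint mk (h3 k)); last exact: measurable_sqnorm2.
  apply: le_Rint => [||u]; first exact: iX.
    by apply/(image_law_L1 mk (h3 k)); [exact: measurable_sqnorm2|exact: plan_L1].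
  by rewrite /sqnorm2 lerDl sqnorm_ge0.
rewrite (image_law_Rint mX l0 mg).
under eq_fun do rewrite (image_law_Rint (h1 _).1 (lX _) mg).
have sq_i (f : Om -> R) (q : Om -> R) : measurable_fun setT f -> (unif R).-L1 q ->
    (forall u, f u ^+ 2 <= A * (1 + q u)) -> (unif R).-L1 (fun u => f u ^+ 2).
  move=> mf iq fq; apply: (L1_le _ (g := fun u => A * (1 + q u))).
  - exact: measurable_funX.
  - by move=> u; rewrite ger0_norm ?sqr_ge0.
  - by apply: L1Z; apply: L1D => //; exact: L1_cst.
have igX k : (unif R).-L1 (fun u => g (X_ k u) ^+ 2) by apply: (sq_i _ _ _ (iX k)).
have ig0 : (unif R).-L1 (fun u => g (X u) ^+ 2) by apply: (sq_i _ _ _ i0).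
pose h_ k u := `|g (X_ k u) - g (X u)|.
have hle k u : h_ k u ^+ 2 <= 2 * (g (X_ k u) ^+ 2 + g (X u) ^+ 2).
  rewrite /h_ real_normK ?num_real//; set a := g _; set b := g _.
  by have := sqr_ge0 (a + b); nra.
have mh k : measurable_fun setT (h_ k).
  by apply: measurableT_comp => //; exact: measurable_funB.
have ih2 k : (unif R).-L1 (fun u => 2 * (g (X_ k u) ^+ 2 + g (X u) ^+ 2)).
  by apply: L1Z; exact: L1D.
have ihk k : (unif R).-L1 (fun u => h_ k u ^+ 2).
  apply: L1_le (ih2 k); first exact: measurable_funX.
  by move=> u; rewrite ger0_norm ?sqr_ge0.
have ch : (fun k => \int[unif R]_u h_ k u) @ \oo --> 0.
  apply: (@Rint_cvg0 _ _ _ (unif R) h_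
    (2 * (A * (1 + M) + \int[unif R]_u (g (X u) ^+ 2)))) => //.
  - by move=> k u; exact: normr_ge0.
  - move=> k; apply: (le_trans (le_Rint (ihk k) (ih2 k) (hle k))).
    rewrite RintZ; last exact: L1D.
    rewrite RintD// ler_pM2l// lerD2r.
    apply: (@le_trans _ _ (\int[unif R]_u (A * (1 + sqnorm (X_ k u))))).
      apply: le_Rint => //; apply: L1Z; apply: L1D => //; exact: L1_cst.
    rewrite RintZ; last by apply: L1D => //; exact: L1_cst.
    rewrite ler_wpM2l// RintD//; last exact: L1_cst.
    by rewrite Rint_cst lerD2l.
  - apply: (@ae_imp _ _ R (unif R)) h5 => u [cx _].
    have cgx : (fun k => g (X_ k u)) @ \oo --> g (X u).
      by apply: (@continuous_cvg _ _ _ _ _ _ g) cx; exact: cg.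
    rewrite -(normr0 R) -(subrr (g (X u))).
    by apply: cvg_norm; apply: cvgB => //; exact: cvg_cst.
apply/cvgrPdist_lt => e e0.
have /cvgrPdist_lt /(_ _ e0) := ch; apply: filterS => k.
rewrite sub0r normrN ger0_norm; last by apply: Rint_ge0 => u; exact: normr_ge0.
move=> /(le_lt_trans _); apply.
have l1 k' : (unif R).-L1 (fun u => g (X_ k' u)) by apply: L1_of_sqr.
have l10 : (unif R).-L1 (fun u => g (X u)) by apply: L1_of_sqr.
rewrite distrC -RintB//; apply: le_normr_Rintegral => //; exact: L1B.
Qed.

Lemma plan_cvg_W1 : (fun k => W1 (marg1 (pi_ k)) (marg1 pi)) @ \oo --> 0.
Proof.
case: pipi => X_ [Y_ [X [Y [[h1 [mX mY] h3 h4 h5] [M h6]]]]].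
have lX k : image_law (X_ k) (unif R) (marg1 (pi_ k)).
  exact: (image_law_comp measurable_fst (h3 k) (marg1_law (pi_ k))).
have l0 : image_law X (unif R) (marg1 pi).
  exact: (image_law_comp measurable_fst h4 (marg1_law pi)).
have iX k : (unif R).-L1 (fun u => sqnorm (X_ k u)).
  by apply/(image_law_L1 (h1 k).1 (lX k)); [exact: measurable_sqnorm|exact: P2_L1].
have i0 : (unif R).-L1 (fun u => sqnorm (X u)).
  by apply/(image_law_L1 mX l0); [exact: measurable_sqnorm|exact: P2_L1].
have XM k : \int[unif R]_u sqnorm (X_ k u) <= M.
  have mk := measurable_pair_of (h1 k).1 (h1 k).2.
  apply: le_trans (h6 k); rewrite (image_law_Rint mk (h3 k)); last exact: measurable_sqnorm2.
  apply: le_Rint => [||u]; first exact: iX.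
    by apply/(image_law_L1 mk (h3 k)); [exact: measurable_sqnorm2|exact: plan_L1].
  by rewrite /sqnorm2 lerDl sqnorm_ge0.
pose h_ k u := enorm (X_ k u - X u).
have mh k : measurable_fun setT (h_ k).
  by apply: measurable_enorm; apply: measurable_subv => //; exact: (h1 k).1.
have ih2 k : (unif R).-L1 (fun u => 2 * (sqnorm (X_ k u) + sqnorm (X u))).
  by apply: L1Z; exact: L1D.
have hle k u : h_ k u ^+ 2 <= 2 * (sqnorm (X_ k u) + sqnorm (X u)).
  by rewrite /h_ sqr_enorm; exact: sqnormB_le.
have ihk k : (unif R).-L1 (fun u => h_ k u ^+ 2).
  apply: L1_le (ih2 k); first exact: measurable_funX.
  by move=> u; rewrite ger0_norm ?sqr_ge0.
have ch : (fun k => \int[unif R]_u h_ k u) @ \oo --> 0.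
  apply: (@Rint_cvg0 _ _ _ (unif R) h_ (2 * (M + \int[unif R]_u sqnorm (X u)))) => //.
  - by move=> k u; exact: enorm_ge0.
  - move=> k; apply: (le_trans (le_Rint (ihk k) (ih2 k) (hle k))).
    rewrite RintZ; last exact: L1D.
    by rewrite RintD// ler_pM2l// lerD2r.
  - apply: (@ae_imp _ _ R (unif R)) h5 => u [cx _].
    have -> : 0 = enorm (X u - X u) by rewrite subrr /enorm sqnorm0 sqrtr0.
    apply: (@continuous_cvg _ _ _ _ _ _ (@enorm R d)); first exact: continuous_enorm.
    by apply: cvgB => //; exact: cvg_cst.
apply: (@squeeze_cvgr _ _ _ _ (fun _ => 0) (fun k => \int[unif R]_u h_ k u)) => //; last exact: cvg_cst.
apply: nearW => k; rewrite W1_ge0/=.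
apply: (W1_le (h1 k).1 mX (lX k) l0); apply: (@L1_of_sqr _ _ _ (unif R) (h_ k)).
  exact: mh.
exact: ihk.
Qed.

Lemma plan_cvg_weak : weak_cvg (fun k => marg1 (pi_ k)) (marg1 pi).
Proof.
split.
  move=> f cf [M fM]; apply: (@plan_cvg_growth f (M ^+ 2)) => //.
  - exact: sqr_ge0.
  - move=> x; have M0 : 0 <= M by apply: le_trans (fM x).
    apply: (@le_trans _ _ (M ^+ 2)).
      by rewrite -(real_normK (num_real (f x))) ler_pXn2r.
    by rewrite ler_peMr ?sqr_ge0// lerDl sqnorm_ge0.
case: pipi => X_ [Y_ [X [Y [_ [M h6]]]]].
exists M => k; apply: le_trans (h6 k).
rewrite /M2 (image_law_Rint measurable_fst (marg1_law (pi_ k))); last exact: measurable_sqnorm.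
apply: le_Rint => [||z]; [exact: plan_L1_fst|exact: plan_L1|].
by rewrite lerDl sqnorm_ge0.
Qed.

End consequences.
End plan_convergence.

(** * Lebesgue measure on row vectors *)

Section boxes.
Context (R : realType) (n : nat).
Local Notation E := 'rV[R]_n.
Local Notation leb := (@lebesgue_measure R).

Definition box (A : 'I_n -> set R) : set E := [set x | forall i, A i (x ord0 i)].

Definition boxes : set (set E) :=
  [set B | exists2 A, (forall i, measurable (A i)) & B = box A].

Lemma measurable_box A : (forall i, measurable (A i)) -> measurable (box A).
Proof.
move=> mA; rewrite (_ : box A = \bigcap_(i : 'I_n)
    (fun x : E => x ord0 i) @^-1` A i); last first.
  by rewrite eqEsubset; split => x /= h i; [move=> _|]; exact: h.
apply: fin_bigcap_measurable => // i _.
by rewrite -[X in measurable X]setTI; exact: measurable_coord.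
Qed.

Lemma boxes_measurable : boxes `<=` measurable.
Proof. by move=> _ [A mA ->]; exact: measurable_box. Qed.

Lemma boxes_setI : setI_closed boxes.
Proof.
move=> _ _ [A mA ->] [B mB ->]; exists (fun i => A i `&` B i).
  by move=> i; exact: measurableI.
apply/seteqP; split => x /=; first by move=> [h1 h2] i; split.
by move=> h; split => i; case: (h i).
Qed.

Lemma measurable_gen_boxes (A : set E) : measurable A -> <<s boxes >> A.
Proof.
move=> mA; pose T' := g_sigma_algebraType boxes.
have mid : measurable_fun setT (fun x : T' => (x : E)).
  apply: measurable_rV => i _ B mB; rewrite setTI; apply: sub_sigma_algebra.
  exists (fun j => if j == i then B else setT).
    by move=> j; case: ifP.
  apply/seteqP; split => x /=; last by move=> /(_ i); rewrite eqxx.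
  by move=> Bx j /=; case: eqP => // ->.
by have := mid measurableT _ mA; rewrite setTI preimage_id.
Qed.

Definition cube (k : R) : set E := box (fun _ => `]-k, k[%classic).

Lemma cube_cover : \bigcup_k cube k%:R = setT.
Proof.
rewrite -subTset => x _ /=; exists (Num.bound (\sum_i `|x ord0 i|)) => // i /=.
rewrite in_itv/= -ltr_norml (le_lt_trans _ (archi_boundP _))//.
  by rewrite (bigD1 i)//= lerDl sumr_ge0.
by rewrite sumr_ge0.
Qed.

Lemma measure_boxes_unique (m1 m2 : {measure set E -> \bar R}) :
  (forall A, (forall i, measurable (A i)) -> m1 (box A) = m2 (box A)) ->
  (forall k : nat, (m1 (cube k%:R) < +oo)%E) ->
  forall B, measurable B -> m1 B = m2 B.
Proof.
move=> h hoo B mB; apply: (g_sigma_algebra_measure_unique boxes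
  boxes_measurable (fun k : nat => cube k%:R)) => //.
- by move=> k; exists (fun _ => `]-k%:R, k%:R[%classic).
- exact: cube_cover.
- exact: boxes_setI.
- by move=> _ [A mA ->]; exact: h.
- exact: measurable_gen_boxes.
Qed.

Lemma lebesgue_boxE A : (forall i, measurable (A i)) ->
  lebesgue_rV R n (box A) = (\prod_(i < n) leb (A i))%E.
Proof. exact: lebesgue_rV_box. Qed.

Lemma lebesgue_cube (k : nat) : (lebesgue_rV R n (cube k%:R) < +oo)%E.
Proof.
rewrite /cube lebesgue_boxE//; apply: (@le_lt_trans _ _ (\prod_(i < n) (2 * k%:R)%:E)%E).
  rewrite (eq_bigr (fun=> (2 * k%:R)%:E))// => i _.
  rewrite lebesgue_measure_itv/= lte_fin; case: ltP => h; first by rewrite -EFinD; congr EFin; lra.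
  by congr EFin; have : 0 <= k%:R :> R by []; move: h; lra.
by rewrite prodEFin ltry.
Qed.

Lemma lebesgue_rV_unique (m : {measure set E -> \bar R}) :
  (forall A, (forall i, measurable (A i)) ->
     m (box A) = (\prod_(i < n) leb (A i))%E) ->
  forall B, measurable B -> m B = lebesgue_rV R n B.
Proof.
move=> h B mB; apply/esym/measure_boxes_unique => // [A mA|].
  by rewrite h//; exact: lebesgue_boxE.
exact: lebesgue_cube.
Qed.

End boxes.

Section insertion.
Context (R : realType) (n : nat).
Local Notation leb := (@lebesgue_measure R).
Implicit Types (i : 'I_n.+1) (y : 'rV[R]_n).

(** Splits the space into lines of direction i and their base points, so that Lebesgue integrals can
    be sliced along any coordinate, whereas [lebesgue_rV] unrolls the first one. *)
Definition ins i (p : measurableTypeR R * 'rV[R]_n) : 'rV[R]_n.+1 :=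
  \row_j oapp (fun k => p.2 ord0 k) p.1 (unlift i j).

Lemma ins_at i r y : ins i (r, y) ord0 i = r.
Proof. by rewrite mxE unlift_none. Qed.

Lemma ins_lift i r y k : ins i (r, y) ord0 (lift i k) = y ord0 k.
Proof. by rewrite mxE liftK. Qed.

Lemma insD i r t y : ins i (r + t, y) = ins i (r, y) + t *: delta_mx ord0 i.
Proof.
apply/rowP => j; rewrite !mxE eqxx /=.
case: unliftP => [k ->|->] /=; last by rewrite eqxx mulr1.
by rewrite eq_sym (negbTE (neq_lift _ _)) mulr0 addr0.
Qed.

Lemma measurable_ins i : measurable_fun setT (ins i).
Proof.
apply: measurable_rV => j; rewrite /ins; under eq_fun do rewrite mxE.
case: unliftP => [k _|_] /=; last exact: measurable_fst.
exact: measurableT_comp (measurable_coord k) measurable_snd.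
Qed.

Lemma lebesgue_ins i B : measurable B ->
  pushforward (leb \x lebesgue_rV R n)%E (ins i) B = lebesgue_rV R n.+1 B.
Proof.
move=> mB; have mi := measurable_ins i.
apply: (lebesgue_rV_unique (m := pushforward (leb \x lebesgue_rV R n)%E (ins i))) mB.
move=> A mA; rewrite /pushforward (bigD1_ord i)//= -(@lebesgue_boxE R n (fun k => A (lift i k)))//.
rewrite -product_measure1E//; [|exact: mA|exact: (@measurable_box _ _ (fun k => A (lift i k)))].
congr product_measure1; apply/seteqP; split => -[r x] /=.
  move=> h; split => [|k]; first by have := h i; rewrite ins_at.
  by have := h (lift i k); rewrite ins_lift.
move=> [Ar Ax] j; rewrite mxE; case: unliftP => [k ->|->] //=.
Qed.

Lemma integral_ins i (f : 'rV[R]_n.+1 -> \bar R) :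
  measurable_fun setT f -> (forall x, 0 <= f x)%E ->
  (\int[lebesgue_rV R n.+1]_x f x =
   \int[lebesgue_rV R n]_y \int[leb]_r f (ins i (r, y)))%E.
Proof.
move=> mf f0; have mi := measurable_ins i.
have mfi : measurable_fun setT (f \o ins i) by exact: measurableT_comp.
transitivity (\int[leb \x lebesgue_rV R n]_p f (ins i p))%E.
  rewrite -(@ge0_integral_pushforward _ _ _ _ R (ins i) mi
    (leb \x lebesgue_rV R n)%E setT f measurableT mf (fun x _ => f0 x)).
  by apply: eq_measure_integral => A mA _; apply/esym; exact: lebesgue_ins.
rewrite (@fubini_tonelli1 _ _ _ _ R leb (lebesgue_rV R n) _ mfi) /fubini_F; last first.
  by move=> p; exact: f0.
by rewrite (@fubini_tonelli _ _ _ _ R leb (lebesgue_rV R n) _ mfi)// => p; exact: f0.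
Qed.

End insertion.

Section translation.
Context (R : realType).
Local Notation leb := (@lebesgue_measure R).

Lemma lebesgue_measureD (v : R) (A : set R) : measurable A ->
  leb ((fun x => x + v) @^-1` A) = leb A.
Proof.
move=> mA; have mv : measurable_fun setT (fun x : measurableTypeR R => x + v : measurableTypeR R).
  by apply: measurable_funD => //; exact: measurable_cst.
apply/esym.
apply: (@lebesgue_measure_unique R (pushforward leb (fun x : measurableTypeR R => x + v : measurableTypeR R))) mA.
move=> _ [[a b] _ <-].
change (leb `]a, b]%classic = leb ((fun x => x + v) @^-1` `]a, b]%classic)).
have -> : (fun x => x + v) @^-1` `]a, b]%classic = `]a - v, b - v]%classic.
  by apply/seteqP; split => x /=; rewrite !in_itv/= ltrBlDr lerBrDr.
rewrite !lebesgue_measure_itv/= !lte_fin ltrD2r; case: ifP => // _.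
by rewrite -!EFinD; congr EFin; ring.
Qed.

Lemma lebesgue_rVD n (v : 'rV[R]_n) B : measurable B ->
  lebesgue_rV R n ((fun x => x + v) @^-1` B) = lebesgue_rV R n B.
Proof.
move=> mB; have mv : measurable_fun setT (fun x : 'rV[R]_n => x + v).
  by apply: measurable_addv => //; exact: measurable_cst.
apply: (lebesgue_rV_unique (m := pushforward (lebesgue_rV R n) (fun x => x + v))) mB.
move=> A mA.
change (lebesgue_rV R n ((fun x => x + v) @^-1` box A) = (\prod_(i < n) leb (A i))%E).
have -> : (fun x => x + v) @^-1` box A = box (fun i => (fun x => x + v ord0 i) @^-1` A i).
  by apply/seteqP; split => x /= h i; have := h i; rewrite mxE.
rewrite lebesgue_boxE; first by apply: eq_bigr => i _; rewrite lebesgue_measureD.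
move=> i; rewrite -[X in measurable X]setTI.
by apply: measurable_funD => //; exact: measurable_cst.
Qed.

End translation.

Section substitution.
Context (R : realType).
Local Notation leb := (@lebesgue_measure R).

(** The lower bound c on the slopes makes the images of the segments [-k, k] exhaust the line;
    substitution on each segment then passes to the limit by monotone convergence. *)
Lemma ge0_substitution (F G : R -> R) (c : R) : 0 < c ->
  (forall x y, x < y -> c * (y - x) <= F y - F x) ->
  (forall x, derivable F x 1) -> continuous (derive1 F) ->
  continuous G -> (forall x, 0 <= G x) ->
  (\int[leb]_x (G x)%:E = \int[leb]_x (G (F x) * derive1 F x)%:E)%E.
Proof.
move=> c0 Fc dF cF' cG G0.
have F_lt x y : x < y -> F x < F y.
  move=> xy; rewrite -subr_gt0 (lt_le_trans _ (Fc _ _ xy))// mulr_gt0// subr_gt0//.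
have cF : continuous F.
  by move=> x; exact/differentiable_continuous/derivable1_diffP/dF.
have F'0 x : 0 <= derive1 F x.
  apply: (@incr_derive1_ge0 _ F setT) => //; last by rewrite interiorT.
  by move=> a b _ _; exact: F_lt.
pose I (k : nat) : set R := `[- k%:R, k%:R]%classic.
pose J (k : nat) : set R := `[F (- k%:R), F k%:R]%classic.
have IJ k : (\int[leb]_(x in J k) (G x)%:E =
    \int[leb]_(x in I k) (G (F x) * derive1 F x)%:E)%E.
  rewrite /I /J integration_by_substitution_increasing//.
  - by have : 0 <= k%:R :> R by []; lra.
  - by move=> x y _ _; exact: F_lt.

  - by apply/cvg_ex; exists (derive1 F (- k%:R)); apply: cvg_at_right_filter; exact: cF'.
  - by apply/cvg_ex; exists (derive1 F k%:R); apply: cvg_at_left_filter; exact: cF'.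
  - split; [by move=> x _; exact: dF| |].
      by apply: cvg_at_right_filter; exact: cF.
    by apply: cvg_at_left_filter; exact: cF.
  - exact: continuous_subspaceT.
have mG : measurable_fun setT (EFin \o G).
  by apply/measurable_EFinP; exact: continuous_measurable_fun.
have mGF : measurable_fun setT (EFin \o (fun x => G (F x) * derive1 F x)).
  apply/measurable_EFinP; apply: measurable_funM.
    by apply: measurableT_comp; exact: continuous_measurable_fun.
  exact: continuous_measurable_fun.
have Icov : \bigcup_k I k = setT.
  rewrite -subTset => x _; exists (Num.bound `|x|) => //=.
  by rewrite /I /= in_itv/= -ler_norml ltW// archi_boundP.
have Jcov : \bigcup_k J k = setT.
  rewrite -subTset => x _; pose k := Num.bound ((`|x| + `|F 0|) / c).
  have q0 : 0 <= (`|x| + `|F 0|) / c by apply: divr_ge0; [exact: addr_ge0|exact: ltW].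
  have k0 : (`|x| + `|F 0|) / c < k%:R by exact: archi_boundP.
  have kp : 0 < k%:R :> R by exact: le_lt_trans k0.
  rewrite ltr_pdivrMr// in k0.
  exists k => //=; rewrite /J /= in_itv/=.
  have := Fc 0 k%:R kp; have := Fc (- k%:R) 0; rewrite oppr_lt0 => /(_ kp).
  have := ler_norm x; have := ler_norm (- x); rewrite normrN.
  have := ler_norm (F 0); have := ler_norm (- F 0); rewrite normrN.
  by move=> *; apply/andP; split; lra.
have Ind : nondecreasing_seq I.
  move=> k l kl; apply/subsetPset => x; rewrite /I /= !in_itv/=.
  have : k%:R <= l%:R :> R by rewrite ler_nat.
  by move=> h /andP[h1 h2]; apply/andP; split; lra.
have Jnd : nondecreasing_seq J.
  have Fle x y : x <= y -> F x <= F y.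
    by rewrite le_eqVlt => /predU1P[->//|/F_lt/ltW].
  move=> k l kl; apply/subsetPset => x; rewrite /J /= !in_itv/=.
  have h : k%:R <= l%:R :> R by rewrite ler_nat.
  move=> /andP[h1 h2]; apply/andP; split.
    by apply: le_trans h1; apply: Fle; rewrite lerN2.
  by apply: le_trans h2 _; exact: Fle.
have h1 := @ge0_nondecreasing_set_cvg_integral _ (measurableTypeR R) R J (EFin \o G) leb Jnd
  ltac:(by move=> k; exact: measurable_itv) (fun k => measurable_funTS mG)
  (fun k x _ => ltac:(by rewrite lee_fin)).
have h2 := @ge0_nondecreasing_set_cvg_integral _ (measurableTypeR R) R I _ leb Ind
  ltac:(by move=> k; exact: measurable_itv) (fun k => measurable_funTS mGF)
  (fun k x _ => ltac:(by rewrite lee_fin mulr_ge0)).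
rewrite Icov in h2; rewrite Jcov in h1.
have JI : (fun k => \int[leb]_(x in J k) (EFin \o G) x)%E =
    (fun k => \int[leb]_(x in I k) (EFin \o (fun x => G (F x) * derive1 F x)%R) x)%E.
  by apply/funext => k; exact: IJ.
rewrite JI in h1; exact: (cvg_unique _ h1 h2).
Qed.

End substitution.

(** * Bounded pointwise limits and Baire functions *)

Section minmax.
Context (R : realType) (T : Type) (F : set_system T) {FF : Filter F}.
Variables (f g : T -> R) (a b : R).
Hypotheses (fa : f @ F --> a) (gb : g @ F --> b).

Lemma cvg_max2 : (fun x => Num.max (f x) (g x)) @ F --> Num.max a b.
Proof.
rewrite (_ : (fun x => _) = fun x => (f x + g x + `|f x - g x|) / 2); last first.
  by apply/funext => x; rewrite maxr_absE.
rewrite maxr_absE; apply: cvgMl.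
apply: cvgD; first exact: cvgD.
by apply: cvg_norm; exact: cvgB.
Qed.

Lemma cvg_min2 : (fun x => Num.min (f x) (g x)) @ F --> Num.min a b.
Proof.
rewrite (_ : (fun x => _) = fun x => (f x + g x - `|f x - g x|) / 2); last first.
  by apply/funext => x; rewrite minr_absE.
rewrite minr_absE; apply: cvgMl.
apply: cvgB; first exact: cvgD.
by apply: cvg_norm; exact: cvgB.
Qed.

Lemma cvg_sumr I (r : seq I) (P : pred I) (h : I -> T -> R) (c : I -> R) :
  (forall i, P i -> h i @ F --> c i) ->
  (fun x => \sum_(i <- r | P i) h i x) @ F --> \sum_(i <- r | P i) c i.
Proof. by move=> hc; apply: (@cvg_big _ _ +%R) => // y; exact: add_continuous. Qed.

End minmax.

Section baire.
Import HBNNSimple.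
Context (R : realType) (n : nat).
Local Notation E := 'rV[R]_n.

(** Induction on this class extends an inequality from bounded continuous functions to all bounded
    measurable ones, see [baire_measurable]. *)
Inductive baire : (E -> R) -> Prop :=
| baire_continuous f M : continuous f -> (forall x, `|f x| <= M) -> baire f
| baire_limit (f_ : nat -> E -> R) f M : (forall k, baire (f_ k)) ->
    (forall k x, `|f_ k x| <= M) ->
    (forall x, (fun k => f_ k x) @ \oo --> f x) -> baire f.

Lemma baire_bounded f : baire f -> exists M, forall x, `|f x| <= M.
Proof.
case=> [g M _ gM|f_ g M _ fM cf]; first by exists M.
exists M => x; rewrite -[X in X <= _](cvg_lim (@Rhausdorff R) (cvg_norm (cf x))).
apply: limr_le; first by apply/cvg_ex; exists `|g x|; exact: (cvg_norm (cf x)).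
by apply: nearW => k; exact: fM.
Qed.

Lemma baire_mfun f : baire f -> measurable_fun setT f.
Proof.
elim=> [g M cg _|f_ g M _ mf _ fg]; first exact: continuous_measurable_rV.
by apply: (measurable_fun_cvg mf) => x _; exact: fg.
Qed.

(** A double induction: on [g] with a continuous first argument, then on [f]. *)
Lemma baire_comp2 (phi : R * R -> R) f g : continuous phi ->
  (forall M, exists M', forall a b, `|a| <= M -> `|b| <= M -> `|phi (a, b)| <= M') ->
  baire f -> baire g -> baire (fun x => phi (f x, g x)).
Proof.
move=> cphi bphi bf.
have step1 h M : continuous h -> (forall x, `|h x| <= M) -> baire g ->
    baire (fun x => phi (h x, g x)).
  move=> ch hM; elim=> [k N ck kN|k_ k N bk IH kN ck].
    have [M' hM'] := bphi (Num.max M N).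
    apply: (@baire_continuous _ M').
      by move=> x; apply: (continuous_comp (f := fun x => (h x, k x)));
        [exact: (cvg_pair (ch x) (ck x))|exact: cphi].
    by move=> x; apply: hM'; rewrite le_max ?hM ?kN ?orbT.
  have [M' hM'] := bphi (Num.max M N).
  apply: (@baire_limit (fun j x => phi (h x, k_ j x)) _ M') => //.
    by move=> j x; apply: hM'; rewrite le_max ?hM ?kN ?orbT.
  move=> x; apply: (@continuous_cvg _ _ _ _ _ _ phi); first exact: cphi.
  exact: (cvg_pair (cvg_cst (h x)) (ck x)).
elim: bf => [h M ch hM bg|h_ h M bh IH hM ch bg]; first exact: (step1 h M).
have [N gN] := baire_bounded bg.
have [M' hM'] := bphi (Num.max M N).
apply: (@baire_limit (fun j x => phi (h_ j x, g x)) _ M').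
- by move=> j; exact: IH.
- by move=> j x; apply: hM'; rewrite le_max ?hM ?gN ?orbT.
- move=> x; apply: (@continuous_cvg _ _ _ _ _ _ phi); first exact: cphi.
  exact: (cvg_pair (ch x) (cvg_cst (g x))).
Qed.

Lemma baireD f g : baire f -> baire g -> baire (fun x => f x + g x).
Proof.
apply: (@baire_comp2 (fun p => p.1 + p.2)) => [p|M].
  by apply: cvgD; [exact: cvg_fst|exact: cvg_snd].
exists (M + M) => a b aM bM /=; rewrite (le_trans (ler_normD _ _))// lerD//.
Qed.

Lemma baire_max f g : baire f -> baire g -> baire (fun x => Num.max (f x) (g x)).
Proof.
apply: (@baire_comp2 (fun p => Num.max p.1 p.2)) => [p|M].
  by apply: cvg_max2; [exact: cvg_fst|exact: cvg_snd].
by exists M => a b aM bM /=; rewrite /Num.max; case: ifP.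
Qed.

Lemma baire_cst c : baire (fun _ => c).
Proof. by apply: (@baire_continuous _ `|c|) => //; exact: cst_continuous. Qed.

Lemma baireZ c f : baire f -> baire (fun x => c * f x).
Proof.
move=> bf; apply: (@baire_comp2 (fun p => c * p.1) f f) => // [p|M].
  by apply: cvgMr; exact: cvg_fst.
by exists (`|c| * M) => a b aM bM /=; rewrite normrM ler_wpM2l.
Qed.

Lemma baire_sum I (r : seq I) (P : pred I) (f : I -> E -> R) :
  (forall i, P i -> baire (f i)) -> baire (fun x => \sum_(i <- r | P i) f i x).
Proof.
move=> bf; elim: r => [|i r IH].
  by under eq_fun do rewrite big_nil; exact: baire_cst.
under eq_fun do rewrite big_cons.
case Pi: (P i) => //; apply: baireD => //; exact: bf.
Qed.

(** The sets whose indicator is of Baire class form a sigma-algebra; it contains the open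
    half-spaces, which generate all measurable sets. *)
Lemma baire_indic (A : set E) : measurable A -> baire (\1_A : E -> R).
Proof.
move=> mA; pose D := [set B : set E | baire (\1_B : E -> R)].
pose H := [set B | exists (i : 'I_n) (a : R), B = [set x : E | a < x ord0 i]].
have HD : H `<=` D.
  move=> _ [i [a ->]]; rewrite /D /=.
  (* Ramps of slope k across the boundary of the half-space, increasing to its indicator. *)
  pose f_ (k : nat) (x : E) := Num.min 1 (k%:R * Num.max (x ord0 i - a) 0).
  have f0 k x : 0 <= f_ k x by rewrite le_min ler01 mulr_ge0// le_max lexx orbT.
  have f1 k x : `|f_ k x| <= 1 by rewrite ger0_norm// ge_min lexx.
  apply: (@baire_limit f_ _ 1) => // [k|x].
    apply: (@baire_continuous _ 1) => //.
    move=> x; apply: (@cvg_min2 _ _ _ (nbhs_filter x)); first exact: cvg_cst.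
    apply: cvgMr; apply: (@cvg_max2 _ _ _ (nbhs_filter x)); last exact: cvg_cst.
    by apply: cvgB; [exact: coord_continuous|exact: cvg_cst].
  rewrite indicE; case: (boolP (x \in _)); rewrite ?inE ?notin_setE/= => ax.
    have xa : 0 < x ord0 i - a by rewrite subr_gt0.
    apply: cvg_near_cst; exists (Num.bound ((x ord0 i - a)^-1)) => // k /= Nk.
    rewrite /f_ max_l ?ltW//; apply/min_idPl.
    rewrite -ler_pdivrMr// mul1r (le_trans (ltW (archi_boundP _)))//.
      by rewrite invr_ge0 ltW.
    by rewrite ler_nat.
  apply: cvg_near_cst; apply: nearW => k; rewrite /f_ max_r ?mulr0 ?min_r//.
  by rewrite subr_le0 leNgt; apply/negP.
have sD : sigma_algebra setT D.
  split.
  - by rewrite /D /= indic0; exact: (baire_cst 0).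
  - move=> B bB; rewrite /D /= setTD.
    rewrite (_ : \1_(~` B) = fun x => 1 + (-1) * \1_B x); last first.
      by apply/funext => x; rewrite !indicE in_setC; case: (x \in B); rewrite /= ?mulr1 ?mulr0 ?subrr ?addr0.
    by apply: baireD; [exact: baire_cst|exact: baireZ].
  - move=> F bF; rewrite /D /=.
    pose f_ := fix f_ k := if k is k'.+1 then fun x => Num.max (f_ k' x) (\1_(F k') x : R)
      else (fun _ : E => 0 : R).
    have f_E k x : f_ k x = if `[< exists2 j, (j < k)%N & F j x >] then 1 else 0.
      elim: k => [|k IH] /=.
        by case: asboolP => // -[].
      rewrite IH indicE; case: asboolP => [[j jk Fj]|nF]; case: asboolP => [[l lk Fl]|nF'].
      - by case: (x \in _) => /=; rewrite ?maxxx// max_l.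
      - by case: nF'; exists j => //; exact: ltnW.
      - move: lk; rewrite ltnS leq_eqVlt => /predU1P[lk|lk]; last by case: nF; exists l.
        by rewrite -lk mem_set// max_r.
      - case: (boolP (x \in F k)) => /= [/set_mem Fk|_]; last by rewrite maxxx.
        by case: nF'; exists k.
    apply: (@baire_limit f_ _ 1).
    + elim=> [|k IH] /=; first exact: baire_cst.
      by apply: baire_max => //; exact: bF.
    + by move=> k x; rewrite f_E; case: ifP => _; rewrite ?normr1 ?normr0.
    + move=> x; rewrite indicE; case: (boolP (x \in _)); rewrite ?inE ?notin_setE => Fx.
        case: Fx => j _ Fj; apply: cvg_near_cst; exists j.+1 => // k /= jk.
        by rewrite f_E; case: asboolP => // -[]; exists j.
      apply: cvg_near_cst; apply: nearW => k; rewrite f_E; case: asboolP => //.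
      by move=> [j _ Fj]; exfalso; apply: Fx; exists j.
suff : <<s H >> A.
  have sub : <<s H >> `<=` D by exact: (smallest_sub sD HD).
  by move=> /sub.
pose T' := g_sigma_algebraType H.
have mid : measurable_fun setT (fun x : T' => (x : E)).
  apply: measurable_rV => i; apply: (measurability _ (RGenOInfty.measurableE R)).
  move=> _ [_ [a ->] <-]; rewrite setTI; apply: sub_sigma_algebra.
  exists i, a; apply/seteqP; split => x /=; by rewrite in_itv/= andbT.
by have := mid measurableT _ mA; rewrite setTI preimage_id.
Qed.

Lemma baire_measurable (f : E -> R) M :
  measurable_fun setT f -> (forall x, `|f x| <= M) -> baire f.
Proof.
(* Shifted by M the function is nonnegative, hence an increasing limit of simple functions. *)
move=> mf fM; pose g x := f x + M.
have g0 x : 0 <= g x.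
  by have := fM x; rewrite ler_norml /g => /andP[h _]; rewrite -lerBlDr sub0r.
have mg : measurable_fun setT (EFin \o g).
  by apply/measurable_EFinP/measurable_funD => //; exact: measurable_cst.
pose s := nnsfun_approx measurableT mg.
have s_le (k : nat) (x : E) : (s k : E -> R) x <= g x.
  have nd : nondecreasing_seq (fun k => s k x).
    by move=> i j ij; have /lefP := nd_nnsfun_approx measurableT mg ij; exact.
  have cs : (fun k => (s k x)%:E) @ \oo --> (g x)%:E.
    by apply: (cvg_nnsfun_approx measurableT mg) => // y _; rewrite lee_fin.
  have /fine_cvgP[_ cs'] := cs.
  rewrite -(cvg_lim (@Rhausdorff R) cs').
  by apply: (nondecreasing_cvgn_le nd); apply/cvg_ex; exists (g x).
have bs k : baire (s k).
  rewrite (_ : (s k : E -> R) = fun x => \sum_(y <- finmap.enum_fset (fset_set (range (s k))))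
      y * \1_(s k @^-1` [set y]) x); last first.
    by apply/funext => x; rewrite [LHS]fimfunE fsbig_finite//.
  apply: baire_sum => y _; apply: baireZ; apply: baire_indic.
  by rewrite -[X in measurable X]setTI; exact: measurable_funP.
have -> : f = fun x => g x + (- M) by apply/funext => x; rewrite /g addrK.
apply: baireD; last exact: baire_cst.
apply: (@baire_limit (fun k => s k) _ (M + M)) => // [k x|x].
  rewrite ger0_norm//; apply: le_trans (s_le k x) _; rewrite /g lerD2r.
  exact: le_trans (ler_norm _) (fM x).
have cs : (fun k => (s k x)%:E) @ \oo --> (g x)%:E.
  by apply: (cvg_nnsfun_approx measurableT mg) => // y _; rewrite lee_fin.
by have /fine_cvgP[] := cs.
Qed.

End baire.

(** * Entropy *)

Section exp_weight.
Context (R : realType).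
Local Notation leb := (@lebesgue_measure R).

Lemma integral_exp_abs : (\int[leb]_r (expR (- `|r|))%:E < +oo)%E.
Proof.
pose p := @exponential_pdf R 1.
have p0 x : 0 <= p x by exact: exponential_pdf_ge0.
have mp : measurable_fun setT (p : measurableTypeR R -> R) by exact: measurable_exponential_pdf.
have ip : (\int[leb]_x (p x)%:E = 1)%E by exact: integral_exponential_pdf.
have mo : measurable_fun setT (-%R : measurableTypeR R -> measurableTypeR R).
  exact: oppr_measurable.
have mpo : measurable_fun setT (fun x : measurableTypeR R => p (- x)) by exact: measurableT_comp.
have ipo : (\int[leb]_x (p (- x))%:E = 1)%E.
  apply: etrans ip; apply/esym; transitivity (\int[pushforward leb (-%R : measurableTypeR R -> measurableTypeR R)]_(x in setT) (EFin \o p) x)%E.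
    by apply: eq_measure_integral => A mA _; exact/esym/lebesgue_measureN.
  apply: (@ge0_integral_pushforward _ _ _ _ R _ mo leb setT (EFin \o p)) => //.
  - exact/measurable_EFinP.
  - by move=> x _; rewrite lee_fin.
apply: (@le_lt_trans _ _ (\int[leb]_r (p r + p (- r))%:E)%E).
  apply: ge0_le_integral => //.
  - apply/measurable_EFinP; apply: measurableT_comp; first exact: measurable_expR.
    by apply: measurableT_comp => //; apply: measurableT_comp.
  - by apply/measurable_EFinP; exact: measurable_funD.
  - move=> r _; rewrite lee_fin.
    have [r0|r0] := leP 0 r.
      by rewrite ger0_norm// /p (exponential_pdfE _ r0) mul1r mulN1r lerDl; exact: p0.
    have r1 : 0 <= - r by rewrite oppr_ge0 ltW.
    by rewrite ltr0_norm// /p (exponential_pdfE _ r1) mul1r mulN1r lerDr; exact: p0.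
under eq_integral do rewrite EFinD.
rewrite ge0_integralD//.
- by apply: lte_add_pinfty; rewrite ?(lt_eqF, ip, ipo) ?ltry// -?ge0_fin_numE// ?ip ?ipo//; (apply: le_lt_trans; [by rewrite le_eqVlt; apply/orP; left; apply/eqP; exact: ip || exact: ipo|exact: ltry]).
- by move=> x _; rewrite lee_fin.
- exact/measurable_EFinP.
- by move=> x _; rewrite lee_fin.
- exact/measurable_EFinP.
Qed.

(** Preferred to the Euclidean norm because [weight] then factors over the coordinates and is
    integrated by induction on the dimension. *)
Definition l1norm n (x : 'rV[R]_n) : R := \sum_i `|x ord0 i|.

Lemma l1norm_ge0 n (x : 'rV[R]_n) : 0 <= l1norm x.
Proof. exact: sumr_ge0. Qed.

Lemma continuous_l1norm n : continuous (@l1norm n).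
Proof.
move=> x; apply: (@cvg_sumr _ _ _ (nbhs_filter x)) => i _.
by apply: cvg_norm; exact: coord_continuous.
Qed.

Lemma measurable_l1norm n : measurable_fun setT (@l1norm n).
Proof. by apply: continuous_measurable_rV; exact: continuous_l1norm. Qed.

Lemma l1norm_le_enorm n (x : 'rV[R]_n) : l1norm x <= n%:R * enorm x.
Proof.
rewrite -[X in X%:R]card_ord mulr_natl -sumr_const.
by apply: ler_sum => i _; exact: coord_le_enorm.
Qed.

Lemma l1norm_ins n (i : 'I_n.+1) (r : measurableTypeR R) (y : 'rV[R]_n) :
  l1norm (ins i (r, y)) = `|r| + l1norm y.
Proof.
rewrite /l1norm (bigD1_ord i)//= ins_at; congr (_ + _).
by apply: eq_bigr => k _; rewrite ins_lift.
Qed.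

Definition weight n (x : 'rV[R]_n) : R := expR (- l1norm x).

Lemma measurable_weight n : measurable_fun setT (@weight n).
Proof.
apply: measurableT_comp; first exact: measurable_expR.
by apply: measurableT_comp => //; exact: measurable_l1norm.
Qed.

Lemma weight_L1 n : (lebesgue_rV R n).-L1 (@weight n).
Proof.
apply: L1_lty; first exact: measurable_weight.
  by move=> x; exact: expR_ge0.
elim: n => [|n IH].
  rewrite /= integral_dirac//; last by apply/measurable_EFinP; exact: measurable_weight.
  by rewrite diracT mul1e ltry.
rewrite (integral_ins ord0); last 2 first.
- by apply/measurable_EFinP; exact: measurable_weight.
- by move=> x; rewrite lee_fin expR_ge0.
rewrite (eq_integral (fun y : 'rV[R]_n => (\int[leb]_r (expR (- `|r|))%:E) * (weight y)%:E)%E); last first.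
  move=> y _; rewrite muleC -ge0_integralZl//.
  - by apply: eq_integral => r _; rewrite /weight l1norm_ins opprD expRD mulrC EFinM.
  - apply/measurable_EFinP; apply: measurableT_comp; first exact: measurable_expR.
    by apply: measurableT_comp => //; apply: measurableT_comp.
  - by rewrite lee_fin expR_ge0.
rewrite ge0_integralZl//.
- apply: lte_mul_pinfty => //; first by apply: integral_ge0 => r _; rewrite lee_fin expR_ge0.
  by rewrite ge0_fin_numE ?integral_exp_abs//; apply: integral_ge0 => r _; rewrite lee_fin expR_ge0.
- by apply/measurable_EFinP; exact: measurable_weight.
- by move=> x _; rewrite lee_fin expR_ge0.
- by apply: integral_ge0 => r _; rewrite lee_fin expR_ge0.
Qed.

End exp_weight.

(** Only the minorant is integrable; the integral of [f], like an entropy, may be infinite. *)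
Lemma ae_le_integral_EFin d (T : measurableType d) (R : realType)
    (m : {measure set T -> \bar R}) (w f : T -> R) :
  m.-L1 w -> measurable_fun setT f -> {ae m, forall x, w x <= f x} ->
  ((\int[m]_x w x)%:E <= \int[m]_x (f x)%:E)%E.
Proof.
move=> w1 mf wf; have mw := L1_measurable w1.
have mf' : measurable_fun setT (EFin \o f) by exact/measurable_EFinP.
have mw' : measurable_fun setT (EFin \o w) by exact/measurable_EFinP.
rewrite RintegralE// integralE [leRHS]integralE; apply: leeB.
  apply: ae_ge0_le_integral => //; [exact: measurable_funepos|exact: measurable_funepos|].
  apply: ae_imp wf => x wf _; rewrite !funeposE -!EFin_max lee_fin.
  by rewrite ge_max !le_max wf lexx orbT.
apply: ae_ge0_le_integral => //; [exact: measurable_funeneg|exact: measurable_funeneg|].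
apply: ae_imp wf => x wf _; rewrite !funenegE /= -!EFin_max lee_fin.
by rewrite ge_max !le_max lerN2 wf lexx orbT.
Qed.

Lemma dominates_ae d (T : measurableType d) (R : realType)
    (m1 m2 : {measure set T -> \bar R}) (P : T -> Prop) :
  m1 `<< m2 -> {ae m2, forall x, P x} -> {ae m1, forall x, P x}.
Proof.
move=> /null_content_dominatesP m12 [A [mA A0 PA]]; exists A; split => //.
exact: m12.
Qed.

Lemma measurable_inv_ge0 d (T : measurableType d) (R : realType) (f : T -> R) :
  measurable_fun setT f -> (forall x, 0 <= f x) ->
  measurable_fun setT (fun x => (f x)^-1).
Proof.
move=> mf f0.
rewrite (_ : (fun x => _) = fun x => if 0 < f x then expR (- ln (f x)) else 0).
  apply: measurable_fun_ifT => //.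
    by apply: measurable_fun_ltr => //; exact: measurable_cst.
  apply: measurableT_comp; first exact: measurable_expR.
  by apply: measurableT_comp => //; apply: measurableT_comp => //; exact: measurable_ln.
apply/funext => x; case: ltP => [fx|fx]; first by rewrite expRN lnK.
by have -> : f x = 0 by [apply/eqP; rewrite eq_le fx f0]; rewrite invr0.
Qed.

Lemma measurable_invr d (T : measurableType d) (R : realType) (f : T -> R) :
  measurable_fun setT f -> measurable_fun setT (fun x => (f x)^-1).
Proof.
move=> mf.
rewrite (_ : (fun x => _) = fun x => (Num.max (f x) 0)^-1 - (Num.max (- f x) 0)^-1).
  have m1 (g : T -> R) : measurable_fun setT g -> measurable_fun setT (fun x => (Num.max (g x) 0)^-1).
    move=> mg; apply: measurable_inv_ge0 => [|x]; last by rewrite le_max lexx orbT.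
    by apply: measurable_maxr.
  by apply: measurable_funB; apply: m1 => //; exact: measurableT_comp.
apply/funext => x; have [f0|f0] := leP 0 (f x).
  by rewrite [X in _ - X^-1]max_r ?oppr_le0// invr0 subr0.
by rewrite max_l ?oppr_ge0 ?(ltW f0)// invrN invr0 sub0r opprK.
Qed.

Section density.
Context (R : realType) (d : nat) (mu : P2 R d).
Local Notation E := 'rV[R]_d.
Local Notation leb := (lebesgue_rV R d).
Hypothesis ac : mu `<< leb.

Lemma density_L1 : leb.-L1 (density mu).
Proof.
have h := Radon_Nikodym_integrable (ac : charge_of_finite_measure mu `<< leb).
apply: eq_integrable h => // x _ /=.
by rewrite /density fineK//; exact: Radon_Nikodym_fin_num.
Qed.

Lemma measurable_density : measurable_fun setT (density mu).
Proof. exact: L1_measurable density_L1. Qed.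

Lemma density_ge0 : {ae leb, forall x, 0 <= density mu x}.
Proof.
have := ae_eq_Radon_Nikodym_SigmaFinite ac measurableT.
apply: ae_imp => x /(_ I) /= h.
by rewrite /density -h; apply: fine_ge0; exact: Radon_Nikodym_SigmaFinite.f_ge0.
Qed.

(** A version of the density that is nonnegative everywhere, whereas [density] is so only almost
    everywhere. *)
Definition dens (x : E) : R := Num.max 0 (density mu x).

Lemma dens_ge0 x : 0 <= dens x.
Proof. by rewrite le_max lexx. Qed.

Lemma densE : {ae leb, forall x, density mu x = dens x}.
Proof. by apply: ae_imp density_ge0 => x h; rewrite /dens max_r. Qed.

Lemma measurable_dens : measurable_fun setT dens.
Proof. by apply: measurable_maxr => //; exact: measurable_density. Qed.

Lemma dens_L1 : leb.-L1 dens.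
Proof. exact: ae_eq_L1 measurable_dens density_L1 densE. Qed.

Lemma dens_ge0_integral (g : E -> \bar R) :
  measurable_fun setT g -> (forall x, 0 <= g x)%E ->
  (\int[mu]_x g x = \int[leb]_x (g x * (dens x)%:E))%E.
Proof.
move=> mg g0; rewrite -(Radon_Nikodym_SigmaFinite.change_of_variables ac g0 measurableT mg).
have mf : measurable_fun setT (Radon_Nikodym_SigmaFinite.f mu leb).
  exact: measurable_int (Radon_Nikodym_SigmaFinite.f_integrable ac).
apply: ae_eq_integral => //.
- exact: emeasurable_funM.
- by apply: emeasurable_funM => //; apply/measurable_EFinP; exact: measurable_dens.
- have h := ae_eq_Radon_Nikodym_SigmaFinite ac measurableT.
  apply: (@ae_imp2 _ _ _ leb _ _ _ _ h densE) => x /= /(_ I) -> hx _.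
  by congr (_ * _)%E; rewrite -hx /density fineK//; exact: Radon_Nikodym_fin_num.
Qed.

Lemma dens_Rint (g : E -> R) : mu.-L1 g ->
  leb.-L1 (fun x => g x * dens x) /\
  \int[mu]_x g x = \int[leb]_x (g x * dens x).
Proof.
move=> g1; have mg := L1_measurable g1.
have m2 : measurable_fun setT (fun x => g x * dens x).
  by apply: measurable_funM => //; exact: measurable_dens.
split.
  apply/integrableP; split; first exact/measurable_EFinP.
  rewrite (_ : (fun x => _) = fun x => (`|g x|%:E * (dens x)%:E)%E); last first.
    by apply/funext => x; rewrite /= normrM (ger0_norm (dens_ge0 x)).
  rewrite -(@dens_ge0_integral (fun x => `|g x|%:E)).
  - by have /integrableP[] := g1.
  - by apply/measurable_EFinP; exact: measurableT_comp.
  - by move=> x; rewrite lee_fin.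
rewrite /Rintegral -(Radon_Nikodym_change_of_variables ac measurableT g1).
congr fine; apply: ae_eq_integral => //.
- apply: emeasurable_funM; first exact/measurable_EFinP.
  exact: measurable_int (Radon_Nikodym_integrable (ac : charge_of_finite_measure mu `<< leb)).
- exact/measurable_EFinP.
- apply: ae_imp densE => x hx _ /=; rewrite EFinM -hx /density fineK//.
  exact: Radon_Nikodym_fin_num.
Qed.

Lemma Rint_dens : \int[leb]_x dens x = 1.
Proof.
have [_ h] := dens_Rint (L1_cst mu 1); rewrite Rint_cst in h.
by rewrite h; under [RHS]eq_Rintegral do rewrite mul1r.
Qed.

Lemma density_gt0 : {ae mu, forall x, 0 < density mu x}.
Proof.
pose A := [set x : E | ~ 0 < density mu x].
have mA : measurable A.
  rewrite (_ : A = density mu @^-1` `]-oo, 0]%classic).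
    by rewrite -[X in measurable X]setTI; apply: measurable_density.
  by apply/seteqP; split => x; rewrite /A /= in_itv/= leNgt => /negP.
exists A; split => //.
have -> : mu A = (\int[mu]_x (\1_A x)%:E)%E by rewrite integral_indic// setIT.
rewrite dens_ge0_integral.
- apply: integral0_eq => x _; rewrite indicE; case: (boolP (x \in A)) => [/set_mem/negP|_]; last by rewrite mul0e.
  by rewrite -leNgt /dens => /max_l ->; rewrite mule0.
- by apply/measurable_EFinP; exact: measurable_indic.
- by move=> x; rewrite lee_fin.
Qed.

Lemma density_dens : {ae mu, forall x, density mu x = dens x /\ 0 < dens x}.
Proof.
by apply: ae_imp density_gt0 => x h; rewrite /dens max_r ?ltW//.
Qed.

(** Where the density vanishes the quotient is 0 by convention and the mass of [h] is lost, hence an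
    inequality. *)
Lemma dens_div_L1 (h : E -> R) : leb.-L1 h -> (forall x, 0 <= h x) ->
  mu.-L1 (fun x => h x / dens x) /\ \int[mu]_x (h x / dens x) <= \int[leb]_x h x.
Proof.
move=> h1 h0; have mh := L1_measurable h1.
have m1 : measurable_fun setT (fun x => h x / dens x).
  apply: measurable_funM => //; apply: measurable_inv_ge0; last exact: dens_ge0.
  exact: measurable_dens.
have q0 x : 0 <= h x / dens x by rewrite divr_ge0 ?dens_ge0.
have le1 : (\int[mu]_x (h x / dens x)%:E <= \int[leb]_x (h x)%:E)%E.
  rewrite dens_ge0_integral; last 2 first.
  - exact/measurable_EFinP.
  - by move=> x; rewrite lee_fin.
  apply: ge0_le_integral => //.
  - by move=> x _; rewrite -EFinM lee_fin mulr_ge0 ?dens_ge0.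
  - by apply: emeasurable_funM; apply/measurable_EFinP => //; exact: measurable_dens.
  - exact/measurable_EFinP.
  - move=> x _; rewrite -EFinM lee_fin.
    have [->|n0] := eqVneq (dens x) 0; first by rewrite mulr0.
    by rewrite divfK.
have L : mu.-L1 (fun x => h x / dens x).
  apply: L1_lty => //; apply: le_lt_trans le1 _.
  by rewrite -RintegralE// ltry.
by split => //; rewrite -lee_fin !RintegralE.
Qed.

End density.

Section duality.
Context (R : realType) (d : nat).
Local Notation E := 'rV[R]_d.
Local Notation leb := (lebesgue_rV R d).
Implicit Types mu : P2 R d.

(* Legendre duality between the entropy and the exponential, normalised by
   [ln k >= g + 1 - e^g / k] instead of Jensen's inequality. *)
Definition dual mu (g : E -> R) : R :=
  \int[mu]_x g x + 1 - \int[leb]_x expR (g x).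

Lemma measurable_expR_comp d' (T : measurableType d') (g : T -> R) :
  measurable_fun setT g -> measurable_fun setT (fun x => expR (g x)).
Proof. by move=> mg; apply: measurableT_comp => //; exact: measurable_expR. Qed.

Lemma ln_ge (r : R) : 0 < r -> 1 - r^-1 <= ln r.
Proof.
move=> r0; have := expR_ge1Dx (- ln r); rewrite expRN lnK// => h; lra.
Qed.

Lemma entropy_ge mu (g : E -> R) : mu.-L1 g -> leb.-L1 (fun x => expR (g x)) ->
  ((dual mu g)%:E <= entropy mu)%E.
Proof.
move=> g1 e1; rewrite /entropy; case: asboolP => [ac|_]; last exact: leey.
have [q1 qle] := dens_div_L1 ac e1 (fun x => expR_ge0 _).
pose w x := g x + 1 - expR (g x) / dens mu x.
have w1 : mu.-L1 w by apply: L1B => //; apply: L1D => //; exact: L1_cst.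
apply: (@le_trans _ _ (\int[mu]_x w x)%:E).
  rewrite lee_fin /w RintB//; last by apply: L1D => //; exact: L1_cst.
  by rewrite RintD//; [rewrite Rint_cst /dual lerB|exact: L1_cst].
apply: ae_le_integral_EFin => //.
  apply: measurableT_comp; first exact: measurable_ln.
  exact: measurable_density.
apply: ae_imp (density_dens ac) => x [-> k0]; rewrite /w.
have : 0 < dens mu x / expR (g x) by rewrite divr_gt0 ?expR_gt0.
move/ln_ge; rewrite invf_div lnM ?posrE ?invr_gt0 ?expR_gt0// lnV ?posrE ?expR_gt0// expRK.
lra.
Qed.

(* [- l1norm] serves as a reference potential making [e^g] integrable. *)
Lemma l1norm_L1 mu : mu.-L1 (@l1norm R d).
Proof.
apply: (@L1_le _ _ _ mu _ (fun x => d%:R * (1 + sqnorm x))).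
- exact: measurable_l1norm.
- move=> x; rewrite ger0_norm ?l1norm_ge0//.
  by rewrite (le_trans (l1norm_le_enorm _))// ler_wpM2l// enorm_le1.
- by apply: L1Z; apply: L1D; [exact: L1_cst|exact: P2_L1].
Qed.

Lemma pot_L1 mu (h : E -> R) (M : R) : measurable_fun setT h -> (forall x, `|h x| <= M) ->
  mu.-L1 (fun x => - l1norm x + h x).
Proof.
move=> mh hM; apply: L1D; first exact: L1N (l1norm_L1 mu).
by apply: (@L1_le _ _ _ mu _ (fun _ => M)) => //; exact: L1_cst.
Qed.

Lemma expR_pot_L1 (h : E -> R) (M : R) : measurable_fun setT h -> (forall x, `|h x| <= M) ->
  leb.-L1 (fun x => expR (- l1norm x + h x)).
Proof.
move=> mh hM; apply: (@L1_le _ _ _ leb _ (fun x => expR M * weight x)).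
- apply: measurable_expR_comp; apply: measurable_funD => //.
  by apply: measurableT_comp => //; exact: measurable_l1norm.
- move=> x; rewrite ger0_norm ?expR_ge0// expRD mulrC ler_wpM2r ?expR_ge0//.
  by rewrite ler_expR (le_trans (ler_norm _)).
- by apply: L1Z; exact: weight_L1.
Qed.

Definition w0 : R := \int[leb]_x (weight x).

(** The reference potential itself, used in the duality. The entropy is bounded below only up to the
    second moment, which the penalisations have to absorb later. *)
Lemma entropy_ge_M2 mu : ((1 - w0 - d%:R * (1 + M2 mu))%:E <= entropy mu)%E.
Proof.
have m0 : measurable_fun setT (fun _ : E => 0 : R) by exact: measurable_cst.
have b0 (x : E) : `|0 : R| <= 0 by rewrite normr0.
have := entropy_ge (pot_L1 mu m0 b0) (expR_pot_L1 m0 b0).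
apply: le_trans; rewrite lee_fin /dual.
rewrite (_ : \int[leb]_x expR (- l1norm x + 0) = w0); last first.
  by apply: eq_Rintegral => x _; rewrite addr0.
rewrite (_ : \int[mu]_x (- l1norm x + 0) = - \int[mu]_x l1norm x); last first.
  rewrite -RintN; last exact: l1norm_L1.
  by apply: eq_Rintegral => x _; rewrite addr0.
suff : \int[mu]_x l1norm x <= d%:R * (1 + M2 mu) by clear m0 b0; lra.
have L : mu.-L1 (fun x => 1 + sqnorm x).
  by apply: L1D; [exact: L1_cst|exact: P2_L1].
rewrite [leRHS](_ : _ = \int[mu]_x (d%:R * (1 + sqnorm x))); last first.
  by rewrite RintZ// RintD//; [rewrite Rint_cst|exact: L1_cst|exact: P2_L1].
apply: le_Rint; [exact: l1norm_L1|exact: L1Z|] => x.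
by rewrite (le_trans (l1norm_le_enorm _))// ler_wpM2l// enorm_le1.
Qed.

Section converse.
Variables (mu : P2 R d) (c : R).
Hypothesis dc : forall h : E -> R, continuous h -> (exists M, forall x, `|h x| <= M) ->
  dual mu (fun x => - l1norm x + h x) <= c.

(** Induction on the Baire class: both integrals in [dual] pass to the limit by dominated
    convergence, the second one against a multiple of [weight]. *)
Lemma dual_le_bounded (h : E -> R) (M : R) : measurable_fun setT h ->
  (forall x, `|h x| <= M) -> dual mu (fun x => - l1norm x + h x) <= c.
Proof.
move=> mh hM; have := baire_measurable mh hM.
elim=> [f N cf fN|h_ f N bh IH hN hf]; first by apply: dc => //; exists N.
have mh_ k : measurable_fun setT (h_ k).
  exact: baire_mfun.
have mf : measurable_fun setT f by apply: baire_mfun; exact: baire_limit hf.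
have [M' fM] := baire_bounded (baire_limit bh hN hf).
have ml : measurable_fun setT (fun x : E => - l1norm x).
  by apply: measurableT_comp => //; exact: measurable_l1norm.
have [_ c1] : mu.-L1 f /\ (fun k => \int[mu]_x h_ k x) @ \oo --> \int[mu]_x f x.
  apply: (@Rint_dominated _ _ _ mu h_ f (fun _ => N)) => //; first exact: L1_cst.
  by apply: aeW => x; exact: hf.
have [_ c2] : leb.-L1 (fun x => expR (- l1norm x + f x)) /\
    (fun k => \int[leb]_x expR (- l1norm x + h_ k x)) @ \oo -->
    \int[leb]_x expR (- l1norm x + f x).
  apply: (@Rint_dominated _ _ _ leb (fun k x => expR (- l1norm x + h_ k x)) _ (fun x => expR N * weight x)).
  - by move=> k; apply: measurable_expR_comp; exact: measurable_funD.
  - by apply: measurable_expR_comp; exact: measurable_funD.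
  - by apply: L1Z; exact: weight_L1.
  - apply: aeW => x; apply: (@continuous_cvg _ _ _ _ _ _ expR); first exact: continuous_expR.
    by apply: cvgD; [exact: cvg_cst|exact: hf].
  - move=> k x; rewrite ger0_norm ?expR_ge0// expRD mulrC ler_wpM2r ?expR_ge0//.
    by rewrite ler_expR (le_trans (ler_norm _)).
have c3 : (fun k => dual mu (fun x => - l1norm x + h_ k x)) @ \oo -->
    dual mu (fun x => - l1norm x + f x).
  apply: cvgB => //; apply: cvgD; last exact: cvg_cst.
  have e k : \int[mu]_x (- l1norm x + h_ k x) = \int[mu]_x (- l1norm x) + \int[mu]_x h_ k x.
    rewrite RintD//; first exact: L1N (l1norm_L1 mu).
    by apply: (@L1_le _ _ _ mu _ (fun _ => N)) => //; exact: L1_cst.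
  under eq_fun do rewrite e.
  rewrite RintD//; first by apply: cvgD => //; exact: cvg_cst.
  - exact: L1N (l1norm_L1 mu).
  - by apply: (@L1_le _ _ _ mu _ (fun _ => M')) => //; exact: L1_cst.
by apply: (cvgr_le_bound c3); apply: nearW.
Qed.

(** On a Lebesgue-null set A the potential k 1_A leaves the exponential integral unchanged and gains
    k mu(A), for every k. *)
Lemma dual_ac : mu `<< leb.
Proof.
apply/null_content_dominatesP => A mA A0.
have m0 : measurable_fun setT (fun _ : E => 0 : R) by exact: measurable_cst.
have b0 (x : E) : `|0 : R| <= 0 by rewrite normr0.
pose K := \int[mu]_x (- l1norm x) + 1 - w0.
have h k : K + k%:R * fine (mu A) <= c.
  have mk : measurable_fun setT (fun x => k%:R * \1_A x : R).
    by apply: measurable_funM => //; exact: measurable_indic.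
  have bk x : `|k%:R * \1_A x : R| <= k%:R.
    by rewrite indicE; case: (x \in A); rewrite ?mulr1 ?mulr0 ?normr0// ger0_norm.
  have := dual_le_bounded mk bk; rewrite /dual.
  have L1A : mu.-L1 (\1_A : E -> R).
    apply: (@L1_le _ _ _ mu _ (fun _ => 1)); [exact: measurable_indic| |exact: L1_cst].
    by move=> x; rewrite indicE; case: (x \in A); rewrite ?normr0 ?normr1.
  rewrite RintD; [|exact: L1N (l1norm_L1 mu)|exact: L1Z].
  rewrite RintZ//.
  have -> : \int[mu]_x \1_A x = fine (mu A).
    by rewrite /Rintegral -[in RHS](setIT A) -integral_indic.
  have -> : \int[leb]_x expR (- l1norm x + k%:R * \1_A x) = w0.
    apply: ae_eq_Rint.
    - by apply: measurable_expR_comp; apply: measurable_funD => //; apply: measurableT_comp => //; exact: measurable_l1norm.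
    - exact: measurable_weight.
    - exists A; split => // x /= nx; apply: contrapT => xA; apply: nx.
      by rewrite indicE memNset//= mulr0 addr0.
  by rewrite /K; move: (\int[mu]_x _) w0 (_ * _) => p q r; clear; lra.
have f0 : 0 <= fine (mu A) by exact: fine_ge0.
have : fine (mu A) = 0.
  apply/eqP; rewrite eq_le f0 andbT leNgt; apply/negP => fp.
  have := archi_boundP (_ : 0 <= Num.max 0 ((c - K) / fine (mu A))).
  rewrite le_max lexx => /(_ isT); set k := Num.bound _ => kb.
  have := h k; apply/negP; rewrite -ltNge -ltrBlDl -ltr_pdivrMr//.
  by apply: le_lt_trans kb; rewrite le_max lexx orbT.
move=> h0; have : mu A \is a fin_num by rewrite fin_num_measure.
by move=> /fineK <-; rewrite h0.
Qed.

(** The optimal potential is the logarithm of the density; its truncations are admissible and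
    Fatou's lemma recovers the entropy from them. *)
Lemma entropy_le : (entropy mu <= c%:E)%E.
Proof.
have ac := dual_ac.
rewrite /entropy asboolT//.
have mk := measurable_dens ac; have k0 := dens_ge0 mu.
pose u x := ln (dens mu x) + l1norm x.
(* Truncation of [u] at levels -k and k; the value -k where the density vanishes makes the
   exponential tend to 0 there. *)
pose h k x : R := if 0 < dens mu x then Num.max (- k%:R) (Num.min k%:R (u x)) else - k%:R.
have mu_ : measurable_fun setT u.
  apply: measurable_funD; last exact: measurable_l1norm.
  by apply: measurableT_comp => //; exact: measurable_ln.
have mh k : measurable_fun setT (h k).
  apply: measurable_fun_ifT => //.
    by apply: measurable_fun_ltr => //; exact: measurable_cst.
  by apply: measurable_maxr => //; exact: measurable_minr.
have hk k x : `|h k x| <= k%:R.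
  rewrite /h ler_norml; case: ifP => _; last by rewrite lexx -subr_ge0 opprK addr_ge0.
  rewrite le_max lexx /= ge_max ge_min lexx /= andbT.
  by rewrite -subr_ge0 opprK addr_ge0.
have hcv x : 0 < dens mu x -> (fun k => h k x) @ \oo --> u x.
  move=> kx; apply: cvg_near_cst; exists (Num.bound `|u x|) => // k /= Nk.
  have uk : `|u x| <= k%:R.
    by rewrite (le_trans (ltW (archi_boundP _)))// ler_nat.
  move: uk; rewrite ler_norml => /andP[u1 u2].
  by rewrite /h kx min_r// max_r.
have [q1 qle] := dens_div_L1 ac (@weight_L1 R d) (fun x => expR_ge0 _).
(* Adding [w] makes the truncations nonnegative where the density is positive: this is [ln_ge] at
   the quotient of the density by [weight]. *)
pose w x := 1 + weight x / dens mu x.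
have w1 : mu.-L1 w by apply: L1D => //; exact: L1_cst.
have w_ge0 x : 0 <= w x by rewrite addr_ge0// divr_ge0// expR_ge0.
have hw x k : 0 < dens mu x -> 0 <= h k x + w x.
  move=> kx; rewrite /h kx -lerBlDr sub0r le_max le_min.
  have : - w x <= u x.
    rewrite /w /u /weight.
    have := ln_ge (divr_gt0 kx (expR_gt0 (- l1norm x))).
    rewrite invf_div lnM ?posrE ?invr_gt0 ?expR_gt0// lnV ?posrE ?expR_gt0// expRK.
    lra.
  move=> ->; rewrite andbT; apply/orP; right.
  by rewrite (@le_trans _ _ 0)// oppr_le0.
(* The exponential integrals tend to the total mass of the density, which cancels the [+ 1] of
   [dual]. *)
have ce : (fun k => \int[leb]_x expR (- l1norm x + h k x)) @ \oo --> (1 : R).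
  rewrite -(Rint_dens ac).
  have := @Rint_dominated _ _ _ leb (fun k x => expR (- l1norm x + h k x)) (dens mu)
    (fun x => weight x + dens mu x).
  case=> //.
  - move=> k; apply: measurable_expR_comp; apply: measurable_funD => //.
    by apply: measurableT_comp => //; exact: measurable_l1norm.
  - by apply: L1D; [exact: weight_L1|exact: dens_L1].
  - apply: aeW => x; have [kx|] := ltP 0 (dens mu x).
      rewrite -[X in _ --> X](lnK (_ : dens mu x \is Num.pos)) ?posrE//.
      apply: (@continuous_cvg _ _ _ _ _ _ expR); first exact: continuous_expR.
      rewrite (_ : ln _ = - l1norm x + u x); last by rewrite /u; lra.
      by apply: cvgD; [exact: cvg_cst|exact: hcv].
    move=> kx; have kx0 : dens mu x = 0 by apply/eqP; rewrite eq_le kx k0.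
    rewrite kx0; rewrite (_ : (fun k => _) = fun k : nat => weight x * (expR (-1)) ^+ k).
      by rewrite -(mulr0 (weight x)); apply: cvgMr; apply: cvg_expr;
        rewrite ger0_norm ?expR_ge0// expR_lt1 oppr_lt0.
    apply/funext => k; rewrite /h kx0 ltxx expRD /weight; congr (_ * _).
    by rewrite -expRM_natl mulrN1.
  - move=> k x; rewrite ger0_norm ?expR_ge0// /h; case: ltP => kx.
      rewrite (_ : - l1norm x + _ = Num.max (- l1norm x - k%:R) (- l1norm x + Num.min k%:R (u x))); last by rewrite addr_maxr.
      rewrite maxEle; case: ifP => _.
        apply: (@le_trans _ _ (dens mu x)); last by rewrite lerDr expR_ge0.
        rewrite -[leRHS]lnK ?posrE// ler_expR.
        have : Num.min k%:R (u x) <= u x by rewrite ge_min lexx orbT.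
        by rewrite /u; lra.
      apply: (@le_trans _ _ (weight x)); last by rewrite lerDl.
      by rewrite /weight ler_expR gerDl oppr_le0.
    apply: (@le_trans _ _ (weight x)); last by rewrite lerDl.
    by rewrite /weight ler_expR gerDl oppr_le0.
have L1h k : mu.-L1 (h k).
  by apply: (@L1_le _ _ _ mu _ (fun _ => k%:R)) => //; exact: L1_cst.
have mF k : measurable_fun setT (fun x => Num.max 0 (h k x + w x)).
  apply: measurable_maxr => //; apply: measurable_funD => //.
  exact: L1_measurable w1.
have aF k : {ae mu, forall x, h k x + w x = Num.max 0 (h k x + w x)}.
  by apply: ae_imp (density_dens ac) => x [_ kx]; rewrite max_r// hw.
have aF_lim : {ae mu, forall x, u x + w x = Num.max 0 (u x + w x)}.
  apply: ae_imp (density_dens ac) => x [_ kx]; rewrite max_r//.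
  have c1 : (fun k => h k x + w x) @ \oo --> u x + w x.
    by apply: cvgD; [exact: hcv|exact: cvg_cst].
  apply: (cvgr_ge_bound c1).
  by apply: nearW => k; exact: hw.
(* The exponential integrals are within e of 1 only from some rank N on, so the sequence is shifted
   by N. *)
have fatou e : 0 < e -> mu.-L1 (fun x => Num.max 0 (u x + w x)) /\
    \int[mu]_x Num.max 0 (u x + w x) <= c + e + \int[mu]_x l1norm x + \int[mu]_x w x.
  move=> e0.
  have [N _ hN] : \forall k \near \oo, \int[leb]_x expR (- l1norm x + h k x) <= 1 + e.
    by apply: (cvgr_le _ ce); rewrite ltrDl.
  apply: (@Rint_fatou _ _ _ mu (fun k x => Num.max 0 (h (k + N)%N x + w x))).
  - by move=> k; exact: ae_eq_L1 (mF _) (L1D (L1h _) w1) (aF _).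
  - by apply: measurable_maxr => //; apply: measurable_funD => //; exact: L1_measurable w1.
  - by move=> k x; rewrite le_max lexx.
  - by move=> x; rewrite le_max lexx.
  - apply: ae_imp (density_dens ac) => x [_ kx]; apply: cvg_max2; first exact: cvg_cst.
    apply: cvgD; last exact: cvg_cst.
    by apply: (@cvg_subseq R (fun k => h k x) (u x) (fun k => (k + N)%N)); [move=> k; rewrite leq_addr|exact: hcv].
  - move=> k; rewrite -(ae_eq_Rint _ (mF _) (aF _)); last first.
      by apply: measurable_funD => //; exact: L1_measurable w1.
    rewrite RintD// lerD2r.
    have := dual_le_bounded (mh (k + N)%N) (hk (k + N)%N); rewrite /dual.
    rewrite RintD//; last exact: L1N (l1norm_L1 mu).
    rewrite RintN; last exact: l1norm_L1.
    have := hN (k + N)%N (leq_addl _ _).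
    move: (\int[leb]_x _) (\int[mu]_x _) (\int[mu]_x _) => p q r; lra.
have [LF _] := fatou 1 ltr01.
have mln : measurable_fun setT (fun x => ln (density mu x)).
  apply: measurableT_comp; first exact: measurable_ln.
  exact: measurable_density.
have LG : mu.-L1 (fun x => Num.max 0 (u x + w x) - w x - l1norm x).
  by apply: L1B; [exact: L1B|exact: l1norm_L1].
have aG : {ae mu, forall x, Num.max 0 (u x + w x) - w x - l1norm x = ln (density mu x)}.
  apply: ae_imp2 (aF_lim) (density_dens ac) => x h1 [-> _].
  by rewrite -h1 /u; lra.
have LN := ae_eq_L1 mln LG aG.
rewrite -RintegralE// lee_fin -(ae_eq_Rint (L1_measurable LG) mln aG).
rewrite RintB//; [|exact: L1B|exact: l1norm_L1].
rewrite RintB//; apply/ler_addgt0Pr => e e0; have [_] := fatou e e0.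
move: (\int[mu]_x _) (\int[mu]_x _) (\int[mu]_x _) => p q r; lra.
Qed.

End converse.
End duality.

Section uniform_box.
Context (R : realType) (n : nat) (h : R).
Hypothesis h0 : 0 < h.
Local Notation E := 'rV[R]_n.
Local Notation leb := (lebesgue_rV R n).

Definition sbox : set E := box (fun _ => `[0, h]%classic).

Lemma measurable_sbox : measurable sbox.
Proof. exact: measurable_box. Qed.

Lemma invh_ge0 : 0 <= h ^- n.
Proof. by rewrite invr_ge0 exprn_ge0// ltW. Qed.

Definition ubox_measure : {measure set E -> \bar R} :=
  mscale (NngNum invh_ge0) (mrestr leb measurable_sbox).

Lemma lebesgue_sbox : leb sbox = (h ^+ n)%:E.
Proof.
rewrite lebesgue_boxE//.
under eq_bigr do rewrite lebesgue_measure_itv/= lte_fin h0 oppr0 adde0.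
by rewrite prodEFin prodr_const card_ord.
Qed.

Lemma ubox_measureE A : ubox_measure A = ((h ^- n)%:E * leb (A `&` sbox))%E.
Proof. by []. Qed.

Lemma ubox_setT : ubox_measure setT = 1%E.
Proof.
rewrite ubox_measureE setTI lebesgue_sbox -EFinM mulVf//.
by rewrite expf_neq0// gt_eqF.
Qed.

Definition ubox_fun : set E -> \bar R := ubox_measure.
HB.instance Definition _ := Measure.on ubox_fun.
HB.instance Definition _ := Measure_isProbability.Build _ _ _ ubox_fun ubox_setT.
Definition ubox : probability E R := ubox_fun.

Lemma uboxE A : ubox A = ((h ^- n)%:E * leb (A `&` sbox))%E.
Proof. by []. Qed.

Lemma ubox_boxE (A : 'I_n -> set R) : (forall i, measurable (A i)) ->
  ubox (box A) = ((h ^- n)%:E *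
    \prod_(i < n) (@lebesgue_measure R) (A i `&` `[0%R, h]%classic))%E.
Proof.
move=> mA; rewrite uboxE.
rewrite (_ : box A `&` sbox = box (fun i => A i `&` `[0, h]%classic)).
  by rewrite lebesgue_boxE// => i; exact: measurableI.
apply/seteqP; split => x; first by move=> [xA xs] i; split; [exact: xA|exact: xs].
by move=> xA; split=> i; have [] := xA i.
Qed.

Lemma ubox_integral_le (g : E -> \bar R) : measurable_fun setT g ->
  (forall x, 0 <= g x)%E -> (\int[ubox]_x g x <= (h ^- n)%:E * \int[leb]_x g x)%E.
Proof.
move=> mg g0; have := @ge0_integral_mscale _ _ _ (mrestr leb measurable_sbox) setT measurableT (NngNum invh_ge0) g mg (fun x _ => g0 x).
move=> e; apply: (@le_trans _ _ ((h ^- n)%:E * \int[mrestr leb measurable_sbox]_x g x)%E).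
  by rewrite le_eqVlt; apply/orP; left; apply/eqP; exact: e.
apply: lee_wpmul2l; first by rewrite lee_fin invh_ge0.
apply: ge0_le_measure_integral => // A mA.
apply: le_measure; rewrite ?inE//.
by apply: measurableI => //; exact: measurable_sbox.
Qed.

Lemma ubox_ae : {ae ubox, forall x, sbox x}.
Proof.
exists (~` sbox); split => //; first by apply: measurableC; exact: measurable_sbox.
by rewrite uboxE setICl measure0 mule0.
Qed.

End uniform_box.

Lemma continuous_oppf (R : realType) (T : topologicalType) (f : T -> R) :
  continuous f -> continuous (fun x => - f x).
Proof. by move=> cf x; apply: cvgN; exact: cf. Qed.

Lemma continuous_addf (R : realType) (T : topologicalType) (f g : T -> R) :
  continuous f -> continuous g -> continuous (fun x => f x + g x).
Proof. by move=> cf cg x; apply: cvgD; [exact: cf|exact: cg]. Qed.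

Section entropy_consequences.
Context (R : realType) (d : nat).
Local Notation E := 'rV[R]_d.
Local Notation leb := (lebesgue_rV R d).
Implicit Types mu nu : P2 R d.

(** The duality describes the entropy by integrals alone, so it does not see which Radon-Nikodym
    derivative has been chosen. *)
Lemma entropy_same mu nu : same_law mu nu -> entropy mu = entropy nu.
Proof.
suff le mu' nu' : same_law mu' nu' -> (entropy nu' <= entropy mu')%E.
  move=> h; apply/eqP; rewrite eq_le !le//.
  by move=> A mA; exact/esym/(h A mA).
move=> h; have := entropy_ge_M2 mu'.
case: (entropy mu') (@entropy_ge _ _ mu') => [c ge _|_ _|//]; last exact: leey.
apply: entropy_le => g cg [M gM].
have mg := continuous_measurable_rV cg.
have -> : dual nu' (fun x => - l1norm x + g x) = dual mu' (fun x => - l1norm x + g x).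
  congr (_ + _ - _); apply: (image_law_Rint (f := id) _ h) => //.
  apply: measurable_funD => //; apply: measurableT_comp => //; exact: measurable_l1norm.
rewrite -lee_fin; apply: ge; [exact: pot_L1 gM|exact: expR_pot_L1 gM].
Qed.

Lemma l1norm_growth (g : E -> R) (M : R) : (forall x, `|g x| <= M) -> forall x,
  (- l1norm x + g x) ^+ 2 <= (2 * d%:R ^+ 2 + 2 * M ^+ 2) * (1 + sqnorm x).
Proof.
move=> gM x; have := gM x; have := l1norm_le_enorm x; have := l1norm_ge0 x.
rewrite -sqr_enorm; have := enorm_ge0 x; move: (enorm x) (l1norm x) (g x) => a b c a0 b0 ba cM.
have M0 : 0 <= M by exact: le_trans cM.
have c2 : c ^+ 2 <= M ^+ 2 by rewrite -(real_normK (num_real c)) ler_pXn2r ?nnegrE.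
have b2 : b ^+ 2 <= (d%:R * a) ^+ 2 by rewrite ler_pXn2r ?nnegrE ?mulr_ge0.
have e1 : (- b + c) ^+ 2 <= 2 * b ^+ 2 + 2 * c ^+ 2 by have := sqr_ge0 (b + c); nra.
apply: (le_trans e1); rewrite exprMn in b2.
have := sqr_ge0 a; have := sqr_ge0 M; have := sqr_ge0 (d%:R : R).
move: (a ^+ 2) (M ^+ 2) (d%:R ^+ 2) b2 c2 => p q r b2 c2 r0 q0 p0.
have := mulr_ge0 q0 p0; nra.
Qed.

(** A supremum of functionals [dual], each continuous along [plan_cvg] because its potential has
    linear growth. *)
Lemma entropy_lsc (pi_ : nat -> plan R d) pi (c : R) : plan_cvg pi_ pi ->
  (forall k, (entropy (marg1 (pi_ k)) <= c%:E)%E) -> (entropy (marg1 pi) <= c%:E)%E.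
Proof.
move=> pic le; apply: entropy_le => g cg [M gM].
have mg := continuous_measurable_rV cg.
have c0 : continuous (fun x : E => - l1norm x + g x).
  by apply: continuous_addf => //; apply: continuous_oppf; exact: continuous_l1norm.
have := plan_cvg_growth pic c0 _ (l1norm_growth gM).
have -> : 0 <= 2 * d%:R ^+ 2 + 2 * M ^+ 2 :> R.
  by rewrite addr_ge0// mulr_ge0// sqr_ge0.
move=> /(_ isT) c1.
have c3 : (fun k => dual (marg1 (pi_ k)) (fun x => - l1norm x + g x)) @ \oo -->
    dual (marg1 pi) (fun x => - l1norm x + g x).
  by apply: cvgB; [apply: cvgD => //; exact: cvg_cst|exact: cvg_cst].
apply: (cvgr_le_bound c3).
apply: nearW => k; rewrite -lee_fin; apply: le_trans (le k).
by apply: entropy_ge; [exact: pot_L1 gM|exact: expR_pot_L1 gM].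
Qed.

Lemma entropy_mollify mu (e : R) : 0 < e -> exists nu (c : R),
  [/\ (entropy nu <= c%:E)%E, W1 mu nu <= e & W2 mu nu <= e].
Proof.
(* convolution with the uniform law on a small cube *)
move=> e0; pose h := e / (1 + d%:R).
have d1 : 0 < 1 + d%:R :> R by rewrite ltr_pwDl.
have h0 : 0 < h by rewrite divr_gt0.
pose P : probability (E * E)%type R := (mu \x ubox d h0)%E.
have mX : measurable_fun setT (fun z : E * E => z.1) by exact: measurable_fst.
have mY : measurable_fun setT (fun z : E * E => z.1 + z.2).
  by apply: measurable_addv; [exact: measurable_fst|exact: measurable_snd].
have lX : image_law (fun z : E * E => z.1) P mu.
  move=> A mA; rewrite /pushforward /P /=.
  rewrite (_ : _ @^-1` A = A `*` setT); last by apply/seteqP; split => z /=; tauto.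
  by rewrite product_measure1E// [X in (_ * X)%E]probability_setT mule1.
have lV : image_law (fun z : E * E => z.2) P (ubox d h0).
  move=> A mA; rewrite /pushforward /P /=.
  rewrite (_ : _ @^-1` A = setT `*` A); last by apply/seteqP; split => z /=; tauto.
  by rewrite product_measure1E// [X in (X * _)%E]probability_setT mul1e.
have en : {ae P, forall z : E * E, enorm z.2 <= e}.
  have mS : measurable [set v : E | enorm v <= e].
    rewrite -[X in measurable X]setTI; apply: (@measurable_fun_le _ _ _ _ (fun v : E => enorm v) (fun=> e)) => //.
    exact: measurable_enorm.
  apply: (image_law_ae measurable_snd lV mS).1.
  apply: ae_imp (ubox_ae d h0) => v vs.
  apply: le_trans (_ : l1norm v <= _); last first.
    apply: (@le_trans _ _ (\sum_(i < d) h)).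
      by apply: ler_sum => i _; have := vs i; rewrite /= in_itv/= => /andP[v0 v1]; rewrite ger0_norm.
    rewrite sumr_const card_ord -mulr_natr /h mulrAC -mulrA ler_piMr// ?(ltW e0)//.
    by rewrite ler_pdivrMr// mul1r lerDr.
  rewrite -(ler_pXn2r (_ : (0 < 2)%N)) ?nnegrE ?enorm_ge0 ?l1norm_ge0// sqr_enorm.
  rewrite /sqnorm /dot /l1norm [leRHS]expr2 mulr_suml ler_sum// => i _.
  rewrite -expr2 -(real_normK (num_real _)) expr2 ler_wpM2l// (bigD1 i)//= lerDl sumr_ge0//.
have mS1 : measurable_fun setT (fun z : E * E => sqnorm z.1) by exact: measurable_sqn.
have mS2 : measurable_fun setT (fun z : E * E => sqnorm z.2).
  by apply: measurable_sqn; exact: measurable_snd.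
have sn : {ae P, forall z : E * E, sqnorm z.2 <= e ^+ 2}.
  apply: ae_imp en => z ze; rewrite -sqr_enorm ler_pXn2r ?nnegrE ?enorm_ge0//.
  exact: ltW.
have iX : P.-L1 (fun z : E * E => sqnorm z.1).
  exact: (image_law_L1 mX lX (@measurable_sqnorm R d)).1 (P2_L1 mu).
have ae_bound (g : E * E -> R) c : measurable_fun setT g -> (forall z, 0 <= g z) ->
    {ae P, forall z, g z <= c} -> P.-L1 g /\ \int[P]_z g z <= c.
  move=> mg g0 gc; have c1 := @L1_cst _ _ _ P c.
  have mm : measurable_fun setT (fun z => Num.min (g z) `|c|).
    by apply: measurable_minr => //; exact: measurable_cst.
  have L : P.-L1 (fun z => Num.min (g z) `|c|).
    apply: (@L1_le _ _ _ P _ (fun=> `|c|)) => //; last exact: L1_cst.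
    by move=> z; rewrite ger0_norm ?ge_min ?lexx ?orbT// le_min g0 normr_ge0.
  have ae : {ae P, forall z, Num.min (g z) `|c| = g z}.
    apply: ae_imp gc => z gz; rewrite min_l//.
    by rewrite (le_trans gz)// ler_norm.
  have Lg := ae_eq_L1 mg L ae; split => //.
  rewrite -[leRHS](@Rint_cst _ _ _ P c); exact: ae_le_Rint.
have [i2 b2] := ae_bound _ _ mS2 (fun z => sqnorm_ge0 _) sn.
have [i1 b1] := ae_bound _ _ (measurable_enorm measurable_snd) (fun z => enorm_ge0 _) en.
have iY : P.-L1 (fun z : E * E => sqnorm (z.1 + z.2)).
  apply: (@L1_le _ _ _ P _ (fun z => 2 * (sqnorm z.1 + sqnorm z.2))).
  - exact: measurable_sqn.
  - by move=> z; rewrite ger0_norm ?sqnorm_ge0// sqnormD.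
  - by apply: L1Z; exact: L1D.
pose nu := P2_of mY iY.
have lY : image_law (fun z : E * E => z.1 + z.2) P nu by exact: P2_of_law.
have eN (z : E * E) : z.1 - (z.1 + z.2) = - z.2 by rewrite opprD addNKr.
(* The convolution has density at most h^(-d), whose logarithm therefore bounds its entropy; the
   bound is obtained through the duality. *)
exists nu, (ln (h ^- d)); split.
- apply: entropy_le => g cg [M gM]; rewrite /dual.
  pose G x := - l1norm x + g x.
  have mg := continuous_measurable_rV cg.
  have mG : measurable_fun setT G.
    by apply: measurable_funD => //; apply: measurableT_comp => //; exact: measurable_l1norm.
  have eG : leb.-L1 (fun x => expR (G x)) by exact: expR_pot_L1 gM.
  have hd0 : 0 < h ^- d by rewrite invr_gt0 exprn_gt0.
  have mex : measurable_fun setT (fun x => (expR (G x))%:E).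
    by apply/measurable_EFinP; exact: measurable_expR_comp.
  have le1 : (\int[nu]_x (expR (G x))%:E <= (h ^- d * \int[leb]_x expR (G x))%:E)%E.
    rewrite (image_law_ge0_integral mY lY mex) => [|y]; last by rewrite lee_fin expR_ge0.
    rewrite /P (@fubini_tonelli1 _ _ _ _ _ mu (ubox d h0) (fun z : E * E => (expR (G (z.1 + z.2)))%:E)); last 2 first.
    - by apply: measurableT_comp mex mY.
    - by move=> z; rewrite lee_fin expR_ge0.
    rewrite /fubini_F; apply: (@le_trans _ _ (\int[mu]_x (h ^- d * \int[leb]_x expR (G x))%:E)%E).
      apply: ge0_le_integral => //.
      + by move=> x _; apply: integral_ge0 => y _; rewrite lee_fin expR_ge0.
      + apply: (@measurable_fun_fubini_tonelli_F _ _ _ _ _ (ubox d h0) (fun z : E * E => (expR (G (z.1 + z.2)))%:E)); last by move=> z; rewrite lee_fin expR_ge0.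
        by apply: measurableT_comp mex mY.
      + move=> x _ /=; have mx : measurable_fun setT (fun y : E => (expR (G (x + y)))%:E).
          apply: measurableT_comp mex _; apply: measurable_addv => //; exact: measurable_cst.
        apply: (le_trans (ubox_integral_le h0 mx _)) => [y|]; first by rewrite lee_fin expR_ge0.
        rewrite EFinM RintegralE//.
        apply: lee_wpmul2l; first by rewrite lee_fin ltW.
        have mxx : measurable_fun setT (fun y : E => y + x).
          by apply: measurable_addv => //; exact: measurable_cst.
        rewrite le_eqVlt; apply/orP; left; apply/eqP.
        transitivity (\int[pushforward leb (fun y : E => (y + x)%R)]_y (expR (G y))%:E)%E.
          rewrite ge0_integral_pushforward//; first by apply: eq_integral => y _ /=; rewrite addrC.
        by apply: eq_measure_integral => A mA _; exact: lebesgue_rVD.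
    by rewrite integral_cst//= [X in (_ * X)%E]probability_setT mule1.
  have L : nu.-L1 (fun x => expR (G x)).
    apply: L1_lty => //; first exact: measurable_expR_comp.
    by apply: le_lt_trans le1 _; rewrite ltry.
  have le2 : \int[nu]_x expR (G x) <= h ^- d * \int[leb]_x expR (G x).
    by rewrite -lee_fin RintegralE.
  (* The tangent to the exponential at ln (h^(-d)), evaluated at [G x]. *)
  have : \int[nu]_x G x <= \int[nu]_x (h ^+ d * expR (G x) + (ln (h ^- d) - 1)).
    apply: le_Rint; first exact: pot_L1 gM.
      by apply: L1D; [exact: (L1Z _ L)|exact: L1_cst].
    move=> x; have := expR_ge1Dx (G x - ln (h ^- d)).
    by rewrite expRD expRN lnK ?posrE// invrK mulrC; lra.
  rewrite [X in _ <= X -> _]RintD; [|exact: (L1Z _ L)|exact: L1_cst].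
  rewrite Rint_cst RintZ// => le3.
  have le4 : h ^+ d * \int[nu]_x expR (G x) <= \int[leb]_x expR (G x).
    by rewrite -ler_pdivlMl ?exprn_gt0.
  by move: le3 le4; rewrite /G; clear; lra.
- apply: le_trans (W1_le mX mY lX lY _) _.
    by under eq_fun do rewrite eN enormN.
  by under eq_Rintegral do rewrite eN enormN.
- rewrite -(ler_pXn2r (_ : (0 < 2)%N)) ?nnegrE ?W2_ge0 ?(ltW e0)//.
  apply: le_trans (sqr_W2_le mX mY lX lY _) _.
    by under eq_fun do rewrite eN sqnormN.
  by under eq_Rintegral do rewrite eN sqnormN.
Qed.

End entropy_consequences.

(** * Scores of laws of finite entropy *)

Section directional.
Context (R : realType).
Local Notation leb1 := (@lebesgue_measure R).

(** Regularity is required in the single direction i, so that both the coordinates and the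
    difference quotients of Moreau envelopes qualify, although the latter have merely Lipschitz
    gradients. *)
Record dirC1 d (i : 'I_d) (f f' : 'rV[R]_d -> R) : Prop := DirC1 {
  dirC1_cont : continuous f;
  dirC1_cont' : continuous f';
  dirC1_derive : forall x, is_derive x (delta_mx ord0 i : 'rV[R]_d) (f : _ -> R^o) (f' x);
  dirC1_bound : exists K, forall x, `|f' x| <= K;
  dirC1_growth : exists2 A, 0 <= A & forall x, f x ^+ 2 <= A * (1 + sqnorm x) }.

Lemma is_derive_ins n (i : 'I_n.+1) (f f' : 'rV[R]_n.+1 -> R) :
  (forall x, is_derive x (delta_mx ord0 i : 'rV[R]_n.+1) (f : _ -> R^o) (f' x)) ->
  forall y (r : R), is_derive r (1 : R) (fun r => f (ins i (r, y)) : R^o) (f' (ins i (r, y))).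
Proof.
move=> df y r; have [c dE] := df (ins i (r, y)).
have e : (fun h : R => h^-1 *: (((fun r => f (ins i (r, y)) : R^o) \o shift r) (h *: 1) - f (ins i (r, y)))) =
   (fun h => h^-1 *: (((f : _ -> R^o) \o shift (ins i (r, y))) (h *: delta_mx ord0 i) - f (ins i (r, y)))).
  apply/funext => h /=; rewrite [h *: 1]mulr1 (addrC h) insD.
  by rewrite [ins i _ + _]addrC.
split; first by rewrite /derivable e.
by rewrite /derive e.
Qed.

Lemma continuous_ins1 n (i : 'I_n.+1) y : continuous (fun r : R => ins i (r, y) : 'rV[R]_n.+1).
Proof.
apply: continuous_rV => k; under eq_fun do rewrite mxE /=.
case: unliftP => [j _|_] /=; first by move=> r; exact: cvg_cst.
by move=> r; exact: cvg_id.
Qed.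

(** On each line of direction i the map is r + eta f, whose slope is at least 1 - |eta| K > 0; the
    one-dimensional substitution is then integrated over the lines. *)
Lemma substitution_dir d (i : 'I_d) (f f' G : 'rV[R]_d -> R) (K eta : R) :
  dirC1 i f f' -> (forall x, `|f' x| <= K) -> `|eta| * K < 1 ->
  continuous G -> (forall x, 0 <= G x) ->
  (\int[lebesgue_rV R d]_x (G x)%:E =
   \int[lebesgue_rV R d]_x (G (x + (eta * f x) *: delta_mx ord0 i) * (1 + eta * f' x))%:E)%E.
Proof.
case: d i f f' G => [|n] i f f' G; first by case: i.
move=> [cf cf' df _ _] fK eK cG G0.
have j0 x : 0 <= 1 + eta * f' x.
  rewrite -lerBlDl sub0r; have := lerN2 1 (- (eta * f' x)).
  have : `|eta * f' x| <= 1.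
    by rewrite normrM (le_trans _ (ltW eK))// ler_wpM2l.
  by rewrite ler_norml => /andP[].
have mG := continuous_measurable_rV cG.
have mf := continuous_measurable_rV cf.
have mf' := continuous_measurable_rV cf'.
have mT : measurable_fun setT (fun x : 'rV[R]_n.+1 => x + (eta * f x) *: delta_mx ord0 i).
  apply: measurable_addv => //; apply: measurable_scalerv; last exact: measurable_cst.
  by apply: measurable_funM => //; exact: measurable_cst.
rewrite !(integral_ins i); first last.
- by move=> x; rewrite lee_fin.
- exact/measurable_EFinP.
- by move=> x; rewrite lee_fin mulr_ge0.
- apply/measurable_EFinP; apply: measurable_funM; first exact: measurableT_comp.
  by apply: measurable_funD; [exact: measurable_cst|apply: measurable_funM => //; exact: measurable_cst].
apply: eq_integral => y _.
pose g r := ins i (r, y) : 'rV[R]_n.+1.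
pose F (r : R) : R := r + eta * f (g r).
have dF (r : R) : is_derive r (1 : R) F (1 + eta * f' (g r)).
  have h1 := is_derive_id r (1 : R).
  have h2 := is_deriveZ eta (is_derive_ins df y r).
  exact: (is_deriveD h1 h2).
have dF' : derive1 F = fun r => 1 + eta * f' (g r).
  by apply/funext => r; rewrite derive1E; exact: derive_val.
have c0 : 0 < 1 - `|eta| * K by rewrite subr_gt0.
have cg : continuous g by exact: continuous_ins1.
rewrite (@ge0_substitution _ F (fun r => G (g r)) _ c0).
- apply: eq_integral => r _; congr (_ %:E); rewrite dF'; congr (G _ * _).
  by rewrite /F /g insD.
- move=> x y0 xy.
  have wF : {within `[x, y0], continuous F}.
    apply: continuous_subspaceT => z; apply/differentiable_continuous/derivable1_diffP.
    by have [] := dF z.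
  have [c _ ->] := MVT xy (fun z _ => dF z) wF.
  rewrite ler_wpM2r ?subr_ge0 ?(ltW xy)// lerD2l -lerN2 opprK.
  by rewrite (le_trans (ler_norm _))// normrN normrM ler_wpM2l.
- by move=> x; have [] := dF x.
- rewrite dF' => r; apply: cvgD; first exact: cvg_cst.
  by apply: cvgMr; apply: (continuous_comp (cg r)); exact: cf'.
- by move=> r; apply: (continuous_comp (cg r)); exact: cG.
- by move=> r; exact: G0.
Qed.

End directional.

Section perturbation.
Context (R : realType) (d : nat).
Local Notation E := 'rV[R]_d.
Local Notation leb := (lebesgue_rV R d).
Variables (mu nu : P2 R d) (i : 'I_d) (f f' : E -> R) (K eta c : R).
Hypotheses (df : dirC1 i f f') (fK : forall x, `|f' x| <= K) (eK : `|eta| * K < 1).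
Hypothesis fnu : image_law (fun x : E => x + (eta * f x) *: delta_mx ord0 i) mu nu.
Hypothesis entc : (entropy mu <= c%:E)%E.

(** A potential [G] for nu is pulled back to the potential [g] for mu: by the change of variables
    both have the same exponential integral, and the Jacobian accounts for the logarithm. *)
Lemma entropy_perturb : (entropy nu <= (c - \int[mu]_x ln (1 + eta * f' x))%:E)%E.
Proof.
have [cf cf' _ _ _] := df.
have mf := continuous_measurable_rV cf.
have mf' := continuous_measurable_rV cf'.
have mT : measurable_fun setT (fun x : E => x + (eta * f x) *: delta_mx ord0 i).
  apply: measurable_addv => //; apply: measurable_scalerv; last exact: measurable_cst.
  by apply: measurable_funM => //; exact: measurable_cst.
have c0 : 0 < 1 - `|eta| * K by rewrite subr_gt0.
have je x : `|eta * f' x| <= `|eta| * K by rewrite normrM ler_wpM2l.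
have j0 x : 1 - `|eta| * K <= 1 + eta * f' x.
  by rewrite lerD2l; have := je x; rewrite ler_norml => /andP[].
have jp x : 0 < 1 + eta * f' x by exact: lt_le_trans c0 (j0 x).
have mj : measurable_fun setT (fun x => ln (1 + eta * f' x)).
  apply: measurableT_comp; first exact: measurable_ln.
  by apply: measurable_funD; [exact: measurable_cst|apply: measurable_funM => //; exact: measurable_cst].
have jL : mu.-L1 (fun x => ln (1 + eta * f' x)).
  apply: (@L1_le _ _ _ mu _ (fun=> Num.max `|ln (1 - `|eta| * K)| `|ln (1 + `|eta| * K)|)) => //; last exact: L1_cst.
  move=> x; have h1 : ln (1 - `|eta| * K) <= ln (1 + eta * f' x) by rewrite ler_ln ?posrE.
  have h2 : ln (1 + eta * f' x) <= ln (1 + `|eta| * K).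
    rewrite ler_ln ?posrE//; first by rewrite lerD2l (le_trans (ler_norm _)).
    by rewrite ltr_pwDl// mulr_ge0// (le_trans _ (fK x)).
  rewrite le_max; have [p0|p0] := leP 0 (ln (1 + eta * f' x)).
    by apply/orP; right; rewrite ger0_norm// (le_trans h2)// ler_norm.
  apply/orP; left; rewrite ltr0_norm// -normrN (le_trans _ (ler_norm _))// lerN2//.
apply: entropy_le => h ch [M hM]; rewrite /dual.
pose G x := - l1norm x + h x.
have mh := continuous_measurable_rV ch.
have cG : continuous G.
  by apply: continuous_addf => //; apply: continuous_oppf; exact: continuous_l1norm.
have mG := continuous_measurable_rV cG.
have eG : leb.-L1 (fun x => expR (G x)) by exact: expR_pot_L1 hM.
pose g x := G (x + (eta * f x) *: delta_mx ord0 i) + ln (1 + eta * f' x).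
have GL : mu.-L1 (fun x => G (x + (eta * f x) *: delta_mx ord0 i)).
  exact: (image_law_L1 mT fnu mG).1 (pot_L1 nu mh hM).
have gL : mu.-L1 g by exact: L1D.
have mg := L1_measurable gL.
have ecG : continuous (fun x => expR (G x)).
  by move=> x; apply: (continuous_comp (cG x)); exact: continuous_expR.
have sub := substitution_dir df fK eK ecG (fun x => expR_ge0 _).
have ge x : expR (G (x + (eta * f x) *: delta_mx ord0 i)) * (1 + eta * f' x) = expR (g x).
  by rewrite /g [in RHS]expRD lnK// posrE.
have sub' : (\int[leb]_x (expR (G x))%:E = \int[leb]_x (expR (g x))%:E)%E.
  by rewrite sub; apply: eq_integral => x _; rewrite ge.
have egL : leb.-L1 (fun x => expR (g x)).
  apply: L1_lty; [exact: measurable_expR_comp|by move=> x; exact: expR_ge0|].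
  by rewrite -sub' -RintegralE// ltry.
have := entropy_ge gL egL; move=> /le_trans/(_ entc); rewrite lee_fin /dual.
rewrite /g RintD// -/g.
rewrite -(image_law_Rint mT fnu mG).
rewrite (_ : \int[leb]_x expR (g x) = \int[leb]_x expR (G x)); last by rewrite /Rintegral sub'.
by rewrite /G; lra.
Qed.

End perturbation.

(** * Square-integrable functions and Riesz representation *)

Section L2.
Context d (T : measurableType d) (R : realType) (P : probability T R).

Definition L2 (f : T -> R) : Prop :=
  measurable_fun setT f /\ P.-L1 (fun x => f x ^+ 2).

Lemma L2_L1 f : L2 f -> P.-L1 f.
Proof. by move=> [mf f2]; exact: L1_of_sqr. Qed.

Lemma L2_mul f g : L2 f -> L2 g -> P.-L1 (fun x => f x * g x).
Proof.
move=> [mf f2] [mg g2]; apply: (@L1_le _ _ _ P _ (fun x => f x ^+ 2 + g x ^+ 2)).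
- exact: measurable_funM.
- move=> x; rewrite normrM -(real_normK (num_real (f x))) -(real_normK (num_real (g x))).
  by have := sqr_ge0 (`|f x| - `|g x|); have := normr_ge0 (f x); have := normr_ge0 (g x); nra.
- exact: L1D.
Qed.

Lemma L2D f g : L2 f -> L2 g -> L2 (fun x => f x + g x).
Proof.
move=> Lf Lg; have fg := L2_mul Lf Lg; case: Lf Lg => [mf f2] [mg g2].
split; first exact: measurable_funD.
rewrite (_ : (fun x => _) = fun x => f x ^+ 2 + 2 * (f x * g x) + g x ^+ 2).
  by apply: L1D => //; apply: L1D => //; exact: L1Z.
by apply/funext => x; ring.
Qed.

Lemma L2Z k f : L2 f -> L2 (fun x => k * f x).
Proof.
move=> [mf f2]; split; first by apply: measurable_funM => //; exact: measurable_cst.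
rewrite (_ : (fun x => _) = fun x => k ^+ 2 * f x ^+ 2); first exact: L1Z.
by apply/funext => x; ring.
Qed.

Lemma L2B f g : L2 f -> L2 g -> L2 (fun x => f x - g x).
Proof.
move=> Lf Lg; rewrite (_ : (fun x => _) = fun x => f x + (-1) * g x).
  by apply: L2D => //; exact: L2Z.
by apply/funext => x; ring.
Qed.

Lemma L2_bounded (f : T -> R) (M : R) : measurable_fun setT f -> (forall x, `|f x| <= M) -> L2 f.
Proof.
move=> mf fM; split=> //; apply: (@L1_le _ _ _ P _ (fun=> M ^+ 2)); last exact: L1_cst.
  exact: measurable_funX.
by move=> x; rewrite normrX ler_pXn2r ?nnegrE// (le_trans _ (fM x)).
Qed.

Lemma cvg_geometric_increments (u : nat -> R) (B : R) :
  (forall k, `|u k.+1 - u k| <= B * 2 ^- k) -> cvgn u.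
Proof.
move=> uB; have -> : u = fun n => u 0%N + series (fun k => u k.+1 - u k) n.
  by apply/funext => n; rewrite seriesEnat/= telescope_sumr// addrC subrK.
apply: is_cvgD; first exact: is_cvg_cst.
apply: normed_cvg; apply: (@series_le_cvg _ _ (geometric B 2^-1)) => //.
- by move=> n; exact: normr_ge0.
- have B0 : 0 <= B by have := le_trans (normr_ge0 _) (uB 0%N); rewrite expr0 divr1.
  by move=> n; rewrite /geometric/= mulr_ge0 ?exprn_ge0.
- by move=> n; rewrite /geometric/= exprVn; exact: uB.
- by apply: is_cvg_geometric_series; rewrite ger0_norm// invf_lt1// ltr1n.
Qed.

(** The Riesz-Fischer argument: convergence holds almost everywhere because the increments are
    geometrically small. *)
Lemma L2_complete (g : nat -> T -> R) : (forall n, L2 (g n)) ->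
  (forall n m, (n <= m)%N -> \int[P]_x (g m x - g n x) ^+ 2 <= 8 ^- n) ->
  exists2 s, L2 s & forall n, \int[P]_x (s x - g n x) ^+ 2 <= 8 ^- n.
Proof.
move=> Lg cg.
(* Squared increments integrate to at most 8^(-k); the factor 4^k leaves the summable 2^(-k), and a
   bound on [D k x] makes the increment of order 2^(-k). *)
pose D k x := 4 ^+ k * (g k.+1 x - g k x) ^+ 2.
pose S n x := \sum_(0 <= k < n) D k x.
have D0 k x : 0 <= D k x by apply: mulr_ge0; [exact: exprn_ge0|exact: sqr_ge0].
have LD k : P.-L1 (D k) by apply: L1Z; have [] := L2B (Lg k.+1) (Lg k).
have LS n : P.-L1 (S n) by apply: L1_sum => k _; exact: LD.
have S0 n x : 0 <= S n x by exact: sumr_ge0.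
have IS n : \int[P]_x S n x <= 2.
  rewrite Rint_sum; last by move=> k _; exact: LD.
  apply: (@le_trans _ _ (\sum_(0 <= k < n) 2 ^- k)).
    apply: ler_sum => k _; rewrite RintZ; last by have [] := L2B (Lg k.+1) (Lg k).
    rewrite -(@ler_pM2l _ (2 ^+ k)) ?exprn_gt0// divff ?expf_neq0// mulrA -exprMn -natrM.
    have := cg k k.+1 (leqnSn _).
    by rewrite -(@ler_pM2l _ (8 ^+ k)) ?exprn_gt0// divff// expf_neq0.
  rewrite (eq_bigr (geometric 1 2^-1)) => [|k _]; last by rewrite /geometric/= mul1r exprVn.
  have -> : \sum_(0 <= k < n) geometric 1 2^-1 k = series (geometric 1 2^-1) n by [].
  rewrite geometric_seriesE; last by rewrite lt_eqF// invf_lt1// ltr1n.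
  have : 0 <= (2^-1 : R) ^+ n by rewrite exprn_ge0.
  have -> : 1 - 2^-1 = 2^-1 :> R by rewrite [X in X - _](splitr 1) mul1r addrK.
  by rewrite /= mul1r invrK mulrBl mul1r lerBlDr lerDl mulr_ge0.
have ae := fatou_frequently LS S0 IS.
have cv : {ae P, forall x, cvgn (g^~ x)}.
  apply: ae_imp ae => x [B hB].
  have SB n : S n x <= B.
    have [m nm Sm] := hB n; apply: le_trans Sm.
    rewrite /S [leRHS](@big_cat_nat _ _ _ n)//= lerDl.
    by apply: sumr_ge0.
  have B0 : 0 <= B by exact: le_trans (SB 0%N).
  apply: (@cvg_geometric_increments _ (Num.sqrt B)) => k.
  have : D k x <= B.
    by apply: le_trans (SB k.+1); rewrite /S big_nat_recr//= lerDr; exact: sumr_ge0.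
  rewrite /D => h.
  rewrite -(ler_pXn2r (_ : (0 < 2)%N)) ?nnegrE ?mulr_ge0 ?sqrtr_ge0 ?invr_ge0 ?exprn_ge0//.
  rewrite real_normK ?num_real// exprMn sqr_sqrtr//.
  have e4 : 4 ^+ k * (2 ^- k) ^+ 2 = 1 :> R.
    rewrite -exprVn -exprM mulnC exprM -exprMn (_ : 4 * 2^-1 ^+ 2 = 1 :> R) ?expr1n//.
    by rewrite expr2; field.
  have := ler_wpM2l (sqr_ge0 (2 ^- k)) h.
  by rewrite mulrA (mulrC (_ ^+ 2)) e4 mul1r mulrC.
pose s x := fine (limn_esup (fun n => (g n x)%:E)).
have ms : measurable_fun setT s.
  apply: measurableT_comp; first exact: fine_measurable.
  by apply: measurable_fun_limn_esup => n; apply/measurable_EFinP; have [] := Lg n.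
have cs : {ae P, forall x, (fun n => g n x) @ \oo --> s x}.
  apply: ae_imp cv => x cx; rewrite /s.
  have c2 : (fun n => (g n x)%:E) @ \oo --> (limn (g^~ x))%:E.
    by apply: cvg_EFin; [exact: nearW|exact: cx].
  rewrite is_cvg_limn_esupE; last by apply/cvg_ex; eexists; exact: c2.
  by rewrite (cvg_lim _ c2).
have F n : P.-L1 (fun x => (s x - g n x) ^+ 2) /\ \int[P]_x (s x - g n x) ^+ 2 <= 8 ^- n.
  apply: (@Rint_fatou _ _ _ P (fun m x => (g (m + n)%N x - g n x) ^+ 2)).
  - by move=> m; have [] := L2B (Lg (m + n)%N) (Lg n).
  - by apply: measurable_funX; apply: measurable_funB => //; have [] := Lg n.
  - by move=> m x; rewrite sqr_ge0.
  - by move=> x; rewrite sqr_ge0.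
  - apply: ae_imp cs => x cx; rewrite expr2.
    have c1 : (fun m => g (m + n)%N x - g n x) @ \oo --> s x - g n x.
      apply: cvgB; last exact: cvg_cst.
      by apply: (@cvg_subseq R (g^~ x) (s x) (fun m => (m + n)%N)) => // m; rewrite leq_addr.
    by under eq_fun do rewrite expr2; exact: cvgM.
  - by move=> m; apply: cg; rewrite leq_addl.
exists s; last by move=> n; have [] := F n.
have L0 : L2 (fun x => s x - g 0%N x).
  by split; [apply: measurable_funB => //; have [] := Lg 0%N|have [] := F 0%N].
have := L2D L0 (Lg 0%N).
by rewrite (_ : (fun x => _) = s)//; apply/funext => x; rewrite subrK.
Qed.

(* The Riesz representation of a functional controlled by a quadratic, found as
   the minimiser of [B |f|^2 - l f]. *)
Lemma riesz (F : set (T -> R)) (l : (T -> R) -> R) (A B : R) : 0 < B ->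
  (forall f, F f -> L2 f) -> F (fun=> 0) ->
  (forall a f g, F f -> F g -> F (fun x => f x + a * g x) /\
     l (fun x => f x + a * g x) = l f + a * l g) ->
  (forall f, F f -> l f <= A + B * \int[P]_x f x ^+ 2) ->
  exists2 s, L2 s & forall f, F f -> l f = \int[P]_x (s x * f x).
Proof.
move=> B0 FL F0 Flin lAB.
pose J f := B * \int[P]_x f x ^+ 2 - l f.
have JA f : F f -> - A <= J f by move=> Ff; rewrite /J; have := lAB _ Ff; lra.
pose Js := [set J f | f in F].
have infJ : has_inf Js.
  split; first by exists (J (fun=> 0)); exists (fun=> 0).
  by exists (- A) => _ [f Ff <-]; exact: JA.
pose m := inf Js.
have mJ f : F f -> m <= J f.
  by move=> Ff; apply: ge_inf; [exact: infJ.2|exists f].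
have expand a f g : F f -> F g -> J (fun x => f x + a * g x) =
    J f + a * (2 * B * \int[P]_x (f x * g x) - l g) + B * a ^+ 2 * \int[P]_x g x ^+ 2.
  move=> Ff Fg; rewrite /J (Flin a _ _ Ff Fg).2.
  have Lf := FL _ Ff; have Lg := FL _ Fg.
  have fg := L2_mul Lf Lg; case: Lf Lg => [_ f2] [_ g2].
  have -> : \int[P]_x (f x + a * g x) ^+ 2 =
      \int[P]_x (f x ^+ 2 + (2 * a * (f x * g x) + a ^+ 2 * g x ^+ 2)).
    by apply: eq_Rintegral => x _; ring.
  rewrite RintD//; last by apply: L1D; exact: L1Z.
  rewrite RintD; [|exact: L1Z|exact: L1Z].
  by rewrite !RintZ//; ring.
(* A minimising sequence; this precision and the parallelogram identity at midpoints give exactly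
   the rate 8^(-n) required by [L2_complete]. *)
have pick n : exists f, F f /\ J f < m + B / 4 * 8 ^- n.
  have e0 : 0 < B / 4 * 8 ^- n by rewrite !mulr_gt0 ?invr_gt0 ?exprn_gt0.
  have [_ [f Ff <-] lt] := inf_adherent e0 infJ.
  by exists f.
pose g n := sval (cid (pick n)).
have gF n : F (g n) by have [] := svalP (cid (pick n)).
have gJ n : J (g n) < m + B / 4 * 8 ^- n by have [] := svalP (cid (pick n)).
have Lg n : L2 (g n) by exact: FL.
have cau n k : (n <= k)%N -> \int[P]_x (g k x - g n x) ^+ 2 <= 8 ^- n.
  move=> nk; have [Fd ld] := Flin (-1) _ _ (gF k) (gF n).
  have Fd' : F (fun x => g k x + (-1) * g n x) by [].
  pose D := \int[P]_x (g k x + (-1) * g n x) ^+ 2.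
  have -> : \int[P]_x (g k x - g n x) ^+ 2 = D.
    by apply: eq_Rintegral => x _; rewrite mulN1r.
  have [Fh lh] := Flin (2^-1) _ _ (gF n) Fd'.
  have h1 := mJ _ Fh; rewrite expand// in h1.
  have h2 : J (g k) = J (fun x => g n x + 1 * (g k x + (-1) * g n x)).
    by congr J; apply/funext => x; ring.
  rewrite expand// -/D in h2; rewrite -/D in h1.
  have := gJ n; have := gJ k.
  have : (8 ^- k : R) <= 8 ^- n.
    by rewrite lef_pV2 ?posrE ?exprn_gt0// ler_eXn2l// ltr1n.
  move: h1 h2; move: (J _) (J _) (_ - _) (8 ^- n) (8 ^- k) => a b c p q.
  move=> h1 h2 pq ka nb.
  have : B * D <= B * p by nra.
  by rewrite ler_pM2l.
have [s Ls sg] := L2_complete Lg cau.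
(* The Euler-Lagrange equation of the minimiser [s]. The functional is not known to be defined at
   [s], so the first variation is taken at [g n] and n is sent to infinity. *)
exists (fun x => 2 * B * s x); first exact: L2Z.
move=> f Ff; have Lf := FL _ Ff.
have eq0 (X Y : R) : (forall a : R, 0 <= a * X + a ^+ 2 * Y) -> X = 0.
  move=> h; apply/eqP; apply/negPn/negP => X0.
  have Y0 : 0 <= Y.
    by have := h 1; have := h (-1); rewrite expr1n sqrrN expr1n; lra.
  have := h (- X / (2 * (1 + Y))).
  have Z0 : 0 < 2 * (1 + Y) by lra.
  have -> : - X / (2 * (1 + Y)) * X + (- X / (2 * (1 + Y))) ^+ 2 * Y =
    - (X ^+ 2) * ((2 + Y) / (2 * (1 + Y)) ^+ 2) by field; lra.
  rewrite mulNr oppr_ge0 leNgt => /negP; apply.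
  have X2 : 0 < X ^+ 2 by rewrite exprn_even_gt0.
  by apply: mulr_gt0 => //; apply: divr_gt0; [lra|exact: exprn_gt0].
have sf := L2_mul Ls Lf.
have -> : \int[P]_x (2 * B * s x * f x) = 2 * B * \int[P]_x (s x * f x).
  by rewrite -RintZ//; apply: eq_Rintegral => x _; ring.
apply/esym/eqP; rewrite -subr_eq0; apply/eqP; apply: (eq0 _ (B * \int[P]_x f x ^+ 2)) => a.
have step n : - (2 * B * `|a| * \int[P]_x `|(s x - g n x) * f x| + B / 4 * 8 ^- n)
    <= a * (2 * B * \int[P]_x (s x * f x) - l f) + a ^+ 2 * (B * \int[P]_x f x ^+ 2).
  have [Fh _] := Flin a _ _ (gF n) Ff.
  have := mJ _ Fh; rewrite expand// => h.
  have := gJ n => h2.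
  have Lsg := L2_mul (L2B Ls (Lg n)) Lf.
  have e : \int[P]_x (g n x * f x) = \int[P]_x (s x * f x) - \int[P]_x ((s x - g n x) * f x).
    by rewrite -RintB//; apply: eq_Rintegral => x _; ring.
  have le : `|\int[P]_x ((s x - g n x) * f x)| <= \int[P]_x `|(s x - g n x) * f x|.
    rewrite ler_norml lerNl; apply/andP; split.
      rewrite -RintN//; apply: le_Rint; [exact: L1N|exact: L1_norm|] => x.
      by rewrite -normrN ler_norm.
    by apply: le_Rint => //; [exact: L1_norm|] => x; exact: ler_norm.
  rewrite e in h.
  have : `|a * \int[P]_x ((s x - g n x) * f x)| <= `|a| * \int[P]_x `|(s x - g n x) * f x|.
    by rewrite normrM ler_wpM2l.
  rewrite ler_norml => /andP[]; move: h h2.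
  move: (\int[P]_x ((s x - g n x) * f x)) (\int[P]_x `|_|) (\int[P]_x (s x * f x)) (\int[P]_x (f x ^+ 2)) (J _) (l f) (8 ^- n) => p q r t j lf z.
  by move=> h h2 h3 h4; nra.
rewrite -[X in X <= _]oppr0.
suff c : (fun n => - (2 * B * `|a| * \int[P]_x `|(s x - g n x) * f x| + B / 4 * 8 ^- n)) @ \oo --> (- 0 : R).
  by apply: (cvgr_le_bound c); apply: nearW.
apply: cvgN.
have c8 : (fun n => 8 ^- n : R) @ \oo --> (0 : R).
  rewrite (_ : (fun n => _) = fun n => (8^-1) ^+ n); last by apply/funext => n; rewrite exprVn.
  by apply: cvg_expr; rewrite ger0_norm// invf_lt1// ltr1n.
have ci : (fun n => \int[P]_x `|(s x - g n x) * f x|) @ \oo --> (0 : R).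
  have [K K0 fK] : exists2 K : R, 0 < K & \int[P]_x f x ^+ 2 <= K.
    exists (1 + \int[P]_x f x ^+ 2); last by rewrite lerDr.
    by rewrite ltr_pwDl// Rint_ge0// => x; exact: sqr_ge0.
  apply/cvgrPdist_le => e e0.
  have e1 : 0 < e / K by rewrite divr_gt0.
  near=> n; rewrite sub0r normrN ger0_norm; last by apply: Rint_ge0.
  have Lsg := L2B Ls (Lg n).
  apply: (@le_trans _ _ (\int[P]_x ((2^-1 * (e / K)) * f x ^+ 2 + (2^-1 * (e / K)^-1) * (s x - g n x) ^+ 2))).
    apply: le_Rint; [exact: L1_norm (L2_mul _ _)| |].
      by apply: L1D; apply: L1Z; [have [] := Lf|have [] := Lsg].
    move=> x; rewrite normrM -(real_normK (num_real (f x))) -(real_normK (num_real (s x - g n x))).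
    move: (`|f x|) (`|s x - g n x|) => u v.
    have r1 : (e / K) * (e / K)^-1 = 1 by rewrite divff// gt_eqF.
    have r0 : 0 < (e / K)^-1 by rewrite invr_gt0.
    move: (e / K) ((e / K)^-1) e1 r1 r0 => p q p0 pq q0.
    have := mulr_ge0 (ltW q0) (sqr_ge0 (p * u - v)).
    have -> : q * (p * u - v) ^+ 2 = (p * q) * p * u ^+ 2 - 2 * (p * q) * (v * u) + q * v ^+ 2 by ring.
    by rewrite pq; lra.
  rewrite RintD; last 2 first.
    by apply: L1Z; have [] := Lf.
    by apply: L1Z; have [] := Lsg.
  rewrite !RintZ; [|by have [] := Lsg|by have [] := Lf].
  have h1 : 2^-1 * (e / K) * \int[P]_x f x ^+ 2 <= e / 2.
    apply: (@le_trans _ _ (2^-1 * (e / K) * K)); first by rewrite ler_wpM2l// mulr_ge0// ltW.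
    by rewrite -mulrA divfK ?gt_eqF// mulrC.
  have h2 : 2^-1 * (e / K)^-1 * \int[P]_x (s x - g n x) ^+ 2 <= e / 2.
    apply: (@le_trans _ _ (2^-1 * (e / K)^-1 * 8 ^- n)).
      by rewrite ler_wpM2l// mulr_ge0// invr_ge0 ltW.
    rewrite mulrC -ler_pdivlMr; last by rewrite mulr_gt0// invr_gt0.
    near: n; apply: (cvgr_le _ c8).
    by rewrite !divr_gt0// mulr_gt0// invr_gt0.
  lra.
rewrite -[X in _ --> X]addr0; apply: cvgD.
  by rewrite -(mulr0 (2 * B * `|a|)); exact: cvgMr.
by rewrite -(mulr0 (B / 4)); exact: cvgMr.
Unshelve. all: by end_near. Qed.

End L2.

(** * Test functions and weak gradients *)

Section open_boxes.
Context (R : realType) (n : nat).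
Local Notation E := 'rV[R]_n.
Local Notation leb := (lebesgue_rV R n).

Definition obox (a b : 'I_n -> R) : set E := box (fun i => `]a i, b i[%classic).
Definition oboxes : set (set E) := [set B | exists a b, B = obox a b].

Lemma measurable_obox a b : measurable (obox a b).
Proof. exact: measurable_box. Qed.

Lemma oboxI a b a' b' : obox a b `&` obox a' b' =
  obox (fun i => Num.max (a i) (a' i)) (fun i => Num.min (b i) (b' i)).
Proof.
apply/seteqP; split => x.
  move=> [h h'] i; have := h i; have := h' i; rewrite /= !in_itv/= => /andP[p q] /andP[r s].
  by rewrite gt_max lt_min p q r s.
move=> h; split => i; have := h i; rewrite /= !in_itv/= gt_max lt_min.
  by move=> /andP[/andP[-> _] /andP[-> _]].
by move=> /andP[/andP[_ ->] /andP[_ ->]].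
Qed.

Lemma oboxes_setI : setI_closed oboxes.
Proof. by move=> _ _ [a [b ->]] [a' [b' ->]]; rewrite oboxI; do 2 eexists. Qed.

Lemma cubeE (k : R) : cube k = obox (fun _ => - k) (fun _ => k).
Proof. by []. Qed.

Lemma measurable_gen_oboxes (A : set E) : measurable A -> <<s oboxes>> A.
Proof.
move=> mA; pose T' := g_sigma_algebraType oboxes.
have mid : measurable_fun setT (fun x : T' => (x : E)).
  apply: measurable_rV => i; apply: (measurability _ (RGenOInfty.measurableE R)).
  move=> _ [_ [a ->] <-]; rewrite setTI.
  rewrite (_ : _ @^-1` _ = \bigcup_k (obox (fun j => if j == i then a else - k%:R) (fun _ => k%:R) : set T')).
    apply: bigcup_measurable => k _; apply: sub_sigma_algebra.
    by do 2 eexists.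
  apply/seteqP; split => x /=.
    rewrite in_itv/= andbT => ax; pose k := Num.bound (enorm (x : E)).
    have xk j : `|(x : E) ord0 j| < k%:R.
      by rewrite (le_lt_trans (coord_le_enorm _ _))// archi_boundP// enorm_ge0.
    exists k => // j; rewrite /= in_itv/=; have := xk j; rewrite ltr_norml => /andP[h ->].
    by rewrite andbT; case: eqP => [->|].
  by move=> [k _ /(_ i)]; rewrite /= eqxx !in_itv/= andbT => /andP[].
by have := mid measurableT _ mA; rewrite setTI preimage_id.
Qed.

(** Open boxes are stable under intersection and generate the measurable sets, so the integral
    vanishes on all of them, in particular on the set where [w] is nonnegative. *)
Lemma ae0_of_oboxes (w : E -> R) : leb.-L1 w ->
  (forall a b, \int[leb]_x (w x * \1_(obox a b) x) = 0) -> {ae leb, forall x, w x = 0}.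
Proof.
move=> w1 h; have mw := L1_measurable w1.
have mwi A : measurable A -> measurable_fun setT (fun x => w x * \1_A x).
  by move=> mA; apply: measurable_funM => //; exact: measurable_indic.
have wi A : measurable A -> leb.-L1 (fun x => w x * \1_A x).
  move=> mA; apply: (@L1_le _ _ _ leb _ (fun x => `|w x|)); [exact: mwi| |exact: L1_norm].
  by move=> x; rewrite normrM indicE; case: (x \in A); rewrite ?normr1 ?mulr1// normr0 mulr0.
pose D := [set A : set E | measurable A /\ \int[leb]_x (w x * \1_A x) = 0].
have nd : ndseq_closed D.
  move=> F ndF DF; split; first by apply: bigcup_measurable => k _; have [] := DF k.
  have mF : measurable (\bigcup_k F k) by apply: bigcup_measurable => k _; have [] := DF k.
  have [_ c] : leb.-L1 (fun x => w x * \1_(\bigcup_k F k) x) /\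
     (fun k => \int[leb]_x (w x * \1_(F k) x)) @ \oo --> \int[leb]_x (w x * \1_(\bigcup_k F k) x).
    apply: (@Rint_dominated _ _ _ leb (fun k x => w x * \1_(F k) x) _ (fun x => `|w x|)).
    - by move=> k; apply: mwi; have [] := DF k.
    - exact: mwi.
    - exact: L1_norm.
    - apply: aeW => x; apply: cvgMr; apply: cvg_near_cst.
      have [Fx|nF] := pselect ((\bigcup_k F k) x).
        have [j _ Fj] := Fx; exists j => // k /= jk.
        rewrite !indicE !mem_set//; have /subsetPset := ndF _ _ jk; exact.
      apply: nearW => k; rewrite !indicE !memNset// => Fk; apply: nF.
      by exists k.
    - move=> k x; rewrite normrM indicE.
      by case: (x \in F k); rewrite ?normr1 ?mulr1// normr0 mulr0.
  rewrite -(cvg_lim (@Rhausdorff R) c); apply: lim_near_cst => //.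
  by apply: nearW => k; have [] := DF k.
have DT : D setT.
  rewrite -(@cube_cover R n); apply: nd.
    move=> i j ij; apply/subsetPset => x hx l; have := hx l; rewrite /= !in_itv/= => /andP[p q].
    have ijR : (i%:R : R) <= j%:R by rewrite ler_nat.
    by rewrite (lt_le_trans q)// (le_lt_trans _ p)// lerN2.
  by move=> k; split; [exact: measurable_obox|rewrite cubeE; exact: h].
have lam : lambda_system setT D.
  split => //.
  move=> A B AB [mA hA] [mB hB]; split; first exact: measurableD.
  have e : \int[leb]_x (w x * \1_(A `\` B) x) = \int[leb]_x (w x * \1_A x - w x * \1_B x).
    apply: eq_Rintegral => x _; rewrite -mulrBr; congr (_ * _).
    rewrite !indicE in_setD; have [xB|xB] := boolP (x \in B).
      by rewrite mem_set ?subrr//=; apply: AB; exact: set_mem.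
    by rewrite subr0 andbT.
  by rewrite e RintB ?hA ?hB ?subrr//; exact: wi.
have all A : measurable A -> \int[leb]_x (w x * \1_A x) = 0.
  move=> mA; suff : D A by case.
  apply: (lambda_system_subset oboxes_setI lam) => //.
    by move=> _ [a [b ->]]; split; [exact: measurable_obox|exact: h].
  exact: measurable_gen_oboxes.
pose A := [set x | 0 <= w x].
have mA : measurable A.
  rewrite (_ : A = w @^-1` `[0, +oo[%classic).
    by rewrite -[X in measurable X]setTI; exact: mw.
  by apply/seteqP; split => x /=; rewrite in_itv/= andbT.
have int0 : \int[leb]_x `|w x| = 0.
  have -> : \int[leb]_x `|w x| = \int[leb]_x (w x * \1_A x - w x * \1_(~` A) x).
    apply: eq_Rintegral => x _; rewrite !indicE in_setC; have [xA|xA] := boolP (x \in A).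
      by rewrite mulr0 subr0 mulr1 ger0_norm//; exact: (set_mem xA).
    rewrite mulr0 mulr1 sub0r ltr0_norm// ltNge.
    by apply/negP => w0; move/negP: xA; apply; apply: mem_set.
  by rewrite RintB ?all ?subrr//; [exact: measurableC|exact: wi|apply: wi; exact: measurableC].
have : (\int[leb]_x `|(EFin \o w) x| = 0)%E.
  have := RintegralE (L1_norm w1); rewrite int0 => h0.
  by apply: (etrans _ (esym h0)); apply: eq_integral.
have mwE : measurable_fun setT (EFin \o w) by exact/measurable_EFinP.
move/(ae_eq_integral_abs leb measurableT mwE) => h0.
by apply: (ae_imp _ h0) => x /(_ I) /= [].
Qed.

End open_boxes.

Lemma continuous_cmulf (R : realType) (T : topologicalType) (c : R) (f : T -> R) :
  continuous f -> continuous (fun x => c * f x).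
Proof. by move=> cf x; apply: cvgMr; exact: cf. Qed.

Lemma continuous_mulf (R : realType) (T : topologicalType) (f g : T -> R) :
  continuous f -> continuous g -> continuous (fun x => f x * g x).
Proof. by move=> cf cg x; apply: cvgM; [exact: cf|exact: cg]. Qed.

Lemma continuous_normf (R : realType) (T : topologicalType) (f : T -> R) :
  continuous f -> continuous (fun x => `|f x|).
Proof. by move=> cf x; apply: cvg_norm; exact: cf. Qed.

Lemma cvg_prodr (R : realType) I (r : seq I) (h : I -> nat -> R) (c : I -> R) :
  (forall i, h i @ \oo --> c i) ->
  (fun k => \prod_(i <- r) h i k) @ \oo --> \prod_(i <- r) c i.
Proof.
move=> hc; elim: r => [|i r IH].
  by under eq_fun do rewrite big_nil; rewrite big_nil; exact: cvg_cst.
by under eq_fun do rewrite big_cons; rewrite big_cons; exact: cvgM.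
Qed.

Section bumps.
Context (R : realType).

(** t^(-n) e^(-1/t) for t > 0: derivatives stay within the span of this family, which gives the
    smoothness of e^(-1/t). *)
Definition wfun (n : nat) (t : R) : R := if 0 < t then t ^- n * expR (- t^-1) else 0.

Lemma wfun_ge0 n t : 0 <= wfun n t.
Proof. by rewrite /wfun; case: ifP => // t0; rewrite mulr_ge0 ?expR_ge0// invr_ge0 exprn_ge0// ltW. Qed.

Lemma wfun0_le1 t : wfun 0 t <= 1.
Proof.
rewrite /wfun; case: ifP => // t0; rewrite expr0 invr1 mul1r -[leRHS]expR0 ler_expR.
by rewrite oppr_le0 invr_ge0 ltW.
Qed.

(** One term of the series of e^(1/t) suffices; quadratic vanishing at 0 yields the derivative
    there. *)
Lemma wfun_le n t : wfun n t <= (n.+2)`!%:R * t ^+ 2.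
Proof.
rewrite /wfun; case: ifP => [t0|_]; last by rewrite mulr_ge0// sqr_ge0.
have tv : 0 < t^-1 by rewrite invr_gt0.
have f0 : 0 < (n.+2)`!%:R :> R by rewrite ltr0n fact_gt0.
have h : (t^-1) ^+ n.+2 / (n.+2)`!%:R <= expR (t^-1).
  by apply: le_trans (expR_ge1Dxn n.+1 (ltW tv)); rewrite lerDr.
rewrite expRN -exprVn ler_pdivrMr ?expR_gt0//.
rewrite ler_pdivrMr// in h.
have t2 : 0 < t ^+ 2 by rewrite exprn_gt0.
have -> : t^-1 ^+ n = t ^+ 2 * t^-1 ^+ n.+2.
  by rewrite -[n.+2]addn2 exprD mulrCA -exprMn divff ?gt_eqF// expr1n mulr1.
apply: (le_trans (ler_wpM2l (ltW t2) h)).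
by rewrite le_eqVlt; apply/orP; left; apply/eqP; ring.
Qed.

Lemma is_derive_wfun n (t : R) :
  is_derive t (1 : R) (wfun n : R -> R^o) (wfun n.+2 t - n%:R * wfun n.+1 t).
Proof.
have [t0|] := ltP 0 t; last (rewrite le_eqVlt => /predU1P[->|t0]; last first).
- have nr : \near t, (fun t => (t^-1) ^+ n * expR (- t^-1)) t = wfun n t.
    near=> s; have s0 : 0 < s by near: s; exact: lt_nbhsr.
    by rewrite /wfun s0 exprVn.
  pose h (s : R) : R := (s^-1) ^+ n * expR (- s^-1).
  have dV : is_derive t (1 : R) (fun s : R => s^-1) (- t ^- 2 *: (1 : R)).
    by apply: is_deriveV; rewrite gt_eqF.
  have dN := is_deriveN dV.
  have dE := @is_derive1_comp _ expR _ _ _ _ (is_derive_expR _) dN.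
  have dX := is_deriveX n dV.
  have dh := is_deriveM dX dE.
  have eh : (fun s : R => s^-1) ^+ n * (expR \o - (fun s : R => s^-1)) = h.
    by apply/funext => s; rewrite /h /= fctE /=; congr (_ * _); elim: (n) => // k IH; rewrite !exprS -IH.
  rewrite eh in dh.
  have [c v] := dh; apply: DeriveDef; first exact: near_eq_derivable nr c.
  rewrite -(near_eq_derive _ nr) v /wfun t0.
  have tN : t^-1 != 0 by rewrite invr_eq0 gt_eqF.
  have E1 : ((fun s : R => s^-1) ^+ n) t = (t^-1) ^+ n by elim: (n) => // k IH; rewrite !exprS -IH.
  rewrite -!exprVn E1.
  transitivity (t^-1 ^+ n * (expR (- t^-1) * - (- t^-1 ^+ 2 * 1)) +
    expR (- t^-1) * ((n%:R * t^-1 ^+ n.-1) * (- t^-1 ^+ 2 * 1))); first by rewrite exprVn.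
  move: (expR (- t^-1)) (t^-1) => e u.
  by case: (n) => [|k]; rewrite /= !exprS; ring.
- have nr : \near t, (fun _ => 0) t = wfun n t.
    near=> s; have s0 : s < 0 by near: s; exact: lt_nbhsl.
    by rewrite /wfun ltNge (ltW s0).
  have [c v] := is_derive_cst (0 : R) t (1 : R).
  apply: DeriveDef; first exact: near_eq_derivable nr c.
  by rewrite -(near_eq_derive _ nr) v /wfun !(ltNge 0 t) (ltW t0)/= mulr0 subr0.
- rewrite /wfun ltxx mulr0 subr0.
  have cv : (fun h : R => h^-1 *: ((wfun n \o shift (0 : R)) (h *: (1 : R)) - wfun n 0 : R^o)) @ 0^' --> (0 : R).
    apply/cvgrPdist_le => e e0; near=> h.
    rewrite sub0r normrN /= {2}/wfun ltxx subr0 addr0 [h *: 1]mulr1 normrM.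
    have h0 : h != 0 by near: h; exact: nbhs_dnbhs_neq.
    rewrite (ger0_norm (wfun_ge0 _ _)) normfV ler_pdivrMl ?normr_gt0//.
    apply: (le_trans (wfun_le _ _)); rewrite -(real_normK (num_real h)) expr2 mulrA [leRHS]mulrC ler_wpM2r//.
    rewrite -ler_pdivlMl ?ltr0n ?fact_gt0//.
    near: h; apply: dnbhs0_le; rewrite mulr_gt0// invr_gt0 ltr0n fact_gt0//.
  by apply: DeriveDef; [apply/cvg_ex; exists 0|exact: (cvg_lim (@Rhausdorff R) cv)].
Unshelve. all: by end_near. Qed.

Lemma continuous_wfun n : continuous (wfun n).
Proof.
move=> t; apply/differentiable_continuous/derivable1_diffP.
by have [] := is_derive_wfun n t.
Qed.

Lemma is_derive_line d (x v : 'rV[R]_d) (f : 'rV[R]_d -> R) (l : R) :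
  is_derive (0 : R) (1 : R) (fun h : R => f (x + h *: v) : R^o) l ->
  is_derive x v (f : _ -> R^o) l.
Proof.
move=> [c dE].
have e : (fun h : R => h^-1 *: (((fun h : R => f (x + h *: v) : R^o) \o shift (0 : R)) (h *: (1 : R)) - f (x + (0 : R) *: v))) =
   (fun h => h^-1 *: (((f : _ -> R^o) \o shift x) (h *: v) - f x)).
  by apply/funext => h /=; rewrite [h *: 1]mulr1 addr0 scale0r addr0 [x + _]addrC.
apply: DeriveDef; first by rewrite /derivable -e.
by rewrite -dE /derive -e.
Qed.

Variable d : nat.
Local Notation E := 'rV[R]_d.

(** A class closed under partial derivatives, so that [smooth] follows by induction on the list of
    directions. *)
Inductive bump : (E -> R) -> Prop :=
| bump_cst c : bump (fun=> c)
| bump_gen n i c b : bump (fun x => wfun n (c * x ord0 i + b))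
| bump_add f g : bump f -> bump g -> bump (fun x => f x + g x)
| bump_mul f g : bump f -> bump g -> bump (fun x => f x * g x).

Lemma bump_continuous f : bump f -> continuous f.
Proof.
elim=> [c|n i c b|{}f g _ cf _ cg|{}f g _ cf _ cg].
- exact: cst_continuous.
- have ca : continuous (fun x : E => c * x ord0 i + b).
    apply: continuous_addf; last exact: cst_continuous.
    by apply: continuous_cmulf => x; exact: coord_continuous.
  by move=> x; apply: (continuous_comp (ca x)); exact: continuous_wfun.
- exact: continuous_addf.
- exact: continuous_mulf.
Qed.

Lemma bump_derive f (j : 'I_d) : bump f -> exists2 f', bump f' &
  forall x, is_derive x (delta_mx ord0 j : E) (f : E -> R^o) (f' x).
Proof.
elim=> [c|n i c b|{}f g _ [f' bf' df] _ [g' bg' dg]|{}f g bf [f' bf' df] bg [g' bg' dg]].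
- by exists (fun=> 0); [exact: bump_cst|move=> x; exact: is_derive_cst].
- exists (fun x => (c * (i == j)%:R) * (wfun n.+2 (c * x ord0 i + b) + (- n%:R) * wfun n.+1 (c * x ord0 i + b))).
    apply: bump_mul; first exact: bump_cst.
    apply: bump_add; first exact: bump_gen.
    by apply: bump_mul; [exact: bump_cst|exact: bump_gen].
  move=> x; apply: is_derive_line.
  have -> : (fun h : R => wfun n (c * (x + h *: delta_mx ord0 j) ord0 i + b)) =
      wfun n \o (fun h : R => (c * (i == j)%:R) * h + (c * x ord0 i + b)).
    by apply/funext => h /=; rewrite !mxE eqxx/=; congr wfun; ring.
  have d1 : is_derive (0 : R) (1 : R) (fun h : R => (c * (i == j)%:R) * h + (c * x ord0 i + b)) (c * (i == j)%:R).
    have h1 := is_deriveZ (c * (i == j)%:R) (is_derive_id (0 : R) (1 : R)).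
    have h2 := is_deriveD h1 (is_derive_cst (c * x ord0 i + b) (0 : R) (1 : R)).
    by apply: is_derive_eq h2 _; rewrite addr0 [_ *: 1]mulr1.
  have d2 := is_derive_wfun n (c * (i == j)%:R * 0 + (c * x ord0 i + b)).
  have := @is_derive1_comp R (wfun n) _ (0 : R) _ _ d2 d1; rewrite mulr0 add0r => d3.
  by apply: is_derive_eq d3 _; ring.
- exists (fun x => f' x + g' x); first exact: bump_add.
  by move=> x; exact: is_deriveD.
- exists (fun x => f x * g' x + g x * f' x); first by apply: bump_add; exact: bump_mul.
  by move=> x; exact: (is_deriveM (df x) (dg x)).
Qed.

Lemma bump_iter_partial s f : bump f -> bump (iter_partial s f).
Proof.
move=> bf; elim: s => [//|i s IH]; rewrite /iter_partial/= -/(iter_partial s f).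
have [g bg dg] := bump_derive i IH.
suff -> : (fun x => 'D_(delta_mx ord0 i : E) (iter_partial s f : E -> R^o) x) = g by [].
by apply/funext => x; have [] := dg x.
Qed.

Lemma bump_smooth f : bump f -> smooth f.
Proof.
move=> bf s; have bs := bump_iter_partial s bf; split; first exact: bump_continuous.
by move=> i x; have [g _ /(_ x) []] := bump_derive i bs.
Qed.

(** Vanishes off the closed box for every k and converges to the indicator of the open box as k
    grows. *)
Definition box_bump (a b : 'I_d -> R) (k : nat) (x : E) : R :=
  \prod_i (wfun 0 (k%:R * x ord0 i + - (k%:R * a i)) * wfun 0 (- k%:R * x ord0 i + k%:R * b i)).

Lemma bump_box_bump a b k : bump (box_bump a b k).
Proof.
rewrite /box_bump; elim: (index_enum _) => [|i r IH].
  by under eq_fun do rewrite big_nil; exact: bump_cst.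
under eq_fun do rewrite big_cons.
by apply: bump_mul => //; apply: bump_mul; exact: bump_gen.
Qed.

Lemma box_bump_bound a b k x : 0 <= box_bump a b k x <= 1.
Proof.
apply/andP; split; first by apply: prodr_ge0 => i _; rewrite mulr_ge0 ?wfun_ge0.
by apply: prodr_ile1 => i _; rewrite mulr_ge0 ?wfun_ge0//= mulr_ile1 ?wfun_ge0 ?wfun0_le1.
Qed.

Definition cbox (a b : 'I_d -> R) : set E := [set x | forall i, `[a i, b i]%classic (x ord0 i)].

Lemma compact_cbox a b : compact (cbox a b).
Proof. by apply: (@rV_compact R d (fun i => `[a i, b i]%classic)) => i; exact: segment_compact. Qed.

Lemma box_bump_out a b k x : ~ cbox a b x -> box_bump a b k x = 0.
Proof.
move=> /existsNP[i]; rewrite /= in_itv/= => /negP; rewrite negb_and -!ltNge => h.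
rewrite /box_bump (bigD1 i)//=; case/orP: h => h.
  rewrite -mulrBr {1}/wfun ltNge mulr_ge0_le0 ?subr_le0 ?(ltW h)//=.
  by rewrite !mul0r.
rewrite (_ : _ + k%:R * b i = k%:R * (b i - x ord0 i)); last by ring.
rewrite {2}/wfun ltNge mulr_ge0_le0 ?subr_le0 ?(ltW h)//=.
by rewrite mulr0 mul0r.
Qed.

Lemma test_box_bump a b k : test_fun (box_bump a b k).
Proof.
split; first exact/bump_smooth/bump_box_bump.
by exists (cbox a b); [exact: compact_cbox|move=> x; exact: box_bump_out].
Qed.

Lemma wfun_cvg (t : R) : (fun k : nat => wfun 0 (k%:R * t)) @ \oo --> (if 0 < t then 1 else 0 : R).
Proof.
case: ifPn => t0.
  have c : (fun k : nat => expR (- (k%:R * t)^-1)) @ \oo --> (1 : R).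
    rewrite -[X in _ --> X]expR0; apply: (@continuous_cvg _ _ _ _ _ _ expR); first exact: continuous_expR.
    rewrite -[X in _ --> X]oppr0; apply: cvgN.
    have cN : (fun k : nat => k%:R^-1 * t^-1 : R) @ \oo --> 0 * t^-1.
      by apply: cvgMl; rewrite -(cvg_shiftS (fun k : nat => k%:R^-1 : R)); exact: cvg_harmonic.
    rewrite mul0r in cN; apply: cvg_trans cN; apply: near_eq_cvg; apply: nearW => k.
    by rewrite invfM.
  rewrite -(cvg_shiftS (fun k => wfun 0 (k%:R * t))).
  rewrite -(cvg_shiftS (fun k => expR (- (k%:R * t)^-1))) in c.
  apply: cvg_trans c; apply: near_eq_cvg; apply: nearW => k.
  by rewrite /= /wfun mulr_gt0// expr0 invr1 mul1r.
apply: cvg_near_cst; apply: nearW => k; rewrite /wfun ltNge.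
by rewrite mulr_ge0_le0//= leNgt.
Qed.

Lemma box_bump_cvg a b x : (fun k => box_bump a b k x) @ \oo --> (\1_(obox a b) x : R).
Proof.
have -> : (\1_(obox a b) x : R) = \prod_i ((if 0 < x ord0 i - a i then 1 else 0 : R) * (if 0 < b i - x ord0 i then 1 else 0)).
  rewrite indicE; have [xo|xo] := boolP (x \in obox a b).
    rewrite big1// => i _; have := (set_mem xo) i; rewrite /= in_itv/= !subr_gt0 => /andP[-> ->].
    by rewrite mulr1.
  have /existsNP[i] : ~ (obox a b x) by move=> h; move/negP: xo; apply; exact: mem_set.
  rewrite (bigD1 i)//= in_itv/= !subr_gt0 => /negP; rewrite negb_and => /orP[] /negbTE ->.
    by rewrite !mul0r.
  by rewrite mulr0 mul0r.
rewrite /box_bump; apply: cvg_prodr => i.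
apply: cvgM.
  by under eq_fun do rewrite -mulrBr; exact: wfun_cvg.
rewrite (_ : (fun k : nat => _) = fun k => wfun 0 (k%:R * (b i - x ord0 i))); first exact: wfun_cvg.
by apply/funext => k; congr wfun; ring.
Qed.

End bumps.

Section test_functions.
Context (R : realType) (d : nat).
Local Notation E := 'rV[R]_d.
Local Notation leb := (lebesgue_rV R d).

Lemma compact_rV_closed (K : set E) : compact K -> closed K.
Proof. by move=> cK; apply: compact_closed => //; exact: Rhausdorff_rV. Qed.

Lemma compact_support_bounded (f : E -> R) (K : set E) : compact K ->
  continuous f -> (forall x, ~ K x -> f x = 0) -> exists M, forall x, `|f x| <= M.
Proof.
move=> cK cf f0; have [K0|/set0P nK] := eqVneq K set0.
  by exists 0 => x; rewrite f0 ?normr0// K0.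
have [|c _ hc] := @compact_EVT_max E R (fun x => `|f x|) K nK cK.
  by apply: continuous_subspaceT; exact: continuous_normf.
exists `|f c| => x; have [Kx|nKx] := pselect (K x); first by apply: hc; exact: mem_set.
by rewrite f0// normr0.
Qed.

Lemma test_fun_dirC1 (i : 'I_d) (psi : E -> R) : test_fun psi ->
  dirC1 i psi (iter_partial [:: i] psi).
Proof.
move=> [sm [K cK psi0]].
have [cp dp] := sm [::]; have [cp' _] := sm [:: i].
have dpsi x : is_derive x (delta_mx ord0 i : E) (psi : _ -> R^o) (iter_partial [:: i] psi x).
  by apply: DeriveDef => //; exact: dp.
have psi'0 x : ~ K x -> iter_partial [:: i] psi x = 0.
  move=> Kx; have oK : nbhs x (~` K).
    by apply: open_nbhs_nbhs; split => //; apply: closed_openC; exact: compact_rV_closed.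
  have nr : \near x, psi x = (fun=> 0) x by near=> y; apply: psi0; near: y.
  rewrite /iter_partial /= (near_eq_derive _ nr).
  by have [] := is_derive_cst (0 : R^o) x (delta_mx ord0 i : E).
split=> //; first exact: compact_support_bounded cK cp' psi'0.
have [M hM] := compact_support_bounded cK cp psi0.
exists (M ^+ 2); first exact: sqr_ge0.
move=> x; apply: (@le_trans _ _ (M ^+ 2)); last by rewrite ler_peMr ?sqr_ge0// lerDl sqnorm_ge0.
by rewrite -(real_normK (num_real (psi x))) ler_pXn2r ?nnegrE// (le_trans _ (hM x)).
Unshelve. all: by end_near. Qed.

Lemma obox_cbox (a b : 'I_d -> R) : obox a b `<=` cbox a b.
Proof. by move=> x h i; have := h i; rewrite /= !in_itv/= => /andP[/ltW -> /ltW ->]. Qed.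

Lemma measurable_cbox (a b : 'I_d -> R) : measurable (cbox a b).
Proof. by apply: (@measurable_box R d (fun i => `[a i, b i]%classic)) => i; exact: measurable_itv. Qed.

Lemma L1_restrict (w : E -> R) (A : set E) : measurable A ->
  leb.-integrable A (fun x => (w x)%:E) -> leb.-L1 (fun x => w x * \1_A x).
Proof.
move=> mA /(integrable_mkcond _ mA); apply: eq_integrable => // x _.
by rewrite /= patchE indicE; case: ifPn => _; rewrite ?mulr1// mulr0.
Qed.

(** Tested against [box_bump] and in the limit, the two gradients have the same integral over every
    open box. *)
Lemma weak_gradient_unique (f : E -> R) (g g' : E -> E) :
  weak_gradient f g -> weak_gradient f g' -> {ae leb, forall x, g x = g' x}.
Proof.
move=> [ig hg] [ig' hg'].
(* Weak gradients are only locally integrable, so they are compared cube by cube. *)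
pose Q (k : nat) : set E := obox (fun=> - k%:R) (fun=> k%:R).
have aeQ (i : 'I_d) (k : nat) : {ae leb, forall x, (g x ord0 i - g' x ord0 i) * \1_(Q k) x = 0}.
  have mQ : measurable (Q k) by exact: measurable_obox.
  pose C : set E := cbox (fun=> - k%:R) (fun=> k%:R).
  have LC (h : E -> E) (A : set E) : (forall i (K : set E), compact K -> leb.-integrable K (fun x => (h x ord0 i)%:E)) ->
      compact A -> measurable A -> leb.-L1 (fun x => h x ord0 i * \1_A x).
    by move=> ih cA mA; apply: L1_restrict => //; exact: ih.
  have mM (w : E -> R) (A : set E) : leb.-L1 w -> measurable A -> leb.-L1 (fun x => w x * \1_A x).
    move=> w1 mA; apply: (@L1_le _ _ _ leb _ (fun x => `|w x|)); [| |exact: L1_norm].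
      by apply: measurable_funM; [exact: L1_measurable w1|exact: measurable_indic].
    by move=> x; rewrite normrM indicE; case: (x \in A); rewrite ?normr1 ?mulr1// normr0 mulr0.
  have cC := @compact_cbox R d (fun=> - k%:R) (fun=> k%:R) : compact C.
  have mC : measurable C by exact: measurable_cbox.
  have QC : Q k `<=` C by exact: obox_cbox.
  have LQ (h : E -> E) : (forall i (K : set E), compact K -> leb.-integrable K (fun x => (h x ord0 i)%:E)) ->
      leb.-L1 (fun x => h x ord0 i * \1_(Q k) x).
    move=> ih; have := mM _ _ (LC h C ih cC mC) mQ.
    rewrite (_ : (fun x => _) = fun x => h x ord0 i * \1_(Q k) x)//.
    apply/funext => x; rewrite -mulrA; congr (_ * _); rewrite !indicE.
    have [xQ|_] := boolP (x \in Q k); last by rewrite mulr0.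
    by rewrite mulr1 mem_set//; apply: QC; exact: set_mem.
  have L : leb.-L1 (fun x => (g x ord0 i - g' x ord0 i) * \1_(Q k) x).
    rewrite (_ : (fun x => _) = fun x => g x ord0 i * \1_(Q k) x - g' x ord0 i * \1_(Q k) x).
      by apply: L1B; exact: LQ.
    by apply/funext => x; rewrite mulrBl.
  apply: (ae0_of_oboxes L) => a0 b0.
  pose a (j : 'I_d) := Num.max (- k%:R : R) (a0 j); pose b (j : 'I_d) := Num.min (k%:R : R) (b0 j).
  pose O : set E := obox a b; pose K : set E := cbox a b.
  have mO : measurable O by exact: measurable_obox.
  have cK : compact K by exact: compact_cbox.
  have mK : measurable K by exact: measurable_cbox.
  have limh (h : E -> E) : (forall i (K : set E), compact K -> leb.-integrable K (fun x => (h x ord0 i)%:E)) ->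
      (fun n => \int[leb]_x (h x ord0 i * box_bump a b n x)) @ \oo --> \int[leb]_x (h x ord0 i * \1_O x).
    move=> ih; have LK := LC h K ih cK mK.
    have cv x : (fun n => h x ord0 i * \1_K x * box_bump a b n x) @ \oo --> h x ord0 i * \1_K x * \1_O x.
      by apply: cvgMr; exact: box_bump_cvg.
    have bb n x : `|h x ord0 i * \1_K x * box_bump a b n x| <= `|h x ord0 i * \1_K x|.
      rewrite normrM; have /andP[p0 p1] := box_bump_bound a b n x.
      by rewrite (ger0_norm p0) ler_piMr.
    have [_] := @Rint_dominated _ _ _ leb (fun n x => h x ord0 i * \1_K x * box_bump a b n x)
      (fun x => h x ord0 i * \1_K x * \1_O x) (fun x => `|h x ord0 i * \1_K x|)
      (fun n => measurable_funM (L1_measurable LK) (continuous_measurable_rV (bump_continuous (bump_box_bump a b n))))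
      (measurable_funM (L1_measurable LK) (measurable_indic mO)) (L1_norm LK)
      (aeW _ cv) bb.
    have -> : \int[leb]_x (h x ord0 i * \1_K x * \1_O x) = \int[leb]_x (h x ord0 i * \1_O x).
      apply: eq_Rintegral => x _; rewrite -mulrA; congr (_ * _); rewrite !indicE.
      have [xO|_] := boolP (x \in O); last by rewrite mulr0.
      by rewrite mulr1 mem_set//; apply: obox_cbox; exact: set_mem.
    have e n : \int[leb]_x (h x ord0 i * \1_K x * box_bump a b n x) = \int[leb]_x (h x ord0 i * box_bump a b n x).
      apply: eq_Rintegral => x _; rewrite -mulrA; congr (_ * _); rewrite indicE.
      have [_|xK] := boolP (x \in K); first by rewrite mul1r.
      rewrite mul0r box_bump_out// => Kx; move/negP: xK; apply; exact: mem_set.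
    by under eq_fun do rewrite e.
  have eqI n : \int[leb]_x (g x ord0 i * box_bump a b n x) = \int[leb]_x (g' x ord0 i * box_bump a b n x).
    by apply: oppr_inj; rewrite -hg -?hg'//; exact: test_box_bump.
  have c1 := limh g ig; have c2 := limh g' ig'.
  have eqO : \int[leb]_x (g x ord0 i * \1_O x) = \int[leb]_x (g' x ord0 i * \1_O x).
    rewrite -(cvg_lim (@Rhausdorff R) c1) -(cvg_lim (@Rhausdorff R) c2).
    by under eq_fun do rewrite eqI.
  have LO (h : E -> E) : (forall i (K : set E), compact K -> leb.-integrable K (fun x => (h x ord0 i)%:E)) ->
      leb.-L1 (fun x => h x ord0 i * \1_O x).
    move=> ih; have := mM _ _ (LC h K ih cK mK) mO.
    rewrite (_ : (fun x => _) = fun x => h x ord0 i * \1_O x)//.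
    apply/funext => x; rewrite -mulrA; congr (_ * _); rewrite !indicE.
    have [xO|_] := boolP (x \in O); last by rewrite mulr0.
    by rewrite mulr1 mem_set//; apply: obox_cbox; exact: set_mem.
  have -> : \int[leb]_x ((g x ord0 i - g' x ord0 i) * \1_(Q k) x * \1_(obox a0 b0) x) =
      \int[leb]_x (g x ord0 i * \1_O x - g' x ord0 i * \1_O x).
    apply: eq_Rintegral => x _; rewrite -mulrBl -mulrA; congr (_ * _).
    by rewrite /O -oboxI indicI.
  by rewrite RintB ?eqO ?subrr//; exact: LO.
have := @ae_foralln _ _ _ leb (fun n x => if (unpickle n : option ('I_d * nat)) is Some (i, k) then
   (g x ord0 i - g' x ord0 i) * \1_(Q k) x = 0 else True).
move=> /(_ _)/(ae_imp _); apply.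
  move=> x h; apply/rowP => i; pose k := Num.bound (enorm x).
  have Qx : Q k x.
    move=> j; rewrite /= in_itv/= -ltr_norml (le_lt_trans (coord_le_enorm _ _))//.
    by rewrite archi_boundP// enorm_ge0.
  have := h (pickle (i, k)); rewrite pickleK indicE mem_set// mulr1.
  by move/eqP; rewrite subr_eq0 => /eqP.
by move=> n; case: unpickle => [[i k]|]; [exact: aeQ|exact: aeW].
Qed.

End test_functions.

Section score.
Context (R : realType) (d : nat).
Local Notation E := 'rV[R]_d.
Local Notation leb := (lebesgue_rV R d).
Variables (mu : P2 R d) (s : 'I_d -> E -> R).
Hypothesis ac : mu `<< leb.
Hypothesis s2 : forall i, L2 mu (s i).
Hypothesis ibp : forall i f f', dirC1 i f f' ->
  \int[mu]_x f' x = - \int[mu]_x (s i x * f x).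

(** Integration by parts under mu says that s times the density is the weak gradient of the
    density. *)
Let g (x : E) : E := \row_i (s i x * density mu x).

Let g_weak_gradient : weak_gradient (density mu) g.
Proof.
have sL i : leb.-L1 (fun x => g x ord0 i).
  have [L _] := dens_Rint ac (L2_L1 (s2 i)).
  apply: ae_eq_L1 L _.
    under eq_fun do rewrite mxE.
    by apply: measurable_funM; [have [] := s2 i|exact: measurable_density].
  by apply: ae_imp (densE ac) => x h; rewrite mxE h.
split=> [i K cK|i psi tpsi].
  have mK : measurable K.
    rewrite -(setCK K); apply: measurableC; apply: measurable_rV_open.
    by apply: closed_openC; exact: compact_rV_closed.
  by apply: (integrableS measurableT) => //; exact: sL.
have dp := test_fun_dirC1 i tpsi.
have [cp cp' _ [K' hK'] _] := dp.
have [sm [K cK psi0]] := tpsi.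
have [M hM] := compact_support_bounded cK cp psi0.
have mp := continuous_measurable_rV cp; have mp' := continuous_measurable_rV cp'.
have L1' : mu.-L1 (iter_partial [:: i] psi) by exact: L2_L1 (L2_bounded mu mp' hK').
have L2' : mu.-L1 (fun x => s i x * psi x) by apply: L2_mul => //; exact: L2_bounded hM.
have [L3 e1] := dens_Rint ac L1'; have [L4 e2] := dens_Rint ac L2'.
transitivity (\int[mu]_x iter_partial [:: i] psi x).
  rewrite e1; apply: ae_eq_Rint.
  - by apply: measurable_funM => //; exact: measurable_density.
  - exact: L1_measurable L3.
  - by apply: ae_imp (densE ac) => x h; rewrite h mulrC.
rewrite (ibp dp) e2; congr (- _); apply: ae_eq_Rint.
- exact: L1_measurable L4.
- under eq_fun do rewrite mxE.
  by apply: measurable_funM => //; apply: measurable_funM; [have [] := s2 i|exact: measurable_density].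
- by apply: ae_imp (densE ac) => x h; rewrite mxE h; ring.
Qed.

Let wgrad_weak_gradient : weak_gradient (density mu) (wgrad (density mu)).
Proof.
by rewrite /wgrad; have := xgetPex (fun=> 0 : E) (ex_intro _ _ g_weak_gradient).
Qed.

(** [wgrad] is picked by [xget]; its measurability comes from its local integrability on an
    exhausting sequence of boxes. *)
Lemma measurable_score : measurable_fun setT (score mu).
Proof.
have mw i : measurable_fun setT (fun x => wgrad (density mu) x ord0 i).
  have [ig _] := wgrad_weak_gradient.
  rewrite -(_ : \bigcup_k (cbox (fun=> - k%:R) (fun=> k%:R) : set E) = setT).
    apply/measurable_fun_bigcup => [k|k]; first exact: measurable_cbox.
    by have /measurable_int/measurable_EFinP := ig i _ (@compact_cbox R d (fun=> - k%:R) (fun=> k%:R)).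
  rewrite -subTset => x _; exists (Num.bound (enorm x)) => // j.
  rewrite /= in_itv/= -ler_norml (le_trans (coord_le_enorm _ _))// ltW//.
  by rewrite archi_boundP// enorm_ge0.
have mi : measurable_fun setT (fun x => (density mu x)^-1).
  by apply: measurable_invr; exact: measurable_density.
apply: measurable_rV => i; under eq_fun do rewrite mxE.
exact: measurable_funM.
Qed.

Lemma score_ae : {ae mu, forall x, score mu x = \row_i s i x}.
Proof.
have h := dominates_ae ac (weak_gradient_unique wgrad_weak_gradient g_weak_gradient).
apply: ae_imp2 h (density_gt0 ac) => x h k0; apply/rowP => i.
by rewrite /score h !mxE mulrCA mulVf ?mulr1// gt_eqF.
Qed.

Lemma fisher_lty : (fisher mu < +oo)%E.
Proof.
rewrite /fisher asboolT; last by split => //; exists g; exact: g_weak_gradient.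
have L : mu.-L1 (fun x => \sum_i s i x ^+ 2).
  by apply: L1_sum => i _; have [] := s2 i.
rewrite (ae_eq_integral (fun x => (\sum_i s i x ^+ 2)%:E))//.
- by rewrite -RintegralE// ltry.
- by apply/measurable_EFinP; apply: measurable_sqn; exact: measurable_score.
- by apply/measurable_EFinP; exact: L1_measurable L.
- apply: ae_imp score_ae => x h _; rewrite h /sqnorm /dot; congr (_ %:E).
  by apply: eq_bigr => i _; rewrite !mxE expr2.
Qed.

Lemma Rint_score (p : E -> E) : measurable_fun setT p ->
  \int[mu]_x dot (score mu x) (p x) = \int[mu]_x (\sum_i s i x * p x ord0 i).
Proof.
move=> mp; apply: ae_eq_Rint.
- by apply: measurable_dot => //; exact: measurable_score.
- apply: measurable_sum => i; apply: measurable_funM; first by have [] := s2 i.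
  exact: measurable_entry.
- apply: ae_imp score_ae => x h; rewrite h /dot.
  by apply: eq_bigr => i _; rewrite mxE.
Qed.

End score.

Lemma ge0_Rint_eq0 d (T : measurableType d) (R : realType)
    (m : {measure set T -> \bar R}) (f : T -> R) :
  m.-L1 f -> (forall x, 0 <= f x) -> \int[m]_x f x <= 0 -> {ae m, forall x, f x = 0}.
Proof.
move=> f1 f0 If; have mf : measurable_fun setT (EFin \o f).
  by apply/measurable_EFinP; exact: L1_measurable f1.
have : (\int[m]_x `|(EFin \o f) x| = 0)%E.
  transitivity (\int[m]_x (f x)%:E)%E.
    by apply: eq_integral => x _; rewrite /= ger0_norm.
  by rewrite -RintegralE//; congr (_%:E); apply/eqP; rewrite eq_le If Rint_ge0.
move/(ae_eq_integral_abs m measurableT mf) => h0.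
by apply: (ae_imp _ h0) => x /(_ I) /= [].
Qed.

(** * Cyclical monotonicity of minimal plans *)

Section samples.
Context (R : realType) (N : nat).
Local Notation Om := 'rV[R]_N.
Local Notation I01 := (`[0, 1]%classic : set R).

(* The coordinates are N independent uniform variables. *)
Definition samples : probability Om R := ubox N (@ltr01 R).

Lemma unifE (A : set R) : measurable A -> unif R A = (@lebesgue_measure R) (A `&` I01).
Proof.
move=> mA; have := @integral_uniform R 0 1 ltr01 (fun x => (\1_A x)%:E).
rewrite subr0 invr1 mul1e integral_indic// setIT integral_indic// => -> //.
by apply/measurable_EFinP; exact: measurable_indic.
Qed.

Lemma samples_box (A : 'I_N -> set R) : (forall i, measurable (A i)) ->
  samples (box A) = (\prod_(i < N) unif R (A i))%E.
Proof.
move=> mA; rewrite /samples ubox_boxE// expr1n invr1 mul1e.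
by apply: eq_bigr => i _; rewrite unifE.
Qed.

Lemma samples_coord (i : 'I_N) : image_law (fun u : Om => u ord0 i : measurableTypeR R) samples (unif R).
Proof.
move=> A mA; rewrite /pushforward.
have mB j : measurable (if j == i then A else setT : set R) by case: ifP.
rewrite (_ : _ @^-1` A = box (fun j => if j == i then A else setT)); last first.
  apply/seteqP; split => x /=; last by move=> /(_ i); rewrite eqxx.
  by move=> Ax j /=; case: eqP => // ->.
rewrite samples_box// (bigD1 i)//= eqxx big1 ?mule1// => j /negbTE ->.
exact: probability_setT.
Qed.

Lemma samples_perm (f : 'I_N -> 'I_N) : bijective f ->
  image_law (fun u : Om => \row_i u ord0 (f i) : Om) samples samples.
Proof.
move=> [g fK gK].
have mT : measurable_fun setT (fun u : Om => \row_i u ord0 (f i) : Om).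
  by apply: measurable_rV => i; under eq_fun do rewrite mxE; exact: measurable_coord.
pose P' := law samples mT.
suff h A : measurable A -> P' A = samples A by move=> A mA; exact: h.
apply: measure_boxes_unique => [B mB|k]; last first.
  have mc : measurable (cube k%:R : set Om) by exact: measurable_box.
  by rewrite (le_lt_trans (probability_le1 _ mc)) ?ltry.
transitivity (samples (box (B \o g))).
  change (samples ((fun u : Om => \row_i u ord0 (f i) : Om) @^-1` box B) = samples (box (B \o g))).
  congr (samples _); apply/seteqP; split => u /=.
    by move=> h i; have := h (g i); rewrite /= mxE gK.
  by move=> h i; have := h (f i); rewrite /= mxE fK.
apply: (etrans (samples_box (fun i => mB (g i)))).
apply: (etrans _ (esym (samples_box mB))).
rewrite [RHS](reindex g) //.
by exists f => i _; [exact: gK|exact: fK].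
Qed.

End samples.

Section cyclical_monotonicity.
Context (R : realType) (d : nat).
Local Notation E := 'rV[R]_d.

(** Optimality in the form that comparing values at a maximum yields directly; [optimal_of_minimal]
    translates it. *)
Definition minimal_cost (g : plan R d) : Prop := forall g' : plan R d,
  same_law (marg1 g) (marg1 g') -> same_law (marg2 g) (marg2 g') ->
  \int[g]_z sqnorm (z.1 - z.2) <= \int[g']_z sqnorm (z.1 - z.2).

Definition cyc_sum N (z : 'I_N -> E * E) : R :=
  \sum_(i < N) (dot (z (ordS i)).1 (z i).2 - dot (z i).1 (z i).2).

Definition cyclically_monotone (S : set (E * E)) : Prop :=
  forall N (z : 'I_N -> E * E), (forall i, S (z i)) -> cyc_sum z <= 0.

Section sampling.
Variables (g : plan R d) (Z : measurableTypeR R -> E * E).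
Hypotheses (mZ : measurable_fun setT Z) (lZ : image_law Z (unif R) g).
Hypothesis ming : minimal_cost g.

(** Take N + 1 independent samples of the plan and, on the event A that their cyclic sum is
    positive, replace the first component of sample 0 by that of sample 1. Since A is invariant
    under rotation of the samples, the marginals are kept, and minimality makes the mean of the
    summand of rank 0 over A nonpositive. By rotation so is the mean of the whole sum. *)
Lemma cyc_sum_sampled N : {ae @samples R N.+1, forall u : 'rV[R]_N.+1,
  cyc_sum (fun i => Z (u ord0 i)) <= 0}.
Proof.
pose Om := 'rV[R]_N.+1; pose P := @samples R N.+1.
pose S (u : Om) := cyc_sum (fun i => Z (u ord0 i)).
have mZi i : measurable_fun setT (fun u : Om => Z (u ord0 i)).
  by apply: measurableT_comp mZ _; exact: measurable_coord.
have mX i : measurable_fun setT (fun u : Om => (Z (u ord0 i)).1).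
  exact: measurableT_comp measurable_fst (mZi i).
have mY i : measurable_fun setT (fun u : Om => (Z (u ord0 i)).2).
  exact: measurableT_comp measurable_snd (mZi i).
have mS : measurable_fun setT S.
  by apply: measurable_sum => i; apply: measurable_funB; exact: measurable_dot.
pose A := [set u : Om | 0 < S u].
have mA : measurable A.
  rewrite (_ : A = S @^-1` `]0, +oo[%classic).
    by rewrite -[X in measurable X]setTI; exact: mS.
  by apply/seteqP; split => x /=; rewrite in_itv/= andbT.
pose rot (u : Om) : Om := \row_i u ord0 (ordS i).
have lrot : image_law rot P P by apply: samples_perm; exact: ordS_bij.
have mrot : measurable_fun setT rot.
  by apply: measurable_rV => i; under eq_fun do rewrite mxE; exact: measurable_coord.
have Srot u : S (rot u) = S u.
  rewrite /S /cyc_sum [RHS](reindex (@ordS N.+1)) /=; last by apply: onW_bij; exact: ordS_bij.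
  by apply: eq_bigr => i _; rewrite !mxE.
have Arot u : \1_A (rot u) = \1_A u :> R.
  rewrite !indicE (_ : (rot u \in A) = (u \in A))//.
  by apply/idP/idP => /set_mem h; apply/mem_set; move: h; rewrite /A /= Srot.
pose i0 : 'I_N.+1 := ord0; pose i1 := ordS i0.
pose X (u : Om) := if 0 < S u then (Z (u ord0 i1)).1 else (Z (u ord0 i0)).1.
pose Y (u : Om) := (Z (u ord0 i0)).2.
have mXX : measurable_fun setT X.
  apply: measurable_fun_ifT => //.
  by apply: measurable_fun_ltr => //; exact: measurable_cst.
have l1 i : image_law (fun u : Om => Z (u ord0 i)) P g.
  by apply: image_law_comp lZ => //; exact: samples_coord.
have LX i : P.-L1 (fun u : Om => sqnorm (Z (u ord0 i)).1).
  exact: (image_law_L1 (mZi i) (l1 i) (measurable_sqn measurable_fst)).1 (plan_L1_fst g).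
have LY i : P.-L1 (fun u : Om => sqnorm (Z (u ord0 i)).2).
  exact: (image_law_L1 (mZi i) (l1 i) (measurable_sqn measurable_snd)).1 (plan_L1_snd g).
have LXX : P.-L1 (fun u : Om => sqnorm (X u)).
  apply: (@L1_le _ _ _ P _ (fun u : Om => sqnorm (Z (u ord0 i1)).1 + sqnorm (Z (u ord0 i0)).1)).
  - exact: measurable_sqn.
  - move=> u; rewrite ger0_norm ?sqnorm_ge0// /X.
    by case: ifP => _; rewrite ?lerDl ?lerDr sqnorm_ge0.
  - exact: (L1D (LX i1) (LX i0)).
pose g' := plan_of mXX (mY i0) LXX (LY i0).
have lg' := plan_of_law mXX (mY i0) LXX (LY i0) : image_law (fun u : Om => (X u, Y u)) P g'.
have s2 : same_law (marg2 g) (marg2 g').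
  move=> B mB; rewrite /pushforward preimage_id.
  have h1 : image_law Y P (marg2 g) by exact: (image_law_comp measurable_snd (l1 i0) (marg2_law g)).
  have h2 : image_law Y P (marg2 g') by exact: (image_law_comp measurable_snd lg' (marg2_law g')).
  exact: image_law_unique h1 h2 mB.
have s1 : same_law (marg1 g) (marg1 g').
  move=> B mB; rewrite /pushforward preimage_id.
  have h1 : image_law (fun u : Om => (Z (u ord0 i0)).1) P (marg1 g) by exact: (image_law_comp measurable_fst (l1 i0) (marg1_law g)).
  have h2 : image_law X P (marg1 g') by exact: (image_law_comp measurable_fst lg' (marg1_law g')).
  rewrite -(h1 B mB) -(h2 B mB) /pushforward.
  pose B0 := (fun u : Om => (Z (u ord0 i0)).1) @^-1` B.
  pose B1 := (fun u : Om => (Z (u ord0 i1)).1) @^-1` B.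
  have mB0 : measurable B0 by rewrite -[X in measurable X]setTI; exact: mX.
  have mB1 : measurable B1 by rewrite -[X in measurable X]setTI; exact: mX.
  have e10 : P (B1 `&` A) = P (B0 `&` A).
    rewrite -(lrot _ (measurableI _ _ mB0 mA)) /pushforward; congr (P _).
    by apply/seteqP; split => u; rewrite /B0 /B1 /A /= Srot mxE.
  have split C : measurable C -> P C = (P (C `&` A) + P (C `\` A))%E.
    move=> mC; rewrite -{1}(setUIDK C A) measureU//.
    - exact: measurableI.
    - exact: measurableD.
    - by rewrite setDE setIACA setICr setI0.
  have -> : X @^-1` B = (B1 `&` A) `|` (B0 `\` A).
    apply/seteqP; split => u; rewrite /X /A /B1 /B0 /=.
      by case: ifP => Su h; [left|right]; split => //; rewrite Su.
    by move=> [[h ->]|[h /negP/negbTE ->]].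
  have U : P (B1 `&` A `|` B0 `\` A) = (P (B1 `&` A) + P (B0 `\` A))%E.
    rewrite measureU//; [exact: measurableI|exact: measurableD|].
    by rewrite setDE setIACA setICr setI0.
  by apply: (etrans (split _ mB0)); apply: (etrans _ (esym U)); rewrite e10.
have := ming s1 s2.
have mq : measurable_fun setT (fun z : E * E => sqnorm (z.1 - z.2)).
  by apply: measurable_sqn; apply: measurable_subv; [exact: measurable_fst|exact: measurable_snd].
rewrite (image_law_Rint (mZi i0) (l1 i0) mq).
have mXY : measurable_fun setT (fun u : Om => (X u, Y u)) by exact: (@measurable_pair_of R d _ _ X Y mXX (mY i0)).
rewrite (image_law_Rint mXY lg' mq).
move=> le.
have Ld i j : P.-L1 (fun u : Om => dot (Z (u ord0 i)).1 (Z (u ord0 j)).2).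
  apply: (@L1_le _ _ _ P _ (fun u : Om => sqnorm (Z (u ord0 i)).1 + sqnorm (Z (u ord0 j)).2)).
  - exact: measurable_dot.
  - move=> u; have := dot_young (Z (u ord0 i)).1 (Z (u ord0 j)).2 (@ltr01 R).
    rewrite invr1 !mul1r => h; have := normr_ge0 (dot (Z (u ord0 i)).1 (Z (u ord0 j)).2); lra.
  - exact: (L1D (LX i) (LY j)).
have LA (f : Om -> R) : P.-L1 f -> P.-L1 (fun u : Om => \1_A u * f u).
  move=> Lf; apply: (@L1_le _ _ _ P _ (fun u : Om => `|f u|)); last exact: L1_norm.
    by apply: measurable_funM; [exact: measurable_indic|exact: L1_measurable Lf].
  by move=> u; rewrite normrM indicE; case: (u \in A); rewrite ?normr1 ?mul1r// normr0 mul0r.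
pose D i (u : Om) : R := dot (Z (u ord0 (ordS i))).1 (Z (u ord0 i)).2 - dot (Z (u ord0 i)).1 (Z (u ord0 i)).2.
have LD i : P.-L1 (D i) by exact: (L1B (Ld (ordS i) i) (Ld i i)).
(* Rotation of the samples preserves their law and A, and carries the summand of rank i to the next
   one. *)
have Dinv i : \int[P]_u (\1_A u * D (ordS i) u) = \int[P]_u (\1_A u * D i u).
  have mD : measurable_fun setT (fun u : Om => \1_A u * D i u) by exact: L1_measurable (LA _ (LD i)).
  rewrite [RHS](image_law_Rint mrot lrot mD).
  by apply: eq_Rintegral => u _; rewrite Arot /D /rot !mxE.
have D0 : \int[P]_u (\1_A u * D i0 u) <= 0.
  have e u : sqnorm (X u - Y u) = sqnorm ((Z (u ord0 i0)).1 - (Z (u ord0 i0)).2)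
     - 2 * (\1_A u * D i0 u) + (sqnorm (X u) - sqnorm (Z (u ord0 i0)).1).
    rewrite !sqnormBE /X /Y /D indicE -/i1; case: ifPn => Su.
      have uA : u \in A by exact: mem_set.
      by rewrite uA mul1r; ring.
    have uA : (u \in A) = false by apply: memNset => /= h; rewrite h in Su.
    by rewrite uA mul0r; ring.
  have eY : \int[P]_u (sqnorm (X u) - sqnorm (Z (u ord0 i0)).1) = 0.
    rewrite RintB//; have ms := @measurable_sqnorm R d.
    have h1 : image_law (fun u : Om => (Z (u ord0 i0)).1) P (marg1 g) by exact: (image_law_comp measurable_fst (l1 i0) (marg1_law g)).
    have h2 : image_law X P (marg1 g') by exact: (image_law_comp measurable_fst lg' (marg1_law g')).
    rewrite -(image_law_Rint (mX i0) h1 ms) -(image_law_Rint mXX h2 ms).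
    rewrite (image_law_Rint (f := id) _ s1 ms)// subrr//.
  move: le; under [X in _ <= X]eq_Rintegral do rewrite e.
  have Ls : P.-L1 (fun u : Om => sqnorm ((Z (u ord0 i0)).1 - (Z (u ord0 i0)).2)).
    apply: (@L1_le _ _ _ P _ (fun u : Om => 2 * (sqnorm (Z (u ord0 i0)).1 + sqnorm (Z (u ord0 i0)).2))).
    - by apply: measurable_sqn; exact: measurable_subv.
    - by move=> u; rewrite ger0_norm ?sqnorm_ge0// sqnormB_le.
    - by apply: L1Z; exact: (L1D (LX i0) (LY i0)).
  have LAD := LA _ (LD i0).
  rewrite RintD; [|apply: L1B => //; exact: L1Z|exact: L1B].
  by rewrite eY addr0 RintB//; [rewrite RintZ//; lra|exact: L1Z].
have Dall (i : 'I_N.+1) : \int[P]_u (\1_A u * D i u) = \int[P]_u (\1_A u * D i0 u).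
  case: i => i; elim: i => [|i IH] iN; first by have -> : Ordinal iN = i0 by exact: val_inj.
  have iN' : (i < N.+1)%N by exact: ltnW.
  have -> : Ordinal iN = ordS (Ordinal iN') by apply: val_inj; rewrite /= modn_small.
  by rewrite Dinv; exact: IH.
have SD u : S u = \sum_i D i u by [].
have LS : P.-L1 S by apply: L1_sum => i _; exact: LD.
have SA0 : \int[P]_u (\1_A u * S u) <= 0.
  have -> : \int[P]_u (\1_A u * S u) = \int[P]_u (\sum_i \1_A u * D i u).
    by apply: eq_Rintegral => u _; rewrite SD mulr_sumr.
  rewrite Rint_sum; last by move=> i _; exact: LA.
  by rewrite big_seq; apply: sumr_le0 => i _; rewrite Dall.
have SA_ge0 u : 0 <= \1_A u * S u.
  rewrite indicE; have [/set_mem/ltW|_] := boolP (u \in A); first by rewrite mul1r.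
  by rewrite mul0r.
have LAS := LA _ LS.
have h0 := ge0_Rint_eq0 LAS SA_ge0 SA0.
apply: (ae_imp _ h0) => u h; rewrite leNgt; apply/negP => Su.
by move: h; rewrite indicE mem_set// mul1r => h'; move: Su; rewrite -/(S u) h' ltxx.
Qed.

End sampling.

(** Compactness applied to the constant sequence yields a random variable of law [g]. *)
Lemma plan_sampling (g : plan R d) : exists2 Z : measurableTypeR R -> E * E,
  measurable_fun setT Z & image_law Z (unif R) g.
Proof.
have [f _ [pi [X_ [Y_ [_ [_ [[mm _ l _ _] _]]]]]]] :=
  @plan_compact R d (fun=> g) (\int[g]_z sqnorm2 z) (fun=> lexx _).
have [mX mY] := mm 0%N.
by exists (fun u => (X_ 0%N u, Y_ 0%N u)); [exact: measurable_pair_of|exact: l].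
Qed.

Lemma ae_exists d' (T : measurableType d') (P : {measure set T -> \bar R}) (A : set T) (Q : T -> Prop) :
  measurable A -> P A != 0%E -> {ae P, forall x, Q x} -> exists2 x, A x & Q x.
Proof.
move=> mA PA [B [mB PB QB]]; apply: contrapT => h.
move/eqP: PA; apply; apply/eqP; rewrite eq_le measure_ge0 andbT -PB.
apply: le_measure; rewrite ?inE// => x Ax; apply: QB => /= Qx.
by apply: h; exists x.
Qed.

Section support.
Variable g : plan R d.

Let qbox (q : ('rV[rat]_d * 'rV[rat]_d) * ('rV[rat]_d * 'rV[rat]_d)) : set (E * E) :=
  obox (fun i => ratr (q.1.1 ord0 i)) (fun i => ratr (q.1.2 ord0 i)) `*`
  obox (fun i => ratr (q.2.1 ord0 i)) (fun i => ratr (q.2.2 ord0 i)).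

Let measurable_qbox q : measurable (qbox q).
Proof. by apply: measurableX; exact: measurable_obox. Qed.

(* The support of g, written with countably many neighbourhoods. *)
Definition charged : set (E * E) := [set z | forall q, qbox q z -> g (qbox q) != 0%E].

Lemma charged_ae : {ae g, forall z, charged z}.
Proof.
have := @ae_foralln _ _ _ g (fun n z =>
  if (unpickle n : option (('rV[rat]_d * 'rV[rat]_d) * ('rV[rat]_d * 'rV[rat]_d))) is Some q
  then qbox q z -> g (qbox q) != 0%E else True).
move=> /(_ _)/(ae_imp _); apply.
  by move=> z h q; have := h (pickle q); rewrite pickleK.
move=> n; case: unpickle => [q|]; last exact: aeW.
have [g0|g0] := eqVneq (g (qbox q)) 0%E; last exact: aeW.
exists (qbox q); split => // z /= h; apply: contrapT => nz; apply: h.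
by move=> /nz.
Qed.

Lemma charged_nbhs (z : E * E) (e : R) : charged z -> 0 < e -> exists B, [/\ measurable B,
  g B != 0%E & forall w, B w -> forall i, `|w.1 ord0 i - z.1 ord0 i| <= e /\
    `|w.2 ord0 i - z.2 ord0 i| <= e].
Proof.
move=> cz e0.
have pick (x : R) : {p : rat * rat | x - e < ratr p.1 < x /\ x < ratr p.2 < x + e}.
  apply/cid; have [q1] := @rat_in_itvoo R (x - e) x ltac:(by rewrite ltrBlDr ltrDl).
  have [q2] := @rat_in_itvoo R x (x + e) ltac:(by rewrite ltrDl).
  by rewrite !in_itv/= => h2 h1; exists (q1, q2).
pose lo (x : E) : 'rV[rat]_d := \row_i (sval (pick (x ord0 i))).1.
pose hi (x : E) : 'rV[rat]_d := \row_i (sval (pick (x ord0 i))).2.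
pose q := ((lo z.1, hi z.1), (lo z.2, hi z.2)).
have loP (x : E) i : x ord0 i - e < ratr (lo x ord0 i) < x ord0 i.
  by rewrite mxE; have [] := svalP (pick (x ord0 i)).
have hiP (x : E) i : x ord0 i < ratr (hi x ord0 i) < x ord0 i + e.
  by rewrite mxE; have [] := svalP (pick (x ord0 i)).
exists (qbox q); split => //.
  apply: cz; split => i; rewrite /= in_itv/=.
    by have /andP[_ ->] := loP z.1 i; have /andP[-> _] := hiP z.1 i.
  by have /andP[_ ->] := loP z.2 i; have /andP[-> _] := hiP z.2 i.
have close (x y : E) : obox (fun i => ratr (lo x ord0 i)) (fun i => ratr (hi x ord0 i)) y ->
    forall i, `|y ord0 i - x ord0 i| <= e.
  move=> h i; have := h i; rewrite /= in_itv/= => /andP[h1 h2].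
  have /andP[h3 _] := loP x i; have /andP[_ h4] := hiP x i.
  by rewrite ler_norml; apply/andP; split; lra.
by move=> w [w1 w2] i; split; exact: close.
Qed.

(** Neighbourhoods of charged points have positive mass, so independent samples fall near all of
    them with positive probability; [cyc_sum_sampled] then holds arbitrarily close to [z], and
    continuity concludes. *)
Lemma charged_cyclically_monotone : minimal_cost g -> cyclically_monotone charged.
Proof.
move=> ming; have [Z mZ lZ] := plan_sampling g.
move=> [|N] z zS; first by rewrite /cyc_sum big_ord0.
have ae := cyc_sum_sampled mZ lZ ming N.
have pick (n : nat) : exists w : 'I_N.+1 -> E * E, cyc_sum w <= 0 /\
    forall i j, `|(w i).1 ord0 j - (z i).1 ord0 j| <= n.+1%:R^-1 /\
      `|(w i).2 ord0 j - (z i).2 ord0 j| <= n.+1%:R^-1.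
  have n0 : 0 < n.+1%:R^-1 :> R by rewrite invr_gt0.
  pose B i := sval (cid (charged_nbhs (zS i) n0)).
  have BP i := svalP (cid (charged_nbhs (zS i) n0)).
  have mB i : measurable (B i) by have [] := BP i.
  have mZB i : measurable (Z @^-1` B i) by rewrite -[X in measurable X]setTI; exact: mZ.
  have mZB' : measurable (box (fun i => Z @^-1` B i) : set 'rV[R]_N.+1) by exact: measurable_box.
  have nz : samples R N.+1 (box (fun i => Z @^-1` B i)) != 0%E.
    rewrite samples_box//.
    have -> : (\prod_(i < N.+1) unif R (Z @^-1` B i))%E = (\prod_(i < N.+1) fine (g (B i)))%:E.
      rewrite -prodEFin; apply: eq_bigr => i _.
      by rewrite (lZ _ (mB i) : unif R (Z @^-1` B i) = _) fineK// fin_num_measure.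
    rewrite eqe gt_eqF// prodr_gt0// => i _.
    have [_ gB _] := BP i; rewrite fine_gt0// lt0e gB measure_ge0/=.
    by rewrite (le_lt_trans (probability_le1 _ (mB i)))// ltry.
  have [u Au Qu] := ae_exists mZB' nz ae.
  exists (fun i => Z (u ord0 i)); split => // i j.
  by have [_ _] := BP i; apply; exact: Au.
pose w n := sval (cid (pick n)).
have wP n := svalP (cid (pick n)).
have cw (i : 'I_N.+1) : (fun n => (w n i).1) @ \oo --> (z i).1 /\ (fun n => (w n i).2) @ \oo --> (z i).2.
  split; apply: cvg_rV => j; apply/cvgrPdist_le => e e0; near=> n.
    have [h _] := (wP n).2 i j; rewrite distrC (le_trans h)//.
    by apply: ltW; near: n; exact: near_infty_natSinv_lt (PosNum e0).
  have [_ h] := (wP n).2 i j; rewrite distrC (le_trans h)//.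
  by apply: ltW; near: n; exact: near_infty_natSinv_lt (PosNum e0).
have c : (fun n => cyc_sum (w n)) @ \oo --> cyc_sum z.
  apply: cvg_sumr => i _.
  have cd (u v : nat -> E) a b : u @ \oo --> a -> v @ \oo --> b -> (fun n => dot (u n) (v n)) @ \oo --> dot a b.
    by move=> ua vb; apply: cvg_sumr => j _; apply: cvgM; exact: cvg_rV_coord.
  by apply: cvgB; apply: cd; first [exact: (cw _).1|exact: (cw _).2].
apply: (cvgr_le_bound c).
by apply: nearW => n; have [] := wP n.
Unshelve. all: by end_near. Qed.

End support.
End cyclical_monotonicity.
Lemma continuous_coord (R : realType) n (i : 'I_n) :
  continuous (fun x : 'rV[R]_n => x ord0 i).
Proof. by move=> x; exact: coord_continuous. Qed.

Lemma continuous_subv (R : realType) (T : topologicalType) n (f g : T -> 'rV[R]_n) :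
  continuous f -> continuous g -> continuous (fun t => f t - g t).
Proof.
move=> cf cg; apply: continuous_rV => i t; under eq_fun do rewrite !mxE.
have ci (h : T -> 'rV[R]_n) : continuous h -> continuous (fun t => h t ord0 i).
  by move=> ch s; exact: (continuous_comp (ch s) (@continuous_coord R n i _)).
by apply: cvgB; [exact: (ci _ cf)|exact: (ci _ cg)].
Qed.

(** * Convex potentials and resolvents *)

Section convex.
Context (R : realType) (d : nat).
Local Notation E := 'rV[R]_d.
Implicit Types (phi : E -> R) (x y p w c : E).

Definition subgrad phi x p : Prop := forall w, phi x + dot p (w - x) <= phi w.
Definition convexf phi : Prop := forall x y t, 0 <= t <= 1 ->
  phi (x + t *: (y - x)) <= phi x + t * (phi y - phi x).
Definition lipf (M : R) phi : Prop := forall x y, phi y - phi x <= M * enorm (y - x).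

Lemma subgrad_mono phi x x' p p' : subgrad phi x p -> subgrad phi x' p' ->
  0 <= dot (p - p') (x - x').
Proof.
move=> h h'; have := h x'; have := h' x.
by rewrite !(dotBl, dotBr); lra.
Qed.

Lemma subgrad_enorm phi M x p : 0 <= M -> lipf M phi -> subgrad phi x p -> enorm p <= M.
Proof.
move=> M0 lip h; have := h (x + p); have := lip x (x + p).
have -> : x + p - x = p by rewrite addrC addKr.
move=> h1; have -> : dot p p = enorm p ^+ 2 by rewrite sqr_enorm.
move=> h2; have h3 : enorm p ^+ 2 <= M * enorm p by lra.
have [p0|p0] := leP (enorm p) 0; first exact: le_trans p0 M0.
by rewrite -(ler_pM2r p0) -expr2.
Qed.

Lemma lipf_continuous M phi : 0 <= M -> lipf M phi -> continuous phi.
Proof.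
move=> M0 lip x; apply/(@cvgrPdist_le _ _ _ _ (nbhs_filter x)) => e e0.
have c0 : (fun y : E => enorm (y - x)) @ x --> (0 : R).
  rewrite -[X in _ --> X](_ : enorm (x - x) = 0); last by rewrite subrr /enorm sqnorm0 sqrtr0.
  have cs : continuous (fun y : E => y - x).
    by apply: continuous_subv; [move=> y; exact: cvg_id|exact: cst_continuous].
  exact: (continuous_comp (cs x) (@continuous_enorm R d _)).
have M1 : 0 < M + 1 by rewrite ltr_wpDl.
near=> y.
have yx : enorm (y - x) <= e / (M + 1).
  by near: y; apply: (cvgr_le _ c0); rewrite divr_gt0.
have b : M * enorm (y - x) <= e.
  apply: (@le_trans _ _ (M * (e / (M + 1)))); first by rewrite ler_wpM2l.
  by rewrite mulrA ler_pdivrMr// mulrDr mulr1 mulrC lerDl ltW.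
have h1 := lip x y; have h2 := lip y x.
have h3 : enorm (x - y) = enorm (y - x) by exact: enormBC.
rewrite ler_norml; rewrite h3 in h2; apply/andP; split; lra.
Unshelve. all: by end_near. Qed.

Section rockafellar.
Variables (S : set (E * E)) (M : R).
Hypotheses (cm : cyclically_monotone S) (M0 : 0 <= M).
Let SM (z : E * E) : Prop := S z /\ enorm z.2 <= M.

(** An affine function of x whose slope is the second component of the last pair; Rockafellar's
    potential is the supremum over chains with a fixed start. *)
Fixpoint chain (z : E * E) (s : seq (E * E)) (x : E) : R :=
  if s is z' :: s' then dot (z'.1 - z.1) z.2 + chain z' s' x
  else dot (x - z.1) z.2.

Let all_SM (s : seq (E * E)) : Prop := forall z, z \in s -> SM z.

Lemma chain_lip z s x y : SM z -> all_SM s ->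
  chain z s y - chain z s x <= M * enorm (y - x).
Proof.
elim: s z => [|z' s IH] z Sz Ss /=.
  rewrite -dotBl opprB addrA subrK; apply: le_trans (ler_norm _) _.
  by rewrite (le_trans (dot_enorm _ _))// mulrC ler_wpM2r ?enorm_ge0//; have [] := Sz.
rewrite opprD addrACA subrr add0r; apply: IH; first by apply: Ss; rewrite inE eqxx.
by move=> w ws; apply: Ss; rewrite inE ws orbT.
Qed.

Lemma chain_affine z s x y t :
  chain z s (x + t *: (y - x)) = chain z s x + t * (chain z s y - chain z s x).
Proof.
elim: s z => [|z' s IH] z /=; last by rewrite IH; ring.
by rewrite !(dotDl, dotBl, dotZl, dotNl); ring.
Qed.

Lemma chain_rcons z (s : seq (E * E)) (w : E * E) x : chain z (rcons s w) x = chain z s w.1 + dot (x - w.1) w.2.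
Proof. by elim: s z => [|z' s IH] z //=; rewrite IH addrA. Qed.

Lemma chain_sum z0 z s x : chain z s x =
  \sum_(i < size s) dot ((nth z0 s i).1 - (nth z0 (z :: s) i).1) (nth z0 (z :: s) i).2
  + dot (x - (last z s).1) (last z s).2.
Proof.
elim: s z => [|z' s IH] z /=; first by rewrite big_ord0 add0r.
by rewrite big_ord_recl /= IH addrA.
Qed.

(** A chain evaluated at its own starting point is a cyclic sum. *)
Lemma chain_closed z s : SM z -> all_SM s -> chain z s z.1 <= 0.
Proof.
move=> Sz Ss.
have := cm (N := (size s).+1) (z := fun i => nth z (z :: s) i) _.
have -> : cyc_sum (fun i : 'I_(size s).+1 => nth z (z :: s) i) = chain z s z.1.
  rewrite /cyc_sum (chain_sum z) big_ord_recr /=; congr (_ + _).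
    by apply: eq_bigr => i _; rewrite dotBl /= modn_small ?ltnS ?ltn_ord.
  by rewrite /ordS /= modnn /= dotBl (last_nth z).
apply=> i; case: i => [[|i]] /= ilt; first by have [] := Sz.
by have [] := Ss (nth z s i) (mem_nth _ ilt).
Qed.

(* Rockafellar's potential, restricted to slopes of norm at most M so that it
   is finite everywhere. *)
Lemma rockafellar : exists phi, [/\ convexf phi, lipf M phi &
  forall z, S z -> enorm z.2 <= M -> subgrad phi z.1 z.2].
Proof.
have [[z0 Sz0]|ne] := pselect (exists z0, SM z0); last first.
  exists (fun=> 0); split.
  - by move=> x y t _; rewrite subrr mulr0 addr0.
  - by move=> x y; rewrite /= subr0; apply: mulr_ge0 => //; exact: enorm_ge0.
  - by move=> z Sz Mz; exfalso; apply: ne; exists z.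
pose C x : set R := [set chain z0 s x | s in all_SM].
have supC x : has_sup (C x).
  split; first by exists (chain z0 [::] x); exists [::].
  exists (M * enorm (x - z0.1)) => _ [s Ss <-].
  by have := chain_lip z0.1 x Sz0 Ss; have := chain_closed Sz0 Ss; lra.
pose phi x := sup (C x).
have phi_ge s x : all_SM s -> chain z0 s x <= phi x.
  by move=> Ss; apply: ub_le_sup; [exact: (supC x).2|exists s].
have phi_le x (b : R) : (forall s, all_SM s -> chain z0 s x <= b) -> phi x <= b.
  by move=> h; apply: ge_sup; [exact: (supC x).1|move=> _ [s Ss <-]; exact: h].
exists phi; split.
- move=> x y t /andP[t0 t1]; apply: phi_le => s Ss; rewrite chain_affine.
  have := phi_ge s x Ss; have := phi_ge s y Ss.
  move: (chain z0 s x) (chain z0 s y) (phi x) (phi y) => a b p q; nra.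
- move=> x y; rewrite lerBlDr; apply: phi_le => s Ss.
  by have := phi_ge s x Ss; have := chain_lip x y Sz0 Ss; lra.
- move=> z Sz Mz w; rewrite -lerBrDr; apply: phi_le => s Ss.
  rewrite lerBrDr dotC -chain_rcons; apply: phi_ge => z'.
  by rewrite mem_rcons inE => /predU1P[->|/Ss].
Qed.

End rockafellar.

Section prox.
Variables (phi : E -> R) (M : R).
Hypotheses (cphi : convexf phi) (M0 : 0 <= M) (lip : lipf M phi).

(** The usual proximal functional for [phi] tilted by the linear form c; the tilt makes the
    subgradients nearest to c, instead of those of least norm, appear in the limit. *)
Definition prox_fun c (tau : R) x z : R := phi z - dot c z + (2 * tau)^-1 * sqnorm (x - z).
Definition prox c (tau : R) x : E :=
  xget 0 [set z | forall w, prox_fun c tau x z <= prox_fun c tau x w].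
(** The Yosida approximation of the tilted potential, shifted back by c: a subgradient of [phi] at
    the proximal point. *)
Definition resolv c (tau : R) x : E := tau^-1 *: (x - prox c tau x) + c.

Lemma prox_min c tau x : 0 < tau ->
  forall w, prox_fun c tau x (prox c tau x) <= prox_fun c tau x w.
Proof.
move=> tau0.
suff [z hz] : exists z, forall w, prox_fun c tau x z <= prox_fun c tau x w.
  by have := xgetPex (0 : E) (ex_intro (fun z => forall w, prox_fun c tau x z <= prox_fun c tau x w) z hz).
(* Beyond this distance from x the quadratic term exceeds what [phi] and the tilt can gain, so a
   minimiser over the compact cube is a global one. *)
pose r := 2 * tau * (M + enorm c).
have r0 : 0 <= r by rewrite !mulr_ge0 ?addr_ge0 ?enorm_ge0// ltW.
pose K : set E := [set v | forall i, `[x ord0 i - r, x ord0 i + r]%classic (v ord0 i)].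
have cK : compact K.
  by apply: (@rV_compact R d (fun i => `[x ord0 i - r, x ord0 i + r]%classic)) => i; exact: segment_compact.
have Kx : K x by move=> i; rewrite /= in_itv/= lerBlDr !lerDl r0.
have cF : continuous (prox_fun c tau x).
  have cp := lipf_continuous M0 lip.
  have c1 : continuous (fun z : E => dot c z).
    by apply: continuous_dot; [exact: cst_continuous|move=> z; exact: cvg_id].
  have c2 : continuous (fun z : E => sqnorm (x - z)).
    have c3 : continuous (fun z : E => x - z).
      by apply: continuous_subv; [exact: cst_continuous|move=> z; exact: cvg_id].
    by move=> z; exact: (continuous_comp (c3 z) (@continuous_sqnorm R d _)).
  move=> z; apply: (@cvgD _ _ _ _ (nbhs_filter z)).
    by apply: (@cvgB _ _ _ _ (nbhs_filter z)); [exact: cp|exact: c1].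
  by apply: cvgMr; exact: c2.
have [z Kz hz] := @EVT_min_rV R d (prox_fun c tau x) K (ex_intro _ x Kx) cK (continuous_subspaceT cF).
exists z => w; have [Kw|nKw] := pselect (K w); first by apply: hz; exact: mem_set.
apply: (le_trans (hz x (mem_set Kx))).
have rw : r < enorm (x - w).
  have /existsNP[i /= /negP hi] := nKw; apply: lt_le_trans (coord_le_enorm (x - w) i).
  move: hi; rewrite in_itv/= !mxE negb_and -!ltNge => /orP[] h; rewrite ltr_normr; apply/orP; [left|right]; lra.
rewrite /prox_fun subrr sqnorm0 mulr0 addr0.
have h1 := lip w x.
have h2 : dot c w - dot c x <= enorm c * enorm (x - w).
  by rewrite -dotBr enormBC (le_trans (ler_norm _))// dot_enorm.
have h3 : (M + enorm c) * enorm (x - w) <= (2 * tau)^-1 * sqnorm (x - w).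
  rewrite -sqr_enorm expr2 mulrA ler_wpM2r ?enorm_ge0//.
  rewrite mulrC ler_pdivlMr ?mulr_gt0// mulrC; exact: ltW.
by rewrite mulrDl in h3; lra.
Qed.

Lemma prox_resolv c tau x : 0 < tau -> x - prox c tau x = tau *: (resolv c tau x - c).
Proof. by move=> tau0; rewrite /resolv addrK scalerA divff ?scale1r// gt_eqF. Qed.

Lemma resolv_subgrad c tau x : 0 < tau -> subgrad phi (prox c tau x) (resolv c tau x).
Proof.
move=> tau0 w; set J := prox c tau x; set q := resolv c tau x.
have xJ : x - J = tau *: (q - c) by exact: prox_resolv.
pose A := phi w - phi J - dot q (w - J).
suff : 0 <= A by rewrite /A; lra.
(* Minimality is compared along the segment from J to w; the quadratic error is of order t and
   vanishes as t tends to 0. *)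
have key t : 0 < t -> t <= 1 -> - ((2 * tau)^-1 * sqnorm (w - J) * t) <= A.
  move=> t0 t1; have := prox_min c x tau0 (J + t *: (w - J)); rewrite -/J /prox_fun.
  have -> : x - (J + t *: (w - J)) = (x - J) - t *: (w - J) by rewrite opprD addrA.
  rewrite [sqnorm (_ - t *: _)]sqnormBE sqnormZ dotZr {3}xJ dotZl.
  have := cphi J w (_ : 0 <= t <= 1); rewrite (ltW t0) t1 => /(_ isT).
  rewrite dotDr dotZr /A dotBl.
  have tt : (2 * tau)^-1 * (2 * tau) = 1 by rewrite mulVf// mulf_neq0 ?gt_eqF.
  move: (phi (J + _)) (phi w) (phi J) (dot c (w - J)) (dot q _) (sqnorm (w - J)) (sqnorm _) (dot c J) => a b j e f g h l.
  move=> h1 h2.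
  have e1 : (2 * tau)^-1 * (h - 2 * (t * (tau * (f - e))) + t ^+ 2 * g) =
     (2 * tau)^-1 * h - t * (f - e) + (2 * tau)^-1 * g * t * t.
    transitivity ((2 * tau)^-1 * h - ((2 * tau)^-1 * (2 * tau)) * (t * (f - e)) + (2 * tau)^-1 * g * t * t); first by ring.
    by rewrite tt mul1r.
  rewrite e1 in h2.
  have : 0 <= t * (b - j - f + (2 * tau)^-1 * g * t) by nra.
  by rewrite pmulr_rge0//; lra.
apply/ler_addgt0Pr => e e0; rewrite -lerBlDr sub0r.
pose g := (2 * tau)^-1 * sqnorm (w - J).
have g0 : 0 <= g by rewrite mulr_ge0 ?sqnorm_ge0// invr_ge0 mulr_ge0// ltW.
pose t := Num.min 1 (e / (g + 1)).
have t0 : 0 < t by rewrite lt_min ltr01 divr_gt0// ltr_wpDl.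
have t1 : t <= 1 by rewrite ge_min lexx.
apply: le_trans (key t t0 t1); rewrite lerN2 -/g.
apply: (@le_trans _ _ (g * (e / (g + 1)))).
  by rewrite ler_wpM2l// ge_min lexx orbT.
by rewrite mulrA ler_pdivrMr ?ltr_wpDl// mulrDr mulr1 mulrC lerDl ltW.
Qed.

(** Monotonicity of the subdifferential between the two proximal points; the tilt cancels in the
    difference, leaving cocoercivity. *)
Lemma resolv_monotone c tau x x' : 0 < tau ->
  tau * sqnorm (resolv c tau x - resolv c tau x') <=
  dot (resolv c tau x - resolv c tau x') (x - x').
Proof.
move=> tau0; have := subgrad_mono (resolv_subgrad c x tau0) (resolv_subgrad c x' tau0).
have -> : prox c tau x = x - tau *: (resolv c tau x - c).
  by rewrite -prox_resolv// opprB addrC subrK.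
have -> : prox c tau x' = x' - tau *: (resolv c tau x' - c).
  by rewrite -prox_resolv// opprB addrC subrK.
move: (resolv c tau x) (resolv c tau x') => q q'.
by rewrite /sqnorm !(dotBl, dotBr, dotZr, dotZl); lra.
Qed.

Lemma resolv_lip c tau x x' : 0 < tau ->
  tau * enorm (resolv c tau x - resolv c tau x') <= enorm (x - x').
Proof.
move=> tau0; have h := resolv_monotone c x x' tau0.
set q := resolv c tau x - resolv c tau x' in h *.
have h2 := le_trans (ler_norm _) (dot_enorm q (x - x')).
have [q0|q0] := leP (enorm q) 0.
  have -> : enorm q = 0 by apply/eqP; rewrite eq_le q0 enorm_ge0.
  by rewrite mulr0 enorm_ge0.
rewrite -(ler_pM2r q0) [leRHS]mulrC; apply: le_trans h2; apply: le_trans h.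
by rewrite -sqr_enorm expr2 mulrA.
Qed.

Lemma resolv_enorm c tau x : 0 < tau -> enorm (resolv c tau x) <= M.
Proof. by move=> tau0; apply: subgrad_enorm M0 lip (resolv_subgrad c x tau0). Qed.

Lemma resolv_closer c tau x y : 0 < tau -> subgrad phi x y ->
  sqnorm (resolv c tau x - c) <= sqnorm (y - c).
Proof.
move=> tau0 h; have := subgrad_mono h (resolv_subgrad c x tau0).
rewrite prox_resolv// dotZr pmulr_rge0//.
have -> : y - resolv c tau x = (y - c) - (resolv c tau x - c) by rewrite opprB addrA subrK.
move: (y - c) (resolv c tau x - c) => a b; rewrite dotBl -/(sqnorm b) => h1.
have := sqnorm_ge0 (a - b); rewrite sqnormBE; lra.
Qed.

(** As tau decreases the distance to c increases, and its increments control those of the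
    resolvents. Being bounded, it makes them a Cauchy sequence. *)
Lemma resolv_nested c tau sigma x : 0 < tau -> tau <= sigma ->
  sqnorm (resolv c tau x - resolv c sigma x) <=
  sqnorm (resolv c tau x - c) - sqnorm (resolv c sigma x - c).
Proof.
move=> tau0 ts; have sig0 := lt_le_trans tau0 ts.
have [<-|n] := eqVneq tau sigma; first by rewrite !subrr sqnorm0.
have := subgrad_mono (resolv_subgrad c x tau0) (resolv_subgrad c x sig0).
have -> : prox c tau x - prox c sigma x = (x - prox c sigma x) - (x - prox c tau x).
  by apply/rowP => i; rewrite !mxE; ring.
rewrite !prox_resolv//.
have -> : resolv c tau x - resolv c sigma x = (resolv c tau x - c) - (resolv c sigma x - c).
  by rewrite opprB addrA subrK.
move: (resolv c tau x - c) (resolv c sigma x - c) => a b.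
rewrite sqnormBE !(dotBl, dotBr, dotZr) -!/(sqnorm _) (dotC b a) => h.
have h2 := sqnorm_ge0 (a - b); rewrite sqnormBE in h2.
have st : 0 < sigma - tau by rewrite subr_gt0 lt_neqAle n.
have : 0 <= (sigma - tau) * (dot a b - sqnorm b) by nra.
by rewrite pmulr_rge0//; lra.
Qed.

Definition tau_ (k : nat) : R := k.+1%:R^-1.

Lemma tau_gt0 k : 0 < tau_ k.
Proof. by rewrite invr_gt0. Qed.

Lemma tau_le k l : (k <= l)%N -> tau_ l <= tau_ k.
Proof. by move=> kl; rewrite /tau_ lef_pV2 ?posrE// ler_nat. Qed.

Lemma cvg_of_increments (u n : nat -> R) (B : R) : (forall k, n k <= B) ->
  (forall k l, (k <= l)%N -> (u l - u k) ^+ 2 <= n l - n k) -> cvgn u.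
Proof.
move=> nB h.
have ndn : nondecreasing_seq n.
  by move=> k l kl; rewrite -subr_ge0 (le_trans _ (h k l kl))// sqr_ge0.
have cn : cvgn n.
  by apply: nondecreasing_is_cvgn => //; exists B => _ [k _ <-].
apply/cauchy_cvgP/cauchy_ballP => e e0.
have e2 : 0 < (e / 2) ^+ 2 by rewrite exprn_gt0// divr_gt0.
have /cvgrPdist_lt/(_ _ e2)[K _ hK] := cn.
have close l : (K <= l)%N -> `|u l - u K| < e / 2.
  move=> Kl; rewrite -(ltr_pXn2r (_ : (0 < 2)%N)) ?nnegrE ?divr_ge0 ?(ltW e0)//.
  rewrite real_normK ?num_real//; apply: le_lt_trans (h _ _ Kl) _.
  have := hK K (leqnn K); rewrite ger0_norm; last first.
    by rewrite subr_ge0; exact: nondecreasing_cvgn_le.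
  apply: le_lt_trans; rewrite lerD2r; exact: nondecreasing_cvgn_le.
exists ([set y | `|y - u K| < e / 2], [set y | `|y - u K| < e / 2]).
  by split; exists K => // l; exact: close.
move=> [y z] /= [hy hz].
by rewrite /ball/= -(subrKA (u K)) (le_lt_trans (ler_normD _ _))// [ltRHS]splitr ltrD// distrC.
Qed.

Lemma resolv_cvgn c x i : cvgn (fun k => resolv c (tau_ k) x ord0 i).
Proof.
apply: (@cvg_of_increments _ (fun k => sqnorm (resolv c (tau_ k) x - c)) (2 * (M ^+ 2 + sqnorm c))).
  move=> k; apply: (le_trans (sqnormB_le _ _)); rewrite ler_wpM2l// lerD2r.
  by rewrite -sqr_enorm ler_pXn2r ?nnegrE ?enorm_ge0//; apply: resolv_enorm; exact: tau_gt0.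
move=> k l kl; apply: le_trans (resolv_nested c x (tau_gt0 l) (tau_le kl)).
by have := sqr_coord_le (resolv c (tau_ l) x - resolv c (tau_ k) x) i; rewrite !mxE.
Qed.

(* The element of the subdifferential at x that is nearest to c: resolvents
   converge to it as [tau] tends to 0. *)
Definition nearest c x : E := \row_i limn (fun k => resolv c (tau_ k) x ord0 i).

Lemma resolv_cvg c x : (fun k => resolv c (tau_ k) x) @ \oo --> nearest c x.
Proof. by apply: cvg_rV => i; rewrite mxE; exact: resolv_cvgn. Qed.

Lemma cvg_dot (u v : nat -> E) a b : u @ \oo --> a -> v @ \oo --> b ->
  (fun n => dot (u n) (v n)) @ \oo --> dot a b.
Proof. by move=> ua vb; apply: cvg_sumr => j _; apply: cvgM; exact: cvg_rV_coord. Qed.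

Lemma tau_cvg0 : tau_ @ \oo --> (0 : R).
Proof. exact: cvg_harmonic. Qed.

Lemma prox_cvg c x : (fun k => prox c (tau_ k) x) @ \oo --> x.
Proof.
apply: cvg_rV => i.
have e k : prox c (tau_ k) x ord0 i = x ord0 i - tau_ k * (resolv c (tau_ k) x ord0 i - c ord0 i).
  have := congr1 (fun v : E => v ord0 i) (prox_resolv c x (tau_gt0 k)).
  by rewrite /= !mxE; lra.
have c0 : (fun k => x ord0 i - tau_ k * (resolv c (tau_ k) x ord0 i - c ord0 i)) @ \oo -->
    x ord0 i - 0 * (nearest c x ord0 i - c ord0 i).
  apply: cvgB; first exact: cvg_cst.
  apply: cvgM; first exact: tau_cvg0.
  by apply: cvgB; [apply: cvg_rV_coord; exact: resolv_cvg|exact: cvg_cst].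
rewrite mul0r subr0 in c0.
by under eq_fun do rewrite e.
Qed.

Lemma nearest_subgrad c x : subgrad phi x (nearest c x).
Proof.
move=> w.
have c1 : (fun k => phi (prox c (tau_ k) x) + dot (resolv c (tau_ k) x) (w - prox c (tau_ k) x)) @ \oo
    --> phi x + dot (nearest c x) (w - x).
  apply: cvgD.
    apply: (@continuous_cvg _ _ _ _ _ _ phi); last exact: prox_cvg.
    exact: lipf_continuous M0 lip x.
  apply: cvg_dot; first exact: resolv_cvg.
  by apply: cvgB; [exact: cvg_cst|exact: prox_cvg].
apply: (cvgr_le_bound c1).
by apply: nearW => k; apply: resolv_subgrad; exact: tau_gt0.
Qed.

Lemma nearest_enorm c x : enorm (nearest c x) <= M.
Proof. exact: subgrad_enorm M0 lip (nearest_subgrad c x). Qed.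

Lemma nearest_closer c x y : subgrad phi x y -> sqnorm (nearest c x - c) <= sqnorm (y - c).
Proof.
move=> h.
have c1 : (fun k => sqnorm (resolv c (tau_ k) x - c)) @ \oo --> sqnorm (nearest c x - c).
  by apply: cvg_dot; apply: cvgB; first [exact: resolv_cvg|exact: cvg_cst].
apply: (cvgr_le_bound c1).
by apply: nearW => k; apply: resolv_closer => //; exact: tau_gt0.
Qed.

Lemma continuous_resolv c tau : 0 < tau -> continuous (resolv c tau).
Proof.
move=> tau0; apply: continuous_rV => i; apply: (@lipf_continuous tau^-1); first by rewrite invr_ge0 ltW.
move=> x y /=; rewrite ler_pdivlMl//.
apply: le_trans (resolv_lip c y x tau0); rewrite ler_wpM2l ?(ltW tau0)//.
apply: le_trans (coord_le_enorm _ i); rewrite !mxE; exact: ler_norm.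
Qed.

Lemma measurable_resolv c tau : 0 < tau -> measurable_fun setT (resolv c tau).
Proof. by move=> tau0; apply: continuous_measurable_rVv; exact: continuous_resolv. Qed.

Lemma measurable_nearest c : measurable_fun setT (nearest c).
Proof.
apply: measurable_rV => i.
apply: (@measurable_fun_cvg _ _ _ _ (fun k x => resolv c (tau_ k) x ord0 i)).
  by move=> k; apply: measurable_entry; apply: measurable_resolv; exact: tau_gt0.
by move=> x _; apply: cvg_rV_coord; exact: resolv_cvg.
Qed.

(* Moreau envelope; its gradient is [resolv c tau]. *)
Definition envelope c tau x : R := prox_fun c tau x (prox c tau x) + dot c x.

(** The proximal point of x competes in the minimisation at x'. *)
Lemma envelope_le c tau x x' : 0 < tau -> envelope c tau x' - envelope c tau x <=
  dot (resolv c tau x) (x' - x) + (2 * tau)^-1 * sqnorm (x' - x).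
Proof.
move=> tau0; have := prox_min c x' tau0 (prox c tau x).
rewrite /envelope; move: (prox_fun c tau x' (prox c tau x')) => F h.
suff : prox_fun c tau x' (prox c tau x) = prox_fun c tau x (prox c tau x) +
    dot (resolv c tau x - c) (x' - x) + (2 * tau)^-1 * sqnorm (x' - x).
  by move=> h2; rewrite h2 dotBl !dotBr in h; rewrite dotBr; lra.
rewrite /prox_fun; set J := prox c tau x.
have -> : x' - J = (x - J) + (x' - x) by apply/rowP => i; rewrite !mxE; ring.
rewrite sqnormDE (prox_resolv c x tau0) dotZl -/J.
have tt : (2 * tau)^-1 * (2 * tau) = 1 by rewrite mulVf// mulf_neq0 ?gt_eqF.
move: (sqnorm (tau *: _)) (sqnorm (x' - x)) (dot _ (x' - x)) (phi J - _) => q r p f.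
transitivity (f + (2 * tau)^-1 * q + ((2 * tau)^-1 * (2 * tau)) * p + (2 * tau)^-1 * r); first by ring.
by rewrite tt mul1r.
Qed.

Lemma envelope_ge c tau x x' : 0 < tau ->
  dot (resolv c tau x) (x' - x) - (2 * tau)^-1 * sqnorm (x' - x) <=
  envelope c tau x' - envelope c tau x.
Proof.
move=> tau0; have h1 := envelope_le c x' x tau0; have h2 := resolv_monotone c x' x tau0.
have h3 : 0 <= tau * sqnorm (resolv c tau x' - resolv c tau x).
  by rewrite mulr_ge0 ?sqnorm_ge0// ltW.
rewrite sqnormBC in h1; rewrite -(opprB x' x) dotNr in h1.
by rewrite dotBl in h2; lra.
Qed.

Lemma is_derive_envelope c tau x v : 0 < tau ->
  is_derive x v (envelope c tau : E -> R^o) (dot (resolv c tau x) v).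
Proof.
move=> tau0.
pose B := (2 * tau)^-1 * sqnorm v.
have B0 : 0 <= B by rewrite mulr_ge0 ?sqnorm_ge0// invr_ge0 mulr_ge0// ltW.
have cv : (fun h : R => h^-1 *: (((envelope c tau : E -> R^o) \o shift x) (h *: v) - envelope c tau x)) @ 0^' -->
    (dot (resolv c tau x) v : R^o).
  apply/cvgrPdist_le => e e0; near=> h.
  have h0 : h != 0 by near: h; exact: nbhs_dnbhs_neq.
  have hB : `|h| <= e / (B + 1).
    by near: h; apply: dnbhs0_le; rewrite divr_gt0// ltr_wpDl.
  rewrite /= [h *: v + x]addrC.
  have h1 := envelope_le c x (x + h *: v) tau0; have h2 := envelope_ge c x (x + h *: v) tau0.
  rewrite (addrC x) addrK dotZr sqnormZ in h1 h2.
  rewrite (addrC x).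
  have -> : dot (resolv c tau x) v = h^-1 * (h * dot (resolv c tau x) v) by rewrite mulrA mulVf// mul1r.
  rewrite [_ *: _]/(_ * _) -mulrBr normrM normfV ler_pdivrMl ?normr_gt0//.
  apply: (@le_trans _ _ (h ^+ 2 * B)).
    rewrite ler_norml /B; apply/andP; split; lra.
  rewrite -(real_normK (num_real h)) expr2 -mulrA ler_wpM2l//.
  apply: (@le_trans _ _ (e / (B + 1) * B)); first by rewrite ler_wpM2r.
  by rewrite mulrAC ler_pdivrMr ?ltr_wpDl// mulrDr mulr1 lerDl ltW.
by apply: DeriveDef; [apply/cvg_ex; eexists; exact: cv|exact: (cvg_lim (@Rhausdorff R) cv)].
Unshelve. all: by end_near. Qed.

End prox.
End convex.

(** * Tangency of the velocity plans *)

Section rational_points.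
Context (R : realType) (d : nat).
Local Notation E := 'rV[R]_d.

Definition ratv (n : nat) : E :=
  if (unpickle n : option 'rV[rat]_d) is Some q then \row_i ratr (q ord0 i) else 0.

Lemma ratv_dense (x : E) : exists u : nat -> nat, (fun k => ratv (u k)) @ \oo --> x.
Proof.
have pick (k : nat) (r : R) : {q : rat | r < ratr q < r + k.+1%:R^-1}.
  by apply/cid; have [|q] := @rat_in_itvoo R r (r + k.+1%:R^-1);
    [rewrite ltrDl invr_gt0|rewrite in_itv/=; exists q].
pose q k : 'rV[rat]_d := \row_i sval (pick k (x ord0 i)).
exists (fun k => pickle (q k)); apply: cvg_rV => i.
rewrite /ratv; under eq_fun do rewrite pickleK mxE.
have c0 : (fun k : nat => x ord0 i + k.+1%:R^-1) @ \oo --> x ord0 i.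
  by rewrite -[X in _ --> X]addr0; apply: cvgD; [exact: cvg_cst|exact: cvg_harmonic].
apply: (squeeze_cvgr _ (cvg_cst (x ord0 i)) c0); apply: nearW => k.
by have /andP[h1 h2] := svalP (pick k (x ord0 i)); rewrite mxE (ltW h1) (ltW h2).
Qed.

Lemma le_of_ratv (F : E -> R) (c : R) : continuous F -> (forall n, F (ratv n) <= c) ->
  forall x, F x <= c.
Proof.
move=> cF h x; have [u cu] := ratv_dense x.
have c1 : (fun k => F (ratv (u k))) @ \oo --> F x.
  by apply: (@continuous_cvg _ _ _ _ _ _ F); [exact: cF|exact: cu].
by apply: (cvgr_le_bound c1); apply: nearW.
Qed.

Lemma ratv_close (x : E) (e : R) : 0 < e -> exists n, sqnorm (ratv n - x) < e.
Proof.
move=> e0; have [u cu] := ratv_dense x.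
have c1 : (fun k => sqnorm (ratv (u k) - x)) @ \oo --> (0 : R).
  rewrite -[X in _ --> X](@dot0l R d (x - x)) -[X in dot X _](subrr x).
  by apply: cvg_dot; apply: cvgB; first [exact: cu|exact: cvg_cst].
have [N _ /(_ N (leqnn N)) hN] := cvgr_lt _ c1 _ e0.
by exists (u N).
Qed.

End rational_points.

Lemma dot_L1 (R : realType) n d (T : measurableType d) (m : {measure set T -> \bar R}) (A B : T -> 'rV[R]_n) :
  measurable_fun setT A -> measurable_fun setT B ->
  m.-L1 (fun w => sqnorm (A w)) -> m.-L1 (fun w => sqnorm (B w)) -> m.-L1 (fun w => dot (A w) (B w)).
Proof.
move=> mA mB LA LB; apply: (@L1_le _ _ _ m _ (fun w => sqnorm (A w) + sqnorm (B w))).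
- exact: measurable_dot.
- move=> w; have := dot_young (A w) (B w) (@ltr01 R); rewrite invr1 !mul1r.
  by have := normr_ge0 (dot (A w) (B w)); lra.
- exact: (L1D LA LB).
Qed.

Lemma sqnormB_L1 (R : realType) n d (T : measurableType d) (m : {measure set T -> \bar R}) (A B : T -> 'rV[R]_n) :
  measurable_fun setT A -> measurable_fun setT B ->
  m.-L1 (fun w => sqnorm (A w)) -> m.-L1 (fun w => sqnorm (B w)) -> m.-L1 (fun w => sqnorm (A w - B w)).
Proof.
move=> mA mB LA LB; apply: (@L1_le _ _ _ m _ (fun w => 2 * (sqnorm (A w) + sqnorm (B w)))).
- by apply: measurable_sqn; exact: measurable_subv.
- by move=> w; rewrite ger0_norm ?sqnorm_ge0//; exact: sqnormB_le.
- by apply: L1Z; exact: (L1D LA LB).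
Qed.

Lemma sqnormD_L1 (R : realType) n d (T : measurableType d) (m : {measure set T -> \bar R}) (A B : T -> 'rV[R]_n) :
  measurable_fun setT A -> measurable_fun setT B ->
  m.-L1 (fun w => sqnorm (A w)) -> m.-L1 (fun w => sqnorm (B w)) -> m.-L1 (fun w => sqnorm (A w + B w)).
Proof.
move=> mA mB LA LB; apply: (@L1_le _ _ _ m _ (fun w => 2 * (sqnorm (A w) + sqnorm (B w)))).
- by apply: measurable_sqn; exact: measurable_addv.
- by move=> w; rewrite ger0_norm ?sqnorm_ge0//; exact: sqnormD.
- by apply: L1Z; exact: (L1D LA LB).
Qed.

Lemma sqnormZ_L1 (R : realType) n d (T : measurableType d) (m : {measure set T -> \bar R}) (k : R) (A : T -> 'rV[R]_n) :
  m.-L1 (fun w => sqnorm (A w)) -> m.-L1 (fun w => sqnorm (k *: A w)).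
Proof. by move=> LA; rewrite (_ : (fun w => _) = fun w => k ^+ 2 * sqnorm (A w)); [exact: L1Z|apply/funext => w; rewrite sqnormZ]. Qed.

Lemma Rint_sqnormD (R : realType) n d (T : measurableType d) (m : {measure set T -> \bar R}) (A B : T -> 'rV[R]_n) :
  measurable_fun setT A -> measurable_fun setT B ->
  m.-L1 (fun w => sqnorm (A w)) -> m.-L1 (fun w => sqnorm (B w)) ->
  \int[m]_w sqnorm (A w + B w) = \int[m]_w sqnorm (A w) + 2 * \int[m]_w dot (A w) (B w) + \int[m]_w sqnorm (B w).
Proof.
move=> mA mB LA LB; have L := dot_L1 mA mB LA LB; have L2 := L1Z 2 L.
rewrite (_ : (fun w => sqnorm (A w + B w)) = (fun w => sqnorm (A w) + 2 * dot (A w) (B w) + sqnorm (B w))).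
  by rewrite RintD//; [rewrite RintD// RintZ|exact: (L1D LA L2)].
by apply/funext => w; rewrite sqnormDE.
Qed.

Lemma Rint_sqnormB (R : realType) n d (T : measurableType d) (m : {measure set T -> \bar R}) (A B : T -> 'rV[R]_n) :
  measurable_fun setT A -> measurable_fun setT B ->
  m.-L1 (fun w => sqnorm (A w)) -> m.-L1 (fun w => sqnorm (B w)) ->
  \int[m]_w sqnorm (A w - B w) = \int[m]_w sqnorm (A w) + \int[m]_w sqnorm (B w) - 2 * \int[m]_w dot (A w) (B w).
Proof.
move=> mA mB LA LB; have L2 := L1Z 2 (dot_L1 mA mB LA LB).
rewrite (_ : (fun w => sqnorm (A w - B w)) = (fun w => sqnorm (A w) + sqnorm (B w) - 2 * dot (A w) (B w))).
  by rewrite RintB ?RintD ?RintZ//; [exact: dot_L1|exact: (L1D LA LB)].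
by apply/funext => w; rewrite sqnormBE addrAC.
Qed.

Section subgradient_optimality.
Context (R : realType) (d : nat).
Local Notation E := 'rV[R]_d.
Context dT (T : measurableType dT) (P : probability T R) (X Z : T -> E).
Hypotheses (mX : measurable_fun setT X) (mZ : measurable_fun setT Z).
Variables (g : plan R d) (psi : E -> R) (K : R).
Hypotheses (lg : image_law (fun w => (X w, Z w)) P g) (cpsi : continuous psi)
  (psiK : forall x, `|psi x| <= K * (1 + sqnorm x))
  (sub : forall w, subgrad psi (X w) (Z w)).

(** The Legendre transform of [psi], computed over rational points so as to be measurable. *)
Let G (z : E) : \bar R := esups (fun n => (dot z (ratv R d n) - psi (ratv R d n))%:E) 0.

Let mG : measurable_fun setT G.
Proof.
apply: measurable_fun_esups => n; apply/measurable_EFinP; apply: measurable_funB.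
  by apply: measurable_dot => //; exact: measurable_cst.
exact: measurable_cst.
Qed.

Let G_ge n z : ((dot z (ratv R d n) - psi (ratv R d n))%:E <= G z)%E.
Proof. by apply: ereal_sup_ubound; exists n. Qed.

Let G_young x z : G z \is a fin_num -> dot x z <= psi x + fine (G z).
Proof.
move=> Gf; rewrite addrC -lerBlDr.
apply: (le_of_ratv (F := fun x => dot x z - psi x)).
  apply: continuous_addf; last exact: continuous_oppf.
  by apply: continuous_dot; [move=> y; exact: cvg_id|exact: cst_continuous].
by move=> n; rewrite -lee_fin fineK// dotC.
Qed.

Let G_XZ w : G (Z w) = (dot (X w) (Z w) - psi (X w))%:E.
Proof.
have le : (G (Z w) <= (dot (X w) (Z w) - psi (X w))%:E)%E.
  apply: ge_ereal_sup => _ [n _ <-]; rewrite lee_fin.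
  by have := sub w (ratv R d n); rewrite dotBr (dotC (X w)); lra.
have Gf : G (Z w) \is a fin_num.
  rewrite fin_numE; apply/andP; split; apply/negP => /eqP h; move: le (G_ge 0 (Z w)); by rewrite h.
apply/eqP; rewrite eq_le le /= -(fineK Gf) lee_fin.
by have := G_young (X w) Gf; lra.
Qed.

Let mGf : measurable [set z | G z \is a fin_num].
Proof.
rewrite -[X in measurable X]setTI; apply: (mG measurableT (Y := [set r | r \is a fin_num])).
rewrite (_ : [set r | _] = ~` [set +oo%E] `&` ~` [set -oo%E]).
  by apply: measurableI; apply: measurableC; exact: emeasurable_set1.
apply/seteqP; split => r /=.
  by rewrite fin_numE => /andP[/eqP h1 /eqP h2]; split.
by move=> [h1 h2]; rewrite fin_numE; apply/andP; split; apply/eqP.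
Qed.

(** The easy half of Kantorovich duality: Young's inequality for [psi] and its transform holds under
    any coupling and is an equality under [g]. *)
Lemma subgrad_optimal : optimal g.
Proof.
have l1 : image_law X P (marg1 g) by exact: (image_law_comp measurable_fst lg (marg1_law g)).
have l2 : image_law Z P (marg2 g) by exact: (image_law_comp measurable_snd lg (marg2_law g)).
have ms := @measurable_sqnorm R d.
have mpsi : measurable_fun setT psi by exact: continuous_measurable_rV.
have mGr : measurable_fun setT (fun z => fine (G z)).
  by apply: measurableT_comp mG; exact: fine_measurable.
have mXZ := @measurable_pair_of R d _ _ X Z mX mZ.
have mq : measurable_fun setT (fun z : E * E => sqnorm (z.1 - z.2)).
  by apply: measurable_sqn; apply: measurable_subv; [exact: measurable_fst|exact: measurable_snd].
have psiL (m : P2 R d) : m.-L1 psi.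
  apply: (@L1_le _ _ _ m _ (fun x => K * (1 + sqnorm x))) => //.
  by apply: L1Z; apply: L1D; [exact: L1_cst|exact: P2_L1].
have LX : P.-L1 (fun w => sqnorm (X w)) by exact: (image_law_L1 mX l1 ms).1 (P2_L1 _).
have LZ : P.-L1 (fun w => sqnorm (Z w)) by exact: (image_law_L1 mZ l2 ms).1 (P2_L1 _).
have LXZ := dot_L1 mX mZ LX LZ.
have LpX : P.-L1 (fun w => psi (X w)) by exact: (image_law_L1 mX l1 mpsi).1 (psiL _).
have GrE : (fun w => fine (G (Z w))) = (fun w => dot (X w) (Z w) - psi (X w)).
  by apply/funext => w; rewrite G_XZ.
have LG : (marg2 g).-L1 (fun z => fine (G z)).
  apply/(image_law_L1 mZ l2 mGr); rewrite (_ : _ \o _ = fun w => fine (G (Z w)))// GrE.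
  exact: (L1B LXZ LpX).
have aeG : {ae marg2 g, forall z, G z \is a fin_num}.
  apply/(image_law_ae mZ l2); last by apply: aeW => w; rewrite G_XZ.
  exact: mGf.
have cP := Rint_sqnormB mX mZ LX LZ; have LcP := sqnormB_L1 mX mZ LX LZ.
have gE : (\int[g]_z (sqnorm (z.1 - z.2))%:E)%E = (\int[P]_w sqnorm (X w - Z w))%:E.
  rewrite (image_law_ge0_integral mXZ lg); last 2 first.
  - exact/measurable_EFinP.
  - by move=> z; rewrite lee_fin sqnorm_ge0.
  by rewrite RintegralE.
rewrite /optimal gE; apply/eqP; rewrite eq_le; apply/andP; split; last first.
  by apply: (transport_cost_le (c := fun z : E * E => sqnorm (z.1 - z.2)) mX mZ l1 l2) => // z; exact: sqnorm_ge0.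
apply: le_ereal_inf_tmp => _ [k [k1 k2] <-].
have mf := @measurable_fst _ _ E E; have msn := @measurable_snd _ _ E E.
have L1k : k.-L1 (fun z : E * E => sqnorm z.1) by exact: (image_law_L1 mf k1 ms).1 (P2_L1 _).
have L2k : k.-L1 (fun z : E * E => sqnorm z.2) by exact: (image_law_L1 msn k2 ms).1 (P2_L1 _).
have ck := Rint_sqnormB mf msn L1k L2k; have Lck := sqnormB_L1 mf msn L1k L2k.
have Ldk := dot_L1 mf msn L1k L2k.
rewrite -RintegralE// lee_fin cP ck.
have -> : \int[k]_z sqnorm z.1 = \int[P]_w sqnorm (X w).
  by rewrite -(image_law_Rint mf k1 ms) (image_law_Rint mX l1 ms).
have -> : \int[k]_z sqnorm z.2 = \int[P]_w sqnorm (Z w).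
  by rewrite -(image_law_Rint msn k2 ms) (image_law_Rint mZ l2 ms).
have Lpk : k.-L1 (fun z : E * E => psi z.1) by exact: (image_law_L1 mf k1 mpsi).1 (psiL _).
have LGk : k.-L1 (fun z : E * E => fine (G z.2)) by exact: (image_law_L1 msn k2 mGr).1 LG.
have le : \int[k]_z dot z.1 z.2 <= \int[k]_z (psi z.1 + fine (G z.2)).
  apply: ae_le_Rint => //; first exact: (L1D Lpk LGk).
  apply: ae_imp ((image_law_ae msn k2 mGf).1 aeG) => z; exact: G_young.
rewrite RintD// -(image_law_Rint mf k1 mpsi) -(image_law_Rint msn k2 mGr) in le.
rewrite (image_law_Rint mX l1 mpsi) (image_law_Rint mZ l2 mGr) GrE RintB// in le.
by lra.
Qed.

End subgradient_optimality.

Section tangent.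
Context (R : realType) (d : nat).
Local Notation E := 'rV[R]_d.

Lemma Wfib_lt (g g' : plan R d) (th : probability (E * E * E)%type R) (e t : R) :
  Gamma g g' th -> 0 < e -> t < e ^+ 2 ->
  (\int[th]_w (sqnorm (w.1.2 - w.2))%:E <= t%:E)%E -> (Wfib g g' < e%:E)%E.
Proof.
move=> Gth e0 te th_t; rewrite /Wfib.
set I := ereal_inf _.
have It : (I <= t%:E)%E by apply: le_trans th_t; apply: ereal_inf_lbound; exists th.
have I0 : (0 <= I)%E.
  apply: le_ereal_inf_tmp => _ [k _ <-]; apply: integral_ge0 => w _.
  by rewrite lee_fin sqnorm_ge0.
case: I It I0 => [r| |]//; rewrite !lee_fin => rt r0.
rewrite poweR_EFin lte_fin powR12_sqrt//.
by rewrite -(@ltr_pXn2r _ 2)// ?nnegrE ?sqrtr_ge0 ?ltW// sqr_sqrtr// (le_lt_trans rt).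
Qed.

Section approximation.
Variables (phi : E -> R) (M : R) (del : R) (J : nat) (b c tau : R).
Hypotheses (cphi : convexf phi) (M0 : 0 <= M) (lip : lipf M phi)
  (b0 : 0 <= b) (c0 : 0 <= c) (tau0 : 0 < tau) (del0 : 0 < del).
Local Notation r := (ratv R d).

(** A measurable choice of slope at [z.1] close to [z.2]: the subgradient nearest to the last of the
    first n rational points whose squared distance to [z.2] is below del, and to the point of index
    0 by default. *)
Fixpoint select n (z : E * E) : E :=
  if n is m.+1 then
    if sqnorm (r m - z.2) < del then nearest phi (r m) z.1 else select m z
  else nearest phi (r 0) z.1.

Lemma measurable_select n : measurable_fun setT (select n).
Proof.
have mn c' : measurable_fun setT (fun z : E * E => nearest phi c' z.1).
  by apply: measurableT_comp measurable_fst; exact: measurable_nearest cphi M0 lip _.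
elim: n => [|n IH] /=; first exact: mn.
apply: measurable_fun_ifT.
- apply: measurable_fun_ltr; last exact: measurable_cst.
  by apply: measurable_sqn; apply: measurable_subv; [exact: measurable_cst|exact: measurable_snd].
- exact: mn.
- exact: IH.
Qed.

Lemma select_index n z : exists2 i, (i < n.+1)%N & select n z = nearest phi (r i) z.1.
Proof.
elim: n => [|n [i ilt IH]]; first by exists 0%N.
have -> : select n.+1 z =
  if sqnorm (r n - z.2) < del then nearest phi (r n) z.1 else select n z by [].
case: (_ < del); first by exists n; [exact: ltnW|reflexivity].
by exists i; [exact: ltnW|exact: IH].
Qed.

(** [z.2] is itself a subgradient, so the one nearest to a rational point is at least as close to
    that point; the factor 4 is the triangle inequality for squares. *)
Lemma select_close n z i : (i < n)%N -> sqnorm (r i - z.2) < del -> subgrad phi z.1 z.2 ->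
  sqnorm (select n z - z.2) <= 4 * del.
Proof.
elim: n => [//|n IH] /=; rewrite ltnS leq_eqVlt => iin hi sz.
have close k : sqnorm (r k - z.2) < del -> sqnorm (nearest phi (r k) z.1 - z.2) <= 4 * del.
  move=> hk; apply: (le_trans (sqnorm_triangle _ (r k) _)).
  have := nearest_closer cphi M0 lip (r k) sz; rewrite (sqnormBC z.2).
  by move: (sqnorm (nearest _ _ _ - _)) (sqnorm (r k - z.2)) hk => p q; lra.
case: ifPn => [|nc]; first exact: close.
case/predU1P: iin => [ein|]; first by rewrite ein (negbTE nc) in hi.
by move=> /IH; apply.
Qed.

(* As [tau] tends to 0 the resolvents tend to the [nearest] slopes, so the
   velocity tends to [c x - b (select J z)], which is close to [c x - b y].  For
   small [eta], [x + eta * approx_vel] is a subgradient of the potential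
   [approx_pot eta], which is convex: [slope_sum] is a sum of J subgradients of
   [phi], and the envelopes have Lipschitz gradients, absorbed by the quadratic
   term.  Hence the smoothed velocity is optimal up to time [eta]. *)
Definition slope_sum (z : E * E) : E := \sum_(i < J.+1) nearest phi (r i) z.1 - select J z.
Definition approx_vel (z : E * E) : E :=
  c *: z.1 + b *: (slope_sum z - \sum_(i < J.+1) resolv phi (r i) tau z.1).

Lemma measurable_approx_vel : measurable_fun setT approx_vel.
Proof.
apply: measurable_addv; first by apply: measurable_scalev; exact: measurable_fst.
apply: measurable_scalev; apply: measurable_subv.
  apply: measurable_subv; last exact: measurable_select.
  apply: measurable_sumv => i; apply: measurableT_comp measurable_fst.
  exact: measurable_nearest cphi M0 lip _.
apply: measurable_sumv => i; apply: measurableT_comp measurable_fst.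
exact: measurable_resolv cphi M0 lip _ _ tau0.
Qed.

Definition approx_pot (eta : R) (x : E) : R :=
  (1 + eta * c) / 2 * sqnorm x +
  eta * b * (J%:R * phi x - \sum_(i < J.+1) envelope phi (r i) tau x).

(** The selected slope is one of the J + 1 summands; removing it leaves exactly J subgradients of
    [phi]. *)
Lemma slope_sum_subgrad z x' :
  dot (slope_sum z) (x' - z.1) <= J%:R * (phi x' - phi z.1).
Proof.
have [i0 ilt e] := select_index J z; rewrite /slope_sum e.
rewrite (bigD1 (Ordinal ilt))//= [X in dot X _](_ : _ =
  \sum_(i < J.+1 | i != Ordinal ilt) nearest phi (r i) z.1); last by rewrite addrAC subrr add0r.
rewrite dot_suml.
apply: (@le_trans _ _ (\sum_(i < J.+1 | i != Ordinal ilt) (phi x' - phi z.1))).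
  apply: ler_sum => i _; have := nearest_subgrad cphi M0 lip (r i) z.1 x'; lra.
rewrite sumr_const -(_ : J = #|[pred i | i != Ordinal ilt]|) ?mulr_natl//.
by rewrite cardC1 card_ord.
Qed.

Lemma approx_pot_subgrad eta z : 0 < eta -> eta * b * J.+1%:R <= tau ->
  subgrad (approx_pot eta) z.1 (z.1 + eta *: approx_vel z).
Proof.
move=> eta0 etab x'; rewrite /approx_pot.
pose v := x' - z.1.
have ex : x' = z.1 + v by rewrite /v addrC subrK.
have h1 := slope_sum_subgrad z x'; rewrite -/v in h1.
have h2 : \sum_(i < J.+1) envelope phi (r i) tau x' - \sum_(i < J.+1) envelope phi (r i) tau z.1 <=
    dot (\sum_(i < J.+1) resolv phi (r i) tau z.1) v + J.+1%:R * ((2 * tau)^-1 * sqnorm v).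
  rewrite -sumrB dot_suml.
  have -> : J.+1%:R * ((2 * tau)^-1 * sqnorm v) = \sum_(i < J.+1) ((2 * tau)^-1 * sqnorm v).
    by rewrite sumr_const card_ord mulr_natl.
  rewrite -[leRHS]big_split /=; apply: ler_sum => i _.
  exact: (envelope_le M0 lip (r i) z.1 x' tau0).
have h3 : sqnorm x' = sqnorm z.1 + 2 * dot z.1 v + sqnorm v by rewrite {1}ex sqnormDE.
have h4 : dot (z.1 + eta *: approx_vel z) v = (1 + eta * c) * dot z.1 v +
    eta * b * (dot (slope_sum z) v - dot (\sum_(i < J.+1) resolv phi (r i) tau z.1) v).
  by rewrite /approx_vel; move: (slope_sum z) (\sum_(i < J.+1) resolv phi (r i) tau z.1) => p q;
    rewrite !(dotDl, dotNl, dotZl); ring.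
rewrite -/v h4 h3.
(* The smallness of eta is used here: the quadratic errors of the J + 1 envelopes are absorbed by
   half of |v|^2. *)
have h5 : eta * b * (J.+1%:R * ((2 * tau)^-1 * sqnorm v)) <= sqnorm v / 2.
  have t1 : eta * b * J.+1%:R / tau <= 1 by rewrite ler_pdivrMr// mul1r.
  have := ler_wpM2r (sqnorm_ge0 v) t1; rewrite mul1r invfM.
  by move: (J.+1%:R) (sqnorm v) (tau^-1) => k S t; lra.
have eb : 0 <= eta * b by rewrite mulr_ge0// ltW.
have h6 := ler_wpM2l eb h1; have h7 := ler_wpM2l eb h2.
have h8 : 0 <= eta * c * sqnorm v by rewrite !mulr_ge0 ?sqnorm_ge0// ltW.
move: h5 h6 h7 h8; rewrite !mulrBr !mulrDr.
move: (dot (slope_sum z) v) (dot _ v) (dot z.1 v) (\sum_(i < J.+1) envelope _ _ _ x') (\sum_(i < J.+1) envelope _ _ _ z.1) => p q s e1 e2.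
move: (sqnorm v) (sqnorm z.1) (phi x') (phi z.1) (eta * b) (eta * c) (J.+1%:R * _) => S x2 f1 f2 h k l.
by move=> *; lra.
Qed.

Lemma continuous_envelope c' : continuous (envelope phi c' tau).
Proof.
move=> x; apply/(@cvgrPdist_le _ _ _ _ (nbhs_filter x)) => e e0.
have cdiff : (fun y : E => M * enorm (y - x) + (2 * tau)^-1 * sqnorm (y - x)) @ x --> (0 : R).
  have cs : continuous (fun y : E => y - x).
    by apply: continuous_subv; [move=> y; exact: cvg_id|exact: cst_continuous].
  have c1 : continuous (fun y : E => M * enorm (y - x)).
    by apply: continuous_cmulf => y; exact: (continuous_comp (cs y) (@continuous_enorm R d _)).
  have c2 : continuous (fun y : E => (2 * tau)^-1 * sqnorm (y - x)).
    by apply: continuous_cmulf => y; exact: (continuous_comp (cs y) (@continuous_sqnorm R d _)).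
  have c3 := @continuous_addf R _ _ _ c1 c2 x.
  have z0 : M * enorm (x - x) + (2 * tau)^-1 * sqnorm (x - x) = 0.
    by rewrite subrr /enorm sqnorm0 sqrtr0 !mulr0 addr0.
  by rewrite -[X in _ --> X]z0; exact: c3.
near=> y.
have yx : M * enorm (y - x) + (2 * tau)^-1 * sqnorm (y - x) <= e.
  by near: y; exact: (cvgr_le _ cdiff).
have h1 := envelope_le M0 lip c' x y tau0; have h2 := envelope_ge cphi M0 lip c' x y tau0.
have h3 : `|dot (resolv phi c' tau x) (y - x)| <= M * enorm (y - x).
  apply: (le_trans (dot_enorm _ _)); rewrite ler_wpM2r ?enorm_ge0//.
  by have := resolv_enorm cphi M0 lip c' (x : E) tau0.
by move: h3; rewrite !ler_norml => /andP[h3 h4]; apply/andP; split; lra.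
Unshelve. all: by end_near. Qed.

Lemma envelope_bound c' : exists K, forall x, `|envelope phi c' tau x| <= K * (1 + sqnorm x).
Proof.
pose e0 := `|envelope phi c' tau (0 : E)|.
exists (e0 + M + (2 * tau)^-1) => x.
have h1 := envelope_le M0 lip c' 0 x tau0; have h2 := envelope_ge cphi M0 lip c' 0 x tau0.
rewrite subr0 in h1 h2.
have h3 : `|dot (resolv phi c' tau 0) x| <= M * enorm x.
  apply: (le_trans (dot_enorm _ _)); rewrite ler_wpM2r ?enorm_ge0//.
  exact: (resolv_enorm cphi M0 lip c' (0 : E) tau0).
have h4 := ler_wpM2l M0 (enorm_le1 x).
have h5 : 0 <= e0 by exact: normr_ge0.
have h6 : `|envelope phi c' tau 0| <= e0 by [].
have t0 : 0 <= (2 * tau)^-1 by rewrite invr_ge0 mulr_ge0// ltW.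
have s0 := sqnorm_ge0 x.
have h7 := mulr_ge0 h5 s0.
move: h3 h6; rewrite !ler_norml => /andP[h3 h3'] /andP[h6 h6'].
move: h1 h2 h3 h3' h4 h6 h6' h7; move: (dot _ _) (envelope _ _ _ x) (envelope _ _ _ 0) (enorm x) (sqnorm x) s0 ((2 * tau)^-1) t0 => p q s n S S0 t t0 *.
by apply/andP; split; nra.
Qed.

Lemma approx_pot_bound eta : exists K, forall x, `|approx_pot eta x| <= K * (1 + sqnorm x).
Proof.
have eb i : exists K, forall x, `|envelope phi (r i) tau x| <= K * (1 + sqnorm x) by exact: envelope_bound.
pose K i := sval (cid (eb i)); have KP i := svalP (cid (eb i)).
exists (`|(1 + eta * c) / 2| + `|eta * b| * (J%:R * (`|phi 0| + M) + \sum_(i < J.+1) K i)) => x.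
have s0 := sqnorm_ge0 x.
rewrite mulrDl (le_trans (ler_normD _ _))// lerD//.
  by rewrite normrM ler_wpM2l// ger0_norm// lerDr.
rewrite normrM -mulrA ler_wpM2l// (le_trans (ler_normB _ _))// mulrDl lerD//.
  rewrite normrM normr_nat -mulrA ler_wpM2l//.
  have h1 := lip 0 x; have h2 := lip x 0; rewrite subr0 in h1; rewrite sub0r enormN in h2.
  have h3 := ler_wpM2l M0 (enorm_le1 x).
  have h4 : - `|phi 0| <= phi 0 <= `|phi 0| by rewrite -ler_norml.
  case/andP: h4 => h4 h5; have h6 := mulr_ge0 (normr_ge0 (phi 0)) s0.
  by rewrite ler_norml mulrDl !mulrDr mulr1; apply/andP; split; lra.
rewrite mulr_suml (le_trans (ler_norm_sum _ _ _))//; apply: ler_sum => i _; exact: KP.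
Qed.

Definition far : set (E * E) := [set z | forall i, (i < J)%N -> del <= sqnorm (r i - z.2)].

Lemma select_dist z : (enorm z.2 <= M -> subgrad phi z.1 z.2) ->
  sqnorm (select J z - z.2) <=
    4 * del + 4 * M ^+ 2 * \1_far z + 4 * sqnorm z.2 * \1_[set z : E * E | M < enorm z.2] z.
Proof.
move=> hz; rewrite !indicE.
have M2 : 0 <= 4 * M ^+ 2 * (z \in far)%:R by rewrite !mulr_ge0 ?sqr_ge0.
have s2 : 0 <= 4 * sqnorm z.2 * (z \in [set z : E * E | M < enorm z.2])%:R.
  by rewrite !mulr_ge0 ?sqnorm_ge0.
have bnd : sqnorm (select J z - z.2) <= 2 * (M ^+ 2 + sqnorm z.2).
  apply: (le_trans (sqnormB_le _ _)); rewrite ler_pM2l// lerD2r.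
  have [i _ ->] := select_index J z.
  rewrite -sqr_enorm; move: (nearest_enorm cphi M0 lip (r i) z.1); move: (nearest _ _ _) => v.
  by move=> h; rewrite ler_pXn2r// nnegrE ?enorm_ge0.
have [zM|Mz] := leP (enorm z.2) M; last first.
  apply: (le_trans bnd); rewrite (mem_set (Mz : [set z : E * E | M < enorm z.2] z)) mulr1.
  have : M ^+ 2 <= sqnorm z.2 by rewrite -sqr_enorm ler_pXn2r ?nnegrE ?enorm_ge0// ltW.
  by move: M2 del0; lra.
have [fz|nfz] := boolP (z \in far).
  apply: (le_trans bnd); rewrite mulr1 -sqr_enorm.
  have : enorm z.2 ^+ 2 <= M ^+ 2 by rewrite ler_pXn2r ?nnegrE ?enorm_ge0.
  by move: M2 s2 del0; rewrite sqr_enorm; lra.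
have [i iJ ci] : exists2 i, (i < J)%N & sqnorm (r i - z.2) < del.
  apply: contrapT => h; move/negP: nfz; apply; rewrite inE => i iJ.
  by rewrite leNgt; apply/negP => ci; apply: h; exists i.
have := select_close iJ ci (hz zM).
by rewrite mulr0 addr0; move: s2; lra.
Qed.

End approximation.

End tangent.

Lemma enorm_sum (R : realType) n I (r : seq I) (P : pred I) (v : I -> 'rV[R]_n) :
  enorm (\sum_(i <- r | P i) v i) <= \sum_(i <- r | P i) enorm (v i).
Proof.
apply: (big_ind2 (fun (x : 'rV[R]_n) y => enorm x <= y)) => //.
  by rewrite /enorm sqnorm0 sqrtr0.
by move=> x a y b h1 h2; apply: (le_trans (enorm_triangle _ _)); exact: lerD.
Qed.

Lemma continuous_sumf (R : realType) (T : topologicalType) I (r : seq I) (f : I -> T -> R) :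
  (forall i, continuous (f i)) -> continuous (fun x => \sum_(i <- r) f i x).
Proof.
move=> h x; apply: (@cvg_sumr _ _ _ (nbhs_filter x) _ _ xpredT f (fun i => f i x)) => i _; exact: h.
Qed.

Lemma Rint_cvg_0 d (T : measurableType d) (R : realType) (m : {measure set T -> \bar R})
    (f_ : nat -> T -> R) (g : T -> R) :
  (forall n, measurable_fun setT (f_ n)) -> m.-L1 g -> (forall n x, 0 <= f_ n x <= g x) ->
  {ae m, forall x, (fun n => f_ n x) @ \oo --> (0 : R)} ->
  (forall n, m.-L1 (f_ n)) /\ forall e, 0 < e -> exists n, \int[m]_x f_ n x < e.
Proof.
move=> mf Lg fg f0.
have fgn n x : `|f_ n x| <= g x by have /andP[h1 h2] := fg n x; rewrite ger0_norm.
split=> [n|e e0]; first by exact: L1_le (mf n) (fgn n) Lg.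
have [_ c] := @Rint_dominated _ _ _ m f_ (fun=> 0) g mf (measurable_cst _) Lg f0 fgn.
have z : \int[m]_x (0 : R) = 0 by rewrite /Rintegral integral0.
rewrite z in c; have [N _ /(_ N (leqnn N)) hN] := cvgr_lt _ c _ e0.
by exists N.
Qed.

Section tangent_law.
Context (R : realType) (d : nat).
Local Notation E := 'rV[R]_d.
Local Notation r := (ratv R d).
Variables (mu : P2 R d) (pi g : plan R d) (b c : R).
Hypotheses (mpi : minimal_cost pi) (b0 : 0 <= b) (c0 : 0 <= c)
  (lg : image_law (fun z : E * E => (z.1, c *: z.1 - b *: z.2)) pi g) (gmu : plans_over mu g).

Section approximant.
Variables (phi : E -> R) (M : R) (del : R) (J : nat) (tau : R).
Hypotheses (cphi : convexf phi) (M0 : 0 <= M) (lip : lipf M phi)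
  (tau0 : 0 < tau) (del0 : 0 < del).

Local Notation vel := (approx_vel phi del J b c tau).

Let mvel : measurable_fun setT vel.
Proof. exact: (measurable_approx_vel _ _ _ _ cphi M0 lip tau0). Qed.

Let slope_enorm (z : E * E) :
  enorm (slope_sum phi del J z - \sum_(i < J.+1) resolv phi (r i) tau z.1) <= (3 * J.+1%:R) * M.
Proof.
have sn (f : nat -> E) : (forall i, enorm (f i) <= M) -> enorm (\sum_(i < J.+1) f i) <= J.+1%:R * M.
  move=> h; apply: (le_trans (enorm_sum _ _ _)).
  by rewrite mulr_natl -[X in _ *+ X](card_ord J.+1) -sumr_const; apply: ler_sum.
rewrite /slope_sum; apply: (le_trans (enorm_triangle _ _)); rewrite enormN.
apply: (le_trans (lerD (enorm_triangle _ _) (le_refl _))); rewrite enormN.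
have h1 := sn (fun i => nearest phi (r i) z.1) (fun i => nearest_enorm cphi M0 lip (r i) z.1).
have h2 := sn (fun i => resolv phi (r i) tau z.1) (fun i => resolv_enorm cphi M0 lip (r i) z.1 tau0).
have h3 : enorm (select phi del J z) <= M.
  by have [i _ ->] := select_index phi del J z; exact: nearest_enorm cphi M0 lip _ _.
have h4 : M <= J.+1%:R * M by rewrite ler_peMl// ler1n.
by lra.
Qed.

Let vel_L1 : pi.-L1 (fun z => sqnorm (vel z)).
Proof.
apply: (@L1_le _ _ _ pi _ (fun z : E * E => 2 * c ^+ 2 * sqnorm z.1 +
    2 * b ^+ 2 * ((3 * J.+1%:R) * M) ^+ 2)).
- by apply: measurable_sqn; exact: mvel.
- move=> z; rewrite ger0_norm ?sqnorm_ge0// /approx_vel.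
  apply: (le_trans (sqnormD _ _)); rewrite !sqnormZ.
  have : sqnorm (slope_sum phi del J z - \sum_(i < J.+1) resolv phi (r i) tau z.1) <=
      ((3 * J.+1%:R) * M) ^+ 2.
    by rewrite -sqr_enorm ler_pXn2r ?nnegrE ?enorm_ge0// mulr_ge0.
  move: (sqnorm (_ - _)) => s hs.
  have := ler_wpM2l (sqr_ge0 b) hs; lra.
- by apply: L1D; [apply: L1Z; exact: plan_L1_fst|exact: L1_cst].
Qed.

Let mf := @measurable_fst _ _ E E.
Let g' : plan R d := plan_of mf mvel (plan_L1_fst pi) vel_L1.

Let lpi : image_law (fst : E * E -> E) pi mu.
Proof. exact: (image_law_comp mf lg gmu). Qed.

Let g'mu : plans_over mu g'.
Proof.
have h : image_law (fun w : E * E => (w.1, vel w)) pi g' by exact: plan_of_law.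
by apply: (image_law_factor mf h); exact: lpi.
Qed.

Let g'_optimal : exists2 eta : R, 0 < eta & optimal (move_plan eta g').
Proof.
(* The [+ 1] keeps the denominator positive when b = 0. *)
pose eta := tau / (b * J.+1%:R + 1).
have den0 : 0 < b * J.+1%:R + 1 by rewrite ltr_wpDl// mulr_ge0.
have eta0 : 0 < eta by rewrite divr_gt0.
exists eta => //.
have etab : eta * b * J.+1%:R <= tau.
  rewrite -mulrA /eta mulrAC ler_pdivrMr//.
  by apply: ler_wpM2l; [exact: ltW|rewrite lerDl].
have [K KP] := approx_pot_bound J b c cphi M0 lip tau0 eta.
apply: (@subgrad_optimal R d _ _ pi fst (fun z => z.1 + eta *: vel z) _ _ _
  (approx_pot phi J b c tau eta) K).
- exact: mf.
- by apply: measurable_addv => //; exact: measurable_scalev.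
- have h : image_law (fun w : E * E => (w.1, vel w)) pi g' by exact: plan_of_law.
  exact: (image_law_comp (measurable_move_map eta) h (move_plan_law eta g')).
- rewrite /approx_pot; apply: continuous_addf.
    by apply: continuous_cmulf; exact: continuous_sqnorm.
  apply: continuous_cmulf; apply: continuous_addf.
    by apply: continuous_cmulf; exact: lipf_continuous M0 lip.
  apply: continuous_oppf; apply: continuous_sumf => i.
  exact: continuous_envelope cphi M0 lip tau0 _.
- exact: KP.
- by move=> w; exact: (approx_pot_subgrad del cphi M0 lip b0 c0 tau0 _ eta0 etab).
Qed.

Let v (z : E * E) : E := c *: z.1 - b *: z.2.
Let mv : measurable_fun setT v.
Proof. by apply: measurable_subv; apply: measurable_scalev. Qed.

(** The two velocities are functions of the same [z], which provides an explicit coupling for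
    [Wfib]. *)
Lemma tangent_of_approx (e t : R) : 0 < e -> t < e ^+ 2 ->
  (pi.-L1 (fun z => sqnorm (v z - vel z)) -> \int[pi]_z sqnorm (v z - vel z) <= t) ->
  exists g', [/\ plans_over mu g', exists2 eta : R, 0 < eta & optimal (move_plan eta g') &
      (Wfib g g' < e%:E)%E].
Proof.
move=> e0 te ht; exists g'; split; [exact: g'mu|exact: g'_optimal|].
have L : pi.-L1 (fun z => sqnorm (v z - vel z)).
  apply: (@L1_le _ _ _ pi _ (fun z => 2 * ((2 * c ^+ 2 * sqnorm z.1 + 2 * b ^+ 2 * sqnorm z.2) + sqnorm (vel z)))).
  - by apply: measurable_sqn; apply: measurable_subv; [exact: mv|exact: mvel].
  - move=> z; rewrite ger0_norm ?sqnorm_ge0//; apply: (le_trans (sqnormB_le _ _)).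
    rewrite ler_pM2l// lerD2r /v; apply: (le_trans (sqnormB_le _ _)); rewrite !sqnormZ; lra.
  - apply: L1Z; apply: L1D => //; apply: L1D; apply: L1Z; [exact: plan_L1_fst|exact: plan_L1_snd].
have mw : measurable_fun setT (fun z : E * E => ((z.1, v z), vel z)).
  by apply/measurable_fun_pairP; split => //=; exact: measurable_pair_of.
pose th : probability (E * E * E)%type R := law pi mw.
have Gth : Gamma g g' th by split => A mA; [exact: lg|].
apply: (Wfib_lt Gth e0 te).
rewrite (image_law_ge0_integral mw (@image_law_law _ _ _ _ _ pi _ mw)); last 2 first.
- apply/measurable_EFinP; apply: measurable_sqn; apply: measurable_subv.
    by apply: measurableT_comp measurable_snd _; exact: measurable_fst.
  exact: measurable_snd.
- by move=> w; rewrite lee_fin sqnorm_ge0.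
by rewrite -RintegralE// lee_fin; exact: ht.
Qed.

End approximant.

(** Four errors separate the velocity from its approximant: large slopes, slopes far from the first
    J rational points, the mesh del, and the distance from resolvents to limits. *)
Lemma tangent_law : tangentK mu g.
Proof.
split => // e e0.
(* Each error is allotted u; doubling the square and the factor b^2 give 8 b^2 u < e^2. The summand
   8 covers b = 0. *)
pose u := e ^+ 2 / (8 * b ^+ 2 + 8).
have den0 : 0 < 8 * b ^+ 2 + 8 by rewrite ltr_wpDl// mulr_ge0// sqr_ge0.
have u0 : 0 < u by rewrite divr_gt0// exprn_gt0.
have te : 8 * b ^+ 2 * u < e ^+ 2.
  rewrite /u mulrA ltr_pdivrMr// mulrC ltr_pM2l ?exprn_gt0//; lra.
pose del := u / 4; have del0 : 0 < del by rewrite divr_gt0.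
have ms := @measurable_snd _ _ E E.
have mtail (M : R) : measurable [set z : E * E | M < enorm z.2].
  rewrite -[X in measurable X]setTI (_ : [set z | _] = (fun z : E * E => enorm z.2) @^-1` `]M, +oo[%classic).
    by apply: (measurable_enorm ms).
  by apply/seteqP; split => z /=; rewrite in_itv/= andbT.
have bnd_indic (A : set (E * E)) (x : R) z : 0 <= x -> 0 <= x * \1_A z <= x.
  by move=> x0; rewrite indicE; case: (_ \in _); rewrite ?mulr1 ?mulr0 ?x0 ?lexx.
have [n [Ln hn]] : exists n : nat, let f := (fun z : E * E => 4 * sqnorm z.2 * \1_[set z : E * E | n%:R < enorm z.2] z) in
    pi.-L1 f /\ \int[pi]_z f z < u.
  have [||||Lt /(_ u u0) [n hn]] := @Rint_cvg_0 _ _ _ pi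
    (fun (n : nat) (z : E * E) => 4 * sqnorm z.2 * \1_[set z : E * E | n%:R < enorm z.2] z)
    (fun z : E * E => 4 * sqnorm z.2); last by exists n; split.
  - move=> n; apply: measurable_funM; last exact: measurable_indic.
    by apply: measurable_funM => //; exact: measurable_sqn.
  - by apply: L1Z; exact: plan_L1_snd.
  - by move=> n z; apply: bnd_indic; rewrite mulr_ge0 ?sqnorm_ge0.
  - apply: aeW => z; apply: cvg_near_cst.
    have [N _ hN] := nbhs_infty_ger (enorm z.2); exists N => // m /hN/= h.
    by rewrite indicE memNset ?mulr0//= => h'; move: (lt_le_trans h' h); rewrite ltxx.
(* M comes before the potential, whose slopes it bounds; J and the resolvent parameter are then
   chosen in turn for this fixed potential. *)
pose M : R := n%:R; have M0 : 0 <= M by exact: ler0n.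
have [phi [cphi lip hphi]] := rockafellar (charged_cyclically_monotone mpi) M0.
have mfar J : measurable (far (R := R) (d := d) del J).
  rewrite (_ : far _ _ = \bigcap_(i in [set i | (i < J)%N]) [set z : E * E | del <= sqnorm (r i - z.2)]).
    apply: fin_bigcap_measurable => [|i _]; first exact: finite_II.
    rewrite -[X in measurable X]setTI (_ : [set z | _] = (fun z : E * E => sqnorm (r i - z.2)) @^-1` `[del, +oo[%classic).
      by apply: measurable_sqn => //; apply: measurable_subv.
    by apply/seteqP; split => z /=; rewrite in_itv/= andbT.
  by apply/seteqP; split => z h.
have [J [LJ hJ]] : exists J : nat, let f := (fun z : E * E => 4 * M ^+ 2 * \1_(far del J) z) in
    pi.-L1 f /\ \int[pi]_z f z < u.
  have [||||Lt /(_ u u0) [J hJ]] := @Rint_cvg_0 _ _ _ pi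
    (fun (J : nat) (z : E * E) => 4 * M ^+ 2 * \1_(far del J) z)
    (fun z : E * E => 4 * M ^+ 2); last by exists J; split.
  - by move=> J; apply: measurable_funM => //; exact: measurable_indic.
  - exact: L1_cst.
  - by move=> J z; apply: bnd_indic; rewrite mulr_ge0 ?sqr_ge0.
  - apply: aeW => z; apply: cvg_near_cst.
    have [i hi] := ratv_close z.2 del0; exists i.+1 => // m /= im.
    by rewrite indicE memNset ?mulr0//= => /(_ i im); rewrite leNgt hi.
pose B k (z : E * E) := \sum_(i < J.+1) (resolv phi (r i) (tau_ R k) z.1 - nearest phi (r i) z.1).
have [k [Lk hk]] : exists k : nat, let f := (fun z : E * E => sqnorm (B k z)) in
    pi.-L1 f /\ \int[pi]_z f z < u.
  have [||||Lt /(_ u u0) [k hk]] := @Rint_cvg_0 _ _ _ pi (fun (k : nat) (z : E * E) => sqnorm (B k z))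
    (fun z : E * E => (J.+1%:R * (M + M)) ^+ 2); last by exists k; split.
  - move=> k; apply: measurable_sqn; apply: measurable_sumv => i; apply: measurable_subv.
      apply: measurableT_comp measurable_fst.
      exact: measurable_resolv cphi M0 lip _ _ (tau_gt0 R k).
    by apply: measurableT_comp measurable_fst; exact: measurable_nearest cphi M0 lip _.
  - exact: L1_cst.
  - move=> k z; rewrite sqnorm_ge0 -sqr_enorm ler_pXn2r ?nnegrE ?enorm_ge0//; last first.
      by rewrite mulr_ge0// addr_ge0.
    apply: (le_trans (enorm_sum _ _ _)).
    rewrite mulr_natl -[X in _ *+ X](card_ord J.+1) -sumr_const; apply: ler_sum => i _.
    apply: (le_trans (enorm_triangle _ _)); rewrite enormN; apply: lerD.
      exact: (resolv_enorm cphi M0 lip (r i) z.1 (tau_gt0 R k)).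
    exact: nearest_enorm cphi M0 lip (r i) z.1.
  - apply: aeW => z.
    have c1 : (fun k => B k z) @ \oo --> (0 : E).
      have -> : (0 : E) = \sum_(i < J.+1) 0 by rewrite big1.
      apply: cvg_rV => l; rewrite summxE.
      rewrite (_ : (fun k => _) = fun k => \sum_(i < J.+1)
        (resolv phi (r i) (tau_ R k) z.1 - nearest phi (r i) z.1) ord0 l); last first.
        by apply/funext => k; rewrite summxE.
      apply: cvg_sumr => i _; apply: cvg_rV_coord.
      rewrite -[X in _ --> X](subrr (nearest phi (r i) z.1)).
      by apply: cvgB; [exact: resolv_cvg cphi M0 lip _ _|exact: cvg_cst].
    by rewrite -[X in _ --> X](dot0l (0 : E)); exact: cvg_dot.
refine (@tangent_of_approx phi M del J (tau_ R k) cphi M0 lip (tau_gt0 R k) e (8 * b ^+ 2 * u) e0 te _) => L.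
have LF : pi.-L1 (fun z => 2 * b ^+ 2 * (4 * del + 4 * M ^+ 2 * \1_(far del J) z +
   4 * sqnorm z.2 * \1_[set z : E * E | M < enorm z.2] z + sqnorm (B k z))).
  by apply: L1Z; apply: L1D => //; apply: L1D => //; apply: L1D => //; exact: L1_cst.
apply: (@le_trans _ _ (\int[pi]_z (2 * b ^+ 2 * (4 * del + 4 * M ^+ 2 * \1_(far del J) z +
   4 * sqnorm z.2 * \1_[set z : E * E | M < enorm z.2] z + sqnorm (B k z))))).
  apply: ae_le_Rint => //; apply: ae_imp (charged_ae pi) => z cz.
  have := select_dist J cphi M0 lip del0 (hphi z cz).
  rewrite (_ : _ - approx_vel _ _ _ _ _ _ _ = b *: ((select phi del J z - z.2) + B k z)); last first.
    rewrite /approx_vel /slope_sum /B sumrB; move: (\sum_(i < _) _) (\sum_(i < _) _) (select _ _ _ _) => p q s.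
    by apply/rowP => l; rewrite !mxE; ring.
  move=> h; rewrite sqnormZ -mulrA mulrCA ler_wpM2l ?sqr_ge0//.
  by apply: (le_trans (sqnormD _ _)); rewrite ler_pM2l// lerD2r.
rewrite RintZ; last by apply: L1D => //; apply: L1D => //; apply: L1D => //; exact: L1_cst.
rewrite RintD//; last by apply: L1D => //; apply: L1D => //; exact: L1_cst.
rewrite RintD//; last by apply: L1D => //; exact: L1_cst.
rewrite RintD//; last exact: L1_cst.
rewrite Rint_cst.
have hb : 0 <= 2 * b ^+ 2 by rewrite mulr_ge0 ?sqr_ge0.
rewrite (_ : 8 * b ^+ 2 * u = 2 * b ^+ 2 * (4 * u)); last by ring.
apply: ler_wpM2l => //; move: hn hJ hk => /= hn hJ hk.
by rewrite /del; lra.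
Qed.

End tangent_law.

(** The pullback half of [image_law_ae], for predicates whose measurability is not at hand. *)
Lemma image_law_ae_pull d d' (T : measurableType d) (T' : measurableType d') (R : realType)
    (m : probability T R) (m' : probability T' R) (f : T -> T') (Q : T' -> Prop) :
  measurable_fun setT f -> image_law f m m' ->
  {ae m', forall y, Q y} -> {ae m, forall x, Q (f x)}.
Proof.
move=> mf fm [B [mB B0 QB]]; exists (f @^-1` B); split.
- by rewrite -[X in measurable X]setTI; exact: mf.
- by rewrite -B0 -fm.
- by move=> x /= h; exact: QB.
Qed.

Lemma image_law_ae_eq d d' (T : measurableType d) (T' : measurableType d') (R : realType)
    (m : probability T R) (m' : probability T' R) (f g : T -> T') :
  measurable_fun setT f -> measurable_fun setT g -> {ae m, forall x, f x = g x} ->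
  image_law f m m' -> image_law g m m'.
Proof.
move=> mf mg fg lf A mA; rewrite -(lf A mA) /pushforward.
have mfA : measurable (f @^-1` A) by rewrite -[X in measurable X]setTI; exact: mf.
have mgA : measurable (g @^-1` A) by rewrite -[X in measurable X]setTI; exact: mg.
rewrite -[g @^-1` A]setIT -[f @^-1` A]setIT -!integral_indic//.
apply: ae_eq_integral => //; [by apply/measurable_EFinP; exact: measurable_indic..|].
by apply: ae_imp fg => x e _; rewrite /= !indicE (_ : (x \in g @^-1` A) = (x \in f @^-1` A))//; apply/idP/idP; rewrite !inE /= e.
Qed.

(** The intervals from p r to q r are pairwise disjoint, so a rational inside each of them
    identifies r. *)
Lemma countable_interlaced (R : realType) (p q : R -> R) :
  (forall r r', r < r' -> q r <= p r') -> countable [set r | p r < q r].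
Proof.
move=> h.
have pick r : {u : rat | p r < q r -> p r < ratr u < q r}.
  apply: cid; have [lt|ge] := ltP (p r) (q r); last by exists 0.
  by have [u] := rat_in_itvoo lt; rewrite in_itv/= => hu; exists u.
apply/countable_injP.
have inj : {in [set r | p r < q r] &, injective (fun r => pickle (sval (pick r)))}.
  move=> r r' /set_mem/= hr /set_mem/= hr' /(pcan_inj (@pickleK _)) e.
  have /andP[a1 a2] := svalP (pick r) hr; have /andP[b1 b2] := svalP (pick r') hr'.
  case: (ltgtP r r') => // rr.
    by have := h _ _ rr; move: b1; rewrite -e => b1; lra.
  by have := h _ _ rr; move: b2; rewrite -e => b2 b3; lra.
by exists (fun r => pickle (sval (pick r))); exact: inj.
Qed.

(** On a line of direction l the l-th coordinates of any two subgradient selections interlace by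
    monotonicity, hence differ at countably many points only; integration over the lines gives a
    null set. This replaces almost everywhere differentiability of convex functions. *)
Lemma nearest_ae_eq (R : realType) (d : nat) (phi : 'rV[R]_d -> R) (M : R) c c' (l : 'I_d) :
  convexf phi -> 0 <= M -> lipf M phi ->
  {ae lebesgue_rV R d, forall x, nearest phi c x ord0 l = nearest phi c' x ord0 l}.
Proof.
case: d phi c c' l => [|d] phi c c' l; first by case: l.
move=> cphi M0 lip.
pose f (x : 'rV[R]_d.+1) := nearest phi c x ord0 l; pose g (x : 'rV[R]_d.+1) := nearest phi c' x ord0 l.
have mf : measurable_fun setT f by apply: measurable_entry; exact: measurable_nearest cphi M0 lip _.
have mg : measurable_fun setT g by apply: measurable_entry; exact: measurable_nearest cphi M0 lip _.
have mA : measurable [set x | f x != g x].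
  rewrite (_ : [set x | _] = ~` ((fun x => f x - g x) @^-1` [set 0])).
    by apply: measurableC; rewrite -[X in measurable X]setTI; apply: measurable_funB.
  by apply/seteqP; split => x /=; rewrite -subr_eq0 => /eqP.
exists [set x | f x != g x]; split => //; last by move=> x /= /eqP.
have mono c1 c2 y (r r' : R) : r < r' ->
    nearest phi c1 (ins l (r, y)) ord0 l <= nearest phi c2 (ins l (r', y)) ord0 l.
  move=> rr; have := subgrad_mono (nearest_subgrad cphi M0 lip c2 (ins l (r', y)))
    (nearest_subgrad cphi M0 lip c1 (ins l (r, y))).
  have -> : ins l (r', y) = ins l (r, y) + (r' - r) *: delta_mx ord0 l.
    by rewrite -insD addrC subrK.
  rewrite addrAC subrr add0r dotZr dot_delta !mxE pmulr_rge0 ?subr_gt0// subr_ge0.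
  exact.
have fg y (r r' : R) : r < r' -> f (ins l (r, y)) <= g (ins l (r', y)) by exact: mono.
have gf y (r r' : R) : r < r' -> g (ins l (r, y)) <= f (ins l (r', y)) by exact: mono.
clear mono; clearbody f g.
have ib (T : Type) (P : T -> bool) (x : T) : \1_[set t | P t] x = (P x)%:R :> R.
  by rewrite indicE; congr (nat_of_bool _)%:R; apply/idP/idP; rewrite in_setE.
rewrite -[[set x | f x != g x]]setIT -integral_indic//.
rewrite (integral_ins l); last 2 first.
- by apply/measurable_EFinP; exact: measurable_indic.
- by move=> x; rewrite lee_fin.
rewrite (eq_integral (fun=> 0%E)) ?integral0// => y _.
have c1 : countable [set r : R | f (ins l (r, y)) < g (ins l (r, y))].
  by apply: countable_interlaced => r r'; exact: gf.
have c2 : countable [set r : R | g (ins l (r, y)) < f (ins l (r, y))].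
  by apply: countable_interlaced => r r'; exact: fg.
have e : [set r : R | f (ins l (r, y)) != g (ins l (r, y))] =
    [set r | f (ins l (r, y)) < g (ins l (r, y))] `|` [set r | g (ins l (r, y)) < f (ins l (r, y))].
  by apply/seteqP; split => r /=; rewrite neq_lt => /orP.
have m1 : measurable [set r : R | f (ins l (r, y)) < g (ins l (r, y))] by exact: countable_measurable.
have m2 : measurable [set r : R | g (ins l (r, y)) < f (ins l (r, y))] by exact: countable_measurable.
have mB : measurable [set r : R | f (ins l (r, y)) != g (ins l (r, y))].
  by rewrite e; exact: measurableU.
have A0 : (@lebesgue_measure R) [set r : R | f (ins l (r, y)) != g (ins l (r, y))] = 0%E.
  by rewrite e measureU0//; exact: countable_lebesgue_measure0.
rewrite (_ : (fun r : R => _) = fun r => (\1_[set r : R | f (ins l (r, y)) != g (ins l (r, y))] r)%:E).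
  by rewrite integral_indic// setIT.
by apply/funext => r; rewrite !ib.
Qed.

Lemma is_derive_shift (R : realType) n (a x v : 'rV[R]_n) (f : 'rV[R]_n -> R) (l : R) :
  is_derive (x + a) v (f : _ -> R^o) l -> is_derive x v (fun y => f (y + a) : R^o) l.
Proof.
move=> [df dl].
have e : (fun h : R => h^-1 *: ((fun y => f (y + a) : R^o) (h *: v + x) - f (x + a))) =
    (fun h : R => h^-1 *: ((f : _ -> R^o) (h *: v + (x + a)) - f (x + a))).
  by apply/funext => h; rewrite addrA.
by apply: DeriveDef; [rewrite /derivable|rewrite /derive]; rewrite /shift /comp /= e.
Qed.

(** * Transport maps and integration by parts *)

Section transport_map.
Context (R : realType) (d : nat).
Local Notation E := 'rV[R]_d.
Variable pi : plan R d.
Hypotheses (mpi : minimal_cost pi) (ac : marg1 pi `<< lebesgue_rV R d).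

Let mf := @measurable_fst _ _ E E.
Let ms := @measurable_snd _ _ E E.
Let pot_ex (n : nat) := rockafellar (charged_cyclically_monotone mpi) (ler0n R n).
Let pot n := sval (cid (pot_ex n)).
Let cpot n : convexf (pot n). Proof. by have [] := svalP (cid (pot_ex n)). Qed.
Let lpot n : lipf n%:R (pot n). Proof. by have [] := svalP (cid (pot_ex n)). Qed.
Let pot_sub n (z : E * E) : charged pi z -> enorm z.2 <= n%:R -> subgrad (pot n) z.1 z.2.
Proof. by move=> cz zn; have [_ _ h] := svalP (cid (pot_ex n)); exact: h. Qed.

Definition map_approx n (x : E) : E := nearest (pot n) 0 x.

Lemma measurable_map_approx n : measurable_fun setT (map_approx n).
Proof. exact: measurable_nearest (cpot n) (ler0n R n) (@lpot n) _. Qed.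

(** Almost everywhere [nearest] does not depend on its reference point; rational references tending
    to [z.2], itself a subgradient, force the value [z.2]. The second alternative is kept as a
    domination. *)
Lemma map_approx_ae : {ae pi, forall z, forall n,
  if enorm z.2 <= n%:R then map_approx n z.1 = z.2 else enorm (map_approx n z.1) <= enorm z.2}.
Proof.
have h1 : {ae pi, forall z, forall n k l,
    nearest (pot n) (ratv R d k) z.1 ord0 l = nearest (pot n) 0 z.1 ord0 l}.
  apply: (image_law_ae_pull mf (marg1_law pi) (Q := fun x => forall n k l, nearest (pot n) (ratv R d k) x ord0 l = nearest (pot n) 0 x ord0 l)).
  apply: (dominates_ae ac); apply: ae_foralln => n; apply: ae_foralln => k.
  have h l : {ae lebesgue_rV R d, forall x, nearest (pot n) (ratv R d k) x ord0 l = nearest (pot n) 0 x ord0 l}.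
    exact: nearest_ae_eq (cpot n) (ler0n R n) (@lpot n).
  by apply: filter_forall h.
apply: ae_imp2 h1 (charged_ae pi) => z hz cz n.
case: (leP (enorm z.2)) => [zn|nz]; last first.
  by apply: (le_trans (nearest_enorm (cpot n) (ler0n R n) (@lpot n) _ _)); exact: ltW.
have [u cu] := ratv_dense z.2.
have c1 : (fun k => sqnorm (map_approx n z.1 - ratv R d (u k))) @ \oo --> sqnorm (map_approx n z.1 - z.2).
  by apply: cvg_dot; apply: cvgB => //; exact: cvg_cst.
have c2 : (fun k => sqnorm (z.2 - ratv R d (u k))) @ \oo --> sqnorm (z.2 - z.2).
  by apply: cvg_dot; apply: cvgB => //; exact: cvg_cst.
have : sqnorm (map_approx n z.1 - z.2) <= sqnorm (z.2 - z.2).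
  apply: (cvgr_le_cvg c1 c2).
  - apply: nearW => k.
    have := nearest_closer (cpot n) (ler0n R n) (@lpot n) (ratv R d (u k)) (pot_sub cz zn).
    rewrite (_ : nearest _ _ _ = map_approx n z.1)//.
    by apply/rowP => l; rewrite hz.
rewrite subrr sqnorm0 => /sqnorm_eq0 h; rewrite -[RHS]add0r -h subrK//.
Qed.

(** The upper limit is measurable and defined everywhere, while the approximations converge only
    almost everywhere. *)
Definition transport (x : E) : E := \row_i fine (limn_esup (fun n => (map_approx n x ord0 i)%:E)).

Lemma measurable_transport : measurable_fun setT transport.
Proof.
apply: measurable_rV => i; rewrite /transport; under eq_fun do rewrite mxE.
apply: measurableT_comp; first exact: fine_measurable.
apply: measurable_fun_limn_esup => n; apply/measurable_EFinP; apply: measurable_entry.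
exact: measurable_map_approx.
Qed.

Lemma map_approx_cvg : {ae pi, forall z, (fun n => map_approx n z.1) @ \oo --> z.2}.
Proof.
apply: ae_imp map_approx_ae => z h; apply: cvg_near_cst.
have [N _ hN] := nbhs_infty_ger (enorm z.2); exists N => // n /hN/= zn.
by have := h n; rewrite zn.
Qed.

Lemma transport_ae : {ae pi, forall z, transport z.1 = z.2}.
Proof.
apply: ae_imp map_approx_cvg => z h; apply/rowP => i; rewrite mxE.
have c : (fun n => (map_approx n z.1 ord0 i)%:E) @ \oo --> (z.2 ord0 i)%:E.
  by apply: cvg_EFin; [exact: nearW|exact: cvg_rV_coord].
by rewrite is_cvg_limn_esupE ?(cvg_lim _ c)//; apply/cvg_ex; eexists; exact: c.
Qed.

Lemma transport_law : image_law (fun x => (x, transport x)) (marg1 pi) pi.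
Proof.
have h : image_law (fun z : E * E => (z.1, transport z.1)) pi pi.
  apply: (@image_law_ae_eq _ _ _ _ _ pi pi id); last exact: image_law_id.
  - exact: measurable_id.
  - by apply: measurable_pair_of => //; apply: measurableT_comp measurable_transport mf.
  - by apply: ae_imp transport_ae => -[x y] /= ->.
apply: (image_law_factor _ (marg1_law pi) h).
by apply: measurable_pair_of; [exact: measurable_id|exact: measurable_transport].
Qed.

Section integration_by_parts.
Variables (i : 'I_d) (s : E -> R).
Hypothesis s2 : L2 (marg1 pi) s.
Hypothesis ibp : forall f f', dirC1 i f f' -> \int[marg1 pi]_x f' x = - \int[marg1 pi]_x (s x * f x).

Let s_L1 : (marg1 pi).-L1 (fun x => `|s x|).
Proof. by apply: L1_norm; exact: L2_L1. Qed.

Let s_bounded_L1 (f : E -> R) (K : R) : measurable_fun setT f -> (forall x, `|f x| <= K) ->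
  (marg1 pi).-L1 (fun x => s x * f x).
Proof. by move=> mf' fK; apply: L2_mul => //; exact: (L2_bounded _ mf' fK). Qed.

Let quotient_approx n x (tau h : R) : 0 < tau -> 0 < h ->
  `|h^-1 * (envelope (pot n) 0 tau (x + h *: delta_mx ord0 i) - envelope (pot n) 0 tau x) -
    resolv (pot n) 0 tau x ord0 i| <= h / (2 * tau).
Proof.
move=> tau0 h0.
have h1 := envelope_le (ler0n R n) (@lpot n) 0 x (x + h *: delta_mx ord0 i) tau0.
have h2 := envelope_ge (cpot n) (ler0n R n) (@lpot n) 0 x (x + h *: delta_mx ord0 i) tau0.
move: h1 h2; rewrite (addrC x) addrK sqnorm_delta dotZr dot_delta.
move: (envelope _ _ _ _ - _) (resolv _ _ _ _ _ _) => q p h1 h2.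
rewrite (_ : h^-1 * q - p = (q - h * p) / h); last by field; rewrite gt_eqF.
have hi : 0 <= h^-1 by rewrite invr_ge0 ltW.
rewrite normrM (ger0_norm hi) ler_pdivrMr//.
rewrite (_ : h / (2 * tau) * h = (2 * tau)^-1 * h ^+ 2); last by ring.
by rewrite ler_norml; apply/andP; split; lra.
Qed.

(** The resolvent is merely Lipschitz, so it is replaced by a difference quotient of the envelope,
    whose derivative is a difference quotient of the resolvent. *)
Let dirC1_quotient n (tau h : R) : 0 < tau -> 0 < h ->
  dirC1 i (fun x : E => h^-1 * (envelope (pot n) 0 tau (x + h *: delta_mx ord0 i) - envelope (pot n) 0 tau x))
    (fun x : E => h^-1 * (resolv (pot n) 0 tau (x + h *: delta_mx ord0 i) ord0 i - resolv (pot n) 0 tau x ord0 i)).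
Proof.
move=> tau0 h0.
have cs : continuous (fun x : E => x + h *: delta_mx ord0 i).
  rewrite (_ : (fun x : E => _) = fun x : E => x - (- (h *: delta_mx ord0 i))); last by apply/funext => x; rewrite opprK.
  by apply: continuous_subv; [move=> y; exact: cvg_id|exact: cst_continuous].
have ce : continuous (envelope (pot n) 0 tau) by exact: continuous_envelope (cpot n) (ler0n R n) (@lpot n) tau0 _.
have cr : continuous (fun x : E => resolv (pot n) 0 tau x ord0 i).
  have crv := @continuous_resolv _ _ _ _ (cpot n) (ler0n R n) (@lpot n) 0 tau tau0.
  by move=> x; exact: (@continuous_comp _ _ _ (resolv (pot n) 0 tau) (fun y : E => y ord0 i) x (crv x) (@continuous_coord R d i _)).
split.
- apply: continuous_cmulf; apply: continuous_addf; last exact: continuous_oppf.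
  by move=> x; exact: (continuous_comp (cs x) (ce _)).
- apply: continuous_cmulf; apply: continuous_addf; last exact: continuous_oppf.
  by move=> x; exact: (continuous_comp (cs x) (cr _)).
- move=> x.
  have d1 := is_derive_envelope (cpot n) (ler0n R n) (@lpot n) 0 x (delta_mx ord0 i) tau0.
  have d2 := is_derive_shift (is_derive_envelope (cpot n) (ler0n R n) (@lpot n) 0 (x + h *: delta_mx ord0 i) (delta_mx ord0 i) tau0).
  have := @is_deriveZ _ _ _ _ h^-1 _ _ _ (@is_deriveB _ _ _ _ _ _ _ _ _ d2 d1).
  by rewrite !dot_delta.
- exists (h^-1 * (n%:R + n%:R)) => x.
  have hi : 0 <= h^-1 by rewrite invr_ge0 ltW.
  rewrite normrM (ger0_norm hi) ler_pM2l ?invr_gt0//.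
  apply: (le_trans (ler_normB _ _)); apply: lerD; apply: (le_trans (coord_le_enorm _ _)).
    exact: (resolv_enorm (cpot n) (ler0n R n) (@lpot n) 0 _ tau0).
  exact: (resolv_enorm (cpot n) (ler0n R n) (@lpot n) 0 _ tau0).
- exists ((n%:R + h / (2 * tau)) ^+ 2); first exact: sqr_ge0.
  move=> x; have := quotient_approx n x tau0 h0.
  have := le_trans (coord_le_enorm _ i) (resolv_enorm (cpot n) (ler0n R n) (@lpot n) 0 x tau0).
  move: (h^-1 * _) (resolv _ _ _ _ _ _) => q p h1 h2.
  have h3 : `|q| <= n%:R + h / (2 * tau).
    rewrite -(subrK p q); apply: (le_trans (ler_normD _ _)); rewrite addrC; exact: lerD.
  rewrite -[leLHS]real_normK ?num_real//.
  apply: (@le_trans _ _ ((n%:R + h / (2 * tau)) ^+ 2)).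
    by rewrite ler_pXn2r// nnegrE (le_trans _ h3).
  by rewrite ler_peMr ?sqr_ge0// lerDl sqnorm_ge0.
Qed.

(** The derivative of the quotient in [dirC1_quotient] is nonnegative by monotonicity of the
    resolvent; only this sign is used. *)
Let resolv_ibp n (tau : R) : 0 < tau ->
  \int[marg1 pi]_x (s x * resolv (pot n) 0 tau x ord0 i) <= 0.
Proof.
move=> tau0; rewrite leNgt; apply/negP => I0.
set I := (X in 0 < X) in I0; pose S := \int[marg1 pi]_x `|s x|.
have S0 : 0 <= S by exact: Rint_ge0.
have S1 : 0 < S + 1 by rewrite ltr_wpDl.
(* Small enough for the error h / (2 tau) S of the quotient to stay below I. *)
pose h := tau * I / (S + 1); have h0 : 0 < h by rewrite divr_gt0// mulr_gt0.
have dC := dirC1_quotient n tau0 h0.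
set f := (fun x : E => h^-1 * _) in dC; set f' := (fun x : E => h^-1 * _) in dC.
have f'0 : 0 <= \int[marg1 pi]_x f' x.
  apply: Rint_ge0 => x; rewrite /f'; apply: mulr_ge0; first by rewrite invr_ge0 ltW.
  have := resolv_monotone (cpot n) (ler0n R n) (@lpot n) 0 (x + h *: delta_mx ord0 i) x tau0.
  have -> : x + h *: delta_mx ord0 i - x = h *: delta_mx ord0 i by rewrite addrC addrA addNr add0r.
  move: (resolv _ _ _ _) (resolv _ _ _ _) => p q; rewrite dotZr dot_delta !mxE => le.
  rewrite -(pmulr_rge0 _ h0); apply: le_trans le.
  by rewrite mulr_ge0 ?sqnorm_ge0// ltW.
have fI : \int[marg1 pi]_x (s x * f x) <= 0 by have := ibp dC; lra.
have mr : measurable_fun setT (fun x : E => resolv (pot n) 0 tau x ord0 i).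
  by apply: measurable_entry; exact: measurable_resolv (cpot n) (ler0n R n) (@lpot n) _ _ tau0.
have mff : measurable_fun setT f by apply: continuous_measurable_rV; exact: dirC1_cont dC.
have Lr : (marg1 pi).-L1 (fun x => s x * resolv (pot n) 0 tau x ord0 i).
  apply: (s_bounded_L1 (K := n%:R)) => // x; apply: (le_trans (coord_le_enorm _ _)).
  exact: (resolv_enorm (cpot n) (ler0n R n) (@lpot n) 0 _ tau0).
have Ld : (marg1 pi).-L1 (fun x => s x * (f x - resolv (pot n) 0 tau x ord0 i)).
  by apply: (s_bounded_L1 (K := h / (2 * tau))) => [|x]; [exact: measurable_funB|exact: quotient_approx].
have : I <= \int[marg1 pi]_x (s x * f x) + h / (2 * tau) * S.
  have e : \int[marg1 pi]_x (s x * f x) - I = \int[marg1 pi]_x (s x * (f x - resolv (pot n) 0 tau x ord0 i)).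
    have -> : (fun x => s x * (f x - resolv (pot n) 0 tau x ord0 i)) = (fun x => s x * f x - s x * resolv (pot n) 0 tau x ord0 i).
      by apply/funext => x; rewrite mulrBr.
    rewrite RintB//; apply: (ae_eq_L1 (f := fun x => s x * (f x - resolv (pot n) 0 tau x ord0 i) + s x * resolv (pot n) 0 tau x ord0 i)).
    - by apply: measurable_funM => //; exact: s2.1.
    - exact: (L1D Ld Lr).
    - by apply: aeW => x; rewrite mulrBr subrK.
  have Lc : (marg1 pi).-L1 (fun x => h / (2 * tau) * `|s x|) by exact: L1Z.
  have le : \int[marg1 pi]_x (- (h / (2 * tau) * `|s x|)) <=
      \int[marg1 pi]_x (s x * (f x - resolv (pot n) 0 tau x ord0 i)).
    apply: le_Rint; [exact: (L1N Lc)|exact: Ld|move=> x].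
    rewrite lerNl -mulrN; apply: (le_trans (ler_norm _)).
    rewrite normrM normrN mulrC ler_wpM2r//; exact: quotient_approx.
  by move: le; rewrite -e RintN// RintZ// -/S; lra.
suff : h / (2 * tau) * S < I by lra.
rewrite /h (_ : _ * S = I * (S / (2 * (S + 1)))); last by field; rewrite !gt_eqF.
by rewrite -[ltRHS]mulr1 ltr_pM2l// ltr_pdivrMr ?mulr_gt0// mul1r; lra.
Qed.

Let map_approx_ibp n : \int[marg1 pi]_x (s x * map_approx n x ord0 i) <= 0.
Proof.
have mr k : measurable_fun setT (fun x : E => resolv (pot n) 0 (tau_ R k) x ord0 i).
  by apply: measurable_entry; exact: measurable_resolv (cpot n) (ler0n R n) (@lpot n) _ _ (tau_gt0 R k).
have [|||||_ c] := @Rint_dominated _ _ _ (marg1 pi) (fun k x => s x * resolv (pot n) 0 (tau_ R k) x ord0 i)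
  (fun x => s x * map_approx n x ord0 i) (fun x => n%:R * `|s x|).
- by move=> k; apply: measurable_funM => //; exact: s2.1.
- by apply: measurable_funM; [exact: s2.1|apply: measurable_entry; exact: measurable_map_approx].
- exact: L1Z.
- apply: aeW => x; apply: cvgM; first exact: cvg_cst.
  by apply: cvg_rV_coord; exact: resolv_cvg (cpot n) (ler0n R n) (@lpot n) _ _.
- move=> k x; rewrite normrM mulrC ler_wpM2r//; apply: (le_trans (coord_le_enorm _ _)).
  exact: (resolv_enorm (cpot n) (ler0n R n) (@lpot n) 0 _ (tau_gt0 R k)).
apply: (cvgr_le_bound c).
by apply: nearW => k; exact: resolv_ibp (tau_gt0 R k).
Qed.

(** The sign passes from resolvents to [map_approx] and then to [transport], dominated by |s| |y|,
    which is integrable as a product of square-integrable functions. *)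
Lemma transport_ibp : (marg1 pi).-L1 (fun x => s x * transport x ord0 i) /\
  \int[marg1 pi]_x (s x * transport x ord0 i) <= 0.
Proof.
have msf : measurable_fun setT (fun z : E * E => s z.1) by apply: measurableT_comp mf; exact: s2.1.
have L2s : L2 pi (fun z : E * E => s z.1).
  split => //; apply/(image_law_L1 mf (marg1_law pi) (g := fun x => s x ^+ 2)); last exact: s2.2.
  by apply: measurable_funX; exact: s2.1.
have L2y : L2 pi (fun z : E * E => enorm z.2).
  split; first exact: measurable_enorm.
  by under eq_fun do rewrite sqr_enorm; exact: plan_L1_snd.
have Lg : pi.-L1 (fun z : E * E => `|s z.1 * enorm z.2|) by apply: L1_norm; exact: L2_mul.
have mt : measurable_fun setT (fun x : E => s x * transport x ord0 i).
  by apply: measurable_funM; [exact: s2.1|apply: measurable_entry; exact: measurable_transport].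
have ma n : measurable_fun setT (fun x : E => s x * map_approx n x ord0 i).
  by apply: measurable_funM; [exact: s2.1|apply: measurable_entry; exact: measurable_map_approx].
have La n : (marg1 pi).-L1 (fun x => s x * map_approx n x ord0 i).
  apply: (s_bounded_L1 (K := n%:R)); first by apply: measurable_entry; exact: measurable_map_approx.
  move=> x; apply: (le_trans (coord_le_enorm _ _)).
  exact: (nearest_enorm (cpot n) (ler0n R n) (@lpot n)).
have [||||L c] := @Rint_dominated_ae _ _ _ pi (fun n (z : E * E) => s z.1 * map_approx n z.1 ord0 i)
  (fun z => s z.1 * transport z.1 ord0 i) _ _ _ Lg.
- by move=> n; exact: (image_law_L1 mf (marg1_law pi) (ma n)).1 (La n).
- by apply: (measurableT_comp mt mf).
- apply: ae_imp2 map_approx_cvg transport_ae => z h ->.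
  by apply: cvgM; [exact: cvg_cst|exact: cvg_rV_coord].
- apply: ae_imp map_approx_ae => z h n; rewrite !normrM ler_wpM2l// (ger0_norm (enorm_ge0 _)).
  apply: (le_trans (coord_le_enorm _ _)).
  by have := h n; case: ifP => // _ ->.
split; first by apply/(image_law_L1 mf (marg1_law pi) mt).
rewrite (image_law_Rint mf (marg1_law pi) mt) -(cvg_lim (@Rhausdorff R) c); apply: limr_le.
  by apply/cvg_ex; eexists; exact: c.
apply: nearW => n; have := map_approx_ibp n.
by rewrite (image_law_Rint mf (marg1_law pi) (ma n)).
Qed.

End integration_by_parts.
End transport_map.

(** * Semicontinuity of the penalised terms *)

Section second_marginal.
Context (R : realType) (d : nat).
Local Notation E := 'rV[R]_d.
Implicit Types (pi : plan R d) (mu : P2 R d).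

Definition swap_plan pi : plan R d :=
  plan_of measurable_snd measurable_fst (plan_L1_snd pi) (plan_L1_fst pi).

Lemma swap_plan_law pi : image_law (fun z : E * E => (z.2, z.1)) pi (swap_plan pi).
Proof. exact: plan_of_law. Qed.

(** As the first marginal of the swapped plan, it inherits every statement about [marg1] and limits
    of plans. *)
Definition second pi : P2 R d := marg1 (swap_plan pi).

Lemma second_law pi : image_law (snd : E * E -> E) pi (second pi).
Proof. exact: (image_law_comp measurable_fst (swap_plan_law pi) (marg1_law _)). Qed.

Definition dist2 pi : R := \int[pi]_z sqnorm (z.1 - z.2).

Lemma measurable_dist2 : measurable_fun setT (fun z : E * E => sqnorm (z.1 - z.2)).
Proof. by apply: measurable_sqn; apply: measurable_subv. Qed.

Lemma dist2_L1 pi : pi.-L1 (fun z => sqnorm (z.1 - z.2)).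
Proof.
apply: (@L1_le _ _ _ pi _ (fun z => 2 * (sqnorm z.1 + sqnorm z.2))); first exact: measurable_dist2.
  by move=> z; rewrite ger0_norm ?sqnorm_ge0//; exact: sqnormB_le.
by apply: L1Z; exact: L1D (plan_L1_fst pi) (plan_L1_snd pi).
Qed.

Lemma dist2_ge0 pi : 0 <= dist2 pi.
Proof. by apply: Rint_ge0 => z; exact: sqnorm_ge0. Qed.

Lemma M2_ge0 mu : 0 <= M2 mu.
Proof. by apply: Rint_ge0 => z; exact: sqnorm_ge0. Qed.

Lemma M2_law dT (T : measurableType dT) (P : probability T R) (X : T -> E) mu :
  measurable_fun setT X -> image_law X P mu -> M2 mu = \int[P]_w sqnorm (X w).
Proof. by move=> mX lX; exact: (image_law_Rint mX lX (@measurable_sqnorm R d)). Qed.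

Lemma dist2_law dT (T : measurableType dT) (P : probability T R) (X Y : T -> E) pi :
  measurable_fun setT X -> measurable_fun setT Y -> image_law (fun w => (X w, Y w)) P pi ->
  dist2 pi = \int[P]_w sqnorm (X w - Y w).
Proof.
by move=> mX mY l; exact: (image_law_Rint (measurable_pair_of mX mY) l measurable_dist2).
Qed.

Lemma M2_same mu nu : same_law mu nu -> M2 mu = M2 nu.
Proof. by move=> h; rewrite (M2_law (@measurable_id _ _ _) h). Qed.

Lemma sqnorm2_Rint pi : \int[pi]_z sqnorm2 z = M2 (marg1 pi) + M2 (second pi).
Proof.
rewrite (M2_law measurable_fst (marg1_law pi)) (M2_law measurable_snd (second_law pi)).
by rewrite -RintD//; [exact: plan_L1_fst|exact: plan_L1_snd].
Qed.

Lemma M2_second_le pi : M2 (second pi) <= 2 * M2 (marg1 pi) + 2 * dist2 pi.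
Proof.
rewrite (M2_law measurable_fst (marg1_law pi)) (M2_law measurable_snd (second_law pi)).
have L1 := L1Z 2 (plan_L1_fst pi); have L2 := L1Z 2 (dist2_L1 pi).
rewrite /dist2 -!RintZ//; try exact: plan_L1_fst; try exact: dist2_L1.
rewrite -RintD//; apply: le_Rint; [exact: plan_L1_snd|exact: (L1D L1 L2)|] => z.
have := sqnormB_le z.1 (z.1 - z.2); rewrite opprB addrC subrK; lra.
Qed.

Lemma image_law_same dT (T : measurableType dT) (P : probability T R) (X : T -> E) (mu nu : P2 R d) :
  image_law X P mu -> image_law X P nu -> same_law mu nu.
Proof. by move=> h1 h2 A mA; exact: (etrans (esym (h1 A mA)) (h2 A mA)). Qed.

Lemma same_law_sym mu nu : same_law mu nu -> same_law nu mu.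
Proof. by move=> h A mA; exact: esym (h A mA). Qed.

Definition pen (c : R) mu : \bar R := (c%:E * entropy mu)%E.

Lemma pen_same c mu nu : same_law mu nu -> pen c mu = pen c nu.
Proof. by move=> h; rewrite /pen (entropy_same h). Qed.

Definition pen_cst : R := `|1 - w0 R d| + d%:R.

Lemma pen_ge c mu : 0 <= c -> ((- (c * pen_cst) - c * d%:R * M2 mu)%:E <= pen c mu)%E.
Proof.
move=> c0; apply: (@le_trans _ _ (c%:E * (1 - w0 R d - d%:R * (1 + M2 mu))%:E)%E).
  rewrite -EFinM lee_fin /pen_cst.
  have h : - `|1 - w0 R d| <= 1 - w0 R d by rewrite lerNl; have := ler_norm (- (1 - w0 R d)); rewrite normrN.
  have := ler_wpM2l c0 h; rewrite !mulrDr; lra.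
by apply: lee_wpmul2l; rewrite ?lee_fin//; exact: entropy_ge_M2.
Qed.

Lemma pen_le c mu x : 0 <= c -> (entropy mu <= x%:E)%E -> (pen c mu <= (c * x)%:E)%E.
Proof. by move=> c0 h; rewrite /pen EFinM; apply: lee_wpmul2l => //; rewrite lee_fin. Qed.

Lemma pen_entropy c mu x : 0 < c -> (pen c mu <= x%:E)%E -> (entropy mu <= (x / c)%:E)%E.
Proof.
move=> c0; rewrite /pen; case: (entropy mu) => [r| |].
- by rewrite -EFinM !lee_fin ler_pdivlMr// mulrC.
- by rewrite gt0_muley ?lte_fin.
- by rewrite leNye.
Qed.

Lemma pen_lsc c (pi_ : nat -> plan R d) pi (x : R) : 0 <= c -> plan_cvg pi_ pi ->
  (forall k, (pen c (marg1 (pi_ k)) <= x%:E)%E) -> (pen c (marg1 pi) <= x%:E)%E.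
Proof.
rewrite le_eqVlt => /predU1P[<-|c0] pipi h.
  (* For c = 0 the penalty is 0 even at infinite entropy, by the convention 0 * +oo = 0. *)
  by move: (h 0%N); rewrite /pen !mul0e.
have := pen_le (ltW c0) (entropy_lsc pipi (fun k => pen_entropy c0 (h k))).
by rewrite mulrC divfK ?gt_eqF.
Qed.

Lemma swap_plan_cvg (pi_ : nat -> plan R d) pi :
  plan_cvg pi_ pi -> plan_cvg (swap_plan \o pi_) (swap_plan pi).
Proof. by apply: plan_cvg_swap => [k|]; exact: swap_plan_law. Qed.

(** Lower semicontinuity in terms of sublevel predicates [Q], which serves both the extended-valued
    penalties and the real integrals. *)
Lemma lsc_limit (pi_ : nat -> plan R d) pi (Q : plan R d -> R -> Prop) (u : nat -> R) (l : R) :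
  (forall (pi_ : nat -> plan R d) x, plan_cvg pi_ pi -> (forall k, Q (pi_ k) x) -> Q pi x) ->
  (forall pi x y, Q pi x -> x <= y -> Q pi y) ->
  plan_cvg pi_ pi -> (forall k, Q (pi_ k) (u k)) -> u @ \oo --> l ->
  forall e, 0 < e -> Q pi (l + e).
Proof.
move=> Qlsc Qmono pipi Qu ul e e0.
have [N _ hN] := cvgr_le _ ul _ (ltr_pwDr e0 (lexx l)).
apply: (Qlsc (fun k => pi_ (k + N)%N)).
  by apply: (plan_cvg_subseq (g := fun k => (k + N)%N)) => // n; rewrite leq_addr.
by move=> k; apply: Qmono (Qu _) _; apply: hN; rewrite /= leq_addl.
Qed.

Lemma pen_lsc_limit c (pi_ : nat -> plan R d) pi (u : nat -> R) (l : R) : 0 <= c -> plan_cvg pi_ pi ->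
  (forall k, (pen c (marg1 (pi_ k)) <= (u k)%:E)%E) -> u @ \oo --> l ->
  (pen c (marg1 pi) <= l%:E)%E.
Proof.
move=> c0 pipi h ul; apply/lee_addgt0Pr => e e0; rewrite -EFinD.
apply: (@lsc_limit pi_ pi (fun pi x => (pen c (marg1 pi) <= x%:E)%E) u l _ _ pipi h ul e e0).
- by move=> pi'_ x h1 h2; exact: (pen_lsc c0 h1 h2).
- by move=> pi' x y h1 xy; apply: (le_trans h1); rewrite lee_fin.
Qed.

Lemma Rint_lsc_limit (c : E * E -> R) (pi_ : nat -> plan R d) pi (u : nat -> R) (l : R) :
  continuous c -> (forall z, 0 <= c z) -> (forall pi, pi.-L1 c) -> plan_cvg pi_ pi ->
  (forall k, \int[pi_ k]_z c z <= u k) -> u @ \oo --> l -> \int[pi]_z c z <= l.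
Proof.
move=> cc c0 Lc pipi h ul; apply/ler_addgt0Pr => e e0.
apply: (@lsc_limit pi_ pi (fun pi x => \int[pi]_z c z <= x) u l _ _ pipi h ul e e0).
- by move=> pi'_ x h1 h2; exact: (plan_cvg_lsc h1 cc c0 (fun k => Lc _) h2).2.
- by move=> pi' x y h1 xy; apply: (le_trans h1).
Qed.

End second_marginal.

(** The common form of the two kinds of continuity assumed: weak continuity, and semicontinuity
    together with a W1-Lipschitz bound. *)
Definition plan_usc (R : realType) d (T : R) (V : R -> P2 R d -> R) : Prop :=
  forall (t_ : nat -> R) t (pi_ : nat -> plan R d) pi, (forall n, t_ n \in `[0, T]) -> t \in `[0, T] ->
  t_ @ \oo --> t -> plan_cvg pi_ pi -> forall e, 0 < e ->
  \forall n \near \oo, V (t_ n) (marg1 (pi_ n)) <= V t (marg1 pi) + e.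

Definition plan_lsc (R : realType) d (T : R) (V : R -> P2 R d -> R) : Prop :=
  forall (t_ : nat -> R) t (pi_ : nat -> plan R d) pi, (forall n, t_ n \in `[0, T]) -> t \in `[0, T] ->
  t_ @ \oo --> t -> plan_cvg pi_ pi -> forall e, 0 < e ->
  \forall n \near \oo, V t (marg1 pi) - e <= V (t_ n) (marg1 (pi_ n)).

(** * Doubling of variables *)

Section doubling.
Context (R : realType) (d : nat).
Local Notation E := 'rV[R]_d.
Variables (T : R) (V1 V2 : R -> P2 R d -> R) (B1 d1 d2 a0 a1 lam kap : R) (a : R -> R).
Hypotheses (T0 : 0 < T) (d1ge : 0 <= d1) (d2ge : 0 <= d2) (a0gt : 0 < a0) (lam0 : 0 < lam) (kap0 : 0 <= kap).
Hypotheses (ca : forall (t_ : nat -> R) t, t_ @ \oo --> t -> (fun n => a (t_ n)) @ \oo --> a t)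
  (ale : forall t, t \in `[0, T] -> a0 <= a t <= a1).
Hypotheses (V1b : forall t mu, t \in `[0, T] -> `|V1 t mu| <= B1)
  (V2b : forall t mu, t \in `[0, T] -> `|V2 t mu| <= B1).
Hypotheses (V1usc : plan_usc T V1) (V2lsc : plan_lsc T V2).
Hypotheses (d1lam : d1 * d%:R <= lam / 4) (d2lam : d2 * d%:R * 2 <= lam / 4) (d2a0 : d2 * d%:R * 2 <= a0 / 2).

Definition gain (t s : R) (pi : plan R d) : R :=
  V1 t (marg1 pi) - V2 s (second pi) - a t * dist2 pi - lam * M2 (marg1 pi) - kap * (T - t).

(** Real upper bounds of the penalties are maximised along with the plan, so that all values stay
    real; at a maximum the bounds are attained, see [max_pen]. *)
Definition admissible (pi : plan R d) (e1 e2 : R) : Prop :=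
  (pen d1 (marg1 pi) <= e1%:E)%E /\ (pen d2 (second pi) <= e2%:E)%E.

Definition gain_bound : R := 2 * B1 + (d1 + d2) * pen_cst R d.

(** The entropies are bounded below only in terms of the second moments. The smallness of d1 and d2
    lets half of the moment penalty and half of the transport cost absorb this. *)
Lemma gain_coercive t s pi e1 e2 : t \in `[0, T] -> s \in `[0, T] -> admissible pi e1 e2 ->
  gain t s pi - e1 - e2 <= gain_bound - lam / 2 * M2 (marg1 pi) - a0 / 2 * dist2 pi.
Proof.
move=> tT sT [h1 h2].
have := le_trans (pen_ge (marg1 pi) d1ge) h1; have := le_trans (pen_ge (second pi) d2ge) h2.
rewrite !lee_fin.
have /andP[at0 _] := ale tT; have aD := ler_wpM2r (dist2_ge0 pi) at0.
have h3 := ler_wpM2r (M2_ge0 (marg1 pi)) d1lam.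
have h4 := ler_wpM2l (mulr_ge0 d2ge (ler0n R d)) (M2_second_le pi).
have h5 := ler_wpM2r (M2_ge0 (marg1 pi)) d2lam.
have h6 := ler_wpM2r (dist2_ge0 pi) d2a0.
have := V1b (marg1 pi) tT; have := V2b (second pi) sT.
rewrite !ler_norml => /andP[h7 _] /andP[_ h8].
have h9 : 0 <= kap * (T - t) by move: tT; rewrite in_itv/= => /andP[_ tT]; rewrite mulr_ge0// subr_ge0.
rewrite /gain /gain_bound; move: (pen_cst R d) (M2 (marg1 pi)) (M2 (second pi)) (dist2 pi) aD h3 h4 h5 h6 h7 h8 h9 => p m1 m2 D.
by move: (kap * _) => k; rewrite !(mulrDl, mulrDr); lra.
Qed.

Lemma admissible_ge pi e1 e2 : admissible pi e1 e2 ->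
  - (d1 * pen_cst R d) - d1 * d%:R * M2 (marg1 pi) <= e1 /\
  - (d2 * pen_cst R d) - d2 * d%:R * M2 (second pi) <= e2.
Proof.
move=> [h1 h2]; split; rewrite -lee_fin.
  exact: le_trans (pen_ge (marg1 pi) d1ge) h1.
exact: le_trans (pen_ge (second pi) d2ge) h2.
Qed.

(** Used twice: for the existence of maxima, and for the limit of maximisers as the time penalty
    becomes infinite. This is why the lower bounds [c_] form a sequence of their own. *)
Lemma gain_compact (t_ s_ e1_ e2_ c_ : nat -> R) (pi_ : nat -> plan R d) (low : R) :
  (forall n, t_ n \in `[0, T]) -> (forall n, s_ n \in `[0, T]) ->
  (forall n, admissible (pi_ n) (e1_ n) (e2_ n)) ->
  (forall n, low <= c_ n) -> (forall n, c_ n <= gain (t_ n) (s_ n) (pi_ n) - e1_ n - e2_ n) ->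
  exists (f : nat -> nat) t s pi e1 e2 c,
    [/\ (forall n, (n <= f n)%N), t_ \o f @ \oo --> t, s_ \o f @ \oo --> s & c_ \o f @ \oo --> c] /\
    [/\ t \in `[0, T], s \in `[0, T], admissible pi e1 e2 & c <= gain t s pi - e1 - e2].
Proof.
move=> tT sT adm lc cg.
have co n := le_trans (cg n) (gain_coercive (tT n) (sT n) (adm n)).
pose m1 n := M2 (marg1 (pi_ n)); pose D n := dist2 (pi_ n).
have m1b n : lam * m1 n <= 2 * (gain_bound - low).
  have := co n; have := lc n; have := dist2_ge0 (pi_ n); rewrite -/(D n) -/(m1 n) => D0.
  have : 0 <= a0 / 2 * D n by rewrite mulr_ge0// divr_ge0// ltW.
  lra.
have Db n : a0 * D n <= 2 * (gain_bound - low).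
  have := co n; have := lc n; have := M2_ge0 (marg1 (pi_ n)); rewrite -/(D n) -/(m1 n) => m0.
  have : 0 <= lam / 2 * m1 n by rewrite mulr_ge0// divr_ge0// ltW.
  lra.
pose G := 2 * (gain_bound - low).
have G0 : 0 <= G by apply: le_trans (m1b 0%N); rewrite mulr_ge0 ?M2_ge0// ltW.
have m1b' n : m1 n <= G / lam by rewrite ler_pdivlMr// mulrC; exact: m1b.
have Db' n : D n <= G / a0 by rewrite ler_pdivlMr// mulrC; exact: Db.
pose M := 3 * (G / lam) + 2 * (G / a0).
have mom n : \int[pi_ n]_z sqnorm2 z <= M.
  rewrite sqnorm2_Rint; have := M2_second_le (pi_ n); have := m1b' n; have := Db' n.
  by rewrite /m1 /D /M; lra.
have [f0 incf0 [pi pipi]] := plan_compact mom.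
have ge0f0 : forall n, (n <= f0 n)%N by exact: increasing_seq_ge.
(* All real sequences are packed for a single diagonal extraction; from index 7 on the entry is the
   default 0. *)
pose u (j n : nat) : R := nth 0 [:: t_ (f0 n); s_ (f0 n); e1_ (f0 n); e2_ (f0 n); c_ (f0 n); m1 (f0 n); D (f0 n)] j.
pose W := (d1 + d2) * pen_cst R d + (d1 + d2) * d%:R * (3 * (G / lam) + 2 * (G / a0)).
have GL : 0 <= G / lam by rewrite divr_ge0// ltW.
have Ga : 0 <= G / a0 by rewrite divr_ge0// ltW.
have pc0 : 0 <= pen_cst R d by rewrite addr_ge0.
have elow n : - W <= e1_ n /\ - W <= e2_ n.
  have [h1 h2] := admissible_ge (adm n).
  have h3 := M2_second_le (pi_ n); have h4 := m1b' n; have h5 := Db' n.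
  have k1 := ler_wpM2l (mulr_ge0 d1ge (ler0n R d)) h4.
  have h6 : M2 (second (pi_ n)) <= 3 * (G / lam) + 2 * (G / a0) by move: h3 h4 h5; rewrite /m1 /D; lra.
  have k2 := ler_wpM2l (mulr_ge0 d2ge (ler0n R d)) h6.
  have k3 : 0 <= d1 * d%:R * (3 * (G / lam) + 2 * (G / a0)) by rewrite !mulr_ge0// addr_ge0// mulr_ge0.
  have k4 : 0 <= d2 * d%:R * (3 * (G / lam) + 2 * (G / a0)) by rewrite !mulr_ge0// addr_ge0// mulr_ge0.
  have k5 : 0 <= d1 * d%:R * (2 * (G / lam) + 2 * (G / a0)) by rewrite !mulr_ge0// addr_ge0// mulr_ge0.
  have k6 := mulr_ge0 d1ge pc0; have k7 := mulr_ge0 d2ge pc0.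
  move: h1 h2 k1 k2 k3 k4 k5 k6 k7; rewrite /W /m1 !mulrDl !mulrDr => *; split; lra.
have eup n : e1_ n + e2_ n <= 2 * B1 - low.
  have := cg n; have := lc n; rewrite /gain.
  have := V1b (marg1 (pi_ n)) (tT n); have := V2b (second (pi_ n)) (sT n).
  rewrite !ler_norml => /andP[h7 _] /andP[_ h8].
  have h9 : 0 <= kap * (T - t_ n).
    by move: (tT n); rewrite in_itv/= => /andP[_ ?]; rewrite mulr_ge0// subr_ge0.
  have /andP[at0 _] := ale (tT n).
  have h10 : 0 <= a (t_ n) * dist2 (pi_ n) by rewrite mulr_ge0 ?dist2_ge0//; apply: le_trans at0; exact: ltW.
  have h11 : 0 <= lam * M2 (marg1 (pi_ n)) by rewrite mulr_ge0 ?M2_ge0// ltW.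
  lra.
have ub j : exists K, forall n, `|u j n| <= K.
  have tb (x_ : nat -> R) n : x_ n \in `[0, T] -> `|x_ n| <= T.
    by rewrite in_itv/= => /andP[h1 h2]; rewrite ger0_norm.
  have eb n : `|e1_ n| <= W + W + `|2 * B1 - low| /\ `|e2_ n| <= W + W + `|2 * B1 - low|.
    have [h1 h2] := elow n; have := eup n; have := ler_norm (2 * B1 - low); have := normr_ge0 (2 * B1 - low).
    have W0 : 0 <= W by rewrite /W addr_ge0// !mulr_ge0// ?addr_ge0// mulr_ge0.
    by move=> h3 h4 h5; split; rewrite ler_norml; apply/andP; split; lra.
  case: j => [|[|[|[|[|[|[|j]]]]]]].
  - by exists T => n; exact: (tb t_ _ (tT (f0 n))).
  - by exists T => n; exact: (tb s_ _ (sT (f0 n))).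
  - by exists (W + W + `|2 * B1 - low|) => n; exact: (eb _).1.
  - by exists (W + W + `|2 * B1 - low|) => n; exact: (eb _).2.
  - exists (`|low| + `|gain_bound|) => n /=.
    have h1 : c_ (f0 n) <= gain_bound.
      apply: le_trans (co (f0 n)) _; have := M2_ge0 (marg1 (pi_ (f0 n))); have := dist2_ge0 (pi_ (f0 n)).
      have l2 : 0 <= lam / 2 by rewrite divr_ge0// ltW.
      have a2 : 0 <= a0 / 2 by rewrite divr_ge0// ltW.
      move=> /(mulr_ge0 a2) h1 /(mulr_ge0 l2) h2; lra.
    have := lc (f0 n); have := ler_norm gain_bound; have := ler_norm (- low); rewrite normrN.
    have := normr_ge0 low; have := normr_ge0 gain_bound.
    have -> : u 4%N n = c_ (f0 n) by [].
    by rewrite ler_norml => *; apply/andP; split; lra.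
  - by exists (G / lam) => n; rewrite (_ : u 5%N n = m1 (f0 n))// ger0_norm ?M2_ge0.
  - by exists (G / a0) => n; rewrite (_ : u 6%N n = D (f0 n))// ger0_norm ?dist2_ge0.
  - by exists 0 => n; rewrite /u nth_default// normr0.
have [f1 incf1 cu] := diagonal_subseq ub.
have ge0f1 : forall n, (n <= f1 n)%N by exact: increasing_seq_ge.
have lims j : exists l : R, u j \o f1 @ \oo --> l by exists (limn (u j \o f1)); exact: cu.
have [t ct] := lims 0%N; have [s cs] := lims 1%N; have [e1 ce1] := lims 2%N; have [e2 ce2] := lims 3%N.
have [c cc] := lims 4%N; have [m cm] := lims 5%N; have [D' cD] := lims 6%N.
have pif := plan_cvg_subseq ge0f1 pipi.
exists (f0 \o f1), t, s, pi, e1, e2, c; split.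
  split => //; first by move=> n; apply: leq_trans (ge0f1 n) (ge0f0 _).
have in0T x (x_ : nat -> R) : (forall n, x_ n \in `[0, T]) -> x_ @ \oo --> x -> x \in `[0, T].
  move=> h cx; rewrite in_itv/= -(cvg_lim (@Rhausdorff R) cx); apply/andP; split.
    apply: limr_ge; first by apply/cvg_ex; eexists; exact: cx.
    by apply: nearW => n; have := h n; rewrite in_itv/= => /andP[].
  apply: limr_le; first by apply/cvg_ex; eexists; exact: cx.
  by apply: nearW => n; have := h n; rewrite in_itv/= => /andP[].
have tT' : t \in `[0, T] by apply: (in0T _ _ _ ct) => n; exact: tT.
have sT' : s \in `[0, T] by apply: (in0T _ _ _ cs) => n; exact: sT.
split => //.
  split; first exact: (pen_lsc_limit d1ge pif (fun k => (adm _).1) ce1).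
  apply: (pen_lsc_limit d2ge (swap_plan_cvg pif) (fun k => (adm _).2) ce2).
have Dle : dist2 pi <= D'.
  apply: (Rint_lsc_limit _ _ _ pif (u := u 6%N \o f1) _ cD) => //.
  - have cs' : continuous (fun z : E * E => z.1 - z.2).
      by apply: continuous_subv => z; [exact: cvg_fst|exact: cvg_snd].
    by move=> z; exact: (continuous_comp (cs' z) (@continuous_sqnorm R d _)).
  - by move=> z; exact: sqnorm_ge0.
  - exact: dist2_L1.
have mle : M2 (marg1 pi) <= m.
  rewrite (M2_law measurable_fst (marg1_law pi)).
  apply: (Rint_lsc_limit _ _ _ pif (u := u 5%N \o f1) _ cm) => //.
  - by move=> z; apply: (continuous_comp _ (@continuous_sqnorm R d _)); exact: cvg_fst.
  - by move=> z; exact: sqnorm_ge0.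
  - exact: plan_L1_fst.
  - by move=> k; rewrite -(M2_law measurable_fst (marg1_law _)).
apply/ler_addgt0Pr => e e0.
have e20 : 0 < e / 2 by rewrite divr_gt0.
have n1 := V1usc (fun n => tT (f0 (f1 n))) tT' ct pif e20.
have n2 := V2lsc (fun n => sT (f0 (f1 n))) sT' cs (swap_plan_cvg pif) e20.
have ct' : (fun n => t_ (f0 (f1 n))) @ \oo --> t by exact: ct.
have cat : (fun n => a (t_ (f0 (f1 n)))) @ \oo --> a t.
  exact: ca.
have cA : (fun n => (V1 t (marg1 pi) + e / 2) - (V2 s (second pi) - e / 2) - a (t_ (f0 (f1 n))) * u 6%N (f1 n)
    - lam * u 5%N (f1 n) - kap * (T - t_ (f0 (f1 n))) - u 2%N (f1 n) - u 3%N (f1 n)) @ \oo -->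
   (V1 t (marg1 pi) + e / 2) - (V2 s (second pi) - e / 2) - a t * D' - lam * m - kap * (T - t) - e1 - e2.
  apply: cvgB; last exact: ce2. apply: cvgB; last exact: ce1.
  apply: cvgB; last by apply: cvgM; [exact: cvg_cst|apply: cvgB; [exact: cvg_cst|exact: ct]].
  apply: cvgB; last by apply: cvgM; [exact: cvg_cst|exact: cm].
  apply: cvgB; first exact: cvg_cst.
  by apply: cvgM; [exact: cat|exact: cD].
have : c <= (V1 t (marg1 pi) + e / 2) - (V2 s (second pi) - e / 2) - a t * D' - lam * m - kap * (T - t) - e1 - e2.
  apply: (cvgr_le_cvg cc cA).
  - near=> n.
    have k1 : V1 (t_ (f0 (f1 n))) (marg1 (pi_ (f0 (f1 n)))) <= V1 t (marg1 pi) + e / 2 by near: n.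
    have k2 : V2 s (second pi) - e / 2 <= V2 (s_ (f0 (f1 n))) (second (pi_ (f0 (f1 n)))) by near: n.
    have := cg (f0 (f1 n)); rewrite /gain /u /= /m1 /D.
    move: k1 k2; lra.
have /andP[at0 _] := ale tT'.
have k1 : a t * dist2 pi <= a t * D' by rewrite ler_wpM2l// (le_trans _ at0)// ltW.
have k2 : lam * M2 (marg1 pi) <= lam * m by rewrite ler_wpM2l// ltW.
by rewrite /gain; lra.
Unshelve. all: by end_near. Qed.

Lemma doubling_max (beta : R) (t0 : R) (pi0 : plan R d) (e10 e20 : R) : 0 < beta -> t0 \in `[0, T] ->
  admissible pi0 e10 e20 ->
  exists t s pi e1 e2, [/\ t \in `[0, T], s \in `[0, T], admissible pi e1 e2 &
    forall t' s' pi' e1' e2', t' \in `[0, T] -> s' \in `[0, T] -> admissible pi' e1' e2' ->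
      gain t' s' pi' - e1' - e2' - (t' - s') ^+ 2 / beta <= gain t s pi - e1 - e2 - (t - s) ^+ 2 / beta].
Proof.
move=> beta0 t0T adm0.
pose S : set R := [set v | exists t s pi e1 e2, [/\ t \in `[0, T], s \in `[0, T], admissible pi e1 e2 &
  v = gain t s pi - e1 - e2 - (t - s) ^+ 2 / beta]].
have Sb : ubound S gain_bound.
  move=> _ [t [s [pi [e1 [e2 [tT sT adm ->]]]]]].
  have := gain_coercive tT sT adm.
  have : 0 <= lam / 2 * M2 (marg1 pi) by rewrite mulr_ge0 ?M2_ge0// divr_ge0// ltW.
  have : 0 <= a0 / 2 * dist2 pi by rewrite mulr_ge0 ?dist2_ge0// divr_ge0// ltW.
  have : 0 <= (t - s) ^+ 2 / beta by rewrite divr_ge0 ?sqr_ge0// ltW.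
  lra.
have hS : has_sup S.
  split; last by exists gain_bound.
  by exists (gain t0 t0 pi0 - e10 - e20 - (t0 - t0) ^+ 2 / beta); exists t0, t0, pi0, e10, e20.
have approx (n : nat) : exists x : R * R * plan R d * R * R,
   [/\ x.1.1.1.1 \in `[0, T], x.1.1.1.2 \in `[0, T], admissible x.1.1.2 x.1.2 x.2 &
     sup S - n.+1%:R^-1 < gain x.1.1.1.1 x.1.1.1.2 x.1.1.2 - x.1.2 - x.2 - (x.1.1.1.1 - x.1.1.1.2) ^+ 2 / beta].
  have [||v [t [s [pi [e1 [e2 [tT sT adm ->]]]]]] hv] := sup_adherent (eps := n.+1%:R^-1) (E := S) => //.
  by exists (t, s, pi, e1, e2).
pose x n := sval (cid (approx n)); have xP n := svalP (cid (approx n)).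
(* The time penalty is put into the lower bounds [c_], whose limit then contains its value at the
   limiting times. *)
have [||f [t [s [pi [e1 [e2 [c [[fn ct cs cc] [tT sT adm le]]]]]]]]] :=
  @gain_compact (fun n => (x n).1.1.1.1) (fun n => (x n).1.1.1.2) (fun n => (x n).1.2) (fun n => (x n).2)
    (fun n => sup S - n.+1%:R^-1 + ((x n).1.1.1.1 - (x n).1.1.1.2) ^+ 2 / beta) (fun n => (x n).1.1.2) (sup S - 1)
    (fun n => let: And4 h _ _ _ := xP n in h) (fun n => let: And4 _ h _ _ := xP n in h)
    (fun n => let: And4 _ _ h _ := xP n in h) _ _.
- move=> n; have : 0 <= ((x n).1.1.1.1 - (x n).1.1.1.2) ^+ 2 / beta by rewrite divr_ge0 ?sqr_ge0// ltW.
  have : n.+1%:R^-1 <= 1 :> R by rewrite invf_le1// ler1n.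
  by move: (n.+1%:R^-1) (_ / beta) => i q; lra.
- move=> n; have [_ _ _] := xP n; rewrite -/(x n).
  move: (n.+1%:R^-1) (_ / beta) (gain _ _ _) (x n).1.2 (x n).2 => i q v p1 p2.
  by rewrite ltrBrDr => /ltW; rewrite -!lerBrDr; lra.
exists t, s, pi, e1, e2; split => // t' s' pi' e1' e2' t'T s'T adm'.
have h1 : gain t' s' pi' - e1' - e2' - (t' - s') ^+ 2 / beta <= sup S.
  by apply: ub_le_sup; [exists gain_bound|exists t', s', pi', e1', e2'].
apply: (le_trans h1).
have cc' : (fun n => sup S - n.+1%:R^-1 + ((x n).1.1.1.1 - (x n).1.1.1.2) ^+ 2 / beta) \o f @ \oo -->
   sup S - 0 + (t - s) ^+ 2 / beta.
  apply: cvgD.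
    apply: cvgB; first exact: cvg_cst.
    exact: (cvg_subseq fn (@cvg_harmonic R)).
  apply: cvgM; last exact: cvg_cst.
  by rewrite expr2; apply: cvgM; apply: cvgB; [exact: ct|exact: cs|exact: ct|exact: cs].
have := cvg_unique (@Rhausdorff R) cc cc'; move: le => + ce; rewrite ce; lra.
Qed.

End doubling.

(** * Variations of the plan and of time at a maximum *)

Section minimal_plans.
Context (R : realType) (d : nat).
Local Notation E := 'rV[R]_d.

Lemma pen_fin (c : R) (mu : P2 R d) (x : R) : 0 <= c -> (pen c mu <= x%:E)%E -> exists p : R, pen c mu = p%:E.
Proof.
move=> c0; have := pen_ge mu c0; case: (pen c mu) => [p _ _|//|//]; by exists p.
Qed.

Lemma second_same (pi1 pi2 : plan R d) : same_law (marg2 pi1) (marg2 pi2) -> same_law (second pi1) (second pi2).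
Proof.
move=> h; have k : image_law (snd : E * E -> E) pi1 (marg2 pi2) by exact: (image_law_comp (@measurable_id _ _ _) (marg2_law pi1) h).
have k2 := image_law_same (marg2_law pi2) (second_law pi2).
exact: (image_law_same (second_law pi1) (image_law_comp (@measurable_id _ _ _) k k2)).
Qed.

Lemma minimal_cost_swap (pi g : plan R d) : minimal_cost pi ->
  image_law (fun z : E * E => (z.2, z.1)) pi g -> minimal_cost g.
Proof.
move=> mpi lg g' h1 h2.
have l1 : image_law (snd : E * E -> E) pi (marg1 g) by exact: (image_law_comp measurable_fst lg (marg1_law g)).
have l2 : image_law (fst : E * E -> E) pi (marg2 g) by exact: (image_law_comp measurable_snd lg (marg2_law g)).
have l1' : image_law (snd : E * E -> E) (swap_plan g') (marg1 g').
  apply: (image_law_factor measurable_snd (swap_plan_law g')); exact: marg1_law.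
have l2' : image_law (fst : E * E -> E) (swap_plan g') (marg2 g').
  apply: (image_law_factor measurable_fst (swap_plan_law g')); exact: marg2_law.
have := mpi (swap_plan g') _ _.
have -> : \int[pi]_z sqnorm (z.1 - z.2) = \int[g]_z sqnorm (z.1 - z.2).
  rewrite -![LHS]/(dist2 pi) -![RHS]/(dist2 g) (dist2_law measurable_snd measurable_fst lg).
  by congr Rintegral; apply/funext => z; rewrite sqnormBC.
have -> : \int[swap_plan g']_z sqnorm (z.1 - z.2) = \int[g']_z sqnorm (z.1 - z.2).
  rewrite -![LHS]/(dist2 _) (dist2_law measurable_snd measurable_fst (swap_plan_law g')).
  by congr Rintegral; apply/funext => z; rewrite sqnormBC.
apply.
- apply: (image_law_same (marg1_law pi)).
  have h : image_law id (marg2 g) (marg2 g') by exact: h2.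
  have k := image_law_comp (@measurable_id _ _ _) l2 h.
  have := image_law_same l2' (marg1_law (swap_plan g')) => e.
  exact: (image_law_comp (@measurable_id _ _ _) k e).
- apply: (image_law_same (marg2_law pi)).
  have k := image_law_comp (@measurable_id _ _ _) l1 h1.
  have := image_law_same l1' (marg2_law (swap_plan g')) => e.
  exact: (image_law_comp (@measurable_id _ _ _) k e).
Qed.

(** A coupling of laws with finite second moments has a finite second moment, so it defines a
    competing plan. *)
Lemma optimal_of_minimal (g : plan R d) : minimal_cost g -> optimal g.
Proof.
move=> mg; rewrite /optimal; apply/eqP; rewrite eq_le; apply/andP; split; last first.
  rewrite -RintegralE; last exact: dist2_L1.
  apply: (transport_cost_le (c := fun z : E * E => sqnorm (z.1 - z.2)) measurable_fst measurable_snd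
    (marg1_law g) (marg2_law g)) => //; [exact: measurable_dist2|by move=> z; exact: sqnorm_ge0|exact: dist2_L1].
apply: le_ereal_inf_tmp => _ [k [k1 k2] <-].
have mf := @measurable_fst _ _ E E; have ms := @measurable_snd _ _ E E.
have L1k : k.-L1 (fun z : E * E => sqnorm z.1) by exact: (image_law_L1 mf k1 (@measurable_sqnorm R d)).1 (P2_L1 _).
have L2k : k.-L1 (fun z : E * E => sqnorm z.2) by exact: (image_law_L1 ms k2 (@measurable_sqnorm R d)).1 (P2_L1 _).
pose g' := plan_of mf ms L1k L2k.
have lg' : image_law (fun z : E * E => (z.1, z.2)) k g' by exact: plan_of_law.
have Lk : k.-L1 (fun z : E * E => sqnorm (z.1 - z.2)) by exact: sqnormB_L1.
rewrite -!RintegralE//; last exact: dist2_L1.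
rewrite lee_fin -[leRHS](dist2_law mf ms lg'); apply: mg.
- apply: (image_law_same k1); exact: (image_law_comp mf lg' (marg1_law g')).
- apply: (image_law_same k2); exact: (image_law_comp ms lg' (marg2_law g')).
Qed.

(** Moving y for a time 1 / c along c (x - y) leads to x: the displaced plan is [pi] swapped, which
    is optimal, so [g] approximates itself. *)
Lemma tangent_reverse (mu : P2 R d) (pi g : plan R d) (c : R) : minimal_cost pi -> 0 < c ->
  image_law (fun z : E * E => (z.2, c *: (z.1 - z.2))) pi g -> plans_over mu g -> tangentK mu g.
Proof.
move=> mpi c0 lg gmu; split => // e e0; exists g; split => //.
  exists c^-1; first by rewrite invr_gt0.
  apply: optimal_of_minimal; apply: (minimal_cost_swap mpi).
  have h := image_law_comp (measurable_move_map c^-1) lg (move_plan_law c^-1 g).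
  apply: image_law_ext h => z; rewrite /= /move_map /= scalerA mulVf ?gt_eqF// scale1r.
  by rewrite addrC subrK.
have mw : measurable_fun setT (fun z : E * E => ((z.1, z.2), z.2)).
  apply/measurable_fun_pairP; split => /=; last exact: measurable_snd.
  exact: (measurable_pair_of measurable_fst measurable_snd).
pose th : probability (E * E * E)%type R := law g mw.
have Gth : Gamma g g th.
  by split => A mA; rewrite /pushforward /th lawE; congr (g _); apply/seteqP; split => -[x y].
apply: (Wfib_lt Gth e0 (t := 0)); first by rewrite exprn_gt0.
rewrite (image_law_ge0_integral mw (@image_law_law _ _ _ _ _ g _ mw)); last 2 first.
- by apply/measurable_EFinP; apply: measurable_sqn; apply: measurable_subv => //; exact: measurableT_comp.
- by move=> w; rewrite lee_fin sqnorm_ge0.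
rewrite (eq_integral (fun=> 0%E)) ?integral0// => z _ /=.
by rewrite subrr sqnorm0.
Qed.

End minimal_plans.

(** The Young parameter q is fixed first, to tame the mixed term of time and cost, and the radius
    afterwards, since [C2 q] may blow up as q tends to 0. *)
Lemma small_error (R : realType) (A C1 e : R) (C2 : R -> R) : 0 <= A -> 0 <= C1 ->
  (forall q, 0 < q -> 0 <= C2 q) -> 0 < e ->
  exists q eta, [/\ 0 < q, 0 < eta & forall tau nu : R, 0 <= tau -> 0 <= nu -> tau + nu < eta ->
    A * q * tau + C1 * tau ^+ 2 + C2 q * nu ^+ 2 <= e * (tau + nu)].
Proof.
move=> A0 C10 C20 e0; pose q := e / (2 * (A + 1)).
have q0 : 0 < q by rewrite divr_gt0// mulr_gt0// ltr_wpDl.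
have Aq : A * q <= e / 2.
  rewrite /q (_ : _ * _ = (e / 2) * (A / (A + 1))); last by field; rewrite gt_eqF// ltr_wpDl.
  apply: ler_piMr; first by rewrite divr_ge0// ltW.
  by rewrite ler_pdivrMr ?ltr_wpDl// mul1r lerDl.
pose eta := e / (2 * (C1 + C2 q + 1)).
have den : 0 < C1 + C2 q + 1 by rewrite ltr_wpDl// addr_ge0// C20.
have eta0 : 0 < eta by rewrite divr_gt0// mulr_gt0.
have b : (C1 + C2 q) * eta <= e / 2.
  rewrite /eta (_ : _ * _ = (e / 2) * ((C1 + C2 q) / (C1 + C2 q + 1))); last by field; rewrite gt_eqF.
  apply: ler_piMr; first by rewrite divr_ge0// ltW.
  by rewrite ler_pdivrMr// mul1r lerDl.
exists q, eta; split => // tau nu t0 n0 tn.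
have C2q := C20 q q0.
have h1 : C1 * tau ^+ 2 <= C1 * eta * tau.
  by rewrite expr2 mulrA ler_wpM2r// ler_wpM2l//; lra.
have h2 : C2 q * nu ^+ 2 <= C2 q * eta * nu.
  by rewrite expr2 mulrA ler_wpM2r// ler_wpM2l//; lra.
have h3 := ler_wpM2r t0 Aq.
have k1 : C1 * eta <= e / 2 by apply: le_trans b; rewrite mulrDl lerDl mulr_ge0// ltW.
have k2 : C2 q * eta <= e / 2 by apply: le_trans b; rewrite mulrDl lerDr mulr_ge0// ltW.
have h4 := ler_wpM2r t0 k1; have h5 := ler_wpM2r n0 k2.
have : 0 <= e / 2 * nu by rewrite mulr_ge0// divr_ge0// ltW.
by rewrite mulrDr; lra.
Qed.

(** The real arithmetic of [max_superdiff]. Primed letters are values after the perturbation, D + 2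
    P + N and M + 2 Q + N the perturbed transport cost and second moment, rho and Ka the expansion
    of the time weight. *)
Lemma superdiff_scalar (R : realType)
    (v1' v1 v2 a' a D P Q N lam M kap T s' t s beta p e1 e2 rho Ka tau nu e q TT : R) :
  0 < a -> 0 <= rho -> 0 <= Ka -> 0 <= D -> 0 < q -> 0 <= TT -> 0 <= tau -> tau <= TT ->
  tau = `|s' - t| -> (s' - t) ^+ 2 = tau ^+ 2 -> N = nu ^+ 2 ->
  `|a' - a + rho * a * (s' - t)| <= Ka * tau ^+ 2 -> `|2 * P| <= q * D + q^-1 * N ->
  v1' - v2 - a' * (D + 2 * P + N) - lam * (M + 2 * Q + N) - kap * (T - s') - p - e2 - (s' - s) ^+ 2 / beta <=
  v1 - v2 - a * D - lam * M - kap * (T - t) - e1 - e2 - (t - s) ^+ 2 / beta ->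
  (rho * a + Ka * TT) * D * q * tau + (Ka * D + beta^-1) * tau ^+ 2 +
    ((rho * a + Ka * TT) * TT * (q^-1 + 1) + a + lam) * nu ^+ 2 <= e * (tau + nu) ->
  v1' - p - (v1 - e1) <= (- (rho * a * D) + 2 * (t - s) / beta - kap) * (s' - t) +
    (2 * a * P + 2 * lam * Q) + e * (tau + nu).
Proof.
move=> a0 rho0 Ka0 D0 q0 TT0 tau0 tauTT taue tau2 Ne ha hP hmax herr.
have N0 : 0 <= N by rewrite Ne sqr_ge0.
pose Kb := rho * a + Ka * TT.
have Kb0 : 0 <= Kb by rewrite addr_ge0// mulr_ge0// ltW.
have da : `|a' - a| <= Kb * tau.
  rewrite -(addrK (rho * a * (s' - t)) (a' - a)) (le_trans (ler_normB _ _))//.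
  rewrite normrM -taue (ger0_norm (mulr_ge0 rho0 (ltW a0))) /Kb mulrDl addrC lerD2l.
  apply: (le_trans ha); rewrite -mulrA ler_wpM2l// expr2 ler_wpM2r//.
have h1 : (a' - a + rho * a * (s' - t)) * D <= Ka * tau ^+ 2 * D.
  by rewrite ler_wpM2r//; exact: le_trans (ler_norm _) ha.
have h2 : (a' - a) * (2 * P + N) <= Kb * tau * (q * D + q^-1 * N + N).
  apply: (le_trans (ler_norm _)); rewrite normrM ler_pM//.
  by apply: (le_trans (ler_normD _ _)); rewrite (ger0_norm N0) lerD2r.
have h3 : Kb * tau * ((q^-1 + 1) * N) <= Kb * TT * ((q^-1 + 1) * N).
  rewrite ler_wpM2r//; last by rewrite ler_wpM2l.
  by rewrite mulr_ge0// addr_ge0// invr_ge0 ltW.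
have h4 : (s' - s) ^+ 2 / beta = tau ^+ 2 / beta + 2 * (t - s) / beta * (s' - t) + (t - s) ^+ 2 / beta.
  by rewrite -tau2; ring.
move: hmax; rewrite h4 => hmax.
move: herr; rewrite -/Kb -Ne => herr.
move: h1 h2 h3 hmax herr; clear ha hP da h4.
move: (q^-1) (beta^-1) (tau ^+ 2) => qi bi t2 h1 h2 h3 hmax herr.
lra.
Qed.

Section at_maximum.
Context (R : realType) (d : nat).
Local Notation E := 'rV[R]_d.
Variables (T : R) (V1 V2 : R -> P2 R d -> R) (d1 d2 lam kap beta rho Ka : R) (a : R -> R).
Variables (t s : R) (pi : plan R d) (e1 e2 : R).
Hypotheses (d1ge : 0 <= d1) (d2ge : 0 <= d2) (lam0 : 0 <= lam) (kap0 : 0 <= kap) (beta0 : 0 < beta).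
Hypotheses (at0 : 0 < a t) (rho0 : 0 <= rho) (Ka0 : 0 <= Ka)
  (da : forall s', s' \in `[0, T] -> `|a s' - a t + rho * a t * (s' - t)| <= Ka * (s' - t) ^+ 2).
Hypotheses (V1same : forall t mu nu, t \in `[0, T] -> same_law mu nu -> V1 t mu = V1 t nu)
  (V2same : forall t mu nu, t \in `[0, T] -> same_law mu nu -> V2 t mu = V2 t nu).
Hypotheses (tT : t \in `[0, T]) (sT : s \in `[0, T]) (adm : admissible d1 d2 pi e1 e2).
Local Notation value := (gain T V1 V2 lam kap a).
Hypothesis max : forall t' s' pi' e1' e2', t' \in `[0, T] -> s' \in `[0, T] -> admissible d1 d2 pi' e1' e2' ->
      value t' s' pi' - e1' - e2' - (t' - s') ^+ 2 / beta <= value t s pi - e1 - e2 - (t - s) ^+ 2 / beta.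

Let mf := @measurable_fst _ _ E E.
Let ms := @measurable_snd _ _ E E.

(** Replacing the bounds by the penalties themselves stays admissible and would raise the value. *)
Lemma max_pen : pen d1 (marg1 pi) = e1%:E /\ pen d2 (second pi) = e2%:E.
Proof.
have [p1 hp1] := pen_fin d1ge adm.1; have [p2 hp2] := pen_fin d2ge adm.2.
have [h1 h2] := adm; rewrite hp1 lee_fin in h1; rewrite hp2 lee_fin in h2.
have adm' : admissible d1 d2 pi p1 p2 by split; rewrite ?hp1 ?hp2.
have h := max tT sT adm'.
by rewrite hp1 hp2; split; congr (_%:E); lra.
Qed.

(** With both marginals and both times fixed, only the transport cost varies. *)
Lemma max_minimal_cost : minimal_cost pi.
Proof.
move=> pi' h1 h2'; have h2 := second_same h2'.
have adm' : admissible d1 d2 pi' e1 e2.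
  by split; [rewrite -(pen_same _ h1)|rewrite -(pen_same _ h2)]; case: adm.
have := max tT sT adm'.
rewrite /gain -(V1same tT h1) -(V2same sT h2) -(M2_same h1) => h.
have : a t * dist2 pi <= a t * dist2 pi' by lra.
by rewrite ler_pM2l.
Qed.

(** Through the given coupling, x is moved by the displacement while y is kept; maximality bounds
    the change of V1 by the exactly computed changes of cost, moment and time penalties. *)
Lemma max_superdiff (g : plan R d) :
  image_law (fun z : E * E => (z.1, (2 * (a t + lam)) *: z.1 - (2 * a t) *: z.2)) pi g ->
  superdiff T (fun s nu => (V1 s nu)%:E - d1%:E * entropy nu)%E t (marg1 pi)
    (- (rho * a t * dist2 pi) + 2 * (t - s) / beta - kap) g.
Proof.
move=> lg; have [pe1 pe2] := max_pen.
have gmu : plans_over (marg1 pi) g.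
  by apply: (image_law_factor mf lg); exact: marg1_law.
split.
- by rewrite -[(d1%:E * _)%E]/(pen d1 (marg1 pi)) pe1.
- apply: (tangent_law max_minimal_cost _ _ lg gmu); first by rewrite mulr_ge0// ltW.
  by rewrite mulr_ge0// addr_ge0// ltW.
move=> e e0.
pose D := dist2 pi; have D0 : 0 <= D by exact: dist2_ge0.
pose Kb := rho * a t + Ka * `|T|.
have Kb0 : 0 <= Kb by rewrite addr_ge0 ?mulr_ge0// ltW.
have [||||q [eta [q0 eta0 herr]]] := @small_error _ (Kb * D) (Ka * D + beta^-1) e
   (fun q => Kb * `|T| * (q^-1 + 1) + a t + lam).
- by rewrite mulr_ge0.
- by rewrite addr_ge0 ?mulr_ge0// invr_ge0 ltW.
- move=> q q0; have q1 : 0 <= q^-1 + 1 by rewrite addr_ge0// invr_ge0 ltW.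
  by rewrite !addr_ge0 ?mulr_ge0// ltW.
- exact: e0.
exists eta => // s' xi th s'T xmu [th1 th2] small.
pose X (w : E * E * E) := w.1.1; pose z (w : E * E * E) := w.2.
(* Recovers y from x and the velocity, as a(t) > 0. *)
pose Y (w : E * E * E) := ((a t + lam) / a t) *: w.1.1 - (2 * a t)^-1 *: w.1.2.
have mX : measurable_fun setT X by exact: measurableT_comp mf measurable_fst.
have mv : measurable_fun setT (fun w : E * E * E => w.1.2) by exact: measurableT_comp ms measurable_fst.
have mz : measurable_fun setT z by exact: measurable_snd.
have mY : measurable_fun setT Y by apply: measurable_subv; exact: measurable_scalev.
pose Gm (y : E * E) : E * E := (y.1, ((a t + lam) / a t) *: y.1 - (2 * a t)^-1 *: y.2).
have mGm : measurable_fun setT Gm.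
  by apply: measurable_pair_of => //; apply: measurable_subv; exact: measurable_scalev.
have lGm : image_law Gm g pi.
  apply: (image_law_factor mGm lg); apply: image_law_ext (image_law_id pi) => y.
  rewrite /Gm /= scalerBr !scalerA mulVf ?mulf_neq0 ?gt_eqF// scale1r opprB addrCA.
  rewrite (_ : (2 * a t)^-1 * (2 * (a t + lam)) = (a t + lam) / a t); last by field; rewrite gt_eqF.
  by rewrite subrr addr0; case: y.
have lXY : image_law (fun w => (X w, Y w)) th pi by exact: (image_law_comp mGm th1 lGm).
have lXz : image_law (fun w => (X w, z w)) th xi by exact: th2.
have LX : th.-L1 (fun w => sqnorm (X w)).
  by apply/(image_law_L1 (measurable_pair_of mX mY) lXY (g := fun y => sqnorm y.1)); [exact: measurable_sqn|exact: plan_L1_fst].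
have LY : th.-L1 (fun w => sqnorm (Y w)).
  by apply/(image_law_L1 (measurable_pair_of mX mY) lXY (g := fun y => sqnorm y.2)); [exact: measurable_sqn|exact: plan_L1_snd].
have Lz : th.-L1 (fun w => sqnorm (z w)).
  by apply/(image_law_L1 (measurable_pair_of mX mz) lXz (g := fun y => sqnorm y.2)); [exact: measurable_sqn|exact: plan_L1_snd].
have mXz := measurable_addv mX mz; have LXz := sqnormD_L1 mX mz LX Lz.
have mXY := measurable_subv mX mY; have LXY := sqnormB_L1 mX mY LX LY.
pose pi' := plan_of mXz mY LXz LY.
have lpi' : image_law (fun w => (X w + z w, Y w)) th pi' by exact: plan_of_law.
have m1 : image_law (fun w => X w + z w) th (marg1 pi') by exact: (image_law_comp mf lpi' (marg1_law pi')).
have m1' : image_law (fun w => X w + z w) th (exp_plan xi).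
  exact: (image_law_comp (@measurable_exp_map R d) lXz (exp_plan_law xi)).
have sm1 := image_law_same m1' m1.
have m2 : image_law Y th (second pi') by exact: (image_law_comp ms lpi' (second_law pi')).
have m2' : image_law Y th (second pi) by exact: (image_law_comp ms lXY (second_law pi)).
have sm2 := image_law_same m2 m2'.
pose P := \int[th]_w dot (X w - Y w) (z w); pose Q := \int[th]_w dot (X w) (z w).
pose N := \int[th]_w sqnorm (z w).
have N0 : 0 <= N by apply: Rint_ge0 => w; exact: sqnorm_ge0.
have nuE : plan_norm xi ^+ 2 = N.
  rewrite sqr_sqrtr; last by apply: Rint_ge0 => w; exact: sqnorm_ge0.
  by rewrite (image_law_Rint (measurable_pair_of mX mz) lXz (g := fun y => sqnorm y.2))//; exact: measurable_sqn.
have DE : dist2 pi' = D + 2 * P + N.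
  rewrite (dist2_law mXz mY lpi') /D (dist2_law mX mY lXY) -Rint_sqnormD//.
  by congr Rintegral; apply/funext => w; rewrite addrAC.
have ME : M2 (marg1 pi') = M2 (marg1 pi) + 2 * Q + N.
  rewrite (M2_law mXz m1) (M2_law mX (image_law_comp mf lXY (marg1_law pi))) Rint_sqnormD//.
have pairE : pairing th = 2 * a t * P + 2 * lam * Q.
  have LP := dot_L1 mXY mz LXY Lz; have LQ := dot_L1 mX mz LX Lz.
  rewrite /P /Q -!RintZ// -RintD; [|exact: L1Z|exact: L1Z].
  congr Rintegral; apply/funext => w.
  have -> : w.1.2 = (2 * (a t + lam)) *: X w - (2 * a t) *: Y w.
    rewrite /X /Y scalerBr !scalerA mulfV ?mulf_neq0 ?gt_eqF// scale1r opprB addrCA.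
    rewrite (_ : (2 * a t) * ((a t + lam) / a t) = 2 * (a t + lam)); last by field; rewrite gt_eqF.
    by rewrite subrr addr0.
  rewrite -[w.2]/(z w); move: (X w) (Y w) (z w) => x y k; rewrite !dotBl !dotZl.
  by ring.
have Pq : `|2 * P| <= q * D + q^-1 * N.
  have LP := dot_L1 mXY mz LXY Lz.
  rewrite /D (dist2_law mX mY lXY) /P /N -!RintZ// -RintD; [|exact: L1Z|exact: L1Z].
  have y w : `|2 * dot (X w - Y w) (z w)| <= q * sqnorm (X w - Y w) + q^-1 * sqnorm (z w).
    by rewrite normrM ger0_norm//; exact: dot_young.
  rewrite ler_norml; apply/andP; split.
    rewrite -RintN; last by apply: L1D; exact: L1Z.
    apply: le_Rint; [by apply: L1N; apply: L1D; exact: L1Z|exact: L1Z|].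
    by move=> w; have := y w; rewrite ler_norml => /andP[].
  apply: le_Rint; [exact: L1Z|by apply: L1D; exact: L1Z|].
  by move=> w; have := y w; rewrite ler_norml => /andP[].
pose tau := `|s' - t|; pose nu := plan_norm xi.
have tau0 : 0 <= tau by exact: normr_ge0.
have nu0 : 0 <= nu by exact: sqrtr_ge0.
have tau2 : (s' - t) ^+ 2 = tau ^+ 2 by rewrite /tau real_normK ?num_real.
have tauT : tau <= `|T|.
  move: tT s'T; rewrite !in_itv/= => /andP[h1 h2] /andP[h3 h4].
  by have := ler_norm T; rewrite /tau ler_norml; move=> hT; apply/andP; split; lra.
have := herr tau nu tau0 nu0 small; rewrite -/tau -/nu => hh.
rewrite -[(d1%:E * entropy (marg1 pi))%E]/(pen d1 (marg1 pi)) pe1 -[(d1%:E * entropy _)%E]/(pen d1 (exp_plan xi)).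
(* An infinite entropy after displacement makes the left-hand side -oo. *)
have [->|pf] := eqVneq (pen d1 (exp_plan xi)) +oo%E; first by rewrite /= leNye.
have [p hp] : exists p : R, pen d1 (exp_plan xi) = p%:E.
  by have := pen_ge (exp_plan xi) d1ge; move: pf; case: (pen d1 _) => [p _ _|//|//]; exists p.
rewrite hp -!EFinB lee_fin.
have adm' : admissible d1 d2 pi' p e2.
  by split; [rewrite -(pen_same _ sm1) hp|rewrite (pen_same _ sm2) pe2].
have := max s'T sT adm'; rewrite /gain -(V1same s'T sm1) (V2same sT sm2) DE ME pairE -/D.
have := da s'T; rewrite tau2.
rewrite -nuE -/nu => h1 h2; rewrite -nuE -/nu in Pq.
have taue : tau = `|s' - t| by [].
have TT : 0 <= `|T| by exact: normr_ge0.
exact: (@superdiff_scalar _ (V1 s' (exp_plan xi)) (V1 t (marg1 pi)) (V2 s (second pi)) (a s') (a t) D P Q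
  (nu ^+ 2) lam (M2 (marg1 pi)) kap T s' t s beta p e1 e2 rho Ka tau nu e q `|T| at0 rho0 Ka0 D0 q0 TT tau0
  tauT taue tau2 erefl h1 Pq h2 hh).
Qed.

(** The same variation with y moved. The weight and the moment penalty do not involve s and y, so
    the derivative in s comes from the time penalty alone and the expansion has no mixed term. *)
Lemma max_subdiff (g : plan R d) :
  image_law (fun z : E * E => (z.2, (2 * a t) *: (z.1 - z.2))) pi g ->
  subdiff T (fun s nu => (V2 s nu)%:E + d2%:E * entropy nu)%E s (second pi)
    (2 * (t - s) / beta) g.
Proof.
move=> lg; have [pe1 pe2] := max_pen.
have ta0 : 0 < 2 * a t by rewrite mulr_gt0.
have gmu : plans_over (second pi) g.
  by apply: (image_law_factor mf lg); exact: second_law.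
split.
- by rewrite -[(d2%:E * _)%E]/(pen d2 (second pi)) pe2.
- exact: (tangent_reverse max_minimal_cost ta0 lg gmu).
move=> e e0.
have [||||q [eta [q0 eta0 herr]]] := @small_error _ 0 beta^-1 e (fun=> a t) => //.
- by rewrite invr_ge0 ltW.
- by move=> *; exact: ltW.
exists eta => // s' xi th s'T xmu [th1 th2] small.
pose Y (w : E * E * E) := w.1.1; pose z (w : E * E * E) := w.2.
pose X (w : E * E * E) := w.1.1 + (2 * a t)^-1 *: w.1.2.
have mY : measurable_fun setT Y by exact: measurableT_comp mf measurable_fst.
have mv : measurable_fun setT (fun w : E * E * E => w.1.2) by exact: measurableT_comp ms measurable_fst.
have mz : measurable_fun setT z by exact: measurable_snd.
have mX : measurable_fun setT X by apply: measurable_addv => //; exact: measurable_scalev.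
pose Gm (y : E * E) : E * E := (y.1 + (2 * a t)^-1 *: y.2, y.1).
have mGm : measurable_fun setT Gm.
  by apply: measurable_pair_of => //; apply: measurable_addv => //; exact: measurable_scalev.
have lGm : image_law Gm g pi.
  apply: (image_law_factor mGm lg); apply: image_law_ext (image_law_id pi) => y.
  rewrite /Gm /= scalerA mulVf ?gt_eqF// scale1r addrC subrK.
  by case: y.
have lXY : image_law (fun w => (X w, Y w)) th pi by exact: (image_law_comp mGm th1 lGm).
have lYz : image_law (fun w => (Y w, z w)) th xi by exact: th2.
have LX : th.-L1 (fun w => sqnorm (X w)).
  by apply/(image_law_L1 (measurable_pair_of mX mY) lXY (g := fun y => sqnorm y.1)); [exact: measurable_sqn|exact: plan_L1_fst].
have LY : th.-L1 (fun w => sqnorm (Y w)).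
  by apply/(image_law_L1 (measurable_pair_of mX mY) lXY (g := fun y => sqnorm y.2)); [exact: measurable_sqn|exact: plan_L1_snd].
have Lz : th.-L1 (fun w => sqnorm (z w)).
  by apply/(image_law_L1 (measurable_pair_of mY mz) lYz (g := fun y => sqnorm y.2)); [exact: measurable_sqn|exact: plan_L1_snd].
have mYz := measurable_addv mY mz; have LYz := sqnormD_L1 mY mz LY Lz.
have mXY := measurable_subv mX mY; have LXY := sqnormB_L1 mX mY LX LY.
pose pi' := plan_of mX mYz LX LYz.
have lpi' : image_law (fun w => (X w, Y w + z w)) th pi' by exact: plan_of_law.
have m1 : image_law X th (marg1 pi') by exact: (image_law_comp mf lpi' (marg1_law pi')).
have m1' : image_law X th (marg1 pi) by exact: (image_law_comp mf lXY (marg1_law pi)).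
have sm1 := image_law_same m1 m1'.
have m2 : image_law (fun w => Y w + z w) th (second pi') by exact: (image_law_comp ms lpi' (second_law pi')).
have m2' : image_law (fun w => Y w + z w) th (exp_plan xi).
  exact: (image_law_comp (@measurable_exp_map R d) lYz (exp_plan_law xi)).
have sm2 := image_law_same m2' m2.
pose P := \int[th]_w dot (X w - Y w) (z w); pose N := \int[th]_w sqnorm (z w).
have nuE : plan_norm xi ^+ 2 = N.
  rewrite sqr_sqrtr; last by apply: Rint_ge0 => w; exact: sqnorm_ge0.
  by rewrite (image_law_Rint (measurable_pair_of mY mz) lYz (g := fun y => sqnorm y.2))//; exact: measurable_sqn.
have mNz : measurable_fun setT (fun w => - z w) by exact: measurable_oppv.
have LNz : th.-L1 (fun w => sqnorm (- z w)) by under eq_fun do rewrite sqnormN.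
have DE : dist2 pi' = dist2 pi - 2 * P + N.
  rewrite (dist2_law mX mYz lpi') (dist2_law mX mY lXY).
  rewrite (_ : (fun w => sqnorm (X w - (Y w + z w))) = fun w => sqnorm ((X w - Y w) + - z w)); last first.
    by apply/funext => w; rewrite opprD addrA.
  have eP : \int[th]_w dot (X w - Y w) (- z w) = - P.
    rewrite /P -RintN; last exact: dot_L1.
    by congr Rintegral; apply/funext => w; rewrite dotNr.
  have eN : \int[th]_w sqnorm (- z w) = N by congr Rintegral; apply/funext => w; rewrite sqnormN.
  by rewrite (Rint_sqnormD mXY mNz LXY LNz) eP eN mulrN.
have pairE : pairing th = 2 * a t * P.
  have LP := dot_L1 mXY mz LXY Lz.
  rewrite /P -!RintZ//; congr Rintegral; apply/funext => w.
  have -> : w.1.2 = (2 * a t) *: (X w - Y w).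
    by rewrite /X /Y addrC addKr scalerA mulfV ?gt_eqF// scale1r.
  by rewrite dotZl.
pose tau := `|s' - s|; pose nu := plan_norm xi.
have tau0 : 0 <= tau by exact: normr_ge0.
have nu0 : 0 <= nu by exact: sqrtr_ge0.
have tau2 : (s' - s) ^+ 2 = tau ^+ 2 by rewrite /tau real_normK ?num_real.
have := herr tau nu tau0 nu0 small; rewrite -/tau -/nu => hh.
rewrite -[(d2%:E * entropy (second pi))%E]/(pen d2 (second pi)) pe2 -[(d2%:E * entropy _)%E]/(pen d2 (exp_plan xi)).
have [->|pf] := eqVneq (pen d2 (exp_plan xi)) +oo%E; first by rewrite /= leey.
have [p hp] : exists p : R, pen d2 (exp_plan xi) = p%:E.
  by have := pen_ge (exp_plan xi) d2ge; move: pf; case: (pen d2 _) => [p _ _|//|//]; exists p.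
rewrite hp -!EFinD lee_fin.
have adm' : admissible d1 d2 pi' e1 p.
  by split; [rewrite (pen_same _ sm1) pe1|rewrite -(pen_same _ sm2) hp].
have := max tT s'T adm'; rewrite /gain (V1same tT sm1) -(V2same s'T sm2) DE (M2_same sm1) pairE.
rewrite -nuE -/nu.
have -> : (t - s') ^+ 2 / beta = tau ^+ 2 / beta - 2 * (t - s) / beta * (s' - s) + (t - s) ^+ 2 / beta.
  by rewrite -tau2; ring.
move: hh; rewrite mul0r mul0r add0r.
move: (V1 t _) (V2 s _) (V2 s' _) (beta^-1) (a t) (tau ^+ 2) (nu ^+ 2) (dist2 pi) (M2 _) => v1 v2 v2' bi A t2 n2 D M.
move: (tau) (nu) => ta n hh hm; lra.
Qed.

End at_maximum.

(** * Existence and sign properties of the score at a maximum *)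

Lemma ln1D_ge (R : realType) (u : R) : `|u| <= 1 / 2 -> u - 2 * u ^+ 2 <= ln (1 + u).
Proof.
rewrite ler_norml => /andP[h1 h2].
have u0 : 0 < 1 + u by lra.
apply: le_trans (ln_ge u0).
rewrite (_ : 1 - (1 + u)^-1 = u / (1 + u)); last by field; rewrite gt_eqF.
rewrite ler_pdivlMr//; nra.
Qed.

Lemma is_derive_coord (R : realType) n (i : 'I_n) (x : 'rV[R]_n) :
  is_derive x (delta_mx ord0 i) (fun y : 'rV[R]_n => y ord0 i : R^o) 1.
Proof.
apply: is_derive_line.
rewrite (_ : (fun h : R => _) = fun h : R => x ord0 i + h : R^o).
  have := @is_deriveD _ _ _ (cst (x ord0 i) : R -> R^o) id 0 1 _ _ (is_derive_cst _ _ _) (is_derive_id _ _).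
  by rewrite add0r.
by apply/funext => h; rewrite !mxE !eqxx mulr1.
Qed.

Lemma dirC1_coord (R : realType) n (i : 'I_n) : dirC1 i (fun y : 'rV[R]_n => y ord0 i) (fun=> 1).
Proof.
split.
- exact: continuous_coord.
- exact: cst_continuous.
- exact: is_derive_coord.
- by exists 1 => x; rewrite normr1.
- by exists 1 => // x; rewrite mul1r (le_trans (sqr_coord_le x i))// lerDr.
Qed.

Lemma dirC1_linear (R : realType) n (i : 'I_n) (f f' g g' : 'rV[R]_n -> R) (c : R) :
  dirC1 i f f' -> dirC1 i g g' -> dirC1 i (fun x => f x + c * g x) (fun x => f' x + c * g' x).
Proof.
move=> [f1 f2 f3 [K f4] [A A0 f5]] [g1 g2 g3 [K' g4] [A' A'0 g5]]; split.
- by apply: continuous_addf => //; exact: continuous_cmulf.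
- by apply: continuous_addf => //; exact: continuous_cmulf.
- by move=> x; exact: (@is_deriveD _ _ _ (f : _ -> R^o) (fun x => c * g x : R^o) x _ _ _ (f3 x)
    (@is_deriveZ _ _ _ (g : _ -> R^o) c x _ _ (g3 x))).
- exists (K + `|c| * K') => x; apply: (le_trans (ler_normD _ _)); apply: lerD => //.
  by rewrite normrM ler_wpM2l.
- exists (2 * A + 2 * c ^+ 2 * A').
    apply: addr_ge0; first exact: mulr_ge0.
    by apply: mulr_ge0 => //; apply: mulr_ge0 => //; exact: sqr_ge0.
  move=> x; have h1 := f5 x; have h2 := ler_wpM2l (sqr_ge0 c) (g5 x).
  have : (f x + c * g x) ^+ 2 <= 2 * f x ^+ 2 + 2 * (c ^+ 2 * g x ^+ 2).
    have := sqr_ge0 (f x - c * g x); nra.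
  lra.
Qed.

Lemma dirC1_0 (R : realType) n (i : 'I_n) : dirC1 i (fun=> 0 : R) (fun=> 0).
Proof.
split.
- exact: cst_continuous.
- exact: cst_continuous.
- by move=> x; exact: is_derive_cst.
- by exists 0 => x; rewrite normr0.
- by exists 0 => // x; rewrite mul0r expr0n.
Qed.

Lemma dirC1_L2 (R : realType) n (i : 'I_n) (f f' : 'rV[R]_n -> R) (mu : P2 R n) : dirC1 i f f' -> L2 mu f.
Proof.
move=> df; have [A A0 fA] := dirC1_growth df.
have mf : measurable_fun setT f by exact: continuous_measurable_rV (dirC1_cont df).
split => //; apply: (@L1_le _ _ _ mu _ (fun x => A * (1 + sqnorm x))).
- exact: measurable_funX.
- by move=> x; rewrite ger0_norm ?sqr_ge0.
- by apply: L1Z; apply: L1D; [exact: L1_cst|exact: P2_L1].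
Qed.

Lemma dirC1_L1' (R : realType) n (i : 'I_n) (f f' : 'rV[R]_n -> R) (mu : P2 R n) : dirC1 i f f' -> mu.-L1 f'.
Proof.
move=> df; have [K fK] := dirC1_bound df.
by apply: L2_L1; apply: (@L2_bounded _ _ _ mu _ K) => //; exact: continuous_measurable_rV (dirC1_cont' df).
Qed.

Lemma le_of_small (R : realType) (x y z h0 : R) : 0 < h0 -> 0 <= z ->
  (forall h, 0 < h -> h <= h0 -> x <= y + h * z) -> x <= y.
Proof.
move=> h00 z0 h; apply/ler_addgt0Pr => e e0.
pose k := Num.min h0 (e / (z + 1)).
have z1 : 0 < z + 1 by rewrite ltr_wpDl.
have k0 : 0 < k by rewrite lt_min h00 divr_gt0.
apply: (le_trans (h k k0 _)); first by rewrite ge_min lexx.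
rewrite lerD2l; apply: (@le_trans _ _ (e / (z + 1) * z)).
  by rewrite ler_wpM2r// ge_min lexx orbT.
by rewrite mulrAC ler_pdivrMr// ler_pM2l// lerDl.
Qed.

Section entropy_side.
Context (R : realType) (d : nat).
Local Notation E := 'rV[R]_d.
Variables (pi : plan R d) (delta L a lam c : R).
Hypotheses (delta0 : 0 < delta) (L0 : 0 <= L) (a0 : 0 <= a) (lam0 : 0 <= lam).
Local Notation mu := (marg1 pi).
Hypotheses (entc : entropy mu = c%:E) (mpi : minimal_cost pi).
Hypothesis pert : forall pi' c', same_law (second pi') (second pi) -> (entropy (marg1 pi') <= c'%:E)%E ->
  delta * (c - c') <= L * W1 mu (marg1 pi') + a * (dist2 pi' - dist2 pi) + lam * (M2 (marg1 pi') - M2 mu).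

Let mf := @measurable_fst _ _ E E.
Let ms := @measurable_snd _ _ E E.

Lemma entropy_fin_ac : mu `<< lebesgue_rV R d.
Proof. by move: entc; rewrite /entropy; case: asboolP. Qed.

(** The marginal is moved by h f in direction i with y kept. At first order in h the entropy gains
    the integral of f', while every other term changes by at most a constant plus a multiple of the
    integral of f^2. *)
Let pert_le i f f' : dirC1 i f f' ->
  delta * \int[mu]_x f' x <= L + a * dist2 pi + lam * M2 mu + (L + a + lam) * \int[mu]_x f x ^+ 2.
Proof.
move=> df; have [K0 fK0] := dirC1_bound df.
pose K := `|K0| + 1; have K1 : 0 < K by rewrite ltr_wpDl.
have fK x : `|f' x| <= K by apply: (le_trans (fK0 x)); have := ler_norm K0; rewrite /K; lra.
have f2 := dirC1_L2 mu df; have Lf' := dirC1_L1' mu df.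
set S := \int[mu]_x f x ^+ 2; set D := dist2 pi; set M := M2 mu.
have S0 : 0 <= S by apply: Rint_ge0 => x; exact: sqr_ge0.
have mff : measurable_fun setT f by exact: f2.1.
have mf' : measurable_fun setT f' by exact: continuous_measurable_rV (dirC1_cont' df).
pose F (z : E * E) := f z.1.
have mF : measurable_fun setT F by exact: measurableT_comp mff mf.
have LF2 : pi.-L1 (fun z => F z ^+ 2).
  by apply/(image_law_L1 mf (marg1_law pi) (g := fun x => f x ^+ 2)); [exact: measurable_funX|exact: f2.2].
have SE : \int[pi]_z F z ^+ 2 = S.
  by rewrite /S (image_law_Rint mf (marg1_law pi) (g := fun x => f x ^+ 2))//; exact: measurable_funX.
have LF : pi.-L1 F by apply: L1_of_sqr.
(* The third argument collects the terms of second order in h; the bound on h keeps |h f'| below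
   1/2, where [ln1D_ge] applies. *)
apply: (@le_of_small _ _ _ (2 * delta * K ^+ 2 + (a + lam) * S) (1 / 2 / K)).
- by rewrite divr_gt0.
- by rewrite addr_ge0 ?mulr_ge0 ?addr_ge0 ?sqr_ge0// ltW.
move=> h h0 hK.
have hK2 : h * K <= 1 / 2 by rewrite -ler_pdivlMr.
pose b (z : E * E) : E := (h * F z) *: delta_mx ord0 i.
have mb : measurable_fun setT b.
  by apply: measurable_scalerv; [exact: measurable_funM|exact: measurable_cst].
have bE z : sqnorm (b z) = h ^+ 2 * F z ^+ 2 by rewrite /b sqnorm_delta exprMn.
have Lb : pi.-L1 (fun z => sqnorm (b z)) by under eq_fun do rewrite bE; exact: L1Z.
have SbE : \int[pi]_z sqnorm (b z) = h ^+ 2 * S by under eq_Rintegral do rewrite bE; rewrite RintZ// SE.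
have L1 := plan_L1_fst pi; have L2' := plan_L1_snd pi.
have mX' := measurable_addv mf mb; have LX' := sqnormD_L1 mf mb L1 Lb.
pose pi' := plan_of mX' ms LX' L2'.
have lpi' : image_law (fun z : E * E => (z.1 + b z, z.2)) pi pi' by exact: plan_of_law.
have sl : same_law (second pi') (second pi).
  by apply: image_law_same (second_law pi); exact: (image_law_comp ms lpi' (second_law pi')).
have lX' : image_law (fun z : E * E => z.1 + b z) pi (marg1 pi') by exact: (image_law_comp mf lpi' (marg1_law pi')).
have lmu : image_law (fun x : E => x + (h * f x) *: delta_mx ord0 i) mu (marg1 pi').
  apply: (image_law_factor _ (marg1_law pi)); last exact: lX'.
  apply: measurable_addv; first exact: measurable_id.
  by apply: measurable_scalerv; [exact: measurable_funM|exact: measurable_cst].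
have hK1 : `|h| * K < 1 by rewrite gtr0_norm//; lra.
have entle : (entropy mu <= c%:E)%E by rewrite entc.
have ent := entropy_perturb df fK hK1 lmu entle.
have := pert sl ent.
have W1b : W1 mu (marg1 pi') <= h * (1 + S).
  have e z : enorm (z.1 - (z.1 + b z)) = h * `|F z|.
    rewrite opprD addrA subrr add0r enormN /enorm bE -exprMn sqrtr_sqr normrM gtr0_norm//.
  apply: (le_trans (W1_le mf mX' (marg1_law pi) lX' _)).
    by under eq_fun do rewrite e; apply: L1Z; exact: L1_norm.
  under eq_Rintegral do rewrite e.
  rewrite RintZ; last exact: L1_norm.
  rewrite ler_pM2l// -SE -[X in _ <= X + _](Rint_cst pi) -RintD//; last exact: L1_cst.
  apply: le_Rint; [exact: L1_norm|by apply: L1D => //; exact: L1_cst|].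
  move=> z; rewrite -[F z ^+ 2]real_normK ?num_real//.
  have := sqr_ge0 (`|F z| - 1); have := normr_ge0 (F z); nra.
have cross (A : E * E -> E) : measurable_fun setT A -> pi.-L1 (fun z => sqnorm (A z)) ->
    2 * \int[pi]_z dot (A z) (b z) <= h * (S + \int[pi]_z sqnorm (A z)).
  move=> mA LA; have Ld := dot_L1 mA mb LA Lb; have LFA := L1D LF2 LA; have LhFA := L1Z h LFA.
  rewrite -SE -RintD// -!RintZ//; apply: le_Rint; [exact: L1Z|exact: LhFA|].
  move=> z; rewrite /b dotZr dot_delta.
  have h1 := sqr_coord_le (A z) i.
  have h2 : 2 * (F z * A z ord0 i) <= F z ^+ 2 + sqnorm (A z).
    have := sqr_ge0 (F z - A z ord0 i); move: h1; nra.
  have := ler_wpM2l (ltW h0) h2; lra.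
have mxy : measurable_fun setT (fun z : E * E => z.1 - z.2) by exact: measurable_subv.
have Lxy : pi.-L1 (fun z => sqnorm (z.1 - z.2)) by exact: dist2_L1.
have DE : dist2 pi' - D <= h * (S + D) + h ^+ 2 * S.
  rewrite (dist2_law mX' ms lpi').
  rewrite (_ : (fun z => sqnorm (z.1 + b z - z.2)) = fun z => sqnorm ((z.1 - z.2) + b z)); last first.
    by apply/funext => z; rewrite addrAC.
  rewrite (Rint_sqnormD mxy mb Lxy Lb) SbE.
  have := cross _ mxy Lxy; rewrite -/(dist2 pi) -/D; lra.
have ME : M2 (marg1 pi') - M <= h * (S + M) + h ^+ 2 * S.
  rewrite (M2_law mX' lX') (Rint_sqnormD mf mb L1 Lb) SbE.
  have := cross _ mf L1; rewrite -(M2_law mf (marg1_law pi)) -/M; lra.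
have Lln : mu.-L1 (fun x => ln (1 + h * f' x)).
  apply: (@L1_le _ _ _ mu _ (fun=> 2)); last exact: L1_cst.
    apply: measurableT_comp; first exact: measurable_ln.
    by apply: measurable_funD; [exact: measurable_cst|exact: measurable_funM].
  move=> x; have hx : `|h * f' x| <= 1 / 2.
    by rewrite normrM gtr0_norm//; apply: le_trans hK2; rewrite ler_wpM2l// ltW.
  have h1 := ln1D_ge hx.
  have h1' : (h * f' x) ^+ 2 <= 1 / 4.
    rewrite -[_ ^+ 2]real_normK ?num_real//.
    have := normr_ge0 (h * f' x); nra.
  have h2 : ln (1 + h * f' x) <= h * f' x.
    by apply: le_ln1Dx; move: hx; rewrite ler_norml => /andP[]; lra.
  by move: hx; rewrite !ler_norml => /andP[k1 k2]; apply/andP; split; lra.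
have lnb : h * \int[mu]_x f' x - 2 * h ^+ 2 * K ^+ 2 <= \int[mu]_x ln (1 + h * f' x).
  have Lhf := L1Z h Lf'; have Lc := L1_cst mu (2 * h ^+ 2 * K ^+ 2).
  rewrite -RintZ// -[X in _ - X <= _](Rint_cst mu) -RintB//; apply: le_Rint => //; first exact: (L1B Lhf Lc).
  move=> x; have hx : `|h * f' x| <= 1 / 2.
    by rewrite normrM gtr0_norm//; apply: le_trans hK2; rewrite ler_wpM2l// ltW.
  apply: le_trans (ln1D_ge hx); rewrite lerD2l lerN2 exprMn -[f' x ^+ 2]real_normK ?num_real// mulrA.
  have h20 : 0 <= 2 * h ^+ 2 by apply: mulr_ge0 => //; exact: sqr_ge0.
  by apply: (ler_wpM2l h20); rewrite ler_pXn2r ?nnegrE// ltW.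
have -> : c - (c - \int[mu]_x ln (1 + h * f' x)) = \int[mu]_x ln (1 + h * f' x) by rewrite opprB addrC subrK.
move=> p1.
have q1 := ler_wpM2l L0 W1b; have q2 := ler_wpM2l a0 DE; have q3 := ler_wpM2l lam0 ME.
have q4 := ler_wpM2l (ltW delta0) lnb.
rewrite -(ler_pM2l h0).
move: p1 q1 q2 q3 q4; rewrite -/D -/M.
move: (\int[mu]_x f' x) (\int[mu]_x _) (W1 _ _) (dist2 _) (M2 _) => I J W D' M'.
rewrite expr2; lra.
Qed.

(** The bound of [pert_le] is of the form required by [riesz], which represents the linear form
    sending f to the integral of f'. *)
Let score_coord_ex (i : 'I_d) : exists s : E -> R, L2 mu s /\
  forall f f', dirC1 i f f' -> \int[mu]_x f' x = - \int[mu]_x (s x * f x).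
Proof.
(* Written with the directional derivative, the form depends on [f] alone and not on a chosen f'. *)
pose l (f : E -> R) := \int[mu]_x 'D_(delta_mx ord0 i : E) (f : E -> R^o) x.
have lE f f' : dirC1 i f f' -> l f = \int[mu]_x f' x.
  by move=> df; congr Rintegral; apply/funext => x; have [_ <-] := dirC1_derive df x.
have [|||||s s2 hs] := @riesz _ _ _ mu [set f | exists f', dirC1 i f f'] l
  (delta^-1 * (L + a * dist2 pi + lam * M2 mu)) (delta^-1 * (L + a + lam) + 1).
- by rewrite ltr_wpDl// mulr_ge0 ?invr_ge0 ?addr_ge0// ltW.
- by move=> f [f' df]; exact: dirC1_L2 df.
- by exists (fun=> 0); exact: dirC1_0.
- move=> k f g [f' df] [g' dg]; have dfg := dirC1_linear k df dg.
  split; first by exists (fun x => f' x + k * g' x).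
  have L1 := dirC1_L1' mu df; have L2 := dirC1_L1' mu dg.
  by rewrite (lE _ _ dfg) (lE _ _ df) (lE _ _ dg) RintD ?RintZ//; exact: L1Z.
- move=> f [f' df]; rewrite (lE _ _ df) mulrDl mul1r.
  have S0 : 0 <= \int[mu]_x f x ^+ 2 by apply: Rint_ge0 => x; exact: sqr_ge0.
  have := pert_le df; rewrite -ler_pdivlMl// mulrDr mulrA; lra.
exists (fun x => - s x); split.
  have := L2Z (-1) s2; rewrite (_ : (fun x => -1 * s x) = fun x => - s x)//.
  by apply/funext => x; rewrite mulN1r.
move=> f f' df; rewrite -(lE _ _ df) hs; last by exists f'.
rewrite -RintN; last by apply: L2_mul; [rewrite (_ : (fun x => - s x) = fun x => -1 * s x); [exact: L2Z|apply/funext => x; rewrite mulN1r]|exact: dirC1_L2 df].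
by congr Rintegral; apply/funext => x; rewrite mulNr opprK.
Qed.

(** Testing with the i-th coordinate gives the integral of s_i x_i equal to -1, and d such terms
    appear; the transport part has the favourable sign because [be] is nonnegative. *)
Lemma entropy_side : (fisher mu < +oo)%E /\ forall al be : R, 0 <= be ->
  mu.-L1 (fun x => dot (score mu x) (al *: x - be *: transport mpi x)) /\
  - (al * d%:R) <= \int[mu]_x dot (score mu x) (al *: x - be *: transport mpi x).
Proof.
pose s i := sval (cid (score_coord_ex i)).
have s2 i : L2 mu (s i) by exact: (svalP (cid (score_coord_ex i))).1.
have ibp i f f' : dirC1 i f f' -> \int[mu]_x f' x = - \int[mu]_x (s i x * f x).
  exact: (svalP (cid (score_coord_ex i))).2.
have ac := entropy_fin_ac.
split; first exact: fisher_lty ac s2 ibp.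
move=> al be be0.
have mp : measurable_fun setT (fun x : E => al *: x - be *: transport mpi x).
  by apply: measurable_subv; apply: measurable_scalev; [exact: measurable_id|exact: measurable_transport].
have Lx i : mu.-L1 (fun x => s i x * x ord0 i) by apply: L2_mul => //; exact: dirC1_L2 (dirC1_coord R i).
have Ly i := (transport_ibp mpi ac (s2 i) (ibp i)).1.
have Ix i : \int[mu]_x (s i x * x ord0 i) = -1.
  by have := ibp i _ _ (dirC1_coord R i); rewrite Rint_cst => h; lra.
have e x : \sum_i s i x * (al *: x - be *: transport mpi x) ord0 i =
    \sum_i (al * (s i x * x ord0 i) - be * (s i x * transport mpi x ord0 i)).
  apply: eq_bigr => i _; rewrite [in LHS]mxE [in LHS]mxE [X in _ + X]mxE [X in _ - X]mxE.
  by move: (transport _ _ _ _) => y; ring.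
have LLx i := L1Z al (Lx i); have LLy i := L1Z be (Ly i).
split.
  apply: (ae_eq_L1 (f := fun x => \sum_i s i x * (al *: x - be *: transport mpi x) ord0 i)).
  - exact: measurable_dot (measurable_score ac s2 ibp) mp.
  - under eq_fun do rewrite e.
    by apply: L1_sum => i _; exact: (L1B (LLx i) (LLy i)).
  - apply: ae_imp (score_ae ac s2 ibp) => x ->.
    by rewrite /dot; apply: eq_bigr => i _; rewrite [in RHS]mxE.
rewrite (Rint_score ac s2 ibp mp).
under eq_Rintegral do rewrite e.
rewrite Rint_sum; last by move=> i _; exact: (L1B (LLx i) (LLy i)).
rewrite (_ : - (al * d%:R) = \sum_(i < d) - al); last by rewrite sumr_const card_ord mulNrn mulr_natr.
apply: ler_sum => i _; rewrite RintB// !RintZ// Ix.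
have := ler_wpM2l be0 (transport_ibp mpi ac (s2 i) (ibp i)).2; rewrite mulr0; lra.
Qed.

End entropy_side.

Lemma young1 (R : realType) (q x y : R) : 0 < q -> x * y <= q * x ^+ 2 + q^-1 * y ^+ 2.
Proof.
move=> q0; rewrite -(ler_pM2l q0) mulrDr [q * (q^-1 * _)]mulrA mulfV ?gt_eqF// mul1r.
have := sqr_ge0 (q * x - y); have := sqr_ge0 (q * x); have := sqr_ge0 y; nra.
Qed.

(** Here A stands for |x - y|, W for the W2 distance of the marginals and B for the velocity error 2
    lam |x|. The terms W, A and 4 a A W are split by Young's inequality so that only 1/a is left
    over; the coefficients 5/2 a and 13/2 a add up to 9 a once W^2 is bounded by the cost. *)
Lemma product_bound (R : realType) (a q A B W : R) : 0 < a -> 0 < q -> 0 <= A -> 0 <= B -> 0 <= W ->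
  (1 + 4 * a * A + B) * (W + A + B) <= a^-1 + q + (5 / 2 * a + q) * W ^+ 2 +
    (13 / 2 * a + q * (4 * a + 1)) * A ^+ 2 + (q^-1 + 4 * a * q^-1 + 2 * q^-1 + 1) * B ^+ 2.
Proof.
move=> a0 q0 A0 B0 W0.
have h (x : R) : 2 * x <= a^-1 + a * x ^+ 2.
  rewrite -(ler_pM2l a0) mulrDr mulfV ?gt_eqF//; have := sqr_ge0 (a * x - 1); nra.
have h1 := h W; have h2 := h A.
have h3 := young1 1 B q0; have h4 := young1 A B q0; have h5 := young1 W B q0.
have h6 := ler_wpM2l (ltW a0) h4.
have h7 : a * (2 * (A * W)) <= a * (A ^+ 2 + W ^+ 2).
  by rewrite ler_pM2l//; have := sqr_ge0 (A - W); nra.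
rewrite expr1n mulr1 mul1r in h3.
move: h1 h2 h3 h4 h5 h6 h7; move: (a^-1) (q^-1) => ai qi.
rewrite !expr2; lra.
Qed.

(** The assumptions on H with explicit constants, since the weight in time and [rate] depend on
    C1. *)
Definition regular_hamiltonian (R : realType) d (H : 'rV[R]_d -> 'rV[R]_d -> P2 R d -> R) (C1 C2 : R) : Prop :=
  [/\ forall (x p : 'rV[R]_d) (mu : P2 R d) (e : R), 0 < e -> exists2 eta : R, 0 < eta &
      forall (y q : 'rV[R]_d) (nu : P2 R d), enorm (x - y) < eta -> enorm (p - q) < eta ->
        W2 mu nu < eta -> `|H x p mu - H y q nu| < e,
    forall p q x y mu nu,
      `|H x p mu - H y q nu| <= C1 * (1 + enorm p + enorm q) * (W2 mu nu + enorm (x - y) + enorm (p - q)) &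
    forall x p mu, `|H x p mu| <= C2 * (1 + enorm x ^+ 2 + enorm p ^+ 2 + M2 mu)].

(** * Estimates at a maximum *)

Section hamiltonian.
Context (R : realType) (d : nat).
Local Notation E := 'rV[R]_d.
Variables (H : E -> E -> P2 R d -> R) (C1 C2 : R).
Hypothesis C10 : 0 < C1.
Hypothesis Hreg : regular_hamiltonian H C1 C2.

Lemma enorm0 : enorm (0 : E) = 0.
Proof. by rewrite /enorm sqnorm0 sqrtr0. Qed.

Lemma H_same x p mu nu : same_law mu nu -> H x p mu = H x p nu.
Proof.
have [_ H_lip _] := Hreg; move=> h; have := H_lip p p x x mu nu; rewrite (W2_same h) !subrr enorm0 !addr0 mulr0.
by rewrite normr_le0 subr_eq0 => /eqP.
Qed.

Lemma measurable_H mu : measurable_fun setT (fun z : E * E => H z.1 z.2 mu).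
Proof.
have [H_continuous _ _] := Hreg.
apply: continuous_measurable_pair => z; apply/(@cvgrPdist_lt _ _ _ _ (nbhs_filter z)) => e e0.
have [eta eta0 h] := H_continuous z.1 z.2 mu e e0.
have c1 : continuous (fun y : E * E => enorm (z.1 - y.1)).
  have cs : continuous (fun y : E * E => z.1 - y.1).
    by apply: continuous_subv => y; [exact: cst_continuous|exact: cvg_fst].
  by move=> y; exact: (continuous_comp (cs y) (@continuous_enorm R d _)).
have c2 : continuous (fun y : E * E => enorm (z.2 - y.2)).
  have cs : continuous (fun y : E * E => z.2 - y.2).
    by apply: continuous_subv => y; [exact: cst_continuous|exact: cvg_snd].
  by move=> y; exact: (continuous_comp (cs y) (@continuous_enorm R d _)).
have l1 : \forall y \near z, enorm (z.1 - y.1) < eta.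
  have := c1 z; rewrite /continuous_at subrr enorm0 => l; exact: (cvgr_lt _ l).
have l2 : \forall y \near z, enorm (z.2 - y.2) < eta.
  have := c2 z; rewrite /continuous_at subrr enorm0 => l; exact: (cvgr_lt _ l).
near=> y; apply: h; [by near: y|by near: y|].
by rewrite W2_same//; exact: image_law_id.
Unshelve. all: by end_near. Qed.

Lemma H_L1 (g : plan R d) mu : g.-L1 (fun z : E * E => H z.1 z.2 mu).
Proof.
have [_ _ H_growth] := Hreg.
apply: (@L1_le _ _ _ g _ (fun z : E * E => C2 * (1 + sqnorm z.1 + sqnorm z.2 + M2 mu))).
- exact: measurable_H.
- by move=> z; have := H_growth z.1 z.2 mu; rewrite !sqr_enorm.
- apply: L1Z; apply: L1D; last exact: L1_cst.
  apply: L1D; last exact: plan_L1_snd.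
  by apply: L1D; [exact: L1_cst|exact: plan_L1_fst].
Qed.

Lemma Hplan_same (g : plan R d) mu : same_law (marg1 g) mu -> Hplan H g = \int[g]_z H z.1 z.2 mu.
Proof. by move=> h; congr Rintegral; apply/funext => z; exact: H_same. Qed.

Lemma Hplan_law dT (T : measurableType dT) (P : probability T R) (X Y : T -> E) (g : plan R d) mu :
  measurable_fun setT X -> measurable_fun setT Y -> image_law (fun w => (X w, Y w)) P g ->
  same_law (marg1 g) mu ->
  P.-L1 (fun w => H (X w) (Y w) mu) /\ Hplan H g = \int[P]_w H (X w) (Y w) mu.
Proof.
move=> mX mY l h; split.
  by apply/(image_law_L1 (measurable_pair_of mX mY) l (g := fun z => H z.1 z.2 mu)); [exact: measurable_H|exact: H_L1].
rewrite (Hplan_same h).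
by rewrite (image_law_Rint (measurable_pair_of mX mY) l (g := fun z => H z.1 z.2 mu))//; exact: measurable_H.
Qed.

(** Both plans are driven by [pi]: pointwise the velocities differ by 2 lam x only, and [pi] itself
    couples the two marginals, so W2^2 is at most the cost. The free parameter q multiplies a
    bounded quantity and will be small. *)
Lemma Hplan_difference (pi g1 g2 : plan R d) (a lam q : R) : 0 < a -> 0 <= lam -> 0 < q ->
  image_law (fun z : E * E => (z.1, (2 * (a + lam)) *: z.1 - (2 * a) *: z.2)) pi g1 ->
  image_law (fun z : E * E => (z.2, (2 * a) *: (z.1 - z.2))) pi g2 ->
  Hplan H g2 - Hplan H g1 <= C1 * (a^-1 + 9 * a * dist2 pi + q * (1 + 4 * a * dist2 pi + 2 * dist2 pi) +
    4 * lam ^+ 2 * M2 (marg1 pi) * (q^-1 + 4 * a * q^-1 + 2 * q^-1 + 1)).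
Proof.
have [_ H_lip _] := Hreg; move=> a0 lam0 q0 l1 l2.
have mf := @measurable_fst _ _ E E; have ms := @measurable_snd _ _ E E.
pose v1 (z : E * E) := (2 * (a + lam)) *: z.1 - (2 * a) *: z.2; pose v2 (z : E * E) := (2 * a) *: (z.1 - z.2).
have mv1 : measurable_fun setT v1 by apply: measurable_subv; exact: measurable_scalev.
have mv2 : measurable_fun setT v2 by apply: measurable_scalev; exact: measurable_subv.
pose m1 := marg1 pi; pose m2 := second pi.
have s1 : same_law (marg1 g1) m1.
  by apply: image_law_same (marg1_law pi); exact: (image_law_comp mf l1 (marg1_law g1)).
have s2 : same_law (marg1 g2) m2.
  by apply: image_law_same (second_law pi); exact: (image_law_comp mf l2 (marg1_law g2)).
have [L1 ->] := Hplan_law mf mv1 l1 s1; have [L2 ->] := Hplan_law ms mv2 l2 s2.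
pose W := W2 m2 m1.
have W0 : 0 <= W by exact: W2_ge0.
have WD : W ^+ 2 <= dist2 pi.
  have Lb : pi.-L1 (fun z => sqnorm (z.2 - z.1)) by under eq_fun do rewrite sqnormBC; exact: dist2_L1.
  apply: (le_trans (sqr_W2_le ms mf (second_law pi) (marg1_law pi) Lb)).
  by under eq_Rintegral do rewrite sqnormBC.
pose k := q^-1 + 4 * a * q^-1 + 2 * q^-1 + 1.
pose F (z : E * E) := C1 * ((a^-1 + q + (5 / 2 * a + q) * W ^+ 2) +
    (13 / 2 * a + q * (4 * a + 1)) * sqnorm (z.1 - z.2) + k * (4 * lam ^+ 2) * sqnorm z.1).
have LD := L1Z (13 / 2 * a + q * (4 * a + 1)) (dist2_L1 pi).
have LM := L1Z (k * (4 * lam ^+ 2)) (plan_L1_fst pi).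
have Lc := L1_cst pi (a^-1 + q + (5 / 2 * a + q) * W ^+ 2).
have LcD := L1D Lc LD; have LcDM := L1D LcD LM.
have LF : pi.-L1 F by exact: L1Z.
rewrite -RintB//; apply: (@le_trans _ _ (\int[pi]_z F z)).
  apply: le_Rint => //; first exact: (L1B L2 L1).
  move=> z; apply: (le_trans (ler_norm _)); apply: (le_trans (H_lip _ _ _ _ _ _)).
  rewrite -/W /F -mulrA ler_pM2l//.
  pose A := enorm (z.1 - z.2); pose B := 2 * lam * enorm z.1.
  have A0 : 0 <= A by exact: enorm_ge0.
  have B0 : 0 <= B by rewrite !mulr_ge0 ?enorm_ge0.
  have e2 : enorm (v2 z) = 2 * a * A by rewrite enormZ ger0_norm// mulr_ge0// ltW.
  have e12 : v1 z = v2 z + (2 * lam) *: z.1.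
    by rewrite /v1 /v2; apply/rowP => i; rewrite !mxE; ring.
  have eB : enorm ((2 * lam) *: z.1) = B by rewrite enormZ ger0_norm// mulr_ge0.
  have e1 : enorm (v1 z) <= 2 * a * A + B by rewrite e12 (le_trans (enorm_triangle _ _))// e2 eB.
  have e3 : enorm (v2 z - v1 z) = B by rewrite e12 opprD addrA subrr add0r enormN.
  rewrite e2 e3 (enormBC z.2) -/A.
  have := product_bound a0 q0 A0 B0 W0.
  have -> : A ^+ 2 = sqnorm (z.1 - z.2) by rewrite sqr_enorm.
  have -> : B ^+ 2 = 4 * lam ^+ 2 * sqnorm z.1 by rewrite !exprMn sqr_enorm; ring.
  rewrite -/k => h; rewrite -[leRHS]addrA [k * _]mulrC.
  have : (1 + 2 * a * A + enorm (v1 z)) * (W + A + B) <= (1 + 4 * a * A + B) * (W + A + B).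
    by rewrite ler_wpM2r ?addr_ge0//; lra.
  by move: h; rewrite mulrAC; lra.
rewrite RintZ// RintD// RintD// !RintZ; [|exact: plan_L1_fst|exact: dist2_L1].
rewrite Rint_cst -/(dist2 pi) -(M2_law mf (marg1_law pi)) ler_pM2l//.
have a2 : 0 <= 5 / 2 * a + q by rewrite addr_ge0 ?mulr_ge0// ltW.
have := ler_wpM2l a2 WD; rewrite /k; move: (dist2 pi) (M2 _) (W ^+ 2) => D M w.
move: (a^-1) (q^-1) (lam ^+ 2) => ai qi l; lra.
Qed.

End hamiltonian.

Lemma expR_quadratic (R : realType) (u : R) : `|expR u - 1 - u| <= u ^+ 2 * expR `|u|.
Proof.
have h1 := expR_ge1Dx u; have h2 := expR_ge1Dx (- u); have e0 := expR_gt0 u.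
have h3 : expR u - 1 <= u * expR u.
  have := ler_wpM2r (ltW e0) h2; rewrite -expRD addNr expR0; lra.
rewrite ger0_norm; last by lra.
have h4 : expR u - 1 - u <= u * (expR u - 1) by rewrite mulrBr mulr1; lra.
apply: (le_trans h4); have [u0|u0] := leP 0 u.
  by rewrite ger0_norm// expr2 -mulrA ler_wpM2l.
have e1 : 1 <= expR `|u| by rewrite -expR0 ler_expR.
have : u * (expR u - 1) <= u ^+ 2 by nra.
have := ler_wpM2l (sqr_ge0 u) e1; lra.
Qed.

Lemma exists_small (R : realType) (r : seq (R * R)) :
  all (fun p => (0 < p.1) && (0 <= p.2)) r -> exists2 h : R, 0 < h & all (fun p => h * p.2 <= p.1) r.
Proof.
elim: r => [_|[x y] r IH /= /andP[/andP[x0 y0] rpos]]; first by exists 1.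
have [h h0 hr] := IH rpos.
have y1 : 0 < y + 1 by rewrite ltr_wpDl.
exists (Num.min h (x / (y + 1))); first by rewrite lt_min h0 divr_gt0.
apply/andP; split.
  apply: (@le_trans _ _ (x / (y + 1) * y)).
    by rewrite ler_wpM2r// ge_min lexx orbT.
  by rewrite mulrAC ler_pdivrMr// ler_pM2l// lerDl.
apply/allP => -[u v] /= uv; have hu := allP hr _ uv.
have /andP[_ v0] := allP rpos _ uv.
by apply: le_trans hu; rewrite ler_wpM2r// ge_min lexx.
Qed.

Section weight_in_time.
Context (R : realType) (T a0 rho : R).
Hypotheses (T0 : 0 < T) (a0gt : 0 < a0) (rho0 : 0 <= rho).

Definition time_weight (t : R) : R := a0 * expR (rho * (T - t)).
Definition time_weight_max : R := a0 * expR (rho * T).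

Lemma time_weight_bounds t : t \in `[0, T] -> a0 <= time_weight t <= time_weight_max.
Proof.
rewrite in_itv/= => /andP[t0 tT]; rewrite /time_weight /time_weight_max ler_pMr// -expR0 !ler_pM2l// !ler_expR.
by apply/andP; split; [rewrite mulr_ge0// subr_ge0|rewrite ler_wpM2l// gerBl].
Qed.

Lemma time_weight_T : time_weight T = a0.
Proof. by rewrite /time_weight subrr mulr0 expR0 mulr1. Qed.

Lemma time_weight_cvg (t_ : nat -> R) t : t_ @ \oo --> t -> (fun n => time_weight (t_ n)) @ \oo --> time_weight t.
Proof.
move=> ct; apply: cvgM; first exact: cvg_cst.
have c : (fun n => rho * (T - t_ n)) @ \oo --> rho * (T - t).
  by apply: cvgM; [exact: cvg_cst|apply: cvgB; [exact: cvg_cst|exact: ct]].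
exact: (@continuous_cvg _ _ _ _ _ _ expR _ (@continuous_expR R _) c).
Qed.

Lemma time_weight_quadratic t s : t \in `[0, T] -> s \in `[0, T] ->
  `|time_weight s - time_weight t + rho * time_weight t * (s - t)| <=
    time_weight_max * rho ^+ 2 * expR (rho * T) * (s - t) ^+ 2.
Proof.
move=> tT sT; have /andP[w1 w2] := time_weight_bounds tT.
have w0 : 0 <= time_weight t by apply: le_trans w1; exact: ltW.
pose u := - (rho * (s - t)).
have e : time_weight s = time_weight t * expR u.
  by rewrite /time_weight -mulrA -expRD; congr (_ * expR _); rewrite /u; ring.
rewrite e (_ : _ + _ = time_weight t * (expR u - 1 - u)); last by rewrite /u; ring.
rewrite normrM (ger0_norm w0).
have uT : `|u| <= rho * T.
  rewrite /u normrN normrM (ger0_norm rho0) ler_wpM2l//.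
  by move: tT sT; rewrite !in_itv/= ler_norml => /andP[? ?] /andP[? ?]; apply/andP; split; lra.
apply: (@le_trans _ _ (time_weight_max * (u ^+ 2 * expR (rho * T)))).
  apply: ler_pM => //; apply: (le_trans (expR_quadratic u)).
  by rewrite ler_wpM2l ?sqr_ge0// ler_expR.
by rewrite /u sqrrN exprMn; lra.
Qed.

End weight_in_time.

Section one_sided.
Context (R : realType) (d : nat).
Local Notation E := 'rV[R]_d.

Definition maximizer (T : R) (V1 V2 : R -> P2 R d -> R) (d1 d2 lam kap beta : R) (a : R -> R)
    (t s : R) (pi : plan R d) (e1 e2 : R) : Prop :=
  [/\ t \in `[0, T], s \in `[0, T], admissible d1 d2 pi e1 e2 &
    forall t' s' pi' e1' e2', t' \in `[0, T] -> s' \in `[0, T] -> admissible d1 d2 pi' e1' e2' ->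
      gain T V1 V2 lam kap a t' s' pi' - e1' - e2' - (t' - s') ^+ 2 / beta <=
      gain T V1 V2 lam kap a t s pi - e1 - e2 - (t - s) ^+ 2 / beta].

Variables (T : R) (V1 V2 : R -> P2 R d -> R) (G : P2 R d -> R) (B1 Lv Lg C1 C2 K eps b1 b2 : R).
Variable H : E -> E -> P2 R d -> R.
Hypotheses (T0 : 0 < T) (eps0 : 0 < eps) (K0 : 0 < K) (Lv0 : 0 <= Lv) (Lg0 : 0 <= Lg).
Hypotheses (b1ge : 0 <= b1) (b2ge : 0 <= b2) (b12 : b1 + b2 = 1).
Hypothesis C10 : 0 < C1.
Hypothesis Hreg : regular_hamiltonian H C1 C2.
Hypotheses (V1b : forall t mu, t \in `[0, T] -> `|V1 t mu| <= B1)
  (V2b : forall t mu, t \in `[0, T] -> `|V2 t mu| <= B1).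
Hypotheses (V1lip : forall t mu nu, t \in `[0, T] -> `|V1 t mu - V1 t nu| <= Lv * (W1 mu nu + W2 mu nu))
  (V2lip : forall t mu nu, t \in `[0, T] -> `|V2 t mu - V2 t nu| <= Lv * (W1 mu nu + W2 mu nu)).
Hypotheses (V1usc : plan_usc T V1) (V2lsc : plan_lsc T V2).
Hypotheses (V1T : forall mu, V1 T mu = G mu) (V2T : forall mu, V2 T mu = G mu)
  (Glip : forall mu nu, `|G mu - G nu| <= Lg * W1 mu nu).

Local Notation rho := (9 * C1).
Local Notation a0 := ((Num.sqrt eps)^-1).
Local Notation a := (time_weight T a0 rho).

(** The viscous solution is [V1] when (b1, b2) = (1, 0) and [V2] when it is (0, 1). The errors K
    delta and the viscous terms are granted on both sides, so that the two cases share one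
    statement. *)
Hypothesis viscosity : forall delta lam beta kap t s (pi : plan R d) e1 e2 (g1 g2 : plan R d),
  0 < delta -> 0 < lam -> 0 < beta -> 0 <= kap -> 0 <= t < T -> 0 <= s < T ->
  maximizer T V1 V2 (b1 * delta) (b2 * delta) lam kap beta a t s pi e1 e2 ->
  image_law (fun z : E * E => (z.1, (2 * (a t + lam)) *: z.1 - (2 * a t) *: z.2)) pi g1 ->
  image_law (fun z : E * E => (z.2, (2 * a t) *: (z.1 - z.2))) pi g2 ->
  - (- (rho * a t * dist2 pi) + 2 * (t - s) / beta - kap) + Hplan H g1 <=
    K * delta + eps * (2 * (a t + lam) * d%:R) /\
  - (K * delta + eps * (2 * a t * d%:R)) <= - (2 * (t - s) / beta) + Hplan H g2.

(** The part multiplied by T pays for the linear term in time, namely C1 / a and the viscous errors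
    of both sides; the other part is the terminal estimate. *)
Definition rate : R := T * (C1 + 4 * expR (rho * T) * d%:R) + Lg ^+ 2 / 2.

Let sq0 : 0 < Num.sqrt eps. Proof. by rewrite sqrtr_gt0. Qed.
Let a00 : 0 < a0. Proof. by rewrite invr_gt0. Qed.
Let rho0 : 0 <= rho. Proof. by rewrite mulr_ge0// ltW. Qed.
Let a_bounds t : t \in `[0, T] -> a0 <= a t <= time_weight_max T a0 rho.
Proof. exact: time_weight_bounds. Qed.

Lemma velocity_plans (pi : plan R d) (b c : R) :
  exists g1 g2 : plan R d, image_law (fun z : E * E => (z.1, b *: z.1 - c *: z.2)) pi g1 /\
    image_law (fun z : E * E => (z.2, c *: (z.1 - z.2))) pi g2.
Proof.
have mf := @measurable_fst _ _ E E; have ms := @measurable_snd _ _ E E.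
have mb : measurable_fun setT (fun z : E * E => b *: z.1) by exact: measurable_scalev.
have mc : measurable_fun setT (fun z : E * E => c *: z.2) by exact: measurable_scalev.
have m1 := measurable_subv mb mc.
have L1 := sqnormB_L1 mb mc (sqnormZ_L1 b (plan_L1_fst pi)) (sqnormZ_L1 c (plan_L1_snd pi)).
have m2 : measurable_fun setT (fun z : E * E => c *: (z.1 - z.2)).
  by apply: measurable_scalev; exact: measurable_subv.
have L2 := sqnormZ_L1 c (dist2_L1 pi).
exists (plan_of mf m1 (plan_L1_fst pi) L1), (plan_of ms m2 (plan_L1_snd pi) L2).
by split; exact: plan_of_law.
Qed.

(** The two viscosity inequalities are subtracted: the time penalties cancel, and the derivative of
    the weight, rho a times the cost, cancels the term 9 C1 a of [Hplan_difference] exactly. *)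
Lemma no_interior_maximizer delta lam beta kap t s pi e1 e2 q : 0 < q ->
  0 < delta -> 0 < lam -> 0 < beta -> 0 <= kap -> 0 <= t < T -> 0 <= s < T ->
  maximizer T V1 V2 (b1 * delta) (b2 * delta) lam kap beta a t s pi e1 e2 ->
  kap <= 2 * K * delta + eps * (4 * a t * d%:R) + eps * (2 * lam * d%:R) +
   C1 * ((a t)^-1 + q * (1 + 4 * a t * dist2 pi + 2 * dist2 pi) +
    4 * lam ^+ 2 * M2 (marg1 pi) * (q^-1 + 4 * a t * q^-1 + 2 * q^-1 + 1)).
Proof.
move=> q0 delta0 lam0 beta0 kap0 tT sT mx.
have tT' : t \in `[0, T] by case: mx.
have at0 : 0 < a t by have /andP[h _] := a_bounds tT'; exact: lt_le_trans h.
have [g1 [g2 [l1 l2]]] := velocity_plans pi (2 * (a t + lam)) (2 * a t).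
have [h1 h2] := viscosity delta0 lam0 beta0 kap0 tT sT mx l1 l2.
have h3 := Hplan_difference C10 Hreg at0 (ltW lam0) q0 l1 l2.
move: h1 h2 h3; move: (Hplan H g1) (Hplan H g2) (a t) (dist2 pi) (M2 _) => x1 x2 A D M.
move: (q^-1) (A^-1) (beta^-1) => qi Ai bi h1 h2 h3.
lra.
Qed.

Let V_same (V : R -> P2 R d -> R) t mu nu :
  (forall t mu nu, t \in `[0, T] -> `|V t mu - V t nu| <= Lv * (W1 mu nu + W2 mu nu)) ->
  t \in `[0, T] -> same_law mu nu -> V t mu = V t nu.
Proof.
move=> lip tT h; have := lip t mu nu tT; rewrite (W1_same h) (W2_same h) addr0 mulr0.
by rewrite normr_le0 subr_eq0 => /eqP.
Qed.

Let terminal_bound (pi : plan R d) : G (marg1 pi) - G (second pi) <= Lg ^+ 2 / 2 * Num.sqrt eps + a0 / 2 * dist2 pi.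
Proof.
apply: (le_trans (ler_norm _)); apply: (le_trans (Glip _ _)).
have mf := @measurable_fst _ _ E E; have ms := @measurable_snd _ _ E E.
have mxy : measurable_fun setT (fun z : E * E => enorm (z.1 - z.2)).
  by apply: measurable_enorm; exact: measurable_subv.
have Ln : pi.-L1 (fun z => enorm (z.1 - z.2)).
  by apply: L1_of_sqr => //; under eq_fun do rewrite sqr_enorm; exact: dist2_L1.
apply: (@le_trans _ _ (\int[pi]_z (Lg * enorm (z.1 - z.2)))).
  by rewrite RintZ// ler_wpM2l//; exact: (W1_le mf ms (marg1_law pi) (second_law pi) Ln).
have LD := L1Z (a0 / 2) (dist2_L1 pi); have Lc := L1_cst pi (Lg ^+ 2 / 2 * Num.sqrt eps).
rewrite -RintZ; last exact: dist2_L1.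
rewrite -[X in _ <= X + _](Rint_cst pi) -RintD//; apply: le_Rint; [exact: L1Z|exact: (L1D Lc LD)|].
move=> z; rewrite -sqr_enorm; set A := enorm _.
have := sqr_ge0 (A - Lg * Num.sqrt eps).
rewrite -[X in X <= _ -> _](mulr0 (2 * Num.sqrt eps)) -ler_pdivlMl ?mulr_gt0//.
rewrite (_ : _ * (A - Lg * Num.sqrt eps) ^+ 2 = Lg ^+ 2 / 2 * Num.sqrt eps + a0 / 2 * A ^+ 2 - Lg * A).
  by rewrite subr_ge0.
by field; rewrite gt_eqF.
Qed.

(** By contradiction: with a gap beyond the rate, [kap] can be taken too large for a maximiser
    before time T, while at time T the terminal condition does not allow so large a value. *)
Lemma one_sided t0 mu0 : t0 \in `[0, T] -> V1 t0 mu0 - V2 t0 mu0 <= rate * Num.sqrt eps.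
Proof.
move=> t0T; rewrite leNgt; apply/negP => gap.
(* Of these 20 parts, 2 go to the mollification, 1 to the moment, 1 to the entropy and 5 to the
   excess in [kap]; the remaining 11 are those of [vref]. *)
pose theta := (V1 t0 mu0 - V2 t0 mu0 - rate * Num.sqrt eps) / 20.
have th0 : 0 < theta by rewrite divr_gt0// subr_gt0.
have thT0 : 0 < theta / T by rewrite divr_gt0.
pose em := theta / (2 * Lv + 1).
have em0 : 0 < em by rewrite divr_gt0// ltr_wpDl// mulr_ge0.
(* The reference competitor must have finite entropy, hence the mollification of [mu0]. *)
have [nu [c [entc w1 w2]]] := entropy_mollify mu0 em0.
have emL : Lv * (W1 mu0 nu + W2 mu0 nu) <= theta.
  apply: (@le_trans _ _ (Lv * (em + em))); first by rewrite ler_wpM2l// lerD.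
  rewrite /em (_ : _ * _ = theta * (2 * Lv / (2 * Lv + 1))); last by field; rewrite gt_eqF// ltr_wpDl// mulr_ge0.
  apply: ler_piMr; first exact: ltW.
  by rewrite ler_pdivrMr ?ltr_wpDl ?mulr_ge0// mul1r lerDl.
have v1 : V1 t0 mu0 - theta <= V1 t0 nu.
  by have := le_trans (V1lip mu0 nu t0T) emL; rewrite ler_norml => /andP[_]; lra.
have v2 : V2 t0 nu <= V2 t0 mu0 + theta.
  by have := le_trans (V2lip mu0 nu t0T) emL; rewrite ler_norml => /andP[]; lra.
have B10 : 0 <= B1 by apply: le_trans (V1b mu0 t0T).
have pc0 : 0 <= pen_cst R d by rewrite addr_ge0.
pose Bc := 2 * B1 + pen_cst R d; have Bc0 : 0 <= Bc by rewrite addr_ge0// mulr_ge0.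
pose a1 := time_weight_max T a0 rho.
have a10 : 0 < a1 by rewrite /a1 /time_weight_max mulr_gt0 ?expR_gt0.
pose Dm := 2 * Bc / a0; have Dm0 : 0 <= Dm by rewrite divr_ge0 ?mulr_ge0// ltW.
(* Order of choice: q against the a priori bound [Dm] on the cost, then lam, which may depend on q,
   then delta, which may depend on lam, on [K] and on the entropy bound [c]. *)
have [q q0 /= /andP[hq _]] : exists2 h : R, 0 < h & all (fun p => h * p.2 <= p.1)
    [:: (theta / T, C1 * (1 + 4 * a1 * Dm + 2 * Dm))].
  apply: exists_small; rewrite /= thT0 andbT; apply: mulr_ge0; first exact: ltW.
  by rewrite !addr_ge0 ?mulr_ge0// ltW.
pose k := q^-1 + 4 * a1 * q^-1 + 2 * q^-1 + 1.
have qi0 : 0 <= q^-1 by rewrite invr_ge0 ltW.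
have k0 : 0 <= k by rewrite /k !addr_ge0// !mulr_ge0// ltW.
have [lam lam0 /= /and4P[hl1 hl2 hl3 _]] : exists2 h : R, 0 < h & all (fun p => h * p.2 <= p.1)
    [:: (theta, M2 nu); (theta / T, C1 * 8 * Bc * k); (theta / T, eps * (2 * d%:R))].
  by apply: exists_small; rewrite /= th0 thT0 M2_ge0 !mulr_ge0// ltW.
have [delta de0 /= /andP[hd1 /andP[hd2 /andP[hd3 /and4P[hd4 hd5 hd6 _]]]]] : exists2 h : R, 0 < h &
    all (fun p => h * p.2 <= p.1)
    [:: (1, 1); (lam / 4, d%:R * 2); (a0 / 2, d%:R * 2); (theta / T, 2 * K); (theta, `|c|); (theta, pen_cst R d)].
  apply: exists_small; rewrite /= ltr01 ler01 th0 thT0 !divr_gt0//= !mulr_ge0 ?normr_ge0 ?pc0//.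
  by rewrite ltW.
rewrite mulr1 in hd1.
(* The multiple of sqrt eps balances the systematic errors in [no_interior_maximizer]; four small
   errors of at most theta / T remain against the five parts here. *)
pose kap := (C1 + 4 * expR (rho * T) * d%:R) * Num.sqrt eps + 5 * (theta / T).
have kap0 : 0 <= kap.
  rewrite /kap addr_ge0//; last by rewrite mulr_ge0// ltW.
  by rewrite mulr_ge0 ?(ltW sq0)// addr_ge0 ?(ltW C10)// !mulr_ge0// ltW// expR_gt0.
have b1le : b1 <= 1 by rewrite -b12 lerDl.
have b2le : b2 <= 1 by rewrite -b12 lerDr.
have bde b : 0 <= b -> 0 <= b * delta by move=> ?; rewrite mulr_ge0// ltW.
have dd0 : 0 <= delta * d%:R by rewrite mulr_ge0// ltW.
have bd b : 0 <= b -> b <= 1 -> b * delta * d%:R * 2 <= delta * (d%:R * 2).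
  by move=> b0 b1'; rewrite -!mulrA ler_piMl// !mulr_ge0// ltW.
have d1lam : b1 * delta * d%:R <= lam / 4.
  apply: le_trans hd2; apply: le_trans (bd _ b1ge b1le); rewrite ler_peMr ?ler1n//.
  by rewrite mulr_ge0// bde.
have d2lam : b2 * delta * d%:R * 2 <= lam / 4 by apply: le_trans hd2; exact: bd.
have d2a0 : b2 * delta * d%:R * 2 <= a0 / 2 by apply: le_trans hd3; exact: bd.
have ca := @time_weight_cvg R T a0 rho.
have comp := @gain_compact R d T V1 V2 B1 (b1 * delta) (b2 * delta) a0 a1 lam kap a (bde _ b1ge) (bde _ b2ge)
  a00 lam0 kap0 ca a_bounds V1b V2b V1usc V2lsc d1lam d2lam d2a0.
have coer := @gain_coercive R d T V1 V2 B1 (b1 * delta) (b2 * delta) a0 a1 lam kap a (bde _ b1ge) (bde _ b2ge)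
  kap0 a_bounds V1b V2b d1lam d2lam d2a0.
have gbB : gain_bound d B1 (b1 * delta) (b2 * delta) <= Bc.
  rewrite /gain_bound /Bc lerD2l -mulrDl b12 mul1r ler_piMl//.
pose vref := Lg ^+ 2 / 2 * Num.sqrt eps + 11 * theta.
have vref0 : 0 <= vref.
  apply: addr_ge0; apply: mulr_ge0 => //; [by rewrite divr_ge0// sqr_ge0|exact: ltW].
have mid := @measurable_id _ E setT.
(* The diagonal plan of [nu], with zero cost, gives the reference value [vref]. *)
pose pi0 := plan_of mid mid (P2_L1 nu) (P2_L1 nu).
have lpi0 : image_law (fun x : E => (x, x)) nu pi0 by exact: plan_of_law.
have mf := @measurable_fst _ _ E E; have ms := @measurable_snd _ _ E E.
have s1 : same_law nu (marg1 pi0) by exact: (image_law_comp mf lpi0 (marg1_law pi0)).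
have s2 : same_law nu (second pi0) by exact: (image_law_comp ms lpi0 (second_law pi0)).
have adm0 : admissible (b1 * delta) (b2 * delta) pi0 (b1 * delta * c) (b2 * delta * c).
  by split; rewrite -(pen_same _ s1, pen_same _ s2); apply: pen_le => //; exact: bde.
have g0 : vref <= gain T V1 V2 lam kap a t0 t0 pi0 - b1 * delta * c - b2 * delta * c.
  rewrite /gain -(V_same V1lip t0T s1) -(V_same V2lip t0T s2) -(M2_same s1).
  have -> : dist2 pi0 = 0.
    rewrite (dist2_law mid mid lpi0) (_ : (fun w => _) = fun=> 0); first exact: Rint_cst.
    by apply/funext => x; rewrite subrr sqnorm0.
  have k1 : kap * (T - t0) <= kap * T.
    by move: t0T; rewrite in_itv/= => /andP[h _]; rewrite ler_wpM2l// gerBl.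
  have k2 : kap * T = T * (C1 + 4 * expR (rho * T) * d%:R) * Num.sqrt eps + 5 * theta.
    by rewrite /kap; field; rewrite gt_eqF.
  have k3 : b1 * delta * c + b2 * delta * c <= theta.
    rewrite -mulrDl -mulrDl b12 mul1r; apply: le_trans hd5.
    by rewrite ler_wpM2l ?ler_norm// ltW.
  have k4 : 20 * theta = V1 t0 mu0 - V2 t0 mu0 - rate * Num.sqrt eps by rewrite /theta; field.
  rewrite k2 in k1; move: k1 k3 k4 v1 v2 hl1; rewrite /rate /vref mulr0.
  move: (Num.sqrt eps) (expR _) (kap * (T - t0)) => r e kk; lra.
have beta0 n : 0 < n.+1%:R^-1 :> R by rewrite invr_gt0.
have maxn n := @doubling_max R d T V1 V2 B1 (b1 * delta) (b2 * delta) a0 a1 lam kap a (bde _ b1ge) (bde _ b2ge)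
  a00 lam0 kap0 ca a_bounds V1b V2b V1usc V2lsc d1lam d2lam d2a0 n.+1%:R^-1 t0 pi0 _ _ (beta0 n) t0T adm0.
pose good n (x : R * R * plan R d * R * R) :=
  maximizer T V1 V2 (b1 * delta) (b2 * delta) lam kap n.+1%:R^-1 a x.1.1.1.1 x.1.1.1.2 x.1.1.2 x.1.2 x.2.
have ex n : exists x, good n x by have [t [s [pi [e1 [e2 h]]]]] := maxn n; exists (t, s, pi, e1, e2).
pose x n := sval (cid (ex n)); have xP n : good n (x n) := svalP (cid (ex n)).
pose t_ n := (x n).1.1.1.1; pose s_ n := (x n).1.1.1.2; pose pi_ n := (x n).1.1.2.
pose e1_ n := (x n).1.2; pose e2_ n := (x n).2.
have tT n : t_ n \in `[0, T] by case: (xP n).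
have sT n : s_ n \in `[0, T] by case: (xP n).
have adm n : admissible (b1 * delta) (b2 * delta) (pi_ n) (e1_ n) (e2_ n) by case: (xP n).
pose gap_ n := (t_ n - s_ n) ^+ 2 / n.+1%:R^-1.
have gap0 n : 0 <= gap_ n by rewrite /gap_ divr_ge0 ?sqr_ge0.
have val n : vref + gap_ n <= gain T V1 V2 lam kap a (t_ n) (s_ n) (pi_ n) - e1_ n - e2_ n.
  have [_ _ _ h] := xP n; have := h _ _ _ _ _ t0T t0T adm0.
  rewrite subrr expr0n mul0r subr0 -/(t_ n) -/(s_ n) -/(pi_ n) -/(e1_ n) -/(e2_ n) -/(gap_ n).
  by move: g0; lra.
have co n := le_trans (val n) (coer _ _ _ _ _ (tT n) (sT n) (adm n)).
have Dn n : 0 <= a0 / 2 * dist2 (pi_ n) by rewrite mulr_ge0 ?dist2_ge0// divr_ge0// ltW.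
have Mn n : 0 <= lam / 2 * M2 (marg1 (pi_ n)) by rewrite mulr_ge0 ?M2_ge0// divr_ge0// ltW.
have DB n : dist2 (pi_ n) <= Dm.
  by rewrite /Dm ler_pdivlMr//; have := co n; have := Mn n; have := gap0 n; lra.
have MB n : lam * M2 (marg1 (pi_ n)) <= 2 * Bc.
  by have := co n; have := Dn n; have := gap0 n; lra.
have gapB n : gap_ n <= Bc by have := co n; have := Dn n; have := Mn n; lra.
(* A maximiser with both times before T would contradict the choice of [kap]; the product vanishes
   exactly when one of the times is T. *)
have bdry n : (T - t_ n) * (T - s_ n) = 0.
  apply/eqP; rewrite mulf_eq0 !subr_eq0; apply/negPn/negP; rewrite negb_or => /andP[nt ns].
  have := tT n; have := sT n; rewrite !in_itv/= => /andP[s0 sT'] /andP[t0' tT'].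
  have t1 : 0 <= t_ n < T by rewrite t0' lt_neqAle eq_sym nt.
  have t2 : 0 <= s_ n < T by rewrite s0 lt_neqAle eq_sym ns.
  have := no_interior_maximizer q0 de0 lam0 (beta0 n) kap0 t1 t2 (xP n).
  rewrite -/(t_ n) -/(pi_ n).
  have /andP[A1 A2] := a_bounds (tT n); have A0 : 0 < a (t_ n) := lt_le_trans a00 A1.
  have D0 := dist2_ge0 (pi_ n); have M0 := M2_ge0 (marg1 (pi_ n)).
  have f1 : (a (t_ n))^-1 <= Num.sqrt eps by rewrite -[leRHS]invrK lef_pV2.
  have f2 : eps * (4 * a (t_ n) * d%:R) <= 4 * expR (rho * T) * d%:R * Num.sqrt eps.
    have -> : 4 * expR (rho * T) * d%:R * Num.sqrt eps = eps * (4 * a1 * d%:R).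
      rewrite /a1 /time_weight_max -{2}(sqr_sqrtr (ltW eps0)) expr2; field; rewrite gt_eqF//.
    by rewrite ler_pM2l// ler_wpM2r// ler_pM2l.
  have f3 : C1 * (q * (1 + 4 * a (t_ n) * dist2 (pi_ n) + 2 * dist2 (pi_ n))) <= theta / T.
    apply: le_trans hq; rewrite mulrCA ler_pM2l// ler_pM2l//.
    have : a (t_ n) * dist2 (pi_ n) <= a1 * Dm by rewrite ler_pM// ltW.
    by have := DB n; lra.
  have f4 : C1 * (4 * lam ^+ 2 * M2 (marg1 (pi_ n)) * (q^-1 + 4 * a (t_ n) * q^-1 + 2 * q^-1 + 1)) <= theta / T.
    apply: le_trans hl2.
    rewrite (_ : lam * (C1 * 8 * Bc * k) = C1 * (4 * lam * (2 * Bc) * k)); last by ring.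
    rewrite ler_pM2l// (_ : 4 * lam ^+ 2 * _ = 4 * lam * (lam * M2 (marg1 (pi_ n)))); last by ring.
    have l4 : 0 <= 4 * lam by rewrite mulr_ge0// ltW.
    have p1 : 0 <= 4 * lam * (lam * M2 (marg1 (pi_ n))) by rewrite mulr_ge0// mulr_ge0// ltW.
    have p2 : 0 <= q^-1 + 4 * a (t_ n) * q^-1 + 2 * q^-1 + 1 by rewrite !addr_ge0// !mulr_ge0// ltW.
    apply: ler_pM => //; first exact: ler_wpM2l.
    by rewrite /k lerD2r lerD2r lerD2l ler_wpM2r// ler_pM2l.
  set Y1 := q * (1 + _ + _) in f3 *; set Y2 := 4 * _ * _ * _ in f4 *.
  move: f2 f3 f4 hd4 hl3 (ler_wpM2l (ltW C10) f1) thT0; rewrite /kap.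
  move: (theta / T) (Num.sqrt eps) (expR _) ((a (t_ n))^-1) Y1 Y2 (eps * (4 * _ * _)) => th r ex' ai y1 y2 y3.
  move: (d%:R) => dr; lra.
have vgap n : vref <= vref + gap_ n by rewrite lerDl.
have [f [t [s [pi [e1 [e2 [cc [[fn ct cs ccv] [tT' sT' adm' le]]]]]]]]] :=
  comp t_ s_ e1_ e2_ (fun n => vref + gap_ n) pi_ vref tT sT adm vgap val.
have ct' : (fun n => t_ (f n)) @ \oo --> t by exact: ct.
have cs' : (fun n => s_ (f n)) @ \oo --> s by exact: cs.
(* The time penalties stay below [Bc] while their factor n + 1 tends to infinity. *)
have ts : t = s.
  have c1 : (fun n => (t_ (f n) - s_ (f n)) ^+ 2) @ \oo --> (t - s) ^+ 2.
    by rewrite expr2; apply: cvgM; apply: cvgB.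
  have c2 : (fun n => Bc * n.+1%:R^-1) @ \oo --> Bc * 0.
    by apply: cvgM; [exact: cvg_cst|exact: cvg_harmonic].
  have : (t - s) ^+ 2 <= Bc * 0.
    apply: (cvgr_le_cvg c1 c2).
    - apply: nearW => n; apply: (@le_trans _ _ (Bc * (f n).+1%:R^-1)).
        by have := gapB (f n); rewrite /gap_ ler_pdivrMr.
      by rewrite ler_wpM2l// lef_pV2 ?posrE// ler_nat ltnS.
  rewrite mulr0 => h; apply/eqP; rewrite -subr_eq0 -sqrf_eq0 eq_le h sqr_ge0//.
have tsT : (T - t) * (T - s) = 0.
  have c1 : (fun n => (T - t_ (f n)) * (T - s_ (f n))) @ \oo --> (T - t) * (T - s).
    by apply: cvgM; apply: cvgB => //; exact: cvg_cst.
  have c2 : (fun n => (T - t_ (f n)) * (T - s_ (f n))) @ \oo --> (0 : R).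
    by under eq_fun do rewrite bdry; exact: cvg_cst.
  exact: cvg_unique c1 c2.
have tT1 : t = T.
  by move/eqP: tsT; rewrite -ts mulf_eq0 orbb subr_eq0 => /eqP.
have vcc : vref <= cc.
  apply: (cvgr_ge_bound ccv).
  by apply: nearW => n /=; rewrite lerDl.
have hv := le_trans vcc le.
have [h1 h2] := admissible_ge (bde _ b1ge) (bde _ b2ge) adm'.
have h3 := terminal_bound pi.
have h4 := ler_wpM2r (M2_ge0 (marg1 pi)) d1lam.
have h5 := ler_wpM2l (mulr_ge0 (bde _ b2ge) (ler0n R d)) (M2_second_le pi).
have h6 := ler_wpM2r (M2_ge0 (marg1 pi)) d2lam.
have h7 := ler_wpM2r (dist2_ge0 pi) d2a0.
have h8 : b1 * delta * pen_cst R d + b2 * delta * pen_cst R d <= theta.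
  by rewrite -mulrDl -mulrDl b12 mul1r.
have h9 : 0 <= lam / 2 * M2 (marg1 pi) by rewrite mulr_ge0 ?M2_ge0// divr_ge0// ltW.
(* At time T half of the cost absorbs the terminal difference, the penalties absorb the moments, and
   theta bounds the constants of the entropies: less than the 11 theta in [vref] remains. *)
move: hv; rewrite /gain -ts tT1 V1T V2T (time_weight_T T a0 rho) subrr mulr0 subr0 /vref.
move: h1 h2 h3 h4 h5 h6 h7 h8 h9 th0.
move: (G _) (G _) (M2 (marg1 pi)) (M2 (second pi)) (dist2 pi) (pen_cst R d) => G1 G2 m1 m2 D pc.
move: (Num.sqrt eps) (Num.sqrt eps)^-1 => r ri.
move: (b1 * delta) (b2 * delta) => x1 x2; rewrite mulrDr; lra.
Qed.

End one_sided.

(** * Semicontinuity and viscosity inequalities for the two solutions *)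

Section semicontinuity.
Context (R : realType) (d : nat) (T : R).
Local Notation E := 'rV[R]_d.
Implicit Types (V : R -> P2 R d -> R).

Lemma plan_cvg_W1_small (pi_ : nat -> plan R d) pi (L e : R) : plan_cvg pi_ pi -> 0 < e ->
  \forall n \near \oo, `|L| * W1 (marg1 (pi_ n)) (marg1 pi) <= e.
Proof.
move=> pipi e0.
have c : (fun n => `|L| * W1 (marg1 (pi_ n)) (marg1 pi)) @ \oo --> `|L| * 0.
  by apply: cvgM; [exact: cvg_cst|exact: plan_cvg_W1].
by rewrite mulr0 in c; exact: (cvgr_le _ c).
Qed.

Lemma dist_near (t_ : nat -> R) (t eta : R) : t_ @ \oo --> t -> 0 < eta ->
  \forall n \near \oo, `|t_ n - t| < eta.
Proof.
move=> ct eta0; have c : (fun n => `|t_ n - t|) @ \oo --> `|t - t|.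
  by apply: cvg_norm; apply: cvgB => //; exact: cvg_cst.
by rewrite subrr normr0 in c; exact: (cvgr_lt _ c).
Qed.

(** Weak convergence implies W1 but not W2 convergence: the Lipschitz bound moves the measure at
    fixed time, and upper semicontinuity then only moves time at a fixed measure. *)
Lemma usc_plan_cvg V : usc T V -> lipschitz_wrt T (@W1 R d) V -> plan_usc T V.
Proof.
move=> uV [L lV] t_ t pi_ pi t_T tT ct pipi e e0.
have e20 : 0 < e / 2 by rewrite divr_gt0.
have [eta eta0 h] := uV t (marg1 pi) (e / 2) tT e20.
have n1 := plan_cvg_W1_small L pipi e20; have n2 := dist_near ct eta0.
near=> n.
have h1 : `|L| * W1 (marg1 (pi_ n)) (marg1 pi) <= e / 2 by near: n.
have h2 : `|t_ n - t| < eta by near: n.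
have h3 : W2 (marg1 pi) (marg1 pi) < eta by rewrite W2_same//; exact: image_law_id.
have h4 := h (t_ n) (marg1 pi) (t_T n) h2 h3.
have h5 := le_trans (ler_norm _) (lV (t_ n) (marg1 (pi_ n)) (marg1 pi) (t_T n)).
have h6 : L * W1 (marg1 (pi_ n)) (marg1 pi) <= `|L| * W1 (marg1 (pi_ n)) (marg1 pi).
  by rewrite ler_wpM2r ?ler_norm// W1_ge0.
move: h1 h4 h5 h6; lra.
Unshelve. all: by end_near. Qed.

Lemma lsc_plan_cvg V : lsc T V -> lipschitz_wrt T (@W1 R d) V -> plan_lsc T V.
Proof.
move=> lV [L LV] t_ t pi_ pi t_T tT ct pipi e e0.
have uV : usc T (fun t mu => - V t mu).
  move=> t' mu e' t'T e'0; have [eta eta0 h] := lV t' mu e' t'T e'0.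
  by exists eta => // s nu sT st W; have := h s nu sT st W; lra.
have LNV : lipschitz_wrt T (@W1 R d) (fun t mu => - V t mu).
  by exists L => t' mu nu t'T; rewrite -opprD normrN; exact: LV.
apply: filterS (usc_plan_cvg uV LNV t_T tT ct pipi e0) => n; lra.
Qed.

Lemma weakly_continuous_plan_cvg V : weakly_continuous T V -> plan_usc T V /\ plan_lsc T V.
Proof.
move=> wV; split=> t_ t pi_ pi t_T tT ct pipi e e0;
  have c := wV t_ (fun n => marg1 (pi_ n)) t (marg1 pi) t_T tT ct (plan_cvg_weak pipi).
  by apply: (cvgr_le _ c); rewrite ltrDl.
by apply: (cvgr_ge _ c); rewrite ltrBlDr ltrDl.
Qed.

End semicontinuity.

Section viscosity_inequalities.
Context (R : realType) (d : nat).
Local Notation E := 'rV[R]_d.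
Variables (T : R) (eps C1 C2 a0 B1 L1 L2 : R).
Variable H : E -> E -> P2 R d -> R.
Variables (U Ueps : R -> P2 R d -> R).
Hypotheses (T0 : 0 < T) (eps0 : 0 < eps).
Hypotheses (C10 : 0 < C1) (Hreg : regular_hamiltonian H C1 C2) (a00 : 0 < a0).
Hypotheses (Ulip : forall t mu nu, t \in `[0, T] -> `|U t mu - U t nu| <= L2 * W2 mu nu)
  (Uepslip : forall t mu nu, t \in `[0, T] -> `|Ueps t mu - Ueps t nu| <= L1 * W1 mu nu).
Local Notation rho := (9 * C1).
Local Notation a := (time_weight T a0 rho).

Let rho0 : 0 <= rho. Proof. by rewrite mulr_ge0// ltW. Qed.
Let mf := @measurable_fst _ _ E E.
Let ms := @measurable_snd _ _ E E.

Let Usame t mu nu : t \in `[0, T] -> same_law mu nu -> U t mu = U t nu.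
Proof.
move=> tT h; have := Ulip mu nu tT; rewrite (W2_same h) mulr0.
by rewrite normr_le0 subr_eq0 => /eqP.
Qed.

Let Uepssame t mu nu : t \in `[0, T] -> same_law mu nu -> Ueps t mu = Ueps t nu.
Proof.
move=> tT h; have := Uepslip mu nu tT; rewrite (W1_same h) mulr0.
by rewrite normr_le0 subr_eq0 => /eqP.
Qed.

Let a_gt0 t : t \in `[0, T] -> 0 < a t.
Proof. by move=> tT; rewrite mulr_gt0// expR_gt0. Qed.

Let Ka_ge0 : 0 <= time_weight_max T a0 rho * rho ^+ 2 * expR (rho * T).
Proof.
apply: mulr_ge0; last exact: ltW (expR_gt0 _).
by apply: mulr_ge0; [rewrite mulr_ge0 ?(ltW a00)// ltW// expR_gt0|exact: sqr_ge0].
Qed.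

Lemma pen_entropy_eq (c : R) (mu : P2 R d) (x : R) : 0 < c -> pen c mu = x%:E -> exists2 y : R, entropy mu = y%:E & x = c * y.
Proof.
move=> c0; rewrite /pen; case: (entropy mu) => [y [<-]| |]; first by exists y.
- by rewrite gt0_muley ?lte_fin.
- by rewrite gt0_muleNy ?lte_fin.
Qed.

Lemma no_entropy (V : R -> P2 R d -> R) : (fun s nu => (V s nu)%:E + 0%:E * entropy nu)%E = (fun s nu => (V s nu)%:E).
Proof. by apply/funext => s; apply/funext => nu; rewrite mul0e adde0. Qed.

Lemma no_entropyB (V : R -> P2 R d -> R) : (fun s nu => (V s nu)%:E - 0%:E * entropy nu)%E = (fun s nu => (V s nu)%:E).
Proof. by apply/funext => s; apply/funext => nu; rewrite mul0e sube0. Qed.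

(** The factor k is 1 when the viscous equation acts on x and -1 when it acts on y, where the
    velocity 2 a (x - y) has the opposite orientation. *)
Lemma score_inequality (mu : P2 R d) (pi g : plan R d) (mpi : minimal_cost pi) (al be k : R) (p : E -> E) :
  mu = marg1 pi -> mu `<< lebesgue_rV R d ->
  (forall z : E, p z = k *: (al *: z - be *: transport mpi z)) ->
  image_law (fun z : E * E => (z.1, k *: (al *: z.1 - be *: z.2))) pi g ->
  [/\ measurable_fun setT p, graph_plan mu p g & Hplan H g = \int[mu]_x H x (p x) mu].
Proof.
move=> mupi ac pE lg.
have mp : measurable_fun setT p.
  rewrite (_ : p = fun z => k *: (al *: z - be *: transport mpi z)); last exact/funext.
  apply: measurable_scalev; apply: measurable_subv; apply: measurable_scalev; [exact: measurable_id|exact: measurable_transport].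
have mG : measurable_fun setT (fun z : E * E => (z.1, k *: (al *: z.1 - be *: z.2))).
  apply: measurable_pair_of => //; apply: measurable_scalev.
  by apply: measurable_subv; exact: measurable_scalev.
have lp : image_law (fun x : E => (x, p x)) mu g.
  rewrite mupi in ac *; have h := image_law_comp mG (transport_law mpi ac) lg.
  by apply: image_law_ext h => x /=; rewrite pE.
split => //.
have mid : measurable_fun setT (id : E -> E) by exact: measurable_id.
have sm : same_law (marg1 g) mu.
  apply: same_law_sym; exact: (image_law_comp mf lp (marg1_law g)).
exact: (Hplan_law Hreg mid mp lp sm).2.
Qed.

Variables (K : R) (K0 : 0 < K).

(** The viscous equation sees x. The inviscid inequality at y holds without error and is relaxed to
    match the common form. *)
Lemma viscosity_sub :
  (forall (delta t : R) (mu : P2 R d) (r : R) (p : E -> E) (g : plan R d),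
    0 < delta -> 0 <= t < T -> (fisher mu < +oo)%E -> graph_plan mu p g ->
    superdiff T (fun s nu => (Ueps s nu)%:E - delta%:E * entropy nu)%E t mu r g ->
    hjeps_lhs H eps r mu p <= K * delta) ->
  (forall t mu r g, 0 <= t < T -> subdiff T (fun s nu => (U s nu)%:E) t mu r g -> 0 <= - r + Hplan H g) ->
  forall delta lam beta kap t s (pi : plan R d) e1 e2 (g1 g2 : plan R d),
  0 < delta -> 0 < lam -> 0 < beta -> 0 <= kap -> 0 <= t < T -> 0 <= s < T ->
  maximizer T Ueps U (1 * delta) (0 * delta) lam kap beta a t s pi e1 e2 ->
  image_law (fun z : E * E => (z.1, (2 * (a t + lam)) *: z.1 - (2 * a t) *: z.2)) pi g1 ->
  image_law (fun z : E * E => (z.2, (2 * a t) *: (z.1 - z.2))) pi g2 ->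
  - (- (rho * a t * dist2 pi) + 2 * (t - s) / beta - kap) + Hplan H g1 <=
    K * delta + eps * (2 * (a t + lam) * d%:R) /\
  - (K * delta + eps * (2 * a t * d%:R)) <= - (2 * (t - s) / beta) + Hplan H g2.
Proof.
move=> sub sup delta lam beta kap t s pi e1 e2 g1 g2 de0 lam0 beta0 kap0 tT sT [].
rewrite mul1r mul0r => tT' sT' adm mx l1 l2.
have at0 := a_gt0 tT'.
have mpi := max_minimal_cost at0 Uepssame Usame tT' sT' adm mx.
have sd := max_superdiff (ltW de0) (lexx 0) (ltW lam0) beta0 at0 rho0 Ka_ge0
  (fun s' s'T => time_weight_quadratic a00 rho0 tT' s'T) Uepssame Usame tT' sT' adm mx l1.
have := max_subdiff (ltW de0) (lexx 0) beta0 at0 Uepssame Usame tT' sT' adm mx l2.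
rewrite no_entropy => /(sup _ _ _ _ sT) h2.
have [pe1 pe2] := max_pen (ltW de0) (lexx 0) tT' sT' adm mx.
have [c entc e1c] := pen_entropy_eq de0 pe1.
(* Maximality at fixed times and fixed second marginal, together with the W1-Lipschitz bound, is the
   perturbation estimate that [entropy_side] requires. *)
have pert pi' c' : same_law (second pi') (second pi) -> (entropy (marg1 pi') <= c'%:E)%E ->
    delta * (c - c') <= `|L1| * W1 (marg1 pi) (marg1 pi') + a t * (dist2 pi' - dist2 pi) +
      lam * (M2 (marg1 pi') - M2 (marg1 pi)).
  move=> s2 ent.
  have adm' : admissible delta 0 pi' (delta * c') e2.
    by split; [exact: pen_le (ltW de0) ent|rewrite (pen_same _ s2) pe2].
  have := mx _ _ _ _ _ tT' sT' adm'; rewrite /gain (Usame sT' s2) e1c.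
  have := le_trans (ler_norm _) (Uepslip (marg1 pi) (marg1 pi') tT').
  have := ler_wpM2r (W1_ge0 (marg1 pi) (marg1 pi')) (ler_norm L1).
  move: (W1 _ _) (Ueps t _) (Ueps t _) (M2 _) (M2 _) (dist2 _) (dist2 _) (U s _) => w u1 u2 m1 m2 D1 D2 u3 q1 q2 q3.
  lra.
have ac := entropy_fin_ac entc.
have [fish sc] := entropy_side de0 (normr_ge0 L1) (ltW at0) (ltW lam0) entc mpi pert.
have at2 : 0 <= 2 * a t by rewrite mulr_ge0// ltW.
have [_ sc1] := sc (2 * (a t + lam)) (2 * a t) at2.
pose p (x : E) := (2 * (a t + lam)) *: x - (2 * a t) *: transport mpi x.
have l1' : image_law (fun z : E * E => (z.1, 1 *: ((2 * (a t + lam)) *: z.1 - (2 * a t) *: z.2))) pi g1.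
  by apply: image_law_ext l1 => z; rewrite scale1r.
have [mp gp HE] := @score_inequality (marg1 pi) pi g1 mpi _ _ 1 p erefl ac (fun z => esym (scale1r _)) l1'.
have := sub _ _ _ _ _ _ de0 tT fish gp sd; rewrite /hjeps_lhs -HE.
split.
  have := ler_wpM2l (ltW eps0) sc1; rewrite -/(p _).
  rewrite mulrN; lra.
apply: le_trans h2; rewrite oppr_le0 addr_ge0 ?mulr_ge0//; exact: ltW.
Qed.

(** The viscous equation now sees y. Swapping the plan reduces to [entropy_side] with lam = 0, as
    the moment penalty bears on the first marginal only. *)
Lemma viscosity_super :
  (forall t mu r g, 0 <= t < T -> superdiff T (fun s nu => (U s nu)%:E) t mu r g -> - r + Hplan H g <= 0) ->
  (forall (delta t : R) (mu : P2 R d) (r : R) (p : E -> E) (g : plan R d),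
    0 < delta -> 0 <= t < T -> (fisher mu < +oo)%E -> graph_plan mu p g ->
    subdiff T (fun s nu => (Ueps s nu)%:E + delta%:E * entropy nu)%E t mu r g ->
    - (K * delta) <= hjeps_lhs H eps r mu p) ->
  forall delta lam beta kap t s (pi : plan R d) e1 e2 (g1 g2 : plan R d),
  0 < delta -> 0 < lam -> 0 < beta -> 0 <= kap -> 0 <= t < T -> 0 <= s < T ->
  maximizer T U Ueps (0 * delta) (1 * delta) lam kap beta a t s pi e1 e2 ->
  image_law (fun z : E * E => (z.1, (2 * (a t + lam)) *: z.1 - (2 * a t) *: z.2)) pi g1 ->
  image_law (fun z : E * E => (z.2, (2 * a t) *: (z.1 - z.2))) pi g2 ->
  - (- (rho * a t * dist2 pi) + 2 * (t - s) / beta - kap) + Hplan H g1 <=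
    K * delta + eps * (2 * (a t + lam) * d%:R) /\
  - (K * delta + eps * (2 * a t * d%:R)) <= - (2 * (t - s) / beta) + Hplan H g2.
Proof.
move=> sub sup delta lam beta kap t s pi e1 e2 g1 g2 de0 lam0 beta0 kap0 tT sT [].
rewrite mul1r mul0r => tT' sT' adm mx l1 l2.
have at0 := a_gt0 tT'.
have mpi := max_minimal_cost at0 Usame Uepssame tT' sT' adm mx.
have := max_superdiff (lexx 0) (ltW de0) (ltW lam0) beta0 at0 rho0 Ka_ge0
  (fun s' s'T => time_weight_quadratic a00 rho0 tT' s'T) Usame Uepssame tT' sT' adm mx l1.
rewrite no_entropyB => /(sub _ _ _ _ tT) h1.
have sd := max_subdiff (lexx 0) (ltW de0) beta0 at0 Usame Uepssame tT' sT' adm mx l2.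
have [pe1 pe2] := max_pen (lexx 0) (ltW de0) tT' sT' adm mx.
have [c entc e2c] := pen_entropy_eq de0 pe2.
pose pis := swap_plan pi.
have mpis : minimal_cost pis := minimal_cost_swap mpi (swap_plan_law pi).
have swapK (pi' : plan R d) : same_law (marg1 pi') (second (swap_plan pi')).
  apply: image_law_same (marg1_law pi') _.
  exact: (image_law_comp ms (swap_plan_law pi') (second_law (swap_plan pi'))).
have dist2_swap (pi' : plan R d) : dist2 (swap_plan pi') = dist2 pi'.
  rewrite (dist2_law ms mf (swap_plan_law pi')).
  by congr Rintegral; apply/funext => z; rewrite sqnormBC.
have pert pi' c' : same_law (second pi') (second pis) -> (entropy (marg1 pi') <= c'%:E)%E ->
    delta * (c - c') <= `|L1| * W1 (marg1 pis) (marg1 pi') + a t * (dist2 pi' - dist2 pis) +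
      0 * (M2 (marg1 pi') - M2 (marg1 pis)).
  move=> s2 ent; rewrite mul0r addr0.
  have s1 : same_law (marg1 (swap_plan pi')) (marg1 pi).
    have k := swapK pi.
    exact: (image_law_comp (@measurable_id _ _ _) s2 (same_law_sym k)).
  have adm' : admissible 0 delta (swap_plan pi') e1 (delta * c').
    by split; [rewrite (pen_same _ s1) pe1|rewrite -(pen_same _ (swapK pi')); exact: pen_le (ltW de0) ent].
  have := mx _ _ _ _ _ tT' sT' adm'.
  rewrite /gain (Usame tT' s1) (M2_same s1) -(Uepssame sT' (swapK pi')) e2c !dist2_swap -/pis.
  have := Uepslip (marg1 pis) (marg1 pi') sT'; rewrite distrC => /(le_trans (ler_norm _)).
  have := ler_wpM2r (W1_ge0 (marg1 pis) (marg1 pi')) (ler_norm L1).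
  rewrite -[second pi]/(marg1 pis).
  move: (W1 _ _) (Ueps s _) (Ueps s _) (M2 _) (dist2 _) (dist2 _) (U t _) => w u1 u2 m1 D1 D2 u3 q1 q2 q3.
  lra.
have ac := entropy_fin_ac entc.
have [fish sc] := entropy_side de0 (normr_ge0 L1) (ltW at0) (lexx 0) entc mpis pert.
have at2 : 0 <= 2 * a t by rewrite mulr_ge0// ltW.
have [Lsc sc1] := sc (2 * a t) (2 * a t) at2.
pose q (x : E) := (2 * a t) *: x - (2 * a t) *: transport mpis x.
(* The velocity at y is the opposite of the monotone field [q]; the supersolution inequality is
   reversed too, so the one-sided formula has the right sign again. *)
pose p (x : E) := (-1) *: q x.
have l2' : image_law (fun z : E * E => (z.1, (-1) *: ((2 * a t) *: z.1 - (2 * a t) *: z.2))) pis g2.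
  have mG : measurable_fun setT (fun z : E * E => (z.1, (-1) *: ((2 * a t) *: z.1 - (2 * a t) *: z.2))).
    apply: measurable_pair_of => //; apply: measurable_scalev.
    by apply: measurable_subv; exact: measurable_scalev.
  apply: (image_law_factor mG (swap_plan_law pi)); apply: image_law_ext l2 => z /=.
  by rewrite scaleN1r opprB scalerBr.
have [mp gp HE] := @score_inequality (marg1 pis) pis g2 mpis _ _ (-1) p erefl ac (fun z => erefl) l2'.
have := sup _ _ _ _ _ _ de0 sT fish gp sd; rewrite /hjeps_lhs -HE => hs.
split.
  apply: (le_trans h1); rewrite addr_ge0 ?mulr_ge0 ?addr_ge0//; exact: ltW.
have scE : \int[marg1 pis]_x dot (score (marg1 pis) x) (p x) = - \int[marg1 pis]_x dot (score (marg1 pis) x) (q x).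
  rewrite -RintN//; congr Rintegral; apply/funext => x.
  by rewrite /p scaleN1r dotNr.
move: hs; rewrite scE => hs.
have := ler_wpM2l (ltW eps0) sc1; rewrite -/(q _) mulrN.
move: hs; rewrite mulrN; lra.
Qed.

End viscosity_inequalities.

Theorem theorem5p1 (R : realType) (T : R) (d : nat)
    (H : 'rV[R]_d -> 'rV[R]_d -> P2 R d -> R) (G : P2 R d -> R) :
  0 < T -> (1 <= d)%N -> data_assumptions H G ->
  exists2 C : R, 0 <= C &
  forall (eps : R) (Ueps U : R -> P2 R d -> R), 0 < eps ->
    bounded_on T Ueps -> hjeps_solution H T eps Ueps ->
    bounded_on T U -> hj0_solution H T U ->
    (forall mu, Ueps T mu = G mu /\ U T mu = G mu) ->
    lipschitz_wrt T (@W1 R d) Ueps ->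
    lipschitz_wrt T (@W2 R d) U ->
    weakly_continuous T U ->
    (ereal_sup [set (`|Ueps tm.1 tm.2 - U tm.1 tm.2|)%:E
               | tm in [set tm : R * P2 R d | tm.1 \in `[0, T]%R]]
     <= (C * Num.sqrt eps)%:E)%E.
Proof.
move=> T0 _ [Hc [C1 C10 Hl] [C2 C20 Hg] _ [Lg0 GL0]].
pose Lg := `|Lg0|; have Lgge : 0 <= Lg by exact: normr_ge0.
have Hreg : regular_hamiltonian H C1 C2 by [].
have Glip mu nu : `|G mu - G nu| <= Lg * W1 mu nu.
  by apply: (le_trans (GL0 mu nu)); rewrite ler_wpM2r ?ler_norm// W1_ge0.
exists (rate d T Lg C1).
  rewrite /rate addr_ge0//; last by rewrite divr_ge0// sqr_ge0.
  rewrite mulr_ge0 ?(ltW T0)// addr_ge0 ?(ltW C10)// !mulr_ge0//; exact: ltW (expR_gt0 _).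
move=> eps Ueps U eps0 [B1 hB1] [[usub [K1 K10 sub]] [usup [K2 K20 sup]]] [B2 hB2]
  [[usub0 sub0] [usup0 sup0]] term lipe lip0 wU.
have [L1 hL1] := lipe; have [L2 hL2] := lip0.
pose B := `|B1| + `|B2|; pose Lv := `|L1| + `|L2|.
have Lv0 : 0 <= Lv by rewrite addr_ge0.
have b1 t mu : t \in `[0, T] -> `|Ueps t mu| <= B.
  by move=> tT; apply: (le_trans (hB1 t mu tT)); apply: (le_trans (ler_norm _)); rewrite lerDl.
have b2 t mu : t \in `[0, T] -> `|U t mu| <= B.
  by move=> tT; apply: (le_trans (hB2 t mu tT)); apply: (le_trans (ler_norm _)); rewrite lerDr.
have l1 t mu nu : t \in `[0, T] -> `|Ueps t mu - Ueps t nu| <= Lv * (W1 mu nu + W2 mu nu).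
  move=> tT; apply: (le_trans (hL1 t mu nu tT)).
  have w1 := W1_ge0 mu nu; have w2 := W2_ge0 mu nu.
  apply: (@le_trans _ _ (`|L1| * W1 mu nu)); first by rewrite ler_wpM2r// ler_norm.
  by apply: ler_pM => //; rewrite lerDl.
have l2 t mu nu : t \in `[0, T] -> `|U t mu - U t nu| <= Lv * (W1 mu nu + W2 mu nu).
  move=> tT; apply: (le_trans (hL2 t mu nu tT)).
  have w1 := W1_ge0 mu nu; have w2 := W2_ge0 mu nu.
  apply: (@le_trans _ _ (`|L2| * W2 mu nu)); first by rewrite ler_wpM2r// ler_norm.
  by apply: ler_pM => //; rewrite lerDr.
have te mu := (term mu).1; have t0 mu := (term mu).2.
have a00 : 0 < (Num.sqrt eps)^-1 by rewrite invr_gt0 sqrtr_gt0.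
have [uscU lscU] := weakly_continuous_plan_cvg wU.
(* The entropy penalises the first marginal here and the second one in [lower]; [K1] and [K2] may
   depend on eps, but [rate] contains neither. *)
have upper := one_sided T0 eps0 K10 Lv0 Lgge ler01 (lexx 0) (addr0 1) C10 Hreg b1 b2 l1 l2
  (usc_plan_cvg usub lipe) lscU te t0 Glip
  (viscosity_sub eps0 C10 Hreg a00 hL2 hL1 K10 sub sup0).
have lower := one_sided T0 eps0 K20 Lv0 Lgge (lexx 0) ler01 (add0r 1) C10 Hreg b2 b1 l2 l1
  uscU (lsc_plan_cvg usup lipe) t0 te Glip
  (viscosity_super eps0 C10 Hreg a00 hL2 hL1 K20 sub0 sup).
apply: ge_ereal_sup => _ [[t mu] /= tT <-]; rewrite lee_fin ler_norml.
by have := upper t mu tT; have := lower t mu tT; move=> h1 h2; apply/andP; split; lra.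
Qed.
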